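(* Let $m\ge2$, let $\xi\in\Xi_{2,m}$, and let $G_\xi$ be the corresponding spinal group acting on the infinite binary tree. If $M$ is a Markov operator on a graph $X\in Sch(G_\xi)$ such that the numbers $q_\phi$ are not all equal over the essential alphabet $\widetilde{\mathcal{A}}_\xi$ (i.e. there exist $\alpha_\phi,\alpha_\psi\in\widetilde{\mathcal{A}}_\xi$ with $q_\phi\ne q_\psi$), then the spectrum of $M$ is a Cantor set of Lebesgue measure $0$.
   Context: Spinal groups on the binary tree. Let $A=\mathbb{Z}/2\mathbb{Z}$, $B=(\mathbb{Z}/2\mathbb{Z})^m$, and let $\mathrm{Epi}(B,A)$ be the set of surjective homomorphisms $B\to A$. $\Xi_{2,m}$ is the set of sequences $\xi=(\xi_1,\xi_2,\ldots)\in\mathrm{Epi}(B,A)^{\mathbb{N}}$ such that $\bigcap_{j\ge i}\mathrm{Ker}(\xi_j)=\{0\}$ for every $i$. Let $T_2$ be the infinite binary rooted tree, with vertices the finite words over $\{0,1\}$ and boundary $\partial T_2=\{0,1\}^{\mathbb{N}}$. The automorphism $a$ of $T_2$ changes the first letter: $a(0w)=1w$, $a(1w)=0w$. For $b\in B$ the automorphism $b_\xi$ fixes the rightmost ray $1^\infty$ and satisfies $b_\xi(1^{r-1}0w)=1^{r-1}0\,a^{\xi_r(b)}(w)$ for $r\ge1$. Put $B_\xi=\{b_\xi:b\in B\}$ (isomorphic to $B$) and let $G_\xi\le\mathrm{Aut}(T_2)$ be the group generated by $S_\xi=\{a\}\cup B_\xi\setminus\{\mathrm{id}\}$; all elements of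 $S_\xi$ are involutions. $G_\xi$ acts on $\partial T_2$. Space of Schreier graphs. For $x\in\partial T_2$ the orbital Schreier graph rooted at $x$ has as vertex set the orbit $G_\xi x$, with an edge labelled $s$ from $y$ to $sy$ for every vertex $y$ and every $s\in S_\xi$, and root $x$. This gives a map from $\partial T_2$ to the space of isomorphism classes of rooted graphs with edges labelled by $S_\xi$, with the topology of local convergence (two graphs are close if large balls around the roots are isomorphic as rooted labelled graphs). $Sch(G_\xi)$ is the closure of the image of this map with its isolated points removed. For $X\in Sch(G_\xi)$, $G_\xi$ acts on the vertex set of $X$ (each $s\in S_\xi$ sends a vertex $y$ to the endpoint of the edge labelled $s$ starting at $y$). Markov operators. A Markov operator on $X$ is an operator $M=\sum_{s\in S_\xi}p_s s$ on $\ell^2$ of the vertex set of $X$, i.e. $(Mh)(y)=\sum_{s\in S_\xi}p_s h(sy)$, with $p_s>0$, $p_s=p_{s^{-1}}$ for all $s\in S_\xi$ and $\sum_{s\in S_\xi}p_s=1$ (or, more generally, $\sum_s p_s\le1$). Write $p_b$ for $p_{b_\xi}$, $b\in B\setminus\{0\}$. For $\phi\in\mathrm{Epi}(B,A)$ put $q_\phi=\sum_{b\in B\setminus\mathrm{Ker}(\phi)}p_b$. With one letter $\alpha_\phi$ for each $\phi\in\mathrm{Epi}(B,A)$, the essential (eventual) alphabet is $\widetilde{\mathcal{A}}_\xi=\{\alpha_\phi:\xi_j=\phi\text{ for infinitely many }j\in\mathbb{N}\}$. A Cantor set is a nonempty compact, totally disconnected set without isolated points. *)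

(* Defs.v *)
From HB Require Import structures.
From mathcomp Require Import all_boot all_order all_algebra.
From mathcomp Require Import all_classical all_reals all_analysis.
From mathcomp Require Import complex.

Set Implicit Arguments.
Unset Strict Implicit.
Unset Printing Implicit Defensive.

Import Order.TTheory GRing.Theory Num.Theory.
Import numFieldNormedType.Exports.

Local Open Scope classical_set_scope.
Local Open Scope ring_scope.

(** The group A is ['Z_2] and B is ['rV['Z_2]_m]. *)
Definition Epi (m : nat) : set ('rV['Z_2]_m -> 'Z_2) :=
  [set phi : 'rV['Z_2]_m -> 'Z_2 |
    {morph phi : b c / b + c} /\ forall t : 'Z_2, exists b, phi b = t].

(** Sequences are indexed from 0: [xi k] is the (k+1)-st term of the sequence. *)
Definition Xi (m : nat) : set (nat -> 'rV['Z_2]_m -> 'Z_2) :=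
  [set xi | (forall k, Epi (xi k)) /\
            (forall i, \bigcap_(j in [set j | (i <= j)%N]) [set b | xi j b = 0]
                       = [set 0])].

(** Vertices of the tree: finite words over {0,1}, with [true] for the letter 1
    and [false] for the letter 0. *)
Definition word : Type := seq bool.

Definition aut_a (w : word) : word :=
  if w is c :: w' then ~~ c :: w' else [::].

Fixpoint aut_b (m : nat) (xi : nat -> 'rV['Z_2]_m -> 'Z_2) (b : 'rV['Z_2]_m)
    (w : word) : word :=
  match w with
  | [::] => [::]
  | true :: w' => true :: aut_b (fun k => xi k.+1) b w'
  | false :: w' => false :: (if xi 0%N b == 0 then w' else aut_a w')
  end.

(** Labels for the generating set S_xi: [None] stands for [a] and [Some b] for
    [b_xi].  For [xi] in [Xi] the map [b |-> b_xi] is injective and [a] is not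
    one of the [b_xi], so labels and generators are in bijection. *)
Definition slabel (m : nat) : finType := option {b : 'rV['Z_2]_m | b != 0}.

Definition sgen (m : nat) (xi : nat -> 'rV['Z_2]_m -> 'Z_2) (s : slabel m) :
    word -> word :=
  if s is Some b then aut_b xi (val b) else aut_a.

Inductive spinal_group (m : nat) (xi : nat -> 'rV['Z_2]_m -> 'Z_2) :
    (word -> word) -> Prop :=
| spinal_gen s : spinal_group xi (sgen xi s)
| spinal_id : spinal_group xi id
| spinal_mul g h :
    spinal_group xi g -> spinal_group xi h -> spinal_group xi (g \o h)
| spinal_inv g h :
    spinal_group xi g -> cancel g h -> cancel h g -> spinal_group xi h.

Definition bdry : Type := nat -> bool.

(** Meaningful for tree automorphisms [g], which preserve length and prefixes. *)
Definition bact (g : word -> word) (x : bdry) : bdry :=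
  fun n => nth false (g (mkseq x n.+1)) n.

Definition torbit (m : nat) (xi : nat -> 'rV['Z_2]_m -> 'Z_2) (x : bdry) :
    set bdry :=
  [set y | exists2 g, spinal_group xi g & y = bact g x].

Lemma torbit_refl (m : nat) (xi : nat -> 'rV['Z_2]_m -> 'Z_2) (x : bdry) :
  x \in torbit xi x.
Proof.
rewrite inE; exists id; first exact: spinal_id.
by apply/funext => n; rewrite /bact nth_mkseq.
Qed.

Record lgraph (S : Type) := LGraph {
  gvert : choiceType;
  gedge : S -> gvert -> gvert -> Prop;
  groot : gvert }.

Section Graphs.
Context {S : Type}.
Implicit Types X Y : lgraph S.

(** Distances ignore the orientation of edges; balls carry the induced edges. *)
Fixpoint gball X (n : nat) : set (gvert X) :=
  if n is n'.+1 then
    [set z | gball n' z \/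
             exists2 y, gball n' y & exists s, gedge s y z \/ gedge s z y]
  else [set groot X].
Arguments gball : clear implicits.

Definition gconnected X : Prop := forall y : gvert X, exists n, gball X n y.

Definition riso X Y : Prop :=
  exists f : gvert X -> gvert Y,
    [/\ bijective f, f (groot X) = groot Y
      & forall s y z, gedge s y z <-> gedge s (f y) (f z)].

Definition ball_iso (n : nat) X Y : Prop :=
  exists f : gvert X -> gvert Y,
    [/\ set_bij (gball X n) (gball Y n) f, f (groot X) = groot Y
      & forall s y z, gball X n y -> gball X n z ->
          (gedge s y z <-> gedge s (f y) (f z))].

(** Closure and isolated points for the topology of local convergence on the
    space of (isomorphism classes of) connected rooted labelled graphs. *)
Definition gclosure (C : lgraph S -> Prop) : lgraph S -> Prop :=
  fun X => gconnected X /\ forall n, exists Y, C Y /\ ball_iso n X Y.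

Definition gisolated (C : lgraph S -> Prop) : lgraph S -> Prop :=
  fun X => C X /\ exists n, forall Y, C Y -> ball_iso n X Y -> riso X Y.

(** The endpoint of the edge labelled [s] starting at [y] ([y] if there is no
    such edge, which does not happen in the graphs of [Sch]). *)
Definition gact X (s : S) (y : gvert X) : gvert X := xget y [set z | gedge s y z].

End Graphs.

Definition schreier (m : nat) (xi : nat -> 'rV['Z_2]_m -> 'Z_2) (x : bdry) :
    lgraph (slabel m) :=
  @LGraph (slabel m) (set_type (torbit xi x))
    (fun s y z => bact (sgen xi s) (val y) = val z)
    (exist _ x (torbit_refl xi x)).

Definition schreier_closure (m : nat) (xi : nat -> 'rV['Z_2]_m -> 'Z_2) :
    lgraph (slabel m) -> Prop :=
  gclosure (fun X => exists x : bdry, X = schreier xi x).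

Definition Sch (m : nat) (xi : nat -> 'rV['Z_2]_m -> 'Z_2)
    (X : lgraph (slabel m)) : Prop :=
  schreier_closure xi X /\ ~ gisolated (schreier_closure xi) X.

(** All generators are involutions, so the condition p_s = p_(s^-1) is void. *)
Definition markov_weights (R : realType) (m : nat) (p : slabel m -> R) : Prop :=
  (forall s, 0 < p s) /\ \sum_(s : slabel m) p s <= 1.

Definition markov_op (R : realType) (m : nat) (p : slabel m -> R)
    (X : lgraph (slabel m)) (h : gvert X -> R[i]) : gvert X -> R[i] :=
  fun y => \sum_(s : slabel m) (p s)%:C%C * h (gact s y).
Arguments markov_op {R m} p X.

Definition qsum (R : realType) (m : nat) (p : slabel m -> R)
    (phi : 'rV['Z_2]_m -> 'Z_2) : R :=
  \sum_(b : {b : 'rV['Z_2]_m | b != 0} | phi (val b) != 0) p (Some b).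

Definition essential (m : nat) (xi : nat -> 'rV['Z_2]_m -> 'Z_2) :
    set ('rV['Z_2]_m -> 'Z_2) :=
  [set phi | Epi phi /\ infinite_set [set j | xi j = phi]].

Section L2.
Context {R : realType} {V : choiceType}.
Implicit Types (h k : V -> R[i]) (T Q : (V -> R[i]) -> (V -> R[i])).

Definition l2norm2 h : \bar R :=
  (\esum_(v in [set: V]) (complex.Re (h v) ^+ 2 + complex.Im (h v) ^+ 2)%:E)%E.

Definition l2 : set (V -> R[i]) := [set h | (l2norm2 h < +oo)%E].

Definition bounded_operator T : Prop :=
  [/\ forall h, l2 h -> l2 (T h),
      forall (a : R[i]) h k, l2 h -> l2 k -> T (a *: h + k) = a *: T h + T k
    & exists c : R, forall h, l2 h -> (l2norm2 (T h) <= c%:E * l2norm2 h)%E].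

Definition spectrum T : set R[i] :=
  [set z | ~ exists2 Q, bounded_operator Q
             & forall h, l2 h -> Q (T h - z *: h) = h /\ T (Q h) - z *: Q h = h].

End L2.

Definition cantor_set (R : realType) (K : set R) : Prop :=
  [/\ K !=set0, compact K, totally_disconnected K & isolated K = set0].

(* Main.v *)
Require Import Defs.
From mathcomp Require Import all_boot all_order all_algebra.
From mathcomp Require Import all_classical all_reals all_analysis.
From mathcomp Require Import measurable_realfun spectral sesquilinear.
From mathcomp Require Import complex ring lra.

(** Proof idea.  The level-(n+1) graph consists of two copies of the level-n
    graph (a path, up to multiple edges and loops) joined at one end by an edge of
    conductance [q_(xi_n) = 1 / (2 kappa)].  In the coordinate
    [E = lambda - p_a - sum_b p_b], the operator [M - lambda] on a level-n block is
    therefore described by the responses [S_n(E)], [A_n(E)] of its two ends to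
    equal and to opposite currents, which obey an explicit rational recursion.
    Put [a_n = (S_n + A_n) / 2] and [b_n = (S_n - A_n) / 2].  If for some [n] all
    later [kappa_j] satisfy [|kappa_j - a_n| > |b_n|], then [M - lambda] is bounded
    below on all finite levels uniformly.

    The remaining energies form a null set.  For [Im E > 0] all responses lie in a
    horodisc and long blocks contract the upper half-plane, so that the response
    [F] of a long chain is almost independent of its far end.  Harmonic measure is
    replaced by averages over finitely many points of a horizontal line close to
    the real axis.  At a height where the mean of [|1 / (F + i)|^2] hardly changes,
    [F] is almost constant on most of these points; if moreover [Im F] is not small
    there, then, as blocks have almost real responses near the real axis, [F]
    satisfies an approximate reflectionless identity, which forces
    [Re F = kappa_n] for every large [n].  This is impossible when two different
    values of [kappa_n] recur.  Where [Im F] is small, [S_n] and [A_n] are close to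
    a common real number away from all [kappa_j], so few energies nearby are
    exceptional.

    The spectrum of [M] on [X] is the approximate point spectrum of all finite
    levels together: balls of [X] embed in finite levels, and an approximate
    eigenfunction of a finite level vanishing at both ends can be placed in a block
    of [X].  It has no isolated point: two copies of such a function in the next
    level give two eigenvalues there, which differ because an eigenfunction on a
    path is determined by its value at one end. *)

Set Implicit Arguments.
Unset Strict Implicit.
Unset Printing Implicit Defensive.

Import Order.TTheory GRing.Theory Num.Theory.
Import numFieldNormedType.Exports.

Local Open Scope classical_set_scope.
Local Open Scope ring_scope.

(** * Complex numbers and horodiscs *)

(** Origin of the reflectionless identity. If [F] is nearly a constant [f] at the sample points and
    the first block is nearly real there, then [2 kappa_n - conj Phi], with [Phi] the response
    beyond that block, is close to the response of the block loaded by [- conj f]. With [f] frozen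
    the latter is analytic in the energy, the former antianalytic, so averaging moves the relation
    from the sample points to their common centre, at the larger height. There the block is
    dissipative enough to hide its load: both [Phi] and the loaded block are close to [f], and the
    relation becomes [2 kappa_n - conj f = f]. What shapes the argument is that only blocks of a
    fixed level are given boundary values; the response of the infinite chain is never taken to the
    real axis. Hence finite chains and two heights [y' < y], with the parameters chosen in this
    order: [y], the levels [n1] and [n2], a bound [B] on the boundary values of these blocks, the
    tolerance [eps], the height [y'], the chain length [N], the number of nodes. *)

Section ComplexBasics.
Variable R : rcfType.
Local Notation C := R[i].
Local Notation normc := ComplexField.Normc.normc.
Local Notation Re := complex.Re.
Local Notation Im := complex.Im.
Implicit Types (x y z w : C) (r : R).

Lemma complex_eqP z w : Re z = Re w -> Im z = Im w -> z = w.
Proof. by case: z => a b; case: w => c d /= -> ->. Qed.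
Lemma ReD z w : Re (z + w) = Re z + Re w. Proof. by case: z; case: w. Qed.
Lemma ImD z w : Im (z + w) = Im z + Im w. Proof. by case: z; case: w. Qed.
Lemma ReN z : Re (- z) = - Re z. Proof. by case: z. Qed.
Lemma ImN z : Im (- z) = - Im z. Proof. by case: z. Qed.
Lemma ReB z w : Re (z - w) = Re z - Re w. Proof. by rewrite ReD ReN. Qed.
Lemma ImB z w : Im (z - w) = Im z - Im w. Proof. by rewrite ImD ImN. Qed.
Lemma ReM z w : Re (z * w) = Re z * Re w - Im z * Im w.
Proof. by case: z; case: w. Qed.
Lemma ImM z w : Im (z * w) = Re z * Im w + Im z * Re w.
Proof. by case: z => ? ?; case: w. Qed.
Lemma Re_conj z : Re (z^*)%C = Re z. Proof. by case: z. Qed.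
Lemma Im_conj z : Im (z^*)%C = - Im z. Proof. by case: z. Qed.
Lemma ReMr z r : Re (z * r%:C%C) = Re z * r.
Proof. by case: z => a b /=; rewrite mulr0 subr0. Qed.
Lemma ImMr z r : Im (z * r%:C%C) = Im z * r.
Proof. by case: z => a b /=; rewrite mulr0 add0r. Qed.
Lemma conjcD z w : ((z + w)^*)%C = (z^*)%C + (w^*)%C. Proof. exact: rmorphD. Qed.
Lemma conjcN z : ((- z)^*)%C = - (z^*)%C. Proof. exact: rmorphN. Qed.
Lemma conjcB z w : ((z - w)^*)%C = (z^*)%C - (w^*)%C. Proof. exact: rmorphB. Qed.
Lemma conjcM z w : ((z * w)^*)%C = (z^*)%C * (w^*)%C. Proof. exact: rmorphM. Qed.
Lemma conjcV z : ((z^-1)^*)%C = ((z^*)%C)^-1. Proof. exact: conjc_inv. Qed.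
Lemma Re_half z : Re (z / 2) = Re z / 2.
Proof.
have -> : (2^-1 : C) = (2^-1 : R)%:C%C by rewrite fmorphV rmorph_nat.
exact: ReMr.
Qed.
Lemma Im_half z : Im (z / 2) = Im z / 2.
Proof.
have -> : (2^-1 : C) = (2^-1 : R)%:C%C by rewrite fmorphV rmorph_nat.
exact: ImMr.
Qed.

Lemma normcE z : `|z| = (normc z)%:C%C. Proof. by case: z. Qed.
Lemma sqr_normc z : normc z ^+ 2 = Re z ^+ 2 + Im z ^+ 2.
Proof. by case: z => a b; rewrite sqr_sqrtr // addr_ge0 ?sqr_ge0. Qed.
Lemma normc_ge0 z : 0 <= normc z. Proof. by case: z => a b; exact: sqrtr_ge0. Qed.
Lemma normcD z w : normc (z + w) <= normc z + normc w.
Proof. by rewrite -lecR rmorphD /= -!normcE ler_normD. Qed.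
Lemma normcN z : normc (- z) = normc z.
Proof. by apply: complexI; rewrite -!normcE normrN. Qed.
Lemma normcB z w : normc (z - w) <= normc z + normc w.
Proof. by rewrite (le_trans (normcD _ _)) // normcN. Qed.
Lemma normc_distC z w : normc (z - w) = normc (w - z).
Proof. by rewrite -normcN opprB. Qed.
Lemma normc_triangle z w y : normc (z - w) <= normc (z - y) + normc (y - w).
Proof. by have := normcD (z - y) (y - w); rewrite addrA subrK. Qed.
Lemma normc_geB z w : normc z - normc w <= normc (z - w).
Proof. by rewrite lerBlDr -{1}[z](subrK w); exact: normcD. Qed.
Lemma normcM z w : normc (z * w) = normc z * normc w.
Proof. exact: ComplexField.Normc.normcM. Qed.
Lemma normcV z : normc z^-1 = (normc z)^-1.
Proof. exact: ComplexField.Normc.normcV. Qed.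
Lemma normc0 : normc (0 : C) = 0. Proof. exact: ComplexField.Normc.normc0. Qed.
Lemma normc1 : normc (1 : C) = 1. Proof. exact: ComplexField.Normc.normc1. Qed.
Lemma normcX z n : normc (z ^+ n) = normc z ^+ n.
Proof. by elim: n => [|n IH]; rewrite ?expr0 ?normc1 // !exprS normcM IH. Qed.
Lemma normc_eq0 z : (normc z == 0) = (z == 0).
Proof.
apply/eqP/eqP => [|->]; last exact: normc0.
exact: ComplexField.Normc.eq0_normc.
Qed.
Lemma normc_gt0 z : (0 < normc z) = (z != 0).
Proof. by rewrite lt_def normc_eq0 normc_ge0 andbT. Qed.
Lemma normc_conj z : normc (z^*)%C = normc z.
Proof. by case: z => a b /=; rewrite sqrrN. Qed.
Lemma normc_real r : normc r%:C%C = `|r|.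
Proof. by rewrite /= expr0n addr0 sqrtr_sqr. Qed.
Lemma normc_nat n : normc (n%:R : C) = n%:R.
Proof. by rewrite -(rmorph_nat (real_complex R)) normc_real normr_nat. Qed.
Lemma normcf_div z w : normc (z / w) = normc z / normc w.
Proof. by rewrite normcM normcV. Qed.
Lemma normc_half z : normc (z / 2) = normc z / 2.
Proof. by rewrite normcf_div normc_nat. Qed.

Lemma ler_sqr_normc z w : Re z ^+ 2 + Im z ^+ 2 <= Re w ^+ 2 + Im w ^+ 2 ->
  normc z <= normc w.
Proof. by rewrite -!sqr_normc ler_pXn2r ?nnegrE ?normc_ge0. Qed.

Lemma ler_normr_normc_Re z : `|Re z| <= normc z.
Proof.
rewrite -(@ler_pXn2r _ 2) ?nnegrE ?normc_ge0 ?normr_ge0 //.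
by rewrite sqr_normc real_normK ?num_real // lerDl sqr_ge0.
Qed.
Lemma ler_normr_normc_Im z : `|Im z| <= normc z.
Proof.
rewrite -(@ler_pXn2r _ 2) ?nnegrE ?normc_ge0 ?normr_ge0 //.
by rewrite sqr_normc real_normK ?num_real // lerDr sqr_ge0.
Qed.
Lemma ler_Re_normc z : Re z <= normc z.
Proof. exact: le_trans (ler_norm _) (ler_normr_normc_Re z). Qed.
Lemma ler_Im_normc z : Im z <= normc z.
Proof. exact: le_trans (ler_norm _) (ler_normr_normc_Im z). Qed.
Lemma normc_le_ReIm z : normc z <= `|Re z| + `|Im z|.
Proof.
rewrite -(@ler_pXn2r _ 2) ?nnegrE ?normc_ge0 ?addr_ge0 //.
rewrite sqr_normc sqrrD !real_normK ?num_real //.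
by rewrite [leRHS]addrAC lerDl mulrn_wge0 ?mulr_ge0.
Qed.
Lemma ReV z : Re z^-1 = Re z / normc z ^+ 2.
Proof. by rewrite sqr_normc; case: z. Qed.
Lemma ImV z : Im z^-1 = - Im z / normc z ^+ 2.
Proof. by rewrite sqr_normc; case: z => a b /=; rewrite mulNr. Qed.
Lemma Im_neq0 z : Im z != 0 -> z != 0.
Proof. by apply: contraNneq => ->. Qed.
Lemma Im_gt0_neq0 z : 0 < Im z -> z != 0.
Proof. by move=> h; apply: Im_neq0; rewrite gt_eqF. Qed.
Lemma Im_lt0_neq0 z : Im z < 0 -> z != 0.
Proof. by move=> h; apply: Im_neq0; rewrite lt_eqF. Qed.
End ComplexBasics.

Section Horodisc.
Variable R : rcfType.
Local Notation C := R[i].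
Local Notation normc := ComplexField.Normc.normc.
Local Notation Re := complex.Re.
Local Notation Im := complex.Im.

(* The closed disc tangent to the real line at 0 with diameter 1/Y; it is the
   image of [{Im >= Y}] under [z |-> - 1 / z]. *)
Definition horodisc (Y : R) (s : C) : Prop := Y * normc s ^+ 2 <= Im s.

Lemma horodisc0 Y : horodisc Y 0.
Proof. by rewrite /horodisc normc0 expr0n mulr0. Qed.

Lemma horodisc_Im_ge0 Y s : 0 <= Y -> horodisc Y s -> 0 <= Im s.
Proof. by move=> Y0; apply: le_trans; rewrite mulr_ge0 // sqr_ge0. Qed.

Lemma horodisc_Im_gt0 Y s : 0 < Y -> horodisc Y s -> s != 0 -> 0 < Im s.
Proof.
move=> Y0 hs s0; apply: lt_le_trans hs.
by rewrite mulr_gt0 // exprn_gt0 // normc_gt0.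
Qed.

Lemma horodisc_norm Y s : 0 < Y -> horodisc Y s -> normc s <= Y^-1.
Proof.
move=> Y0 hs; have [->|s0] := eqVneq s 0; first by rewrite normc0 invr_ge0 ltW.
have n0 : 0 < normc s by rewrite normc_gt0.
rewrite -(ler_pM2l Y0) divff ?gt_eqF //.
rewrite -(ler_pM2r n0) mul1r -mulrA -expr2.
exact: le_trans hs (ler_Im_normc s).
Qed.

Lemma horodiscP Y s : 0 < Y ->
  horodisc Y s <-> normc (s - (Complex 0 (Y^-1 / 2))) <= Y^-1 / 2.
Proof.
move=> Y0; have h0 : 0 <= Y^-1 / 2 by rewrite divr_ge0 ?invr_ge0 ?ltW.
rewrite -(@ler_pXn2r _ 2) ?nnegrE ?normc_ge0 // /horodisc !sqr_normc.
case: s => x y /=; rewrite subr0.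
have -> : (x ^+ 2 + (y - Y^-1 / 2) ^+ 2 <= (Y^-1 / 2) ^+ 2) =
  (Y^-1 * (Y * (x ^+ 2 + y ^+ 2)) <= Y^-1 * y).
  by rewrite mulKf ?gt_eqF //; apply/idP/idP; nra.
by rewrite ler_pM2l ?invr_gt0.
Qed.

Lemma horodisc_half Y s t : 0 <= Y -> horodisc Y s -> horodisc Y t ->
  horodisc Y ((s + t) / 2).
Proof.
rewrite /horodisc !sqr_normc Re_half Im_half ReD ImD => Y0 hs ht.
have : 0 <= Y * ((Re s - Re t) ^+ 2 + (Im s - Im t) ^+ 2).
  by rewrite mulr_ge0 // addr_ge0 ?sqr_ge0.
nra.
Qed.

(** In the coordinate [beta = 1 / (zeta - s)] the horodisc is a sublevel set of a real quadratic
    polynomial with leading coefficient [Y * |zeta|^2 - Im zeta]. This is positive when [zeta] lies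
    outside the horodisc; the sublevel set is then convex, hence stable under the averaging of
    [beta] that is hidden in [hmean]. *)
Let phi Y (zeta beta : C) : R :=
  Y * normc (zeta * beta - 1) ^+ 2 - Im beta - Im zeta * normc beta ^+ 2.

Let horodisc_phi Y zeta beta : beta != 0 ->
  horodisc Y (zeta - beta^-1) <-> phi Y zeta beta <= 0.
Proof.
move=> b0; have nb : 0 < normc beta ^+ 2 by rewrite exprn_gt0 // normc_gt0.
have e : zeta - beta^-1 = (zeta * beta - 1) / beta by field.
rewrite /horodisc /phi ImB ImV mulNr opprK e normcf_div expr_div_n.
rewrite -(ler_pM2r nb) (mulrA Y) divfK ?gt_eqF // mulrDl divfK ?gt_eqF //.
by split => ?; lra.
Qed.

Let phi_mid Y zeta b1 b2 : 0 <= Y * normc zeta ^+ 2 - Im zeta ->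
  phi Y zeta ((b1 + b2) / 2) <= (phi Y zeta b1 + phi Y zeta b2) / 2.
Proof.
move=> h.
have hX : 0 <= (Y * normc zeta ^+ 2 - Im zeta) * normc (b1 - b2) ^+ 2 / 4.
  by rewrite divr_ge0 // mulr_ge0 // sqr_ge0.
rewrite -subr_ge0; apply: le_trans hX _; rewrite le_eqVlt; apply/orP; left.
rewrite /phi !sqr_normc.
rewrite !(ReB, ImB, ReM, ImM, Re_half, Im_half, ReD, ImD) /=.
by apply/eqP; field.
Qed.

Definition amean (s t : C) : C := (s + t) / 2.

(* [hmean zeta s t] is [zeta] minus the harmonic mean of [zeta - s] and
   [zeta - t]. *)
Definition hmean (zeta s t : C) : C :=
  (zeta * amean s t - s * t) / (zeta - amean s t).

Lemma horodisc_sub_neq0 Y zeta s : Im zeta < Y * normc zeta ^+ 2 ->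
  horodisc Y s -> zeta - s != 0.
Proof.
move=> hz hs; apply: contraTneq hz => /eqP; rewrite subr_eq0 => /eqP ->.
by rewrite -leNgt.
Qed.

Lemma hmeanE zeta s t : zeta - s != 0 -> zeta - t != 0 ->
    zeta - amean s t != 0 ->
  hmean zeta s t = zeta - (amean (zeta - s)^-1 (zeta - t)^-1)^-1.
Proof.
move=> h1 h2 h3; rewrite /hmean /amean.
have h4 : (zeta - t) + (zeta - s) != 0.
  apply: contraNneq h3 => h; rewrite /amean.
  have -> : zeta - (s + t) / 2 = ((zeta - t) + (zeta - s)) / 2 by field.
  by rewrite h mul0r.
by field; rewrite h1 h2 h4.
Qed.

Lemma horodisc_hmean Y zeta s t : 0 < Y -> Im zeta < Y * normc zeta ^+ 2 ->
    horodisc Y s -> horodisc Y t ->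
  horodisc Y (hmean zeta s t).
Proof.
move=> Y0 hz hs ht.
have h1 := horodisc_sub_neq0 hz hs; have h2 := horodisc_sub_neq0 hz ht.
have h3 := horodisc_sub_neq0 hz (horodisc_half (ltW Y0) hs ht).
rewrite hmeanE // /amean.
set b1 := (zeta - s)^-1; set b2 := (zeta - t)^-1.
have p1 : phi Y zeta b1 <= 0.
  by apply/horodisc_phi; rewrite ?invr_eq0 // /b1 invrK opprB addrC subrK.
have p2 : phi Y zeta b2 <= 0.
  by apply/horodisc_phi; rewrite ?invr_eq0 // /b2 invrK opprB addrC subrK.
have p3 : phi Y zeta ((b1 + b2) / 2) <= 0.
  have := @phi_mid Y zeta b1 b2; rewrite subr_ge0 => /(_ (ltW hz)); lra.
(* The averaged coordinate cannot vanish, since [phi] takes the value [Y > 0] at 0. *)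
apply/horodisc_phi => //; apply: contraTneq p3 => ->.
by rewrite /phi mulr0 sub0r normcN normc1 normc0 expr1n expr0n /= !mulr0 mulr1 !subr0 -ltNge.
Qed.

End Horodisc.

(** * Responses of blocks *)

Section Response.
Variable R : rcfType.
Local Notation C := R[i].
Local Notation normc := ComplexField.Normc.normc.
Local Notation Re := complex.Re.
Local Notation Im := complex.Im.
Variables (kappa : nat -> R) (kappa_gt0 : forall n, 0 < kappa n).

(* [respS E n] and [respA E n] are the responses of the two ends of a level-n
   block to equal and to opposite currents at the ends; [kappa n] is half the
   resistance of the edge joining two level-n blocks. *)
Fixpoint resp (E : C) (n : nat) : C * C :=
  if n is n'.+1 then
    let: (s, t) := resp E n' in (amean s t, hmean (kappa n')%:C%C s t)
  else (0, - 2 / E).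

Definition respS E n := (resp E n).1.
Definition respA E n := (resp E n).2.

(** The recursion reflects the mirror symmetry of two level-n blocks joined at one end. Equal
    currents at the outer ends send nothing through the joining edge, so each block responds with
    its inner end free: the mean of [S] and [A]. Opposite currents put the midpoint of that edge at
    potential 0, so each inner end is grounded through half the edge; eliminating its current yields
    [hmean]. *)
Lemma respSS E n : respS E n.+1 = amean (respS E n) (respA E n).
Proof. by rewrite /respS /respA /=; case: (resp E n). Qed.

Lemma respAS E n :
  respA E n.+1 = hmean (kappa n)%:C%C (respS E n) (respA E n).
Proof. by rewrite /respS /respA /=; case: (resp E n). Qed.

(* The response at one end of a block whose other end is loaded by a network of
   response [z]. *)
Definition loaded E n (z : C) : C := hmean (- z) (respS E n) (respA E n).

(* [chain_resp E n j] is the response of a chain of blocks of levels n, n, n + 1,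
   ..., n + j - 1, the far end being grounded through an edge; [tail_resp E n j]
   is that of the part beyond the first block and the edge following it. *)
Fixpoint tail_resp E n j : C :=
  if j is j'.+1 then loaded E n (tail_resp E n.+1 j' - (2 * kappa n.+1)%:C%C)
  else 0.

Definition chain_resp E n j : C :=
  loaded E n (tail_resp E n j - (2 * kappa n)%:C%C).

Section UpperHalfPlane.
Variables (E : C) (Y : R).
Hypotheses (Y_gt0 : 0 < Y) (YE : 2 * Y <= Im E).
Notation S n := (respS E n).
Notation A n := (respA E n).
Notation kC n := ((kappa n)%:C%C : C).

Let E_neq0 : E != 0.
Proof. by apply: Im_gt0_neq0; apply: lt_le_trans YE; rewrite mulr_gt0. Qed.

Lemma kappa_outside_horodisc n : Im (kC n) < Y * normc (kC n) ^+ 2.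
Proof.
by rewrite normc_real /= mulr_gt0 // exprn_gt0 // normr_gt0 gt_eqF.
Qed.

(** Both means preserve the horodisc, since [kappa n] is real and nonzero and so lies outside of it.
    The initial value [-2 / E] belongs to it exactly when [2 * Y <= Im E]; this is the source of the
    factor 2. *)
Lemma horodisc_resp n : horodisc Y (S n) /\ horodisc Y (A n).
Proof.
elim: n => [|n [hS hA]]; last first.
  rewrite respSS respAS; split; first exact: horodisc_half (ltW Y_gt0) hS hA.
  exact: horodisc_hmean (kappa_outside_horodisc n) hS hA.
split; rewrite /respS /respA /=; first exact: horodisc0.
rewrite /horodisc normcf_div normcN normc_nat expr_div_n.
have n0 : 0 < normc E ^+ 2 by rewrite exprn_gt0 // normc_gt0.
have -> : Im (-2 / E) = 2 * Im E / normc E ^+ 2.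
  have -> : - 2 / E = - ((2 : R)%:C%C * E^-1) by rewrite rmorph_nat mulNr.
  by rewrite ImN mulrC ImMr ImV; field; rewrite normc_eq0.
rewrite mulrA ler_pM2r ?invr_gt0 // -natrX; move: YE; lra.
Qed.

Let horodiscS n := (horodisc_resp n).1.
Let horodiscA n := (horodisc_resp n).2.

Lemma respS_succ_neq0 n : S n.+1 != 0.
Proof.
elim: n => [|n IH].
  rewrite respSS /respS /respA /amean /= add0r.
  by rewrite !(mulf_neq0, invr_neq0) // ?oppr_eq0 ?pnatr_eq0.
apply: contraNneq IH => h; have := h; rewrite respSS /amean.
move=> /eqP; rewrite mulf_eq0 invr_eq0 pnatr_eq0 orbF => /eqP e.
have hS := horodiscS n.+1; have hA := horodiscA n.+1.
have := horodisc_Im_gt0 Y_gt0 hS; have [->//|_ /(_ isT) hp] := eqVneq (S n.+1) 0.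
have := horodisc_Im_ge0 (ltW Y_gt0) hA.
have : Im (S n.+1 + A n.+1) = 0 by rewrite e.
by rewrite ImD; lra.
Qed.

Lemma Im_respS_gt0 n : 0 < Im (S n.+1).
Proof. exact: horodisc_Im_gt0 Y_gt0 (horodiscS _) (respS_succ_neq0 n). Qed.

Lemma add_respS_neq0 z n : 0 <= Im z -> z + S n.+1 != 0.
Proof. by move=> hz; apply: Im_gt0_neq0; rewrite ImD ltr_wpDl // Im_respS_gt0. Qed.

Lemma kappa_sub_respS_neq0 n : kC n - S n.+1 != 0.
Proof. by apply: Im_lt0_neq0; rewrite ImB /= sub0r oppr_lt0 Im_respS_gt0. Qed.

(** With end currents [x], [y] the end potentials are [a x + b y] and [b x + a y], where
    [a = S n.+1] and [a^2 - b^2 = S n * A n]. Closing the second end by [z] gives the Moebius map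
    [a - b^2 / (z + a)]. *)
Lemma loadedE z n :
  loaded E n z = (S n.+1 * z + S n * A n) / (z + S n.+1).
Proof.
rewrite /loaded /hmean -respSS.
have -> : - z * S n.+1 - S n * A n = - (S n.+1 * z + S n * A n) by ring.
have -> : - z - S n.+1 = - (z + S n.+1) by ring.
by rewrite invrN mulrNN.
Qed.

Lemma neg_outside_horodisc z : 0 <= Im z -> z != 0 ->
  Im (- z) < Y * normc (- z) ^+ 2.
Proof.
move=> hz z0; rewrite ImN normcN.
apply: (@le_lt_trans _ _ 0); first by rewrite oppr_le0.
by rewrite mulr_gt0 // exprn_gt0 // normc_gt0.
Qed.

Lemma horodisc_loaded z n : 0 <= Im z -> z != 0 -> horodisc Y (loaded E n z).
Proof.
by move=> hz z0; apply: horodisc_hmean (horodiscS n) (horodiscA n) => //;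
  apply: neg_outside_horodisc.
Qed.

Lemma sub_kappa_neq0 (s : C) n : horodisc Y s -> s - (2 * kappa n)%:C%C != 0.
Proof.
move=> hs; apply: contraTneq hs => /eqP; rewrite subr_eq0 => /eqP ->.
rewrite /horodisc normc_real /= -ltNge mulr_gt0 // exprn_gt0 //.
by rewrite normr_gt0 gt_eqF // mulr_gt0.
Qed.

Lemma sub_kappa_Im (s : C) n : horodisc Y s -> 0 <= Im (s - (2 * kappa n)%:C%C).
Proof. by move=> hs; rewrite ImB /= subr0; apply: horodisc_Im_ge0 hs; rewrite ltW. Qed.

Lemma horodisc_tail n j : horodisc Y (tail_resp E n j).
Proof.
elim: j n => [|j IH] n /=; first exact: horodisc0.
by apply: horodisc_loaded; [exact: sub_kappa_Im | exact: sub_kappa_neq0].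
Qed.

Lemma horodisc_chain n j : horodisc Y (chain_resp E n j).
Proof.
have h := horodisc_tail n j.
by apply: horodisc_loaded; [exact: sub_kappa_Im | exact: sub_kappa_neq0].
Qed.

Lemma resp_prodS n :
  S n.+1 * A n.+1 =
  S n.+1 * (kC n * S n.+1 - S n * A n) / (kC n - S n.+1).
Proof. by rewrite respAS /hmean -respSS mulrA. Qed.

Lemma respS_SS n : S n.+2 =
  (2 * kC n * S n.+1 - S n.+1 ^+ 2 - S n * A n) / (2 * (kC n - S n.+1)).
Proof.
have h := kappa_sub_respS_neq0 n.
rewrite [S n.+2]respSS respAS /hmean -respSS {1}/amean.
by field.
Qed.

(** Series composition: a block of level n + 1 is a level-n block, an edge that contributes
    [- 2 kappa n], and a second level-n block carrying the load. *)
Lemma loadedS n z : 0 <= Im z ->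
  loaded E n.+1 z = loaded E n (loaded E n z - (2 * kappa n)%:C%C).
Proof.
move=> hz; rewrite !loadedE.
have h0 := kappa_sub_respS_neq0 n.
have h1 := add_respS_neq0 n hz.
have h2 : 2 * (kC n - S n.+1) * (z + S n.+2) != 0.
  by rewrite !mulf_neq0 ?pnatr_eq0 ?add_respS_neq0.
have e2 : 2 * (kC n - S n.+1) * (z + S n.+2) =
    z * (2 * (kC n - S n.+1)) +
    (2 * kC n * S n.+1 - S n.+1 ^+ 2 - S n * A n).
  by rewrite respS_SS; field.
have -> : (2 * kappa n)%:C%C = 2 * kC n by rewrite rmorphM rmorph_nat.
have e3 : (S n.+2 * z + S n.+1 * A n.+1) / (z + S n.+2) =
  (z * (2 * kC n * S n.+1 - S n.+1 ^+ 2 - S n * A n) +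
     2 * S n.+1 * (kC n * S n.+1 - S n * A n)) /
  (z * (2 * (kC n - S n.+1)) +
    (2 * kC n * S n.+1 - S n.+1 ^+ 2 - S n * A n)).
  rewrite -e2 resp_prodS {1}respS_SS.
  by field; rewrite h0 add_respS_neq0.
rewrite e3; move: h2; rewrite e2 {e2 e3}.
move: (S n.+1) (kC n) (S n * A n) h0 h1 => u k q h0 h1 h2.
field; rewrite h1 /=; apply/andP; split; apply: contraNneq h2 => h; last first.
  by rewrite h.
by apply/eqP; rewrite -[RHS]oppr0 -h; ring.
Qed.

(** A chain begins with two blocks of equal level, which form one block of the next level. Hence one
    and the same long chain can be cut after its first block at different levels, as is needed to
    compare two values of [kappa]. *)
Lemma chain_respS n j : chain_resp E n j.+1 = chain_resp E n.+1 j.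
Proof.
rewrite /chain_resp /= -loadedS //; apply: sub_kappa_Im.
exact: horodisc_tail.
Qed.

Lemma chain_resp_shift n j : chain_resp E n j = chain_resp E (n + j) 0.
Proof.
by elim: j n => [|j IH] n; rewrite ?addn0 // chain_respS IH addSnnS.
Qed.

Lemma respS_neq_respA n : S n != A n.
Proof.
elim: n => [|n IH].
  by rewrite /respS /respA /= eq_sym mulf_neq0 ?invr_neq0 // oppr_eq0 pnatr_eq0.
have h0 := kappa_sub_respS_neq0 n.
rewrite -subr_eq0.
have -> : S n.+1 - A n.+1 = - (S n - A n) ^+ 2 / (4 * (kC n - S n.+1)).
  rewrite respAS /hmean -respSS.
  have e : S n.+1 = (S n + A n) / 2 by rewrite respSS.
  move: h0; rewrite e; move: (S n) (A n) (kC n) => s a k h0.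
  have h1 : 2 * k - (s + a) != 0.
    apply: contraNneq h0 => h.
    have -> : k - (s + a) / 2 = (2 * k - (s + a)) / 2 by field.
    by rewrite h mul0r.
  by field; apply: contraNneq h1 => h; apply/eqP; rewrite -h; ring.
apply: mulf_neq0; first by rewrite oppr_eq0 expf_neq0 // subr_eq0.
by rewrite invr_neq0 // mulf_neq0 // pnatr_eq0.
Qed.

(* The response at the far end of the block, read from the response at its
   near end. *)
Lemma tail_resp_loaded n j :
  (2 * kappa n)%:C%C - tail_resp E n j = loaded E n (- chain_resp E n j).
Proof.
have hF := horodisc_tail n j.
have h0 := add_respS_neq0 n (sub_kappa_Im n hF).
have hb := respS_neq_respA n.
rewrite /chain_resp !loadedE.
move: h0; set w := _ - (2 * kappa n)%:C%C => h0.
have -> : (2 * kappa n)%:C%C - tail_resp E n j = - w by rewrite opprB.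
have hb2 : S n.+1 ^+ 2 - S n * A n != 0.
  rewrite respSS /amean.
  have -> : ((S n + A n) / 2) ^+ 2 - S n * A n = ((S n - A n) / 2) ^+ 2.
    by field.
  by rewrite expf_neq0 // mulf_neq0 ?invr_neq0 ?pnatr_eq0 // subr_eq0.
move: h0 hb2; move: (S n.+1) (S n * A n) w => u q w h0 hb2.
field; rewrite h0 /=; apply: contraNneq hb2 => h.
by apply/eqP; rewrite -h; ring.
Qed.


Definition upper (z : C) : Prop := 0 <= Im z /\ z != 0.

(* A bound [r] on the pseudo-hyperbolic distance, in a form that makes sense on
   the closed half-plane. *)
Definition hclose (r : R) (z w : C) : Prop :=
  normc (z - w) <= r * normc (z - (w^*)%C).

Definition contracting (k : R) (f : C -> C) : Prop :=
  forall r z w, 0 <= r -> upper z -> upper w -> hclose r z w ->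
    hclose (k * r) (f z) (f w).

Lemma hclose1 (z w : C) : 0 <= Im z -> 0 <= Im w -> hclose 1 z w.
Proof.
move=> hz hw; rewrite /hclose mul1r; apply: ler_sqr_normc.
rewrite !(ReB, ImB, Re_conj, Im_conj) lerD2l opprK.
by have := mulr_ge0 hz hw; nra.
Qed.

Lemma upper_tail_shift (s : C) n : horodisc Y s -> upper (s - (2 * kappa n)%:C%C).
Proof. by split; [exact: sub_kappa_Im | exact: sub_kappa_neq0]. Qed.

Lemma upper_loaded_shift z n : upper z ->
  upper (loaded E n z - (2 * kappa n)%:C%C).
Proof. by case=> hz z0; apply: upper_tail_shift; exact: horodisc_loaded. Qed.

Lemma hclose_shift r (z w : C) (x : R) :
  hclose r z w -> hclose r (z - x%:C%C) (w - x%:C%C).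
Proof.
rewrite /hclose.
have -> : ((w - x%:C%C)^*)%C = (w^*)%C - x%:C%C.
  by rewrite rmorphB; congr (_ - _); exact: conjc_real.
have -> : z - x%:C%C - (w - x%:C%C) = z - w by ring.
by have -> : z - x%:C%C - ((w^*)%C - x%:C%C) = z - (w^*)%C by ring.
Qed.

Lemma contracting_loadedS k n : 0 <= k ->
  contracting k (loaded E n) -> contracting (k * k) (loaded E n.+1).
Proof.
move=> k0 hk r z w r0 hz hw zw; rewrite !loadedS; [|by case: hw|by case: hz].
rewrite -mulrA; apply: (hk (k * r)); [exact: mulr_ge0|exact: upper_loaded_shift..|].
by apply: hclose_shift; exact: hk.
Qed.

Lemma loaded0E z : loaded E 0 z = z / (1 - E * z).
Proof.
rewrite loadedE respSS /respS /respA /amean /= mul0r addr0 add0r.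
have [h|h] := eqVneq (1 - E * z) 0.
  have -> : z + - 2 / E / 2 = - (1 - E * z) / E by field.
  by rewrite h oppr0 mul0r !invr0 !mulr0.
field; rewrite E_neq0 h /=.
have -> : z * (E * 2) - 2 = - 2 * (1 - E * z) by ring.
by rewrite mulf_neq0 // oppr_eq0 pnatr_eq0.
Qed.

Lemma one_sub_neq0 z : upper z -> 1 - E * z != 0.
Proof.
case=> hz z0.
have -> : 1 - E * z = (z^-1 - E) * z by field.
rewrite mulf_neq0 //; apply: Im_lt0_neq0; rewrite ImB ImV.
have : 0 <= Im z / normc z ^+ 2 by rewrite divr_ge0 ?sqr_ge0.
by rewrite mulNr => h; move: Y_gt0 YE; lra.
Qed.

Lemma loaded0_dist z w : upper z -> upper w ->
  normc (loaded E 0 z - loaded E 0 w) =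
  normc (z - w) / (normc (1 - E * z) * normc (1 - E * w)).
Proof.
move=> hz hw; have h1 := one_sub_neq0 hz; have h2 := one_sub_neq0 hw.
rewrite !loaded0E -normcM -normcf_div; congr normc.
by field; rewrite ?h1 ?h2.
Qed.

Lemma loaded0_cdist z w : upper z -> upper w ->
  normc (loaded E 0 z - ((loaded E 0 w)^*)%C) =
  normc (z - (w^*)%C + Complex 0 (2 * Im E) * (z * (w^*)%C)) /
    (normc (1 - E * z) * normc (1 - E * w)).
Proof.
move=> hz hw; have h1 := one_sub_neq0 hz; have h2 := one_sub_neq0 hw.
have hc : ((1 - E * w)^*)%C = 1 - (E^*)%C * (w^*)%C.
  by rewrite conjcB conjcM conjc1.
have h3 : 1 - (E^*)%C * (w^*)%C != 0.
  by rewrite -hc conjc_eq0.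
have hd : ((w / (1 - E * w))^*)%C = (w^*)%C / (1 - (E^*)%C * (w^*)%C).
  by rewrite conjcM conjcV hc.
rewrite -[normc (1 - E * w)]normc_conj hc !loaded0E hd.
rewrite -normcM -normcf_div; congr normc.
have -> : Complex 0 (2 * Im E) = E - (E^*)%C.
  by apply: complex_eqP; rewrite ?(ReB, ImB) ?Re_conj ?Im_conj /=; ring.
by field; rewrite ?h1 ?h2 ?h3.
Qed.

Lemma cdist_expand (z w : C) (y : R) :
  normc (z - (w^*)%C + Complex 0 (2 * y) * (z * (w^*)%C)) ^+ 2 =
  normc (z - (w^*)%C) ^+ 2 + 4 * y ^+ 2 * (normc z ^+ 2 * normc w ^+ 2) +
  4 * y * (normc z ^+ 2 * Im w + normc w ^+ 2 * Im z).
Proof.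
rewrite !sqr_normc !(ReD, ImD, ReN, ImN, ReM, ImM, Re_conj, Im_conj) /=.
by ring.
Qed.

(** In the coordinate [-1 / z] this map is the translation by [E], so it does not expand. No factor
    below 1 is possible yet: near [z = 0] the translation is negligible. *)
Lemma contracting_loaded0 : contracting 1 (loaded E 0).
Proof.
move=> r z w r0 hz hw; rewrite /hclose mul1r => zw.
rewrite loaded0_dist // loaded0_cdist // [r * (_ / _)]mulrA ler_pM2r; last first.
  by rewrite invr_gt0 mulr_gt0 // normc_gt0 one_sub_neq0.
apply: le_trans zw _; rewrite ler_wpM2l //.
rewrite -(@ler_pXn2r _ 2) ?nnegrE ?normc_ge0 // cdist_expand -addrA lerDl.
have hE : 0 <= Im E by apply: le_trans YE; rewrite mulr_ge0 // ltW.
have [hz0 _] := hz; have [hw0 _] := hw.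
by rewrite addr_ge0 ?mulr_ge0 ?addr_ge0 ?mulr_ge0 ?sqr_ge0 ?normc_ge0.
Qed.

Lemma dist_kappa_horodisc (s : C) n : horodisc Y s ->
  Num.min (kappa n) (Y * kappa n ^+ 2) <= normc (s - (2 * kappa n)%:C%C).
Proof.
move=> hs; rewrite ge_min; have [h|h] := leP (normc s) (kappa n).
  apply/orP; left; rewrite normc_distC; apply: le_trans (normc_geB _ _).
  by rewrite normc_real (gtr0_norm (mulr_gt0 _ (kappa_gt0 n))) //; lra.
apply/orP; right; apply: le_trans (ler_Im_normc _); rewrite ImB /= subr0.
by apply: le_trans hs; rewrite ler_pM2l // ler_pXn2r ?nnegrE ?normc_ge0 // ltW.
Qed.

Definition contraction_factor : R :=
  Num.sqrt ((1 + (Y * Num.min (kappa 0) (Y * kappa 0 ^+ 2)) ^+ 2)^-1).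

(** Strictness comes with the first joining edge. After the shift by [2 * kappa 0] the points of the
    horodisc keep distance [beta] from 0, so the additional term [2 i Im E z conj w] of
    [loaded0_cdist] is of the order of [z - conj w] and yields a fixed gain. *)
Lemma contracting_loaded1 : contracting contraction_factor (loaded E 1).
Proof.
move=> r z w r0 hz hw zw; rewrite !loadedS; [|by case: hw|by case: hz].
have := contracting_loaded0 r0 hz hw zw; rewrite mul1r.
set s := loaded E 0 z; set t := loaded E 0 w.
have hs : horodisc Y s by case: hz => *; exact: horodisc_loaded.
have ht : horodisc Y t by case: hw => *; exact: horodisc_loaded.
move=> /(hclose_shift (2 * kappa 0)).
have := upper_tail_shift 0 hs; have := upper_tail_shift 0 ht.
have := dist_kappa_horodisc 0 hs; have := dist_kappa_horodisc 0 ht.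
rewrite /contraction_factor; set beta := Num.min _ _.
have b0 : 0 < beta by rewrite lt_min kappa_gt0 mulr_gt0 // exprn_gt0.
move: (s - _) (t - _) => {hs ht} {}s {}t ht hs ut us st.
rewrite /hclose loaded0_dist // loaded0_cdist // [_ * r * (_ / _)]mulrA ler_pM2r; last first.
  by rewrite invr_gt0 mulr_gt0 // normc_gt0 one_sub_neq0.
apply: le_trans st _; rewrite [_ * r]mulrC -mulrA ler_wpM2l //.
set K := 1 + _; have K0 : 0 < K by rewrite ltr_pwDl // sqr_ge0.
rewrite -(@ler_pXn2r _ 2) ?nnegrE ?mulr_ge0 ?sqrtr_ge0 ?normc_ge0 //.
rewrite exprMn sqr_sqrtr ?invr_ge0; last exact: ltW.
rewrite [K^-1 * _]mulrC ler_pdivlMr // cdist_expand.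
have hE : Y <= Im E by move: Y_gt0 YE; lra.
have [us0 _] := us; have [ut0 _] := ut.
have h1 : normc (s - (t^*)%C) <= 2 * (normc s * normc t) / beta.
  apply: le_trans (normcB _ _) _; rewrite normc_conj ler_pdivlMr //.
  have := ler_wpM2l (normc_ge0 s) ht; have := ler_wpM2l (normc_ge0 t) hs.
  by rewrite mulrDl; lra.
have h2 : (normc (s - (t^*)%C) * beta) ^+ 2 <= (2 * (normc s * normc t)) ^+ 2.
  rewrite ler_pXn2r ?nnegrE ?mulr_ge0 ?normc_ge0 ?(ltW b0) //.
  by rewrite -ler_pdivlMr.
have h3 : 0 <= 4 * Im E * (normc s ^+ 2 * Im t + normc t ^+ 2 * Im s).
  by rewrite ?mulr_ge0 ?addr_ge0 ?mulr_ge0 ?sqr_ge0 ?normc_ge0 ?(le_trans (ltW Y_gt0) hE).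
have h4 : Y ^+ 2 * (4 * (normc s ^+ 2 * normc t ^+ 2)) <=
    Im E ^+ 2 * (4 * (normc s ^+ 2 * normc t ^+ 2)).
  apply: ler_wpM2r; first by rewrite !mulr_ge0 ?normc_ge0.
  by rewrite ler_pXn2r ?nnegrE ?(ltW Y_gt0) ?(le_trans (ltW Y_gt0) hE).
have h5 := ler_wpM2l (sqr_ge0 Y) h2.
rewrite /K mulrDr mulr1.
move: h3 h4 h5; rewrite !exprMn; lra.
Qed.

Lemma contraction_factor_ge0 : 0 <= contraction_factor.
Proof. exact: sqrtr_ge0. Qed.

(** Each level applies the map of the previous one twice, so the contraction factor is squared. *)
Lemma contracting_loaded n :
  contracting (contraction_factor ^+ (2 ^ n)) (loaded E n.+1).
Proof.
elim: n => [|n IH]; first by rewrite expr1; exact: contracting_loaded1.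
rewrite expnS mulnC exprM expr2; apply: contracting_loadedS IH.
by rewrite exprn_ge0 // contraction_factor_ge0.
Qed.

(** Passes from the pseudo-hyperbolic to the Euclidean distance: [1 / (s - z0)] with [z0] below the
    axis maps the closed upper half-plane into a bounded disc, and so remains meaningful for
    unbounded responses. *)
Lemma hclose_inv_dist k (s t z0 : C) : 0 <= k -> 0 <= Im s -> 0 <= Im t ->
  Im z0 < 0 -> hclose k s t ->
  normc ((s - z0)^-1 - (t - z0)^-1) <= 2 * k / - Im z0.
Proof.
move=> k0 hs ht hz st.
have ps : - Im z0 <= normc (s - z0).
  by apply: le_trans (ler_Im_normc _); rewrite ImB; lra.
have pt : - Im z0 <= normc (t - z0).
  by apply: le_trans (ler_Im_normc _); rewrite ImB; lra.
have p0 : 0 < - Im z0 by rewrite oppr_gt0.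
have ps0 := lt_le_trans p0 ps; have pt0 := lt_le_trans p0 pt.
have -> : (s - z0)^-1 - (t - z0)^-1 = - (s - t) / ((s - z0) * (t - z0)).
  by field; rewrite -!normc_gt0 ps0 pt0.
rewrite normcf_div normcN normcM ler_pdivrMr ?mulr_gt0 //.
have h1 : normc (s - (t^*)%C) <= normc (s - z0) + normc (t - z0).
  apply: le_trans (normc_triangle _ _ z0) _; rewrite lerD2l.
  apply: ler_sqr_normc; rewrite !(ReB, ImB, Re_conj, Im_conj).
  by have := mulr_ge0 ht (ltW p0); nra.
apply: le_trans st _; apply: le_trans (ler_wpM2l k0 h1) _.
have q1 : 1 <= normc (s - z0) / - Im z0 by rewrite ler_pdivlMr // mul1r.
have q2 : 1 <= normc (t - z0) / - Im z0 by rewrite ler_pdivlMr // mul1r.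
have := ler_wpM2l (mulr_ge0 k0 (normc_ge0 (s - z0))) q2.
have := ler_wpM2l (mulr_ge0 k0 (normc_ge0 (t - z0))) q1.
by rewrite !mulr1 => e1 e2; rewrite mulrDr; lra.
Qed.

Lemma loaded_sub_respS z n : 0 <= Im z ->
  loaded E n z - S n.+1 = - ((S n - A n) / 2) ^+ 2 / (z + S n.+1).
Proof.
move=> hz; rewrite loadedE; have h := add_respS_neq0 n hz.
have -> : S n * A n = S n.+1 ^+ 2 - ((S n - A n) / 2) ^+ 2.
  by rewrite respSS /amean; field.
by field.
Qed.

(** The loaded block is [u - b^2 / (z + u)]. A map of this form that contracts strongly must have a
    small [b], and then it is nearly the constant [u]. *)
Lemma contracting_resp_close k n z : 0 <= k -> k <= 2^-1 ->
  contracting k (loaded E n) -> 0 <= Im z ->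
  (normc ((S n - A n) / 2) ^+ 2 <= 16 * k / Y ^+ 2) /\
  (normc (loaded E n z - S n.+1) <= 16 * k / Y).
Proof.
move=> k0 k1 hk hz; set u := S n.+1; set b := (S n - A n) / 2.
have u0 : 0 < Im u := Im_respS_gt0 n.
(* These two loads make [z + u] equal to [2 i Im u] and [4 i Im u], so that the two responses differ
   by exactly [|b|^2 / (4 Im u)] in norm. *)
pose z1 : C := Complex (- Re u) (Im u).
pose z2 : C := Complex (- Re u) (3 * Im u).
have up1 : upper z1 by split; rewrite ?Im_gt0_neq0 /= ?ltW.
have up2 : upper z2 by split; rewrite ?Im_gt0_neq0 /= ?ltW // mulr_gt0.
have [[h1 _] [h2 _]] := (up1, up2).
have := hk 1 z1 z2 ler01 up1 up2 (hclose1 h1 h2).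
rewrite /hclose mulr1 => h.
have e1 : loaded E n z1 = u - b ^+ 2 / (z1 + u).
  by rewrite -mulNr -loaded_sub_respS // addrC subrK.
have e2 : loaded E n z2 = u - b ^+ 2 / (z2 + u).
  by rewrite -mulNr -loaded_sub_respS // addrC subrK.
have E1 : z1 + u = Complex 0 (2 * Im u).
  by apply: complex_eqP; rewrite ?(ReD, ImD) /=; ring.
have E2 : z2 + u = Complex 0 (4 * Im u).
  by apply: complex_eqP; rewrite ?(ReD, ImD) /=; ring.
have n1 : z1 + u != 0 by rewrite E1 Im_gt0_neq0 //= mulr_gt0.
have n2 : z2 + u != 0 by rewrite E2 Im_gt0_neq0 //= mulr_gt0.
have d : normc (loaded E n z1 - loaded E n z2) = normc b ^+ 2 / (4 * Im u).
  have -> : loaded E n z1 - loaded E n z2 =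
      b ^+ 2 * (z1 - z2) / ((z1 + u) * (z2 + u)).
    by rewrite e1 e2; field; rewrite ?n1 ?n2.
  have -> : z1 - z2 = Complex 0 (- 2 * Im u).
    by apply: complex_eqP; rewrite ?(ReB, ImB) /=; ring.
  have ni y : normc (Complex 0 y : C) = `|y|.
    by rewrite /= expr0n add0r sqrtr_sqr.
  rewrite E1 E2 normcf_div (normcM (b ^+ 2)) normcX normcM !ni mulNr normrN.
  rewrite !normrM.
  by rewrite !normr_nat (gtr0_norm u0); field; rewrite gt_eqF.
have ht : horodisc Y (loaded E n z2).
  by apply: horodisc_loaded; case: up2.
have hb : normc b ^+ 2 / (4 * Im u) <= 4 * k / Y.
  rewrite -d.
  have t1 : normc (loaded E n z1 - ((loaded E n z2)^*)%C) <=
      normc (loaded E n z1 - loaded E n z2) + 2 * Y^-1.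
    apply: le_trans (normc_triangle _ _ (loaded E n z2)) _; rewrite lerD2l.
    apply: le_trans (normcB _ _) _; rewrite normc_conj.
    by have := horodisc_norm Y_gt0 ht; lra.
  have := le_trans h (ler_wpM2l k0 t1).
  move: (normc (_ - loaded _ _ _)) (normc_ge0 (loaded E n z1 - loaded E n z2)).
  move=> x x0; rewrite mulrDr.
  have := ler_wpM2r x0 k1; lra.
have hu : Im u <= Y^-1.
  apply: le_trans (ler_Im_normc _) _; exact: horodisc_norm Y_gt0 (horodiscS n.+1).
have hb2 : normc b ^+ 2 <= 16 * k / Y * Im u.
  by move: hb; rewrite ler_pdivrMr ?mulr_gt0 //; lra.
have kY : 0 <= 16 * k / Y by rewrite !mulr_ge0 // invr_ge0 ltW.
split.
  apply: le_trans hb2 _; rewrite expr2 invfM mulrA.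
  by rewrite ler_wpM2l.
rewrite loaded_sub_respS // normcf_div normcN normcX ler_pdivrMr; last first.
  by rewrite normc_gt0 add_respS_neq0.
apply: le_trans hb2 _; rewrite ler_wpM2l //.
by apply: le_trans (ler_Im_normc _); rewrite ImD lerDr.
Qed.

End UpperHalfPlane.
End Response.

(** * The mean value property at finitely many nodes *)

Section Tame.
Variable R : realType.
Local Notation C := R[i].
Local Notation normc := ComplexField.Normc.normc.
Local Notation Re := complex.Re.
Local Notation Im := complex.Im.

Lemma exprn_small (k e : R) : 0 <= k -> k < 1 -> 0 < e ->
  exists n0, forall n, (n0 <= n)%N -> k ^+ n <= e.
Proof.
move=> k0 k1 e0; have [->|kn0] := eqVneq k 0.
  by exists 1 => -[//|n] _; rewrite exprS mul0r ltW.
have kp : 0 < k by rewrite lt_def kn0.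
pose x := k^-1 - 1.
have x0 : 0 < x by rewrite subr_gt0 invf_gt1.
have ber n : 1 + n%:R * x <= k ^- n.
  elim: n => [|n IH]; first by rewrite mul0r addr0 expr0 invr1.
  rewrite exprSr invfM mulrC; have -> : k^-1 = 1 + x by rewrite /x addrC subrK.
  have := ler_wpM2r (ltW (addr_gt0 ltr01 x0)) IH.
  rewrite -natr1; have := mulr_ge0 (ler0n R n) (sqr_ge0 x); nra.
exists (Num.bound ((e * x)^-1)) => n hn.
have kn : 0 < k ^+ n by rewrite exprn_gt0.
rewrite -(ler_pV2 _ _) ?inE ?unitfE ?gt_eqF ?kn ?e0 //.
apply: le_trans (ber n); apply: le_trans (_ : n%:R * x <= _); last first.
  by rewrite lerDr.
have := archi_boundP (ltW (_ : 0 < (e * x)^-1)).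
rewrite invr_gt0 mulr_gt0 // => /(_ isT) h.
rewrite -ler_pdivrMr // -invfM; apply: ltW; apply: lt_le_trans h _.
by rewrite ler_nat.
Qed.

Section Fix.
Variables (T : Type) (D : T -> Prop) (t0 : T -> R) (y y' : R).
Hypotheses (yy' : y' < y).

Definition base (t : R) (y : R) : C := Complex t y.
(** Carries the half-plane [Im >= y'] to the unit disc and the base point at height [y] to 0. The
    point at height [2 * y' - y] is the mirror image of the base point in the line [Im = y']. *)
Definition cayley (tau : T) (E : C) : C :=
  (E - base (t0 tau) y) / (E - base (t0 tau) (2 * y' - y)).

Lemma cayley_den_neq0 tau E : y' <= Im E ->
  E - base (t0 tau) (2 * y' - y) != 0.
Proof. by move=> hE; apply: Im_gt0_neq0; rewrite ImB /=; move: yy'; lra. Qed.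

Lemma cayley_le1 tau E : y' <= Im E -> normc (cayley tau E) <= 1.
Proof.
move=> hE; rewrite normcf_div ler_pdivrMr ?normc_gt0 ?cayley_den_neq0 // mul1r.
apply: ler_sqr_normc; rewrite !(ReB, ImB) /=; move: yy' hE => h1 h2.
have : 0 <= (Im E - y') * (y - y') by rewrite mulr_ge0 // subr_ge0 // ltW.
nra.
Qed.

(** The polynomial may depend on the parameter but its degree may not, because a single number of
    nodes has to serve all parameters. *)
Definition poly_approx (f : T -> C -> C) : Prop := forall e, 0 < e ->
  exists d, forall tau, D tau -> exists P : {poly C}, (size P <= d)%N /\
    forall E, y' <= Im E -> normc (f tau E - P.[cayley tau E]) <= e.

Definition unif_bounded (f : T -> C -> C) : Prop :=
  exists2 B, 0 < B & forall tau E, D tau -> y' <= Im E -> normc (f tau E) <= B.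

(* The class to which the mean value property at the nodes applies, uniformly
   in the parameter. *)
Definition tame f : Prop := poly_approx f /\ unif_bounded f.

Lemma tame_ext f g :
  (forall tau E, D tau -> y' <= Im E -> f tau E = g tau E) -> tame f -> tame g.
Proof.
move=> fg [hf [B B0 hB]]; split; last first.
  by exists B => // tau E hD hE; rewrite -fg //; exact: hB.
move=> e e0; have [d hd] := hf e e0; exists d => tau hD.
have [P [hP h]] := hd tau hD; exists P; split => // E hE.
by rewrite -fg //; exact: h.
Qed.

Lemma tame_cst (c : T -> C) B : (forall tau, D tau -> normc (c tau) <= B) ->
  tame (fun tau _ => c tau).
Proof.
move=> hc; split.
  move=> e e0; exists 1%N => tau _; exists (c tau)%:P; split.
    by rewrite size_polyC; case: (_ == _).
  by move=> E _; rewrite hornerC subrr normc0 ltW.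
exists (Num.max B 1) => [|tau E hD _]; first by rewrite lt_max ltr01 orbT.
by rewrite le_max hc.
Qed.

Lemma tame_scst (c : C) : tame (fun _ _ => c).
Proof. exact: (@tame_cst (fun _ => c) (normc c)). Qed.

Lemma tame_cayley : tame cayley.
Proof.
split.
  move=> e e0; exists 2%N => tau _; exists 'X; split; first by rewrite size_polyX.
  by move=> E _; rewrite hornerX subrr normc0 ltW.
by exists 1 => // tau E _; exact: cayley_le1.
Qed.

Lemma tame_add f g : tame f -> tame g -> tame (fun tau E => f tau E + g tau E).
Proof.
move=> [hf [B B0 hB]] [hg [B' B0' hB']]; split; last first.
  exists (B + B') => [|tau E hD hE]; first exact: addr_gt0.
  by apply: le_trans (normcD _ _) _; apply: lerD; [exact: hB|exact: hB'].
move=> e e0; have e20 : 0 < e / 2 by rewrite divr_gt0.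
have [d hd] := hf _ e20; have [d' hd'] := hg _ e20.
exists (maxn d d') => tau hD; have [P [hP h]] := hd _ hD.
have [Q [hQ h']] := hd' _ hD; exists (P + Q); split.
  by apply: leq_trans (size_polyD _ _) _; rewrite geq_max !leq_max hP hQ orbT.
move=> E hE; rewrite hornerD.
have -> : f tau E + g tau E - (P.[cayley tau E] + Q.[cayley tau E]) =
  (f tau E - P.[cayley tau E]) + (g tau E - Q.[cayley tau E]) by ring.
by apply: le_trans (normcD _ _) _; have := h E hE; have := h' E hE; lra.
Qed.

Lemma tame_mul f g : tame f -> tame g -> tame (fun tau E => f tau E * g tau E).
Proof.
move=> [hf [B B0 hB]] [hg [B' B0' hB']]; split; last first.
  exists (B * B') => [|tau E hD hE]; first exact: mulr_gt0.
  by rewrite normcM ler_pM ?normc_ge0 ?hB ?hB'.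
move=> e e0.
pose e1 := e / 2 / (B' + 1).
pose e2 := Num.min 1 (e / 2 / B).
have e10 : 0 < e1 by rewrite !divr_gt0 // addr_gt0.
have e20 : 0 < e2 by rewrite lt_min ltr01 !divr_gt0.
have [d hd] := hf _ e10; have [d' hd'] := hg _ e20.
exists (d + d')%N => tau hD; have [P [hP h]] := hd _ hD.
have [Q [hQ h']] := hd' _ hD; exists (P * Q); split.
  apply: leq_trans (size_polyMleq _ _) _; apply: leq_trans (leq_pred _) _.
  exact: leq_add.
move=> E hE; rewrite hornerM; move: (h E hE) (h' E hE).
set p := P.[_]; set q := Q.[_] => hp hq.
have -> : f tau E * g tau E - p * q =
  f tau E * (g tau E - q) + q * (f tau E - p) by ring.
apply: le_trans (normcD _ _) _; rewrite !normcM.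
have nq : normc q <= B' + 1.
  have := normc_triangle q 0 (g tau E); rewrite !subr0 normc_distC => nq.
  have := hB' tau E hD hE.
  have : e2 <= 1 by rewrite ge_min lexx.
  by move: nq hq; lra.
have t1 : normc (f tau E) * normc (g tau E - q) <= e / 2.
  have -> : e / 2 = B * (e / 2 / B) by field; rewrite gt_eqF.
  rewrite ler_pM ?normc_ge0 ?hB //; apply: le_trans hq _.
  by rewrite ge_min lexx orbT.
have t2 : normc q * normc (f tau E - p) <= e / 2.
  have -> : e / 2 = (B' + 1) * e1 by rewrite /e1; field; rewrite gt_eqF // addr_gt0.
  by rewrite ler_pM ?normc_ge0.
by move: t1 t2; lra.
Qed.

Lemma tame_lim f :
  (forall e, 0 < e -> exists2 g, tame g & forall tau E, D tau -> y' <= Im E ->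
     normc (f tau E - g tau E) <= e) -> tame f.
Proof.
move=> hf; split.
  move=> e e0; have e20 : 0 < e / 2 by rewrite divr_gt0.
  have [g [hg _] fg] := hf _ e20; have [d hd] := hg _ e20.
  exists d => tau hD; have [P [hP h]] := hd _ hD; exists P; split => // E hE.
  apply: le_trans (normc_triangle _ _ (g tau E)) _.
  by have := fg tau E hD hE; have := h E hE; lra.
have [g [_ [B B0 hB]] fg] := hf 1 ltr01.
exists (1 + B) => [|tau E hD hE]; first exact: addr_gt0.
rewrite -[f tau E](subrK (g tau E)); apply: le_trans (normcD _ _) _.
by apply: lerD; [exact: fg|exact: hB].
Qed.

(** Geometric series in [1 - f / c], whose norm is at most [r < 1]. *)
Lemma tame_inv f (c : T -> C) (r m : R) : 0 <= r -> r < 1 -> 0 < m ->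
    (forall tau, D tau -> m <= normc (c tau)) ->
    (forall tau E, D tau -> y' <= Im E ->
       normc (f tau E - c tau) <= r * normc (c tau)) ->
  tame f -> tame (fun tau E => (f tau E)^-1).
Proof.
move=> r0 r1 m0 hc hfc hf.
have tc : tame (fun tau _ => (c tau)^-1).
  apply: (@tame_cst _ m^-1) => tau hD; rewrite normcV lef_pV2 ?posrE ?hc //.
  exact: lt_le_trans (hc _ hD).
pose u tau E := 1 + (-1) * (f tau E * (c tau)^-1).
have hu : tame u.
  apply: tame_add (tame_scst 1) _; apply: tame_mul (tame_scst (-1)) _.
  exact: tame_mul.
have hs K : tame (fun tau E => \sum_(k < K) u tau E ^+ k).
  elim: K => [|K IH].
    by apply: tame_ext (tame_scst 0) => tau E _ _; rewrite big_ord0.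
  apply: (@tame_ext (fun tau E => 1 + u tau E * \sum_(k < K) u tau E ^+ k)).
    move=> tau E _ _; rewrite big_ord_recl expr0 mulr_sumr.
    by congr (_ + _); apply: eq_bigr => k _; rewrite -exprS.
  by apply: tame_add (tame_scst 1) _; exact: tame_mul.
have cn0 tau : D tau -> c tau != 0.
  by move=> hD; rewrite -normc_gt0; exact: lt_le_trans (hc _ hD).
have nu tau E : D tau -> y' <= Im E -> normc (u tau E) <= r.
  move=> hD hE; have c0 := cn0 _ hD.
  have -> : u tau E = - (f tau E - c tau) / c tau by rewrite /u; field.
  by rewrite normcf_div normcN ler_pdivrMr ?normc_gt0 // hfc.
apply: tame_lim => e e0.
have r10 : 0 < 1 - r by rewrite subr_gt0.
have [K hK] := exprn_small r0 r1 (mulr_gt0 e0 (mulr_gt0 m0 r10)).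
exists (fun tau E => (c tau)^-1 * \sum_(k < K) u tau E ^+ k).
  exact: tame_mul.
move=> tau E hD hE; have c0 := cn0 _ hD; have nu1 := nu _ _ hD hE.
have d1 : 1 - r <= normc (1 - u tau E).
  by apply: le_trans (normc_geB _ _); rewrite normc1 lerD2l lerN2.
have d0 : 1 - u tau E != 0 by rewrite -normc_gt0; exact: lt_le_trans d1.
have fE : f tau E = c tau * (1 - u tau E) by rewrite /u; field.
have f0 : f tau E != 0 by rewrite fE mulf_neq0.
have -> : (f tau E)^-1 - (c tau)^-1 * \sum_(k < K) u tau E ^+ k =
    u tau E ^+ K / f tau E.
  have gs : (1 - u tau E) * \sum_(k < K) u tau E ^+ k = 1 - u tau E ^+ K.
    rewrite -[in RHS](expr1n _ K) subrXX; congr (_ * _).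
    by apply: eq_bigr => k _; rewrite expr1n mul1r.
  have -> : u tau E ^+ K = 1 - (1 - u tau E) * \sum_(k < K) u tau E ^+ k.
    by rewrite gs; ring.
  by rewrite {2}fE fE; field; rewrite ?c0 ?d0.
rewrite normcf_div normcX ler_pdivrMr ?normc_gt0 //.
apply: le_trans (_ : r ^+ K <= _); first by rewrite lerXn2r ?nnegrE ?normc_ge0.
apply: le_trans (hK K (leqnn K)) _.
rewrite ler_pM2l // fE normcM ler_pM ?hc //; exact: ltW.
Qed.

(** Solving the Cayley transform for the energy gives [1 / (E - e0) = (1 - cayley) / (w - w' *
    cayley)], where [w] and [w'] point from [e0] to the base point and to its mirror image. As [e0]
    lies below the line, [w'] is shorter than [w], by a factor that is uniform for bounded
    abscissas. *)
Lemma tame_inv_sub (e0 : C) L : Im e0 < y' ->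
    (forall tau, D tau -> `|t0 tau| <= L) ->
  tame (fun _ E => (E - e0)^-1).
Proof.
move=> he hL.
pose w tau := base (t0 tau) y - e0.
pose w' tau := base (t0 tau) (2 * y' - y) - e0.
pose X := (L + `|Re e0|) ^+ 2.
pose u := y - Im e0; pose v := 2 * y' - y - Im e0.
have hX tau : D tau -> (t0 tau - Re e0) ^+ 2 <= X.
  move=> hD; rewrite /X -real_normK ?num_real //.
  rewrite ler_pXn2r ?nnegrE ?normr_ge0 //.
    by apply: le_trans (ler_normB _ _) _; rewrite lerD2r hL.
  by rewrite addr_ge0 // (le_trans _ (hL _ hD)).
have u0 : 0 < u by move: yy' he; rewrite /u; lra.
have vu : v ^+ 2 < u ^+ 2.
  have : 0 < (y' - Im e0) * (y - y') by rewrite mulr_gt0 // subr_gt0.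
  by rewrite /u /v; nra.
have X0 : 0 <= X by exact: sqr_ge0.
have Xu : 0 < X + u ^+ 2 by rewrite ltr_wpDl // exprn_gt0.
pose r := Num.sqrt ((X + v ^+ 2) / (X + u ^+ 2)).
have q0 : 0 <= (X + v ^+ 2) / (X + u ^+ 2).
  by rewrite divr_ge0 ?addr_ge0 ?sqr_ge0 // ltW.
have r1 : r < 1.
  rewrite -(@ltr_pXn2r _ 2) ?nnegrE ?sqrtr_ge0 // sqr_sqrtr // expr1n.
  by rewrite ltr_pdivrMr // mul1r ltrD2l.
have hw' tau : D tau -> normc (w' tau) <= r * normc (w tau).
  move=> hD; rewrite -(@ler_pXn2r _ 2) ?nnegrE ?mulr_ge0 ?normc_ge0 ?sqrtr_ge0 //.
  rewrite exprMn sqr_sqrtr // mulrAC ler_pdivlMr // !sqr_normc !(ReB, ImB) /=.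
  have := hX _ hD; rewrite -/u -/v; move: (_ ^+ 2) (u ^+ 2) (v ^+ 2) vu => a b c.
  move=> bc aX; have : 0 <= (X - a) * (b - c).
    by rewrite mulr_ge0 // subr_ge0 // ltW.
  nra.
have hwu tau : D tau -> u <= normc (w tau).
  by move=> _; apply: le_trans (ler_Im_normc _); rewrite ImB /=.
have bw tau : D tau -> normc (w tau) <= L + `|y| + normc e0.
  move=> hD; apply: le_trans (normcB _ _) _; rewrite lerD2r.
  by apply: le_trans (normc_le_ReIm _) _; rewrite /= lerD2r hL.
have bw' tau : D tau -> normc (w' tau) <= L + `|2 * y' - y| + normc e0.
  move=> hD; apply: le_trans (normcB _ _) _; rewrite lerD2r.
  by apply: le_trans (normc_le_ReIm _) _; rewrite /= lerD2r hL.
pose den tau E := w tau + (-1) * (w' tau * cayley tau E).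
have tden : tame den.
  apply: tame_add; first exact: tame_cst bw.
  apply: tame_mul; first exact: tame_scst.
  by apply: tame_mul tame_cayley; exact: tame_cst bw'.
have tinv : tame (fun tau E => (den tau E)^-1).
  apply: (@tame_inv den w r u) => //; first exact: sqrtr_ge0.
  move=> tau E hD hE.
  have -> : den tau E - w tau = - (w' tau * cayley tau E) by rewrite /den; ring.
  rewrite normcN normcM; apply: le_trans (hw' _ hD).
  by rewrite ler_piMr ?normc_ge0 // cayley_le1.
apply: (@tame_ext (fun tau E => (1 + (-1) * cayley tau E) * (den tau E)^-1)).
  move=> tau E hD hE; have h1 := cayley_den_neq0 tau hE.
  have h2 : E - e0 != 0.
    by apply: Im_gt0_neq0; rewrite ImB subr_gt0; exact: lt_le_trans hE.
  have h3 : base (t0 tau) y - base (t0 tau) (2 * y' - y) != 0.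
    by apply: Im_gt0_neq0; rewrite ImB /=; move: yy'; lra.
  have e1 : 1 + (-1) * cayley tau E =
      (base (t0 tau) y - base (t0 tau) (2 * y' - y)) /
      (E - base (t0 tau) (2 * y' - y)) by rewrite /cayley; field.
  have e2 : den tau E = (base (t0 tau) y - base (t0 tau) (2 * y' - y)) *
      (E - e0) / (E - base (t0 tau) (2 * y' - y)).
    by rewrite /den /w /w' /cayley; field.
  by rewrite e1 e2; field; rewrite h1 h2 h3.
apply: tame_mul tinv; apply: tame_add; first exact: tame_scst.
by apply: tame_mul tame_cayley; exact: tame_scst.
Qed.

End Fix.

(* The [2 ^ m]-th roots of -1. *)
Fixpoint unit_roots (m : nat) : seq C :=
  if m is m'.+1 then
    map (@sqrtc R) (unit_roots m') ++ map (fun z => - sqrtc z) (unit_roots m')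
  else [:: -1].

Lemma size_unit_roots m : size (unit_roots m) = (2 ^ m)%N.
Proof.
by elim: m => [//|m IH]; rewrite /= size_cat !size_map IH expnS mul2n addnn.
Qed.

Lemma unit_rootsX m z : z \in unit_roots m -> z ^+ (2 ^ m) = -1.
Proof.
elim: m z => [|m IH] z /=; first by rewrite inE => /eqP ->; rewrite expr1.
rewrite mem_cat expnS => /orP[] /mapP[x hx ->].
  by rewrite exprM sqr_sqrtc IH.
by rewrite exprM sqrrN sqr_sqrtc IH.
Qed.

Lemma sum_unit_roots m k : (0 < k)%N -> (k < 2 ^ m)%N ->
  \sum_(z <- unit_roots m) z ^+ k = 0.
Proof.
elim: m k => [|m IH] k k0 km; first by case: k k0 km => [|[|k]].
rewrite /= big_cat !big_map /= -big_split /=.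
have [ok|ek] := boolP (odd k).
  by apply: big1 => z _; rewrite exprNn -signr_odd ok expr1 mulN1r subrr.
have kE : k = (2 * k./2)%N by rewrite mul2n -[LHS]odd_double_half (negbTE ek).
rewrite (eq_bigr (fun z => z ^+ k./2 + z ^+ k./2)); last first.
  by move=> z _; rewrite {1 2}kE !exprM sqrrN sqr_sqrtc.
rewrite big_split /= IH ?addr0 //.
  by rewrite -(ltn_pmul2l (_ : 0 < 2)%N) // -kE muln0.
by rewrite -(ltn_pmul2l (_ : 0 < 2)%N) // -kE -expnS.
Qed.

Lemma unit_roots_norm m z : z \in unit_roots m -> normc z = 1.
Proof.
move=> /unit_rootsX h.
have : normc z ^+ (2 ^ m) = 1 by rewrite -normcX h normcN normc1.
by move/eqP; rewrite pexprn_eq1 ?expn_eq0 ?normc_ge0 //= => /eqP.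
Qed.

(** The reason for using roots of -1: the point 1 of the circle corresponds to infinity on the line
    and would give no node. *)
Lemma unit_roots_neq1 m z : z \in unit_roots m -> 1 - z != 0.
Proof.
move=> /unit_rootsX h; rewrite subr_eq0 eq_sym; apply: contra_eq_neq h => ->.
by rewrite expr1n -subr_eq0 opprK -[1 + 1]/(2%:R) pnatr_eq0.
Qed.

(* The inverse Cayley transform of a point of the unit circle. *)
Definition node (z : C) : R := Re ('i%C * (1 + z) / (1 - z)).
Definition nodes (m : nat) : seq R := map node (unit_roots m).

Lemma size_nodes m : size (nodes m) = (2 ^ m)%N.
Proof. by rewrite size_map size_unit_roots. Qed.

Lemma nodeE m z : z \in unit_roots m ->
  (node z)%:C%C = 'i%C * (1 + z) / (1 - z).
Proof.
move=> hz; have z1 := unit_roots_norm hz; have h1 := unit_roots_neq1 hz.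
have a1 : Re ('i%C * (1 + z)) = - Im z by rewrite ReM ReD ImD /=; ring.
have a2 : Im ('i%C * (1 + z)) = 1 + Re z by rewrite ImM ReD ImD /=; ring.
apply: complex_eqP; first by [].
have hz2 : Re z ^+ 2 + Im z ^+ 2 = 1 by rewrite -sqr_normc z1 expr1n.
rewrite [RHS]ImM ReV ImV a1 a2 ReB ImB; move: (normc _ ^+ 2) => d.
rewrite [LHS]/= [X in X - Im z]/= [X in X - Re z]/=.
rewrite !mulrA -mulrDl.
suff -> : - Im z * - (0 - Im z) + (1 + Re z) * (1 - Re z) = 0 by rewrite mul0r.
by move: hz2; lra.
Qed.

Lemma cayley_node (T : Type) (t0 : T -> R) y y' tau m z : y' < y ->
    z \in unit_roots m ->
  cayley t0 y y' tau (base (t0 tau + (y - y') * node z) y') = z.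
Proof.
move=> yy' hz; have h1 := unit_roots_neq1 hz; have e := nodeE hz.
move: (node z) e => u e.
have s0 : ((y - y')%:C%C : C) != 0.
  by rewrite -normc_gt0 normc_real normr_gt0 subr_eq0 gt_eqF.
rewrite /cayley.
have -> : base (t0 tau + (y - y') * u) y' - base (t0 tau) y =
    (y - y')%:C%C * (u%:C%C - 'i%C).
  by apply: complex_eqP; rewrite ?(ReM, ImM, ReB, ImB) //=; ring.
have -> : base (t0 tau + (y - y') * u) y' - base (t0 tau) (2 * y' - y) =
    (y - y')%:C%C * (u%:C%C + 'i%C).
  by apply: complex_eqP; rewrite ?(ReM, ImM, ReB, ImB, ReD, ImD) //=; ring.
have i0 : ('i%C : C) != 0 by apply: Im_gt0_neq0 => /=.
have -> : u%:C%C - 'i%C = 2 * 'i%C * z / (1 - z) :> C.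
  by rewrite e; field.
have -> : u%:C%C + 'i%C = 2 * 'i%C / (1 - z) :> C.
  by rewrite e; field.
by move: (_%:C%C) s0 => s s0; field; rewrite s0 i0 h1.
Qed.

Definition node_mean (m : nat) (g : R -> C) : C :=
  (\sum_(u <- nodes m) g u) / (2 ^ m)%:R.

(** The average over the [2 ^ m]-th roots of -1 kills [z^k] for [0 < k < 2 ^ m], so it evaluates
    polynomials of small degree exactly at 0, which is the image of the base point. *)
Lemma node_mean_tame (T : Type) (D : T -> Prop) (t0 : T -> R) y y'
    (f : T -> C -> C) (e : R) : y' < y -> tame D t0 y y' f -> 0 < e ->
  exists m0, forall m, (m0 <= m)%N -> forall tau, D tau ->
    normc (node_mean m (fun u => f tau (base (t0 tau + (y - y') * u) y')) -
           f tau (base (t0 tau) y)) <= e.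
Proof.
move=> yy' [hf _] e0; have e20 : 0 < e / 2 by rewrite divr_gt0.
have [d hd] := hf _ e20; exists d => m dm tau hD.
have [P [sP hP]] := hd tau hD.
have dm2 : (size P <= 2 ^ m)%N.
  by apply: leq_trans sP _; apply: leq_trans dm _; apply: ltnW; exact: ltn_expl.
have n0 : ((2 ^ m)%:R : C) != 0 by rewrite pnatr_eq0 expn_eq0.
have PE : \sum_(z <- unit_roots m) P.[z] = (2 ^ m)%:R * P.[0].
  rewrite (eq_bigr (fun z => \sum_(i < size P) P`_i * z ^+ i)); last first.
    by move=> z _; rewrite horner_coef.
  rewrite exchange_big /=.
  case sE: (size P) dm2 => [|s] dm2.
    have -> : P = 0 by apply/eqP; rewrite -size_poly_eq0 sE.
    by rewrite big_ord0 horner0 mulr0.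
  rewrite big_ord_recl /= [X in _ + X]big1 => [|i _]; last first.
    rewrite -mulr_sumr sum_unit_roots ?mulr0 //.
    by apply: leq_trans dm2; rewrite ltnS /= /bump /= add1n; exact: ltn_ord.
  rewrite addr0 horner_coef0 -mulr_sumr mulrC; congr (_ * _).
  rewrite (eq_bigr (fun=> 1)) => [|z _]; last by rewrite expr0.
  by rewrite big_const_seq count_predT size_unit_roots iter_addr_0.
have fw : normc (f tau (base (t0 tau) y) - P.[0]) <= e / 2.
  have := hP (base (t0 tau) y) (ltW yy').
  by rewrite /cayley subrr mul0r.
have hs : normc (node_mean m (fun u => f tau (base (t0 tau + (y - y') * u) y'))
    - P.[0]) <= e / 2.
  have -> : P.[0] = (\sum_(z <- unit_roots m) P.[z]) / (2 ^ m)%:R.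
    by rewrite PE mulrAC divff // mul1r.
  rewrite /node_mean big_map -mulrBl normcf_div normc_nat.
  rewrite ler_pdivrMr ?ltr0n ?expn_gt0 // -sumrB.
  apply: le_trans (_ : \sum_(z <- unit_roots m) e / 2 <= _); last first.
    by rewrite big_const_seq count_predT size_unit_roots iter_addr_0 mulr_natr.
  rewrite !big_seq; elim/big_ind2 : _ => [|x a z b|z hz].
  - by rewrite normc0.
  - by move=> xa zb; apply: le_trans (normcD _ _) _; exact: lerD.
  have := hP (base (t0 tau + (y - y') * node z) y') (lexx _).
  by rewrite (cayley_node _ _ yy' hz).
apply: le_trans (normc_triangle _ _ P.[0]) _; rewrite [normc (P.[0] - _)]normc_distC.
by move: hs fw; lra.
Qed.

End Tame.

(** * Mean value property for the responses of blocks and chains *)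

Section TameResp.
Variable R : realType.
Local Notation C := R[i].
Local Notation normc := ComplexField.Normc.normc.
Local Notation Re := complex.Re.
Local Notation Im := complex.Im.
Variables (kappa : nat -> R) (kappa_gt0 : forall n, 0 < kappa n).
Variables (T : Type) (D : T -> Prop) (t0 : T -> R) (y y' L : R).
Hypotheses (y'_gt0 : 0 < y') (yy' : y' < y).
Hypothesis t0L : forall tau, D tau -> `|t0 tau| <= L.

Notation tame := (tame D t0 y y').
Notation horo := (horodisc (y' / 2)).
Notation dom tau E := (D tau -> y' <= Im E).

Let rho : R := (y' / 2)^-1 / 2.
Let rho_gt0 : 0 < rho. Proof. by rewrite divr_gt0 // invr_gt0 divr_gt0. Qed.
Let y'2_gt0 : 0 < y' / 2. Proof. by rewrite divr_gt0. Qed.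

Let horoE s : horo s -> normc (s - Complex 0 rho) <= rho.
Proof. by move/(horodiscP _ y'2_gt0). Qed.

Definition horo_valued (f : T -> C -> C) : Prop :=
  forall tau E, D tau -> y' <= Im E -> horo (f tau E).

Lemma tame_inv_disc f (c : T -> C) (r mu : R) : 0 < r -> 0 < mu ->
    (forall tau, D tau -> r + mu <= normc (c tau)) ->
    (forall tau E, D tau -> y' <= Im E -> normc (f tau E - c tau) <= r) ->
  tame f -> tame (fun tau E => (f tau E)^-1).
Proof.
move=> r0 mu0 hc hfc hf.
have rm : 0 < r + mu by rewrite addr_gt0.
apply: (@tame_inv _ _ _ _ _ _ f c (r / (r + mu)) (r + mu)) => //.
- by rewrite divr_ge0 // ltW.
- by rewrite ltr_pdivrMr // mul1r ltrDl.
move=> tau E hD hE; apply: le_trans (hfc _ _ hD hE) _.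
rewrite mulrAC ler_pdivlMr // ler_pM2l //; exact: hc.
Qed.

(** [hmean] consists of two inversions with an average in between. Inversion maps a disc that avoids
    0 to a disc that avoids 0; by convexity the average stays in the image disc, so the second
    inversion is of the same kind. *)
Lemma tame_hmean zeta f g (c : T -> C) (r mu M : R) : 0 < r -> 0 < mu ->
    (forall tau, D tau -> r + mu <= normc (c tau)) ->
    (forall tau, D tau -> normc (c tau) <= M) ->
    (forall tau E, D tau -> y' <= Im E ->
       normc (zeta tau E - f tau E - c tau) <= r) ->
    (forall tau E, D tau -> y' <= Im E ->
       normc (zeta tau E - g tau E - c tau) <= r) ->
  tame zeta -> tame f -> tame g ->
  tame (fun tau E => hmean (zeta tau E) (f tau E) (g tau E)).
Proof.
move=> r0 mu0 hc hM hzf hzg tz tf tg.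
have rm : 0 < r + mu by rewrite addr_gt0.
have neq0 tau (x : C) : D tau -> normc (x - c tau) <= r -> x != 0.
  move=> hD hx; apply: contraTneq hx => ->; rewrite sub0r normcN -ltNge.
  by apply: lt_le_trans (hc _ hD); rewrite ltrDl.
have tsub h : tame h -> tame (fun tau E => zeta tau E - h tau E).
  move=> th; apply: (@tame_ext _ _ _ _ _ _
      (fun tau E => zeta tau E + (-1) * h tau E)).
    by move=> tau E _ _; rewrite mulN1r.
  by apply: tame_add tz _; apply: tame_mul th => //; exact: tame_scst.
have ti1 := tame_inv_disc r0 mu0 hc hzf (tsub _ tf).
have ti2 := tame_inv_disc r0 mu0 hc hzg (tsub _ tg).
pose b tau E := (2^-1 : C) *
  ((zeta tau E - f tau E)^-1 + (zeta tau E - g tau E)^-1).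
have tb : tame b.
  by apply: tame_mul; [exact: tame_scst|exact: tame_add].
pose q := r / (r + mu).
have q0 : 0 <= q by rewrite divr_ge0 // ltW.
have q1 : q < 1 by rewrite ltr_pdivrMr // mul1r ltrDl.
have q2 : 0 < 1 - q ^+ 2 by rewrite subr_gt0 expr_lt1.
(* Centre of the inverted disc. Its radius is [q * |c'|], so the relative radius is the same as
   before inversion (with [mu] as margin). *)
pose c' tau := (c tau * (1 - q ^+ 2)%:C%C)^-1.
have q2C : ((1 - q ^+ 2)%:C%C : C) != 0.
  by rewrite -normc_gt0 normc_real normr_gt0 gt_eqF.
have cn0 tau : D tau -> c tau != 0.
  by move=> hD; rewrite -normc_gt0; exact: lt_le_trans (hc _ hD).
have key tau (x : C) : D tau -> normc (x - c tau) <= r ->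
    normc (x^-1 - c' tau) <= q * normc (c' tau).
  move=> hD hx; have x0 := neq0 _ _ hD hx; have c0 := cn0 _ hD.
  pose u := (x - c tau) / c tau.
  have nu : normc u <= q.
    rewrite normcf_div ler_pdivrMr ?normc_gt0 //; apply: le_trans hx _.
    rewrite mulrAC ler_pdivlMr // ler_pM2l //; exact: hc.
  have xE : x = c tau * (1 + u) by rewrite /u; field.
  have u1 : 1 + u != 0 by apply: contraNneq x0 => h; rewrite xE h mulr0.
  have -> : x^-1 - c' tau = - c' tau * ((u + (q ^+ 2)%:C%C) / (1 + u)).
    rewrite /c' rmorphB /= -[1%:C%C]/(1 : C) in q2C *.
    rewrite xE; move: (c tau) ((q ^+ 2)%:C%C) c0 q2C => d p d0 p0.
    by field; rewrite u1 d0 p0.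
  rewrite normcM normcN mulrC ler_wpM2r ?normc_ge0 // normcf_div.
  rewrite ler_pdivrMr ?normc_gt0 //.
  rewrite -(@ler_pXn2r _ 2) ?nnegrE ?(mulr_ge0 q0 (normc_ge0 _)) ?normc_ge0 //.
  rewrite [(q * _) ^+ 2]exprMn !sqr_normc !(ReD, ImD) /=.
  have : normc u ^+ 2 <= q ^+ 2 by rewrite lerXn2r ?nnegrE ?normc_ge0.
  rewrite sqr_normc; move: (Re u) (Im u) => a d.
  move: q2; move: (q ^+ 2) => p p1 h.
  have : 0 <= (p - (a ^+ 2 + d ^+ 2)) * (1 - p) by rewrite mulr_ge0 ?(ltW p1) // subr_ge0.
  nra.
have nc' tau : D tau -> M^-1 <= normc (c' tau).
  move=> hD; have c0 := cn0 _ hD; rewrite normcV normcM normc_real gtr0_norm //.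
  have c1 : 0 < normc (c tau) by rewrite normc_gt0.
  have M0 : 0 < M by exact: lt_le_trans c1 (hM _ hD).
  rewrite lef_pV2 ?posrE ?mulr_gt0 //; apply: le_trans (hM _ hD).
  by rewrite ler_piMr ?normc_ge0 // gerBl sqr_ge0.
have tib : tame (fun tau E => (b tau E)^-1).
  case: (pselect (exists tau, D tau)) => [[tau1 hD1]|nD]; last first.
    split; first by move=> e e0; exists 0%N => tau hD; case: nD; exists tau.
    by exists 1; rewrite ?ltr01 // => tau E hD; case: nD; exists tau.
  have M0 : 0 < M by apply: lt_le_trans (hM _ hD1); rewrite normc_gt0; exact: cn0.
  apply: (@tame_inv _ _ _ _ _ _ b c' q M^-1) => //; first by rewrite invr_gt0.
  move=> tau E hD hE.
  have k1 := key _ _ hD (hzf _ _ hD hE).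
  have k2 := key _ _ hD (hzg _ _ hD hE).
  have -> : b tau E - c' tau = (((zeta tau E - f tau E)^-1 - c' tau) +
      ((zeta tau E - g tau E)^-1 - c' tau)) / 2.
    have alg (p1 p2 p3 : C) :
        2^-1 * (p1 + p2) - p3 = ((p1 - p3) + (p2 - p3)) / 2 by field.
    exact: alg.
  rewrite normc_half ler_pdivrMr //.
  by apply: le_trans (normcD _ _) _; move: k1 k2; lra.
apply: (@tame_ext _ _ _ _ _ _ (fun tau E => zeta tau E + (-1) * (b tau E)^-1)).
  move=> tau E hD hE.
  have k1 := hzf _ _ hD hE; have k2 := hzg _ _ hD hE.
  have n1 := neq0 _ _ hD k1; have n2 := neq0 _ _ hD k2.
  rewrite hmeanE //; last first.
    apply: (neq0 _ _ hD); rewrite /amean.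
    have -> : zeta tau E - (f tau E + g tau E) / 2 - c tau =
      ((zeta tau E - f tau E - c tau) + (zeta tau E - g tau E - c tau)) / 2.
      by field.
    rewrite normc_half ler_pdivrMr //.
    by apply: le_trans (normcD _ _) _; move: k1 k2; lra.
  by rewrite mulN1r /b /amean [2^-1 * _]mulrC.
by apply: tame_add tz _; apply: tame_mul tib; exact: tame_scst.
Qed.

Let sub2 E : y' <= Im E -> 2 * (y' / 2) <= Im E.
Proof. by move=> h; rewrite mulrC divfK // pnatr_eq0. Qed.

(** By Pythagoras the disc of centre [k - i rho] and radius [rho], over which [k] minus a horodisc
    point ranges, stays away from 0. *)
Lemma kappa_gap (k : R) : 0 < k ->
  exists2 mu, 0 < mu & rho + mu <= normc (Complex k (- rho)).
Proof.
move=> k0; exists (normc (Complex k (- rho) : C) - rho); last by rewrite addrC subrK.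
rewrite subr_gt0 -(@ltr_pXn2r _ 2) ?nnegrE ?normc_ge0 ?(ltW rho_gt0) //.
by rewrite sqr_normc /= sqrrN ltrDr exprn_gt0.
Qed.

Let respS_horo n tau E : D tau -> y' <= Im E -> horo (respS kappa E n).
Proof. by move=> _ /sub2 h; exact: (horodisc_resp kappa_gt0 y'2_gt0 h n).1. Qed.
Let respA_horo n tau E : D tau -> y' <= Im E -> horo (respA kappa E n).
Proof. by move=> _ /sub2 h; exact: (horodisc_resp kappa_gt0 y'2_gt0 h n).2. Qed.

Lemma tame_resp n :
  tame (fun _ E => respS kappa E n) /\ tame (fun _ E => respA kappa E n).
Proof.
elim: n => [|n [tS tA]].
  split; first exact: tame_scst.
  apply: (@tame_ext _ _ _ _ _ _ (fun _ E => (- 2) * (E - 0)^-1)).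
    by move=> tau E _ _; rewrite subr0.
  apply: tame_mul; first exact: tame_scst.
  exact: (tame_inv_sub yy' (_ : Im 0 < y') t0L).
split.
  apply: (@tame_ext _ _ _ _ _ _
      (fun _ E => (2^-1) * (respS kappa E n + respA kappa E n))).
    by move=> tau E _ _; rewrite respSS /amean mulrC.
  by apply: tame_mul; [exact: tame_scst|exact: tame_add].
have [mu mu0 hmu] := kappa_gap (kappa_gt0 n).
apply: (@tame_ext _ _ _ _ _ _
   (fun _ E => hmean (kappa n)%:C%C (respS kappa E n) (respA kappa E n))).
  by move=> tau E _ _; rewrite respAS.
have hd s : horo s ->
    normc ((kappa n)%:C%C - s - Complex (kappa n) (- rho)) <= rho.
  move=> hs; rewrite -normcN.
  have -> : - ((kappa n)%:C%C - s - Complex (kappa n) (- rho)) =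
      s - Complex 0 rho.
    by apply: complex_eqP; rewrite !(ReB, ImB, ReN, ImN) /=; ring.
  exact: horoE.
apply: (@tame_hmean (fun _ _ => (kappa n)%:C%C) (fun _ E => respS kappa E n)
  (fun _ E => respA kappa E n) (fun _ => Complex (kappa n) (- rho)) rho mu
  (normc (Complex (kappa n) (- rho) : C))) => //.
- by move=> tau E hD hE; apply: hd; exact: respS_horo hD hE.
- by move=> tau E hD hE; apply: hd; exact: respA_horo hD hE.
exact: tame_scst.
Qed.

Lemma tame_loaded_shift n (k : R) phi : 0 < k -> horo_valued phi -> tame phi ->
  tame (fun tau E => loaded kappa E n (phi tau E - (2 * k)%:C%C)).
Proof.
move=> k0 hphi tphi; have [tS tA] := tame_resp n.
have [mu mu0 hmu] := kappa_gap k0.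
(* The load and the block response each range over the horodisc, so their sum lies in a disc of
   twice its radius. *)
pose c : C := Complex (2 * k) (- (2 * rho)).
have cE : normc c = 2 * normc (Complex k (- rho) : C).
  have -> : c = 2%:C%C * Complex k (- rho).
    by apply: complex_eqP; rewrite ?(ReM, ImM) /=; ring.
  by rewrite normcM normc_real ger0_norm.
have hd s phi' : horo s -> horo phi' ->
    normc (- (phi' - (2 * k)%:C%C) - s - c) <= 2 * rho.
  move=> hs hp; rewrite -normcN.
  have -> : - (- (phi' - (2 * k)%:C%C) - s - c) =
      (s - Complex 0 rho) + (phi' - Complex 0 rho).
    by apply: complex_eqP; rewrite !(ReD, ImD, ReN, ImN) /=; ring.
  apply: le_trans (normcD _ _) _.
  by have := horoE hs; have := horoE hp; lra.
apply: (@tame_hmean (fun tau E => - (phi tau E - (2 * k)%:C%C))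
  (fun _ E => respS kappa E n) (fun _ E => respA kappa E n) (fun _ => c)
  (2 * rho) (2 * mu) (normc c)) => //.
- by rewrite mulr_gt0.
- by rewrite mulr_gt0.
- by move=> _ _; rewrite cE -mulrDr ler_pM2l.
- by move=> tau E hD hE; apply: hd; [exact: respS_horo hD hE|exact: hphi].
- by move=> tau E hD hE; apply: hd; [exact: respA_horo hD hE|exact: hphi].
apply: (@tame_ext _ _ _ _ _ _
    (fun tau E => (-1) * phi tau E + (2 * k)%:C%C)).
  by move=> tau E _ _; ring.
apply: tame_add; last exact: tame_scst.
by apply: tame_mul tphi; exact: tame_scst.
Qed.

Lemma horo_tail n j : horo_valued (fun _ E => tail_resp kappa E n j).
Proof. by move=> tau E _ /sub2 h; exact: horodisc_tail. Qed.

Lemma horo_chain n j : horo_valued (fun _ E => chain_resp kappa E n j).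
Proof. by move=> tau E _ /sub2 h; exact: horodisc_chain. Qed.

Lemma tame_tail n j : tame (fun _ E => tail_resp kappa E n j).
Proof.
elim: j n => [|j IH] n; first exact: tame_scst.
exact: tame_loaded_shift (kappa_gt0 _) (horo_tail _ _) (IH _).
Qed.

Lemma tame_chain n j : tame (fun _ E => chain_resp kappa E n j).
Proof. exact: tame_loaded_shift (kappa_gt0 _) (horo_tail _ _) (tame_tail _ _). Qed.

Lemma tame_loaded_cst n (c : T -> C) eta B : 0 < eta ->
    (forall tau, D tau -> eta <= Im (c tau)) ->
    (forall tau, D tau -> normc (c tau) <= B) ->
  tame (fun tau E => loaded kappa E n (c tau)).
Proof.
move=> eta0 hc hB; have [tS tA] := tame_resp n.
have hd s tau : horo s ->
    normc (- c tau - s - (- c tau - Complex 0 rho)) <= rho.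
  move=> hs; rewrite -normcN.
  have -> : - (- c tau - s - (- c tau - Complex 0 rho)) = s - Complex 0 rho.
    by ring.
  exact: horoE.
apply: (@tame_hmean (fun tau _ => - c tau)
  (fun _ E => respS kappa E n) (fun _ E => respA kappa E n)
  (fun tau => - c tau - Complex 0 rho) rho eta (B + rho)) => //.
- move=> tau hD; rewrite -normcN; apply: le_trans (ler_Im_normc _).
  by rewrite ImN ImB ImN /=; have := hc _ hD; lra.
- move=> tau hD; apply: le_trans (normcB _ _) _; rewrite normcN.
  apply: lerD; first exact: hB.
  by rewrite /= expr0n add0r sqrtr_sqr gtr0_norm.
- by move=> tau E hD hE; apply: hd; exact: respS_horo hD hE.
- by move=> tau E hD hE; apply: hd; exact: respA_horo hD hE.
by apply: (@tame_cst _ _ _ _ _ _ _ B) => tau hD; rewrite normcN hB.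
Qed.

Lemma horo_loaded_cst n (c : T -> C) eta : 0 < eta ->
  (forall tau, D tau -> eta <= Im (c tau)) ->
  horo_valued (fun tau E => loaded kappa E n (c tau)).
Proof.
move=> eta0 hc tau E hD /sub2 hE; have h := hc _ hD.
apply: horodisc_loaded => //; first exact: le_trans (ltW eta0) h.
by apply: Im_gt0_neq0; exact: lt_le_trans h.
Qed.

Lemma tame_resolvent f (z0 : T -> C) eta B : 0 < eta ->
    (forall tau, D tau -> Im (z0 tau) <= - eta) ->
    (forall tau, D tau -> normc (z0 tau) <= B) ->
  horo_valued f -> tame f -> tame (fun tau E => (f tau E - z0 tau)^-1).
Proof.
move=> eta0 hz hB hf tf.
apply: (@tame_inv_disc _ (fun tau => Complex 0 rho - z0 tau) rho eta) => //.
- move=> tau hD; apply: le_trans (ler_Im_normc _).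
  by rewrite ImB /=; have := hz _ hD; lra.
- move=> tau E hD hE.
  have -> : f tau E - z0 tau - (Complex 0 rho - z0 tau) = f tau E - Complex 0 rho.
    by ring.
  by apply: horoE; exact: hf.
apply: tame_add tf _; apply: (@tame_cst _ _ _ _ _ _ _ B) => tau hD.
by rewrite normcN hB.
Qed.

End TameResp.

(** * Concentration at the nodes *)

Section Concentration.
Variable R : realType.
Local Notation C := R[i].
Local Notation normc := ComplexField.Normc.normc.
Local Notation Re := complex.Re.
Local Notation Im := complex.Im.

Definition rmean (m : nat) (g : R -> R) : R :=
  (\sum_(u <- nodes R m) g u) / (2 ^ m)%:R.
Definition freq (m : nat) (P : R -> Prop) : R :=
  rmean m (fun u => (`[< P u >])%:R).

Let pow2_gt0 m : 0 < ((2 ^ m)%:R : R). Proof. by rewrite ltr0n expn_gt0. Qed.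

Lemma Re_sum (I : Type) (s : seq I) (g : I -> C) :
  Re (\sum_(u <- s) g u) = \sum_(u <- s) Re (g u).
Proof. by elim/big_rec2 : _ => // i a b _ <-; rewrite ReD. Qed.

Lemma Re_node_mean m g : Re (node_mean m g) = rmean m (fun u => Re (g u)).
Proof.
rewrite /node_mean /rmean.
have -> : (((2 ^ m)%:R : C)^-1) = (((2 ^ m)%:R : R)^-1)%:C%C.
  by rewrite fmorphV rmorph_nat.
by rewrite ReMr Re_sum.
Qed.

Lemma eq_rmean m g h : (forall u, g u = h u) -> rmean m g = rmean m h.
Proof. by move=> gh; rewrite /rmean (eq_bigr h). Qed.

Lemma ler_rmean m g h : (forall u, g u <= h u) -> rmean m g <= rmean m h.
Proof. by move=> gh; rewrite ler_pM2r ?invr_gt0 //; apply: ler_sum. Qed.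

Lemma rmeanZ m a g : rmean m (fun u => a * g u) = a * rmean m g.
Proof. by rewrite /rmean -mulr_sumr mulrA. Qed.

Lemma rmeanD m g h : rmean m (fun u => g u + h u) = rmean m g + rmean m h.
Proof. by rewrite /rmean big_split mulrDl. Qed.

Lemma rmean_cst m (a : R) : rmean m (fun=> a) = a.
Proof.
rewrite /rmean big_const_seq count_predT size_nodes iter_addr_0 -[a *+ _]mulr_natr.
by rewrite mulfK // gt_eqF.
Qed.

Lemma freq_ge0 m P : 0 <= freq m P.
Proof. by rewrite -(rmean_cst m 0); apply: ler_rmean => u; rewrite ler0n. Qed.

Lemma freq_le m P Q : (forall u, P u -> Q u) -> freq m P <= freq m Q.
Proof.
move=> PQ; apply: ler_rmean => u; rewrite ler_nat.
by case: (asboolP (P u)) => // /PQ /asboolP ->.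
Qed.

Lemma freq_or m P Q : freq m (fun u => P u \/ Q u) <= freq m P + freq m Q.
Proof.
rewrite -rmeanD; apply: ler_rmean => u; rewrite -natrD ler_nat.
by case: asboolP => // -[] /asboolP -> ; rewrite ?addn1.
Qed.

Lemma freq_markov m (P : R -> Prop) (g : R -> R) (a : R) : 0 < a ->
  (forall u, 0 <= g u) -> (forall u, P u -> a <= g u) ->
  freq m P <= rmean m g / a.
Proof.
move=> a0 g0 gP; rewrite ler_pdivlMr // mulrC -rmeanZ; apply: ler_rmean => u.
by case: asboolP => [/gP|_]; rewrite ?mulr1 ?mulr0.
Qed.

Lemma normc_node_mean m (g : R -> C) :
  normc (node_mean m g) <= rmean m (fun u => normc (g u)).
Proof.
rewrite normcf_div normc_nat ler_pM2r ?invr_gt0 //.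
elim/big_ind2 : _ => // [|x a z b xa zb]; first by rewrite normc0.
by apply: le_trans (normcD _ _) _; exact: lerD.
Qed.

Lemma node_meanB m (g h : R -> C) :
  node_mean m (fun u => g u - h u) = node_mean m g - node_mean m h.
Proof. by rewrite /node_mean sumrB mulrBl. Qed.

Lemma conj_node_mean m (g : R -> C) :
  ((node_mean m g)^*)%C = node_mean m (fun u => ((g u)^*)%C).
Proof.
rewrite /node_mean conjcM conjcV conjc_nat; congr (_ / _).
by elim/big_rec2 : _ => [|i a b _ <-]; rewrite ?conjc0 // conjcD.
Qed.

(* It detects closeness to [x] and obeys the mean value property, being the real
   part of an analytic function; it takes values in [0, 1] and equals 1 at [x]. *)
Definition bump (eta x : R) (s : C) : R :=
  Re (Complex 0 eta * (s - Complex x (- eta))^-1).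

Lemma bumpE eta x s :
  bump eta x s = eta * (Im s + eta) / normc (s - Complex x (- eta)) ^+ 2.
Proof.
rewrite /bump ReM ImV /= mul0r sub0r ImB /= opprK mulNr mulrN opprK.
by rewrite mulrA.
Qed.

Section Bump.
Variables (eta x : R) (s : C).
Hypotheses (eta0 : 0 < eta) (hs : 0 <= Im s).
Let den_gt0 : 0 < normc (s - Complex x (- eta)) ^+ 2.
Proof.
rewrite exprn_gt0 // normc_gt0; apply: Im_gt0_neq0; rewrite ImB /=.
by move: hs eta0; lra.
Qed.
Let denE : normc (s - Complex x (- eta)) ^+ 2 =
  normc (s - x%:C%C) ^+ 2 + 2 * eta * Im s + eta ^+ 2.
Proof. by rewrite !sqr_normc !(ReB, ImB) /=; ring. Qed.

Lemma bump_ge0 : 0 <= bump eta x s.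
Proof.
by rewrite bumpE divr_ge0 ?sqr_ge0 // mulr_ge0 ?addr_ge0 // ltW.
Qed.

Lemma bump_le1 : bump eta x s <= 1.
Proof.
rewrite bumpE ler_pdivrMr // mul1r denE.
have := mulr_ge0 (ltW eta0) hs; have := sqr_ge0 (normc (s - x%:C%C)).
nra.
Qed.

Lemma bump_far : eta <= normc (s - x%:C%C) -> bump eta x s <= 2^-1.
Proof.
move=> h; rewrite bumpE ler_pdivrMr // denE.
have : eta ^+ 2 <= normc (s - x%:C%C) ^+ 2.
  by rewrite ler_pXn2r ?nnegrE ?normc_ge0 ?(ltW eta0).
nra.
Qed.

Lemma bump_near : normc (s - x%:C%C) <= eta -> 2^-1 <= bump eta x s.
Proof.
move=> h; rewrite bumpE ler_pdivlMr // denE.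
have : normc (s - x%:C%C) ^+ 2 <= eta ^+ 2.
  by rewrite ler_pXn2r ?nnegrE ?normc_ge0 ?(ltW eta0).
nra.
Qed.

Let norm_ge_eta : eta <= normc (s - Complex x (- eta)).
Proof. by apply: le_trans (ler_Im_normc _); rewrite ImB /= opprK lerDr. Qed.

Let norm_ge_sub : normc (s - x%:C%C) <= normc (s - Complex x (- eta)).
Proof.
apply: ler_sqr_normc; rewrite !(ReB, ImB) /=.
by have := mulr_ge0 (ltW eta0) hs; nra.
Qed.

Lemma bump_compl : 1 - bump eta x s <= normc (s - x%:C%C) / eta.
Proof.
have d0 : s - Complex x (- eta) != 0.
  by rewrite -normc_gt0; exact: lt_le_trans norm_ge_eta.
have -> : 1 - bump eta x s = Re ((s - x%:C%C) / (s - Complex x (- eta))).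
  have -> : (s - x%:C%C) / (s - Complex x (- eta)) =
      1 - Complex 0 eta * (s - Complex x (- eta))^-1.
    have -> : s - x%:C%C = (s - Complex x (- eta)) - Complex 0 eta.
      by apply: complex_eqP; rewrite !(ReB, ImB) /=; ring.
    by field.
  by rewrite ReB.
apply: le_trans (ler_Re_normc _) _; rewrite normcf_div.
rewrite ler_wpM2l ?normc_ge0 // lef_pV2 ?posrE //.
exact: lt_le_trans norm_ge_eta.
Qed.

Lemma bump_small : s != x%:C%C -> bump eta x s <= eta / normc (s - x%:C%C).
Proof.
move=> sx; apply: le_trans (ler_Re_normc _) _.
have p : 0 < normc (s - x%:C%C) by rewrite normc_gt0 subr_eq0.
rewrite normcM normcV [normc (Complex 0 eta)]/= expr0n add0r sqrtr_sqr gtr0_norm //.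
rewrite ler_pM2l // lef_pV2 ?posrE //; exact: lt_le_trans norm_ge_sub.
Qed.
End Bump.

Section Means.
Variables (D : R -> Prop) (y y' L : R).
Hypotheses (y'_gt0 : 0 < y') (yy' : y' < y).
Hypothesis DL : forall t, D t -> `|t| <= L.
Notation tame := (tame D id y y').
Notation horo := (@horo_valued R R D y').

Definition sample (t u : R) : C := base (t + (y - y') * u) y'.

Lemma rmean_bump (f : R -> C -> C) (x : R -> R) (eta B e : R) : 0 < eta ->
    (forall t, D t -> `|x t| <= B) -> horo f -> tame f -> 0 < e ->
  exists m0, forall m, (m0 <= m)%N -> forall t, D t ->
    `|rmean m (fun u => bump eta (x t) (f t (sample t u))) -
      bump eta (x t) (f t (base t y))| <= e.
Proof.
move=> eta0 xB hf tf e0.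
pose z0 t : C := Complex (x t) (- eta).
have t1 : tame (fun t E => Complex 0 eta * (f t E - z0 t)^-1).
  apply: tame_mul; first exact: tame_scst.
  apply: (@tame_resolvent _ _ _ _ _ _ y'_gt0 _ _ eta (B + eta)) => //.
  move=> t hD; apply: le_trans (normc_le_ReIm _) _ => /=.
  by rewrite normrN (gtr0_norm eta0) lerD2r xB.
have [m0 hm0] := node_mean_tame yy' t1 e0.
exists m0 => m mm t hD; have h := hm0 m mm t hD.
apply: le_trans h; apply: le_trans (ler_normr_normc_Re _).
by rewrite ReB Re_node_mean.
Qed.

Let Im_horo f t u : D t -> horo f -> 0 <= Im (f t (sample t u)).
Proof.
move=> hD hf; apply: (@horodisc_Im_ge0 _ (y' / 2)); first by rewrite divr_ge0 // ltW.
exact: hf.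
Qed.

Let Im_horo_c f t : D t -> horo f -> 0 <= Im (f t (base t y)).
Proof.
move=> hD hf; apply: (@horodisc_Im_ge0 _ (y' / 2)); first by rewrite divr_ge0 // ltW.
by apply: hf => //; exact: ltW.
Qed.

(** Markov's inequality for [1 - bump], whose mean over the nodes is nearly its value at the centre,
    which is small when the central value of [f] is close to [x t]. *)
Lemma freq_far (f : R -> C -> C) (x : R -> R) (eta B e : R) : 0 < eta ->
    (forall t, D t -> `|x t| <= B) -> horo f -> tame f -> 0 < e ->
  exists m0, forall m, (m0 <= m)%N -> forall t, D t ->
    freq m (fun u => eta <= normc (f t (sample t u) - (x t)%:C%C)) <=
      2 * (normc (f t (base t y) - (x t)%:C%C) / eta) + e.
Proof.
move=> eta0 xB hf tf e0; have e20 : 0 < e / 2 by rewrite divr_gt0.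
have [m0 hm0] := rmean_bump eta0 xB hf tf e20.
exists m0 => m mm t hD; have := hm0 m mm t hD.
set g := fun u => bump eta (x t) _.
have h1 : freq m (fun u => eta <= normc (f t (sample t u) - (x t)%:C%C)) <=
    rmean m (fun u => 2 + (- 2) * g u).
  apply: ler_rmean => u; have hi := Im_horo u hD hf.
  case: asboolP => [h|_]; rewrite [nat_of_bool _]/=.
    by have := bump_far eta0 hi h; rewrite /g; lra.
  by have := bump_le1 (x t) eta0 hi; rewrite /g; lra.
move: h1; rewrite rmeanD rmean_cst rmeanZ.
have := bump_compl (x t) eta0 (Im_horo_c hD hf).
rewrite ler_norml => h2 h3 /andP[h4 h5]; move: h2 h3 h4.
by set a := bump _ _ _; set b := rmean m g; set q := _ / eta; lra.
Qed.

(** The converse use of [bump]: it is small at the centre when the central value of [f] is away from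
    [x], so few nodes can come close to [x]. *)
Lemma freq_near (f : R -> C -> C) (x eta e : R) : 0 < eta ->
    horo f -> tame f -> 0 < e ->
    (forall t, D t -> f t (base t y) != x%:C%C) ->
  exists m0, forall m, (m0 <= m)%N -> forall t, D t ->
    freq m (fun u => normc (f t (sample t u) - x%:C%C) <= eta) <=
      2 * (eta / normc (f t (base t y) - x%:C%C)) + e.
Proof.
move=> eta0 hf tf e0 hx; have e20 : 0 < e / 2 by rewrite divr_gt0.
have [m0 hm0] := @rmean_bump f (fun=> x) eta `|x| _ eta0 (fun _ _ => lexx _) hf tf e20.
exists m0 => m mm t hD; have := hm0 m mm t hD.
set g := fun u => bump eta x _.
have h1 : freq m (fun u => normc (f t (sample t u) - x%:C%C) <= eta) <=
    rmean m (fun u => 2 * g u).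
  apply: ler_rmean => u; have hi := Im_horo u hD hf.
  case: asboolP => [h|_]; rewrite [nat_of_bool _]/=.
    by have := bump_near eta0 hi h; rewrite /g; lra.
  by have := bump_ge0 x eta0 hi; rewrite /g; lra.
move: h1; rewrite rmeanZ.
have := bump_small eta0 (Im_horo_c hD hf) (hx _ hD).
rewrite ler_norml => h2 h3 /andP[h4 h5]; move: h2 h3 h5.
by set a := bump _ _ _; set b := rmean m g; set q := eta / _; lra.
Qed.

End Means.

(** The nodes approximate a Cauchy distribution. Its tail is estimated by the mean value property of
    [i U / (E + i U)], which equals [U / (1 + U)] at the base point [i]. *)
Lemma freq_tail (U e : R) : 0 < U -> 0 < e ->
  exists m0, forall m, (m0 <= m)%N -> freq m (fun u => U <= `|u|) <= 2 / (1 + U) + e.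
Proof.
move=> U0 e0.
have U10 : 0 < 1 + U by rewrite addr_gt0.
have t0 : tame (fun _ : unit => True) (fun _ => 0 : R) 1 0
    (fun _ E => (Complex 0 U) * (E - Complex 0 (- U))^-1).
  apply: tame_mul => //; first exact: tame_scst.
  apply: (@tame_inv_sub _ _ _ _ _ _ ltr01 _ 0) => /=; first by rewrite oppr_lt0.
  by move=> *; rewrite normr0.
have e20 : 0 < e / 2 by rewrite divr_gt0.
have [m0 hm0] := node_mean_tame ltr01 t0 e20.
exists m0 => m mm; have := hm0 m mm tt Logic.I.
set g := fun u => _ => h.
have gE u : Re (g u) = bump U 0 (u%:C%C).
  rewrite /g /bump; congr (Re (_ * (_ - _)^-1)).
  by apply: complex_eqP; rewrite /= ?add0r ?subr0 ?mul1r.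
have h1 : freq m (fun u => U <= `|u|) <= rmean m (fun u => 2 + (- 2) * Re (g u)).
  apply: ler_rmean => u; rewrite gE.
  have hi : 0 <= Im (u%:C%C : C) by [].
  case: asboolP => [hu|_]; rewrite [nat_of_bool _]/=.
    have : U <= normc (u%:C%C - 0%:C%C) by rewrite -rmorphB subr0 normc_real.
    by move/(bump_far U0 hi); lra.
  by have := bump_le1 0 U0 hi; lra.
apply: le_trans h1 _; rewrite rmeanD rmean_cst rmeanZ -Re_node_mean.
have := le_trans (ler_normr_normc_Re _) h.
rewrite ReB -[X in _ - X]/(bump U 0 (base 0 1)) bumpE.
have -> : U * (Im (base 0 1) + U) / normc (base 0 1 - Complex 0 (- U)) ^+ 2 =
    U / (1 + U).
  rewrite sqr_normc !(ReB, ImB) /= subrr expr0n add0r opprK.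
  by field; rewrite gt_eqF.
rewrite ler_norml => /andP[h2 _].
have -> : 2 / (1 + U) = 2 - 2 * (U / (1 + U)) by field; rewrite gt_eqF.
by move: h2; lra.
Qed.

End Concentration.

(** * The reflectionless identity *)

Section Reflectionless.
Variable R : realType.
Local Notation C := R[i].
Local Notation normc := ComplexField.Normc.normc.
Local Notation Re := complex.Re.
Local Notation Im := complex.Im.

Definition mob (a q z : C) : C := (a * z + q) / (z + a).

Lemma mob_perturb (a q a0 q0 z : C) (d e B Z : R) : 0 < d -> 0 <= e -> 0 <= B ->
    d <= normc (z + a) -> d <= normc (z + a0) ->
    normc (a - a0) <= e -> normc (q - q0) <= 2 * B * e ->
    normc a0 <= B -> normc q0 <= B ^+ 2 -> normc z <= Z ->
  normc (mob a q z - mob a0 q0 z) <=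
    e * ((Z + 2 * B) / d + (B * Z + B ^+ 2) / d ^+ 2).
Proof.
move=> d0 e0 B0 h1 h2 ha hq ha0 hq0 hz.
have n1 : z + a != 0 by rewrite -normc_gt0; exact: lt_le_trans h1.
have n2 : z + a0 != 0 by rewrite -normc_gt0; exact: lt_le_trans h2.
have Z0 : 0 <= Z by apply: le_trans hz; exact: normc_ge0.
have -> : mob a q z - mob a0 q0 z =
    ((a - a0) * z + (q - q0)) / (z + a) -
    (a0 * z + q0) * (a - a0) / ((z + a) * (z + a0)).
  by rewrite /mob; field; rewrite n1 n2.
apply: le_trans (normcB _ _) _; rewrite [leRHS]mulrDr; apply: lerD.
  rewrite normcf_div mulrA ler_pM ?normc_ge0 ?invr_ge0 ?normc_ge0 //.
    apply: le_trans (normcD _ _) _; rewrite mulrDr normcM.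
    have := ler_pM (normc_ge0 _) (normc_ge0 _) ha hz.
    by move: hq; lra.
  by rewrite lef_pV2 ?posrE //; exact: lt_le_trans h1.
rewrite normcf_div mulrA ler_pM ?normc_ge0 ?invr_ge0 ?normc_ge0 //.
  rewrite normcM mulrC ler_pM ?normc_ge0 //.
  apply: le_trans (normcD _ _) _; apply: lerD => //; rewrite normcM.
  by rewrite ler_pM ?normc_ge0.
rewrite normcM lef_pV2 ?posrE ?exprn_gt0 // ?mulr_gt0 ?(lt_le_trans d0) //.
by rewrite expr2 ler_pM // ltW.
Qed.

Lemma conj_mob (a q z : C) :
  ((mob a q z)^*)%C = mob (a^*)%C (q^*)%C (z^*)%C.
Proof. by rewrite /mob conjcM conjcV !conjcD conjcM. Qed.

Lemma mob_realE (a q : R) (z : C) : z + a%:C%C != 0 ->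
  mob a%:C%C q%:C%C z = a%:C%C - (a ^+ 2 - q)%:C%C / (z + a%:C%C).
Proof.
move=> h; rewrite /mob rmorphB rmorphXn /=.
by field.
Qed.

Lemma Im_mob_real (a q : R) (z : C) : q <= a ^+ 2 -> 0 < Im z ->
  0 <= Im (mob a%:C%C q%:C%C z).
Proof.
move=> hq hz; have h : z + a%:C%C != 0.
  by apply: Im_gt0_neq0; rewrite ImD /= addr0.
rewrite mob_realE // ImB [(_ - _)%:C%C / _]mulrC ImMr ImV ImD /= addr0 sub0r.
rewrite mulNr mulNr opprK mulr_ge0 ?subr_ge0 //.
by rewrite divr_ge0 ?sqr_ge0 // ltW.
Qed.

(** A Moebius map with real coefficients multiplies [z - w] and [z - conj w] by numbers of the same
    modulus. *)
Lemma hclose_mob_real (a q r : R) (z w : C) : 0 < Im z -> 0 < Im w ->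
  hclose r z w -> hclose r (mob a%:C%C q%:C%C z) (mob a%:C%C q%:C%C w).
Proof.
move=> hz hw; rewrite /hclose => zw.
have h1 : z + a%:C%C != 0 by apply: Im_gt0_neq0; rewrite ImD /= addr0.
have h2 : w + a%:C%C != 0 by apply: Im_gt0_neq0; rewrite ImD /= addr0.
have h3 : (w^*)%C + a%:C%C != 0.
  by apply: Im_lt0_neq0; rewrite ImD Im_conj /= addr0 oppr_lt0.
have e3 : normc ((w^*)%C + a%:C%C) = normc (w + a%:C%C).
  by rewrite -[RHS]normc_conj conjcD conjc_real.
have -> : mob a%:C%C q%:C%C z - mob a%:C%C q%:C%C w =
    (a ^+ 2 - q)%:C%C * (z - w) / ((z + a%:C%C) * (w + a%:C%C)).
  by rewrite !mob_realE //; move: ((a ^+ 2 - q)%:C%C) => p; field; rewrite h1 h2.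
have -> : ((mob a%:C%C q%:C%C w)^*)%C = mob a%:C%C q%:C%C (w^*)%C.
  by rewrite conj_mob !conjc_real.
have -> : mob a%:C%C q%:C%C z - mob a%:C%C q%:C%C (w^*)%C =
    (a ^+ 2 - q)%:C%C * (z - (w^*)%C) / ((z + a%:C%C) * ((w^*)%C + a%:C%C)).
  by rewrite !mob_realE //; move: ((a ^+ 2 - q)%:C%C) => p; field; rewrite h1 h3.
rewrite !normcf_div !normcM e3 mulrA ler_pM2r; last first.
  by rewrite invr_gt0 mulr_gt0 // normc_gt0.
by rewrite mulrCA ler_wpM2l ?normc_ge0.
Qed.

Variables (kappa : nat -> R) (kappa_gt0 : forall n, 0 < kappa n).

(** At [s = 2 k - conj Phi] this is the conjugate of [1 / (Phi + i)]. The [i] bounds the test by 1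
    on the closed upper half-plane, so an exceptional node costs at most 2 in the averages. *)
Definition refl_test (k : R) (s : C) : C := (Complex (2 * k) (- 1) - s)^-1.

Lemma refl_testE k s : refl_test k s = - (s - Complex (2 * k) (- 1))^-1.
Proof. by rewrite /refl_test -invrN opprB. Qed.

Lemma refl_test_lip k (s t : C) : 0 <= Im s -> 0 <= Im t ->
  normc (refl_test k s - refl_test k t) <= normc (s - t).
Proof.
move=> hs ht.
have h (x : C) : 0 <= Im x -> 1 <= normc (Complex (2 * k) (- 1) - x).
  move=> hx; rewrite -normcN; apply: le_trans (ler_Im_normc _).
  by rewrite ImN ImB /=; lra.
have h1 := h _ hs; have h2 := h _ ht.
have n1 : Complex (2 * k) (- 1) - s != 0.
  by rewrite -normc_gt0; apply: lt_le_trans h1.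
have n2 : Complex (2 * k) (- 1) - t != 0.
  by rewrite -normc_gt0; apply: lt_le_trans h2.
have -> : refl_test k s - refl_test k t = (s - t) /
   ((Complex (2 * k) (- 1) - s) * (Complex (2 * k) (- 1) - t)).
  by rewrite /refl_test; field; rewrite n1 n2.
rewrite normcf_div normcM ler_pdivrMr ?mulr_gt0 ?normc_gt0 //.
rewrite ler_peMr ?normc_ge0 //.
exact: mulr_ege1.
Qed.

Lemma refl_test_le1 k (s : C) : 0 <= Im s -> normc (refl_test k s) <= 1.
Proof.
move=> hx; rewrite /refl_test normcV.
have h : 1 <= normc (Complex (2 * k) (- 1) - s).
  rewrite -normcN; apply: le_trans (ler_Im_normc _).
  by rewrite ImN ImB /=; lra.
by rewrite invf_le1 // (lt_le_trans ltr01).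
Qed.

Definition near_real (eps B : R) (s : C) : Prop :=
  `|Im s| <= eps /\ normc s <= B.

Definition perturb_const (h B M : R) : R :=
  (M + h + 2 * B) / (h / 4) + (B * (M + h) + B ^+ 2) / (h / 4) ^+ 2.

Section Pointwise.
Variables (E : C) (Y : R) (n j : nat).
Hypotheses (Y_gt0 : 0 < Y) (YE : 2 * Y <= Im E).
Let F := chain_resp kappa E n j.
Let Phi := tail_resp kappa E n j.
Let k := kappa n.

(** By [tail_resp_loaded], [2 kappa - Phi] is the block loaded by [- F]. Conjugation turns the load
    into [- conj F] and conjugates the coefficients of the block, which changes them little as they
    are almost real; finally [F] is replaced by the constant [f]. *)
Lemma reflection_pointwise (f : C) (h M d eps B : R) : 0 < h -> 0 <= eps ->
    eps <= h / 4 -> 0 <= B -> h <= Im f -> normc f <= M ->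
    normc (F - f) <= d -> d <= h / 2 ->
    near_real eps B (respS kappa E n) -> near_real eps B (respA kappa E n) ->
  normc (refl_test k (loaded kappa E n (- (f^*)%C)) -
         (((Phi + 'i%C)^-1)^*)%C) <=
    2 * d / h + 2 * eps * perturb_const h B M.
Proof.
move=> h0 eps0 epsh B0 hf fM Fd dh [S1 S2] [A1 A2].
set a := respS kappa E n.+1; set q := respS kappa E n * respA kappa E n.
have loadE z : loaded kappa E n z = mob a q z by rewrite loadedE.
have hPhi := horodisc_tail kappa_gt0 Y_gt0 YE n j.
have ImPhi := horodisc_Im_ge0 (ltW Y_gt0) hPhi.
pose s2 := mob (a^*)%C (q^*)%C (- (F^*)%C).
have s2E : s2 = (2 * k)%:C%C - (Phi^*)%C.
  rewrite -[(2 * k)%:C%C]conjc_real -conjcB (tail_resp_loaded kappa_gt0 Y_gt0 YE).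
  by rewrite loadE conj_mob conjcN.
have Ims2 : 0 <= Im s2 by rewrite s2E ImB Im_conj /= sub0r opprK.
have -> : (((Phi + 'i%C)^-1)^*)%C = refl_test k s2.
  rewrite conjcV conjcD /refl_test s2E; congr (_^-1).
  by apply: complex_eqP; rewrite ?(ReB, ImB, ReD, ImD, Re_conj, Im_conj) /=; ring.
pose c : C := - (f^*)%C; pose z : C := - (F^*)%C.
have Imc : h <= Im c by rewrite ImN Im_conj opprK.
have zc : normc (c - z) <= d.
  have -> : c - z = ((F - f)^*)%C by rewrite conjcB /c /z; ring.
  by rewrite normc_conj.
have Imz : h / 2 <= Im z.
  have := le_trans (ler_Im_normc _) zc; rewrite ImB; lra.
have Ima : 0 < Im a := Im_respS_gt0 kappa_gt0 Y_gt0 YE n.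
pose a0 := Re a; pose q0 := Re (respS kappa E n) * Re (respA kappa E n).
have aE : a = (respS kappa E n + respA kappa E n) / 2 by rewrite /a respSS.
have q0a : q0 <= a0 ^+ 2.
  rewrite /a0 aE Re_half ReD /q0.
  have := sqr_ge0 (Re (respS kappa E n) - Re (respA kappa E n)); nra.
have aB : normc (a0%:C%C) <= B.
  rewrite normc_real; apply: le_trans (ler_normr_normc_Re _) _.
  rewrite aE normc_half ler_pdivrMr //; apply: le_trans (normcD _ _) _.
  by move: S2 A2; lra.
have da : normc (a - a0%:C%C) <= eps.
  have -> : a - a0%:C%C = Complex 0 (Im a).
    by apply: complex_eqP; rewrite !(ReB, ImB) /=; ring.
  rewrite /= expr0n add0r sqrtr_sqr aE Im_half ImD normrM.
  rewrite (gtr0_norm (_ : 0 < 2^-1)) ?invr_gt0 // ler_pdivrMr //.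
  by apply: le_trans (ler_normD _ _) _; move: S1 A1; lra.
have nRe (s : C) : normc (s - (Re s)%:C%C) = `|Im s|.
  have -> : s - (Re s)%:C%C = Complex 0 (Im s).
    by apply: complex_eqP; rewrite !(ReB, ImB) /=; ring.
  by rewrite /= expr0n add0r sqrtr_sqr.
have dq : normc (q - q0%:C%C) <= 2 * B * eps.
  rewrite /q /q0 rmorphM /=.
  move: (respS _ _ _) (respA _ _ _) S1 S2 A1 A2 => s t S1 S2 A1 A2.
  have -> : s * t - (Re s)%:C%C * (Re t)%:C%C =
     s * (t - (Re t)%:C%C) + (Re t)%:C%C * (s - (Re s)%:C%C) by ring.
  apply: le_trans (normcD _ _) _; rewrite !normcM !nRe normc_real.
  have t1 := ler_pM (normc_ge0 s) (normr_ge0 (Im t)) S2 A1.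
  have t2 := ler_pM (normr_ge0 (Re t)) (normr_ge0 (Im s))
    (le_trans (ler_normr_normc_Re t) A2) S1.
  by move: t1 t2; lra.
have qB : normc (q0%:C%C) <= B ^+ 2.
  rewrite normc_real normrM expr2 ler_pM //.
    exact: le_trans (ler_normr_normc_Re _) S2.
  exact: le_trans (ler_normr_normc_Re _) A2.
have h4 : 0 < h / 4 by rewrite divr_gt0.
have lowc (w : C) (b : C) : h / 2 <= Im w -> - (h / 4) <= Im b ->
    h / 4 <= normc (w + b).
  by move=> hw hb; apply: le_trans (ler_Im_normc _); rewrite ImD; lra.
have nz : normc z <= M + h.
  rewrite normcN normc_conj -[F](subrK f); apply: le_trans (normcD _ _) _.
  by move: Fd dh fM h0; lra.
have nc : normc c <= M + h by rewrite normcN normc_conj; move: fM h0; lra.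
have p1 : normc (mob a q c - mob a0%:C%C q0%:C%C c) <=
    eps * perturb_const h B M.
  apply: mob_perturb => //; apply: lowc; rewrite /= ?oppr_le0 ?(ltW h4) //; lra.
have p2 : normc (s2 - mob a0%:C%C q0%:C%C z) <= eps * perturb_const h B M.
  have dc (s : C) (r : R) : normc ((s^*)%C - r%:C%C) = normc (s - r%:C%C).
    by rewrite -[RHS]normc_conj conjcB conjc_real.
  apply: mob_perturb; rewrite ?dc //.
    apply: lowc => //; rewrite Im_conj lerN2.
    have := le_trans (ler_Im_normc _) da; rewrite ImB /=; lra.
  by apply: lowc; rewrite /= ?oppr_le0 ?(ltW h4).
have zpos : 0 < Im z by apply: lt_le_trans Imz; rewrite divr_gt0.
have cpos : 0 < Im c by exact: lt_le_trans Imc.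
have Imm1 : 0 <= Im (mob a0%:C%C q0%:C%C c) by exact: Im_mob_real.
have Imm2 : 0 <= Im (mob a0%:C%C q0%:C%C z) by exact: Im_mob_real.
have Imm3 : 0 <= Im (mob a q c).
  rewrite -loadE; apply: (@horodisc_Im_ge0 _ Y); first exact: ltW.
  by apply: horodisc_loaded => //; [exact: ltW|exact: Im_gt0_neq0].
have d0 : 0 <= d by apply: le_trans zc; exact: normc_ge0.
have hc0 : hclose (d / h) c z.
  apply: le_trans zc _; rewrite mulrAC ler_pdivlMr // ler_wpM2l //.
  by apply: le_trans (ler_Im_normc _); rewrite ImB Im_conj opprK; lra.
(* The detour through [hclose] gives an error [2 * d / h] free of [B]; this matters because [d] is
   fixed before the block and hence before [B] is known. *)
have hm := hclose_mob_real a0 q0 cpos zpos hc0.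
have hb : normc (refl_test k (mob a0%:C%C q0%:C%C c) -
    refl_test k (mob a0%:C%C q0%:C%C z)) <= 2 * d / h.
  rewrite !refl_testE -opprD normcN.
  have := @hclose_inv_dist R (d / h) _ _ (Complex (2 * k) (- 1))
    (divr_ge0 d0 (ltW h0)) Imm1 Imm2 _ hm.
  by rewrite /= ltrN10 opprK divr1 mulrA; apply.
rewrite loadE -/c.
apply: le_trans (normc_triangle _ _ (refl_test k (mob a0%:C%C q0%:C%C c))) _.
have t1 := le_trans (refl_test_lip k Imm3 Imm1) p1.
have t2 := normc_triangle (refl_test k (mob a0%:C%C q0%:C%C c))
   (refl_test k s2) (refl_test k (mob a0%:C%C q0%:C%C z)).
have t3 := le_trans (refl_test_lip k Imm2 Ims2)
  (_ : _ <= eps * perturb_const h B M).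
rewrite normc_distC in t3; have := t3 p2.
by move: hb t1 t2; lra.
Qed.

Lemma reflection_trivial (c : C) : upper c ->
  normc (refl_test k (loaded kappa E n c) - (((Phi + 'i%C)^-1)^*)%C) <= 2.
Proof.
case=> hc c0; apply: le_trans (normcB _ _) _; rewrite normc_conj.
have i1 : 0 <= Im (loaded kappa E n c).
  apply: (@horodisc_Im_ge0 _ Y); first exact: ltW.
  exact: horodisc_loaded.
have i2 : 0 <= Im Phi.
  apply: (@horodisc_Im_ge0 _ Y); first exact: ltW.
  exact: horodisc_tail.
have := refl_test_le1 k i1.
have : normc (Phi + 'i%C)^-1 <= 1.
  have h : 1 <= normc (Phi + 'i%C).
    by apply: le_trans (ler_Im_normc _); rewrite ImD /= lerDr.
  by rewrite normcV invf_le1 // (lt_le_trans ltr01).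
by lra.
Qed.

(** At the centre the response of a long block hardly depends on its load. Since the chain continues
    with a second block of the same level, [F], [Phi] and the block loaded by [- conj f] are three
    values of one nearly constant map. *)
Lemma reflection_centre (f : C) (h M e3 : R) (i : nat) : j = i.+1 -> f = F ->
    0 < h -> 0 <= e3 -> h <= Im f -> normc f <= M ->
    contracting e3 (loaded kappa E n) ->
  normc (refl_test k f - (((f + 'i%C)^-1)^*)%C) <=
  normc (refl_test k (loaded kappa E n (- (f^*)%C)) -
         (((Phi + 'i%C)^-1)^*)%C) + 4 * e3.
Proof.
move=> ji fF h0 e30 hf fM hc.
have Y0 := ltW Y_gt0.
have cpos : 0 < Im (- (f^*)%C) by rewrite ImN Im_conj opprK; exact: lt_le_trans hf.
have uc : upper (- (f^*)%C) by split; [exact: ltW|exact: Im_gt0_neq0].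
have hPhi := horodisc_tail kappa_gt0 Y_gt0 YE n j.
have uF : upper (Phi - (2 * kappa n)%:C%C).
  exact: (upper_tail_shift kappa_gt0 Y_gt0 n hPhi).
have hP2 := horodisc_tail kappa_gt0 Y_gt0 YE n.+1 i.
have uP : upper (tail_resp kappa E n.+1 i - (2 * kappa n.+1)%:C%C).
  exact: (upper_tail_shift kappa_gt0 Y_gt0 n.+1 hP2).
have up1 (z : C) : upper z -> 0 <= Im (loaded kappa E n z).
  by case=> hz z0; apply: (horodisc_Im_ge0 Y0); exact: horodisc_loaded.
have cl z w : upper z -> upper w ->
    hclose e3 (loaded kappa E n z) (loaded kappa E n w).
  move=> hz hw; rewrite -[e3]mulr1; apply: hc => //.
  by case: hz; case: hw => *; exact: hclose1.
have FE : f = loaded kappa E n (Phi - (2 * kappa n)%:C%C) by rewrite fF.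
have PE : Phi = loaded kappa E n (tail_resp kappa E n.+1 i - (2 * kappa n.+1)%:C%C).
  by rewrite /Phi ji.
set r := loaded kappa E n (- (f^*)%C).
have c1 : normc (refl_test k f - refl_test k r) <= 2 * e3.
  rewrite !refl_testE -opprD normcN.
  have := @hclose_inv_dist R e3 f r (Complex (2 * k) (- 1)) e30.
  rewrite /= ltrN10 opprK divr1 => -> //; first by rewrite FE; exact: up1.
    exact: up1.
  by rewrite {1}FE; exact: cl.
have c2 : normc ((((Phi + 'i%C)^-1)^*)%C - (((f + 'i%C)^-1)^*)%C) <= 2 * e3.
  rewrite -conjcB normc_conj.
  have := @hclose_inv_dist R e3 Phi f (Complex 0 (- 1)) e30.
  have e x : x - Complex 0 (- 1) = x + 'i%C :> C.
    by apply: complex_eqP; rewrite ?(ReB, ImB, ReD, ImD) /= ?oppr0 ?opprK.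
  rewrite !e /= ltrN10 opprK divr1 => -> //.
  - by rewrite PE; exact: up1.
  - by rewrite FE; exact: up1.
  by rewrite PE FE; exact: cl.
apply: le_trans (normc_triangle _ _ (refl_test k r)) _.
have := normc_triangle (refl_test k r) (((f + 'i%C)^-1)^*)%C (((Phi + 'i%C)^-1)^*)%C.
by move: c1 c2; lra.
Qed.

End Pointwise.

(** Equality of the two tests would say [2 k - i - f = conj f - i], that is [Re f = k]; the factor
    on the right is the product of the two denominators. *)
Lemma reflection_solve (k M e : R) (f : C) : 0 < k -> 0 <= Im f -> normc f <= M ->
    normc (refl_test k f - (((f + 'i%C)^-1)^*)%C) <= e ->
  `|2 * Re f - 2 * k| <= e * ((2 * k + 1 + M) * (M + 1)).
Proof.
move=> k0 hf fM he.
have n1 : Complex (2 * k) (- 1) - f != 0.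
  by apply: Im_lt0_neq0; rewrite ImB /=; lra.
have n2 : (f^*)%C - 'i%C != 0.
  by apply: Im_lt0_neq0; rewrite ImB Im_conj /=; lra.
have E : refl_test k f - (((f + 'i%C)^-1)^*)%C =
   (2 * Re f - 2 * k)%:C%C / ((Complex (2 * k) (- 1) - f) * ((f^*)%C - 'i%C)).
  have -> : (2 * Re f - 2 * k)%:C%C =
      ((f^*)%C - 'i%C) - (Complex (2 * k) (- 1) - f).
    by apply: complex_eqP; rewrite ?(ReB, ImB, Re_conj, Im_conj) /=; ring.
  have -> : (((f + 'i%C)^-1)^*)%C = ((f^*)%C - 'i%C)^-1.
    rewrite conjcV conjcD; congr ((_ + _)^-1).
    by apply: complex_eqP; rewrite /= ?oppr0.
  by rewrite /refl_test; field; rewrite n1 n2.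
have n12 : 0 < normc ((Complex (2 * k) (- 1) - f) * ((f^*)%C - 'i%C)).
  by rewrite normc_gt0 mulf_neq0.
have e0 : 0 <= e by apply: le_trans he; exact: normc_ge0.
move: he; rewrite E normcf_div normc_real ler_pdivrMr // => he.
apply: le_trans he _; rewrite ler_wpM2l // normcM ler_pM ?normc_ge0 //.
  apply: le_trans (normcB _ _) _; apply: lerD => //.
  apply: le_trans (normc_le_ReIm _) _ => /=.
  by rewrite normrN normr1 gtr0_norm // mulr_gt0.
apply: le_trans (normcB _ _) _; rewrite normc_conj.
have -> : normc ('i%C : C) = 1 by rewrite /= expr0n add0r expr1n sqrtr1.
by rewrite lerD2r.
Qed.

End Reflectionless.

(** * Integrals over a bounded interval *)

Section IntervalIntegral.
Variable R : realType.
Notation mu := (@lebesgue_measure R).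

Lemma lebesgue_measure_shift (s : R) (A : set R) : measurable A ->
  mu [set t | A (t + s)] = mu A.
Proof.
move=> mA; rewrite -[LHS]/(pushforward mu ((+%R^~ s) : _ -> measurableTypeR R) A).
have ms : measurable_fun [set: R] (+%R^~ s : R -> R).
  by apply: measurable_funD; [exact: measurable_id|exact: measurable_cst].
apply/esym/lebesgue_measure_unique => //= _ [[a b]] _ <-.
rewrite /pushforward.
have -> : (+%R^~ s) @^-1` `]a, b]%classic = `]a - s, b - s]%classic.
  apply/seteqP; split => t /=; rewrite !in_itv /= => /andP[h1 h2].
    by rewrite ltrBlDr h1 lerBrDr.
  by rewrite -ltrBlDr h1 -lerBrDr.
rewrite !lebesgue_measure_itv/= !lte_fin ltrD2r.
by case: ifP => // _; rewrite -!EFinB; congr (_%:E); ring.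
Qed.

Definition bounded_mfun (B : R) (f : R -> R) : Prop :=
  measurable_fun [set: R] f /\ forall t, 0 <= f t <= B.

Local Notation sitv L := (`[- L, L]%classic : set R).

Definition itvI (L : R) (f : R -> R) : R :=
  fine (\int[mu]_(t in sitv L) (f t)%:E)%E.

Section Basic.
Variable L : R.
Hypothesis L0 : 0 < L.
Local Notation I := (sitv L).

Let muI : mu I = (2 * L)%:E.
Proof.
rewrite lebesgue_measure_itv /= lte_fin.
have -> : - L < L by move: L0; lra.
by rewrite -EFinB; congr (_%:E); ring.
Qed.

Let itv_int_ge0 f : (forall t, 0 <= f t) ->
  (0 <= \int[mu]_(t in I) (f t)%:E)%E.
Proof. by move=> f0; apply: integral_ge0 => t _; rewrite lee_fin. Qed.

Lemma bounded_mfunS B f (A : set R) : bounded_mfun B f ->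
  measurable_fun A (fun t => (f t)%:E).
Proof.
move=> [mf _]; apply/measurable_EFinP; exact: measurable_funTS.
Qed.

Let itv_int_le B f : bounded_mfun B f ->
  (\int[mu]_(t in I) (f t)%:E <= (B * (2 * L))%:E)%E.
Proof.
move=> bf; have [mf hf] := bf.
apply: le_trans (_ : (\int[mu]_(t in I) (cst B%:E) t <= _)%E).
  apply: ge0_le_integral => //=.
  - by move=> t _; rewrite lee_fin; case/andP: (hf t).
  - exact: bounded_mfunS bf.
  - by move=> t _; rewrite lee_fin; case/andP: (hf t).
by rewrite integral_cst //= muI -EFinM.
Qed.

Let itv_fin B f : bounded_mfun B f ->
  (\int[mu]_(t in I) (f t)%:E)%E \is a fin_num.
Proof.
move=> bf; rewrite ge0_fin_numE; first by apply: le_lt_trans (itv_int_le bf) _; rewrite ltry.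
by apply: itv_int_ge0 => t; case: bf => _ /(_ t) /andP[].
Qed.

Lemma itvI_fin B f : bounded_mfun B f ->
  (itvI L f)%:E = (\int[mu]_(t in I) (f t)%:E)%E.
Proof. by move=> bf; rewrite /itvI fineK // (itv_fin bf). Qed.

Lemma itvI_ge0 B f : bounded_mfun B f -> 0 <= itvI L f.
Proof.
move=> bf; apply: fine_ge0; apply: itv_int_ge0 => t.
by case: bf => _ /(_ t) /andP[].
Qed.

Lemma itvI_bound B f : bounded_mfun B f -> itvI L f <= B * (2 * L).
Proof. by move=> bf; rewrite -lee_fin (itvI_fin bf); exact: itv_int_le. Qed.

Lemma itvI_le B B' f g : bounded_mfun B f -> bounded_mfun B' g ->
  (forall t, - L <= t <= L -> f t <= g t) -> itvI L f <= itvI L g.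
Proof.
move=> bf bg fg; rewrite -lee_fin (itvI_fin bf) (itvI_fin bg).
apply: ge0_le_integral => //=.
- by move=> t _; rewrite lee_fin; case: bf => _ /(_ t) /andP[].
- exact: bounded_mfunS bf.
- exact: bounded_mfunS bg.
Qed.

Lemma bounded_mfunD B B' f g : bounded_mfun B f -> bounded_mfun B' g ->
  bounded_mfun (B + B') (fun t => f t + g t).
Proof.
move=> [mf hf] [mg hg]; split; first exact: measurable_funD.
by move=> t; case/andP: (hf t) => ? ?; case/andP: (hg t) => ? ?;
  rewrite addr_ge0 // lerD.
Qed.

Lemma bounded_mfunZ B c f : 0 <= c -> bounded_mfun B f ->
  bounded_mfun (c * B) (fun t => c * f t).
Proof.
move=> c0 [mf hf]; split.
  by apply: measurable_funM => //; exact: measurable_cst.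
by move=> t; case/andP: (hf t) => ? ?; rewrite mulr_ge0 // ler_wpM2l.
Qed.

Lemma bounded_mfun_cst c : 0 <= c -> bounded_mfun c (fun=> c).
Proof. by move=> c0; split => [|t]; [exact: measurable_cst|rewrite c0 lexx]. Qed.

Lemma bounded_mfun_shift B f s : bounded_mfun B f ->
  bounded_mfun B (fun t => f (t + s)).
Proof.
move=> [mf hf]; split => [|t]; last exact: hf.
apply: measurableT_comp => //.
by apply: measurable_funD; [exact: measurable_id|exact: measurable_cst].
Qed.

Lemma bounded_mfun_indic (A : set R) : measurable A -> bounded_mfun 1 \1_A.
Proof.
move=> mA; split; first exact: measurable_indic.
by move=> t; rewrite indicE ler0n lern1 leq_b1.
Qed.

Lemma itvID B B' f g : bounded_mfun B f -> bounded_mfun B' g ->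
  itvI L (fun t => f t + g t) = itvI L f + itvI L g.
Proof.
move=> bf bg; apply: EFin_inj.
rewrite EFinD (itvI_fin bf) (itvI_fin bg) (itvI_fin (bounded_mfunD bf bg)).
under eq_integral do rewrite EFinD.
apply: ge0_integralD => //=.
- by move=> t _; rewrite lee_fin; case: bf => _ /(_ t) /andP[].
- exact: bounded_mfunS bf.
- by move=> t _; rewrite lee_fin; case: bg => _ /(_ t) /andP[].
- exact: bounded_mfunS bg.
Qed.

Lemma itvIZ B c f : 0 <= c -> bounded_mfun B f ->
  itvI L (fun t => c * f t) = c * itvI L f.
Proof.
move=> c0 bf; apply: EFin_inj.
rewrite EFinM (itvI_fin bf) (itvI_fin (bounded_mfunZ c0 bf)).
under eq_integral do rewrite EFinM.
apply: ge0_integralZl_EFin => //=.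
- by move=> t _; rewrite lee_fin; case: bf => _ /(_ t) /andP[].
- exact: bounded_mfunS bf.
Qed.

Lemma itvI_cst c : 0 <= c -> itvI L (fun=> c) = c * (2 * L).
Proof.
move=> c0; apply: EFin_inj; rewrite (itvI_fin (bounded_mfun_cst c0)).
by rewrite -[LHS]/(\int[mu]_(t in I) (cst c%:E) t)%E integral_cst //= muI -EFinM.
Qed.

Lemma bounded_mfun_rmean B m (F : R -> R -> R) :
  (forall u, bounded_mfun B (F u)) ->
  bounded_mfun B (fun t => rmean m (fun u => F u t)).
Proof.
move=> hF; split.
  rewrite /rmean; apply: measurable_funM; last exact: measurable_cst.
  by apply: measurable_sum => u; case: (hF u).
move=> t; rewrite -{1}(rmean_cst m 0) -(rmean_cst m B).
by apply/andP; split; apply: ler_rmean => u; case: (hF u) => _ /(_ t) /andP[].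
Qed.

Lemma itvI_rmean B m (F : R -> R -> R) :
  (forall u, bounded_mfun B (F u)) ->
  itvI L (fun t => rmean m (fun u => F u t)) = rmean m (fun u => itvI L (F u)).
Proof.
move=> hF; have B0 : 0 <= B by case: (hF 0) => _ /(_ 0) /andP[]; exact: le_trans.
have hs (s : seq R) : (exists B', bounded_mfun B' (fun t => \sum_(u <- s) F u t))
    /\ itvI L (fun t => \sum_(u <- s) F u t) = \sum_(u <- s) itvI L (F u).
  elim: s => [|u s [[B' hB'] IH]].
    rewrite big_nil; have -> : (fun t => \sum_(u <- [::]) F u t) = (fun=> 0).
      by apply/funext => t; rewrite big_nil.
    split; first by exists 0; exact: bounded_mfun_cst.
    by rewrite itvI_cst // mul0r.
  have -> : (fun t => \sum_(i <- u :: s) F i t) =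
      (fun t => F u t + \sum_(i <- s) F i t).
    by apply/funext => t; rewrite big_cons.
  split; first by exists (B + B'); exact: bounded_mfunD.
  by rewrite (itvID (hF u) hB') IH big_cons.
have [[B' hB'] e] := hs (nodes R m).
rewrite /rmean -e [RHS]mulrC -(itvIZ _ hB'); last by rewrite invr_ge0.
by congr itvI; apply/funext => t; rewrite mulrC.
Qed.

Lemma itvI_indic (A : set R) : measurable A ->
  (itvI L \1_A)%:E = mu (A `&` I).
Proof.
move=> mA; rewrite (itvI_fin (bounded_mfun_indic mA)).
by rewrite integral_indic.
Qed.

Lemma itvI_indic_shift_le (A : set R) s : measurable A ->
  ((itvI L (fun t => \1_A (t + s)))%:E <= mu A)%E.
Proof.
move=> mA.
have mAs : measurable [set t | A (t + s)].
  rewrite -[X in measurable X]setTI.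
  have := bounded_mfun_shift s (bounded_mfun_indic mA).
  have : measurable_fun [set: R] (+%R^~ s).
    by apply: measurable_funD; [exact: measurable_id|exact: measurable_cst].
  by move=> + _; apply.
have -> : (fun t => \1_A (t + s)) = \1_[set t | A (t + s)] :> (R -> R).
  by apply/funext => t; rewrite !indicE; congr (_ _)%:R; apply/idP/idP;
    rewrite !inE.
rewrite itvI_indic // -(lebesgue_measure_shift s mA).
by apply: le_measure; rewrite ?inE //; exact: measurableI.
Qed.

Lemma itvI_indic_shift (A : set R) s a : measurable A ->
    (forall t, A t -> `|t| <= a) -> a + `|s| <= L ->
  (itvI L (fun t => \1_A (t + s)))%:E = mu A.
Proof.
move=> mA hA has.
have mAs : measurable [set t | A (t + s)].
  rewrite -[X in measurable X]setTI.
  have : measurable_fun [set: R] (+%R^~ s).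
    by apply: measurable_funD; [exact: measurable_id|exact: measurable_cst].
  by apply.
have -> : (fun t => \1_A (t + s)) = \1_[set t | A (t + s)] :> (R -> R).
  by apply/funext => t; rewrite !indicE; congr (_ _)%:R; apply/idP/idP;
    rewrite !inE.
rewrite itvI_indic // -(lebesgue_measure_shift s mA); congr (mu _).
apply/seteqP; split => t /=; first by case.
move=> At; split => //=; rewrite in_itv /= -ler_norml.
have := hA _ At; have := ler_normB (t + s) s; rewrite addrK.
by move: has; lra.
Qed.

(** Only the part of the shifted window that leaves the interval is lost. Adding a strip of length
    [|s|] on both sides avoids distinguishing the sign of [s]. *)
Lemma itvI_shift f B s : bounded_mfun B f ->
  itvI L (fun t => f (t + s)) <= itvI L f + B * (2 * `|s|).
Proof.
move=> bf; have bfs := bounded_mfun_shift s bf.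
have B0 : 0 <= B by case: (bf) => _ /(_ 0) /andP[]; exact: le_trans.
rewrite -lee_fin EFinD (itvI_fin bf) (itvI_fin bfs).
pose I1 : set R := `]L, L + `|s|]%classic.
pose I2 : set R := `[- L - `|s|, - L[%classic.
pose g t : R := f t * \1_I t + B * (\1_I1 t + \1_I2 t).
have mI : measurable I by exact: measurable_itv.
have m1 : measurable I1 by exact: measurable_itv.
have m2 : measurable I2 by exact: measurable_itv.
have f0 t : 0 <= f t by case: bf => _ /(_ t) /andP[].
have fB t : f t <= B by case: bf => _ /(_ t) /andP[].
have i0 (A : set R) t : 0 <= (\1_A t : R) by rewrite indicE ler0n.
have mfI : measurable_fun [set: R] (fun t => f t * \1_I t).
  by apply: measurable_funM; [case: bf|exact: measurable_indic].
have mg12 : measurable_fun [set: R] (fun t => (\1_I1 t + \1_I2 t : R)).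
  by apply: measurable_funD; exact: measurable_indic.
have mgB : measurable_fun [set: R] (fun t => B * (\1_I1 t + \1_I2 t)).
  by apply: measurable_funM => //; exact: measurable_cst.
have mg : measurable_fun [set: R] g by exact: measurable_funD.
have g0 t : 0 <= g t by rewrite addr_ge0 ?mulr_ge0 ?addr_ge0.
have mshift : measurable_fun [set: R] (+%R^~ s : R -> R).
  by apply: measurable_funD; [exact: measurable_id|exact: measurable_cst].
have gint : (\int[mu]_t (g (t + s))%:E = \int[mu]_t (g t)%:E)%E.
  have mgE : measurable_fun [set: R] (fun t => (g t)%:E) by exact/measurable_EFinP.
  have := @ge0_integral_pushforward _ _ _ _ R
    ((+%R^~ s) : measurableTypeR R -> measurableTypeR R) mshift mu setT
    (fun t => (g t)%:E) measurableT mgE.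
  rewrite preimage_setT /= => <-; last by move=> t _; rewrite lee_fin.
  by apply: eq_measure_integral => A mA _; exact: lebesgue_measure_shift.
have step : (\int[mu]_(t in I) (f (t + s))%:E <= \int[mu]_t (g (t + s))%:E)%E.
  rewrite integral_mkcond; apply: ge0_le_integral => //=.
  - by move=> t _; rewrite patchE; case: ifP => // _; rewrite lee_fin.
  - by apply/(measurable_restrictT _ mI); exact: bounded_mfunS bfs.
  - by apply/measurable_EFinP; exact: measurableT_comp mg mshift.
  move=> t _; rewrite patchE; case: ifPn => [|_]; last by rewrite lee_fin.
  rewrite inE /= in_itv /= => /andP[h1 h2]; rewrite lee_fin /g !indicE.
  have := ler_norm s; have := ler_norm (- s); rewrite normrN => s1 s2.
  have [u1|u1] := lerP (t + s) L.
    have [u2|u2] := lerP (- L) (t + s).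
      rewrite mem_set; last by rewrite /= in_itv /= u1 u2.
      by rewrite mulr1 lerDl mulr_ge0 // addr_ge0.
    rewrite (mem_set (_ : I2 (t + s))); last first.
      by rewrite /I2 /= in_itv /= u2 andbT; lra.
    apply: le_trans (fB _) _; rewrite -[leLHS]addr0 addrC lerD ?mulr_ge0 //.
    by rewrite mulrDr mulr1 lerDr mulr_ge0.
  rewrite (mem_set (_ : I1 (t + s))); last first.
    by rewrite /I1 /= in_itv /= u1; lra.
  apply: le_trans (fB _) _; rewrite -[leLHS]add0r lerD ?mulr_ge0 //.
  by rewrite mulrDr mulr1 lerDl mulr_ge0.
apply: le_trans step _; rewrite gint.
have -> : (\int[mu]_t (g t)%:E = \int[mu]_t ((f t * \1_I t)%:E) +
   \int[mu]_t ((B * (\1_I1 t + \1_I2 t))%:E))%E.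
  rewrite -ge0_integralD //=.
  - by move=> t _; rewrite lee_fin mulr_ge0.
  - exact/measurable_EFinP.
  - by move=> t _; rewrite lee_fin mulr_ge0 // addr_ge0.
  - exact/measurable_EFinP.
apply: leeD.
  rewrite [leRHS]integral_mkcond le_eqVlt; apply/orP; left; apply/eqP.
  apply: eq_integral => t _; rewrite patchE indicE.
  by case: ifP => _; rewrite ?mulr1 ?mulr0.
under eq_integral do rewrite EFinM EFinD.
rewrite ge0_integralZl_EFin //=; last first.
- by apply/measurable_EFinP.
- by move=> t _; rewrite -EFinD lee_fin addr_ge0.
rewrite ge0_integralD //=; last first.
by apply/measurable_EFinP; exact: measurable_indic.
by apply/measurable_EFinP; exact: measurable_indic.
rewrite !integral_indic // !setIT.
have e1 : mu I1 = `|s|%:E.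
  rewrite lebesgue_measure_itv /= lte_fin ltrDl.
  case: ifP => [_|/negbT]; first by rewrite -EFinB; congr (_%:E); ring.
  by rewrite normr_gt0 negbK => /eqP ->; rewrite normr0.
have e2 : mu I2 = `|s|%:E.
  rewrite lebesgue_measure_itv /= lte_fin gtrBl.
  case: ifP => [_|/negbT]; first by rewrite -EFinB; congr (_%:E); ring.
  by rewrite normr_gt0 negbK => /eqP ->; rewrite normr0.
rewrite [X in (_ * (X + _))%E]e1 [X in (_ * (_ + X))%E]e2 -EFinD -EFinM lee_fin.
by apply: ler_wpM2l => //; lra.
Qed.

End Basic.
End IntervalIntegral.

(** * Boundary values of the responses *)

Section ComplexMeasurable.
Variable R : realType.
Local Notation C := R[i].
Local Notation normc := ComplexField.Normc.normc.
Local Notation Re := complex.Re.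
Local Notation Im := complex.Im.
Notation mu := (@lebesgue_measure R).

Definition cmeasurable (f : R -> C) : Prop :=
  measurable_fun [set: R] (fun t => Re (f t)) /\
  measurable_fun [set: R] (fun t => Im (f t)).

Lemma cmeasurable_cst c : cmeasurable (fun=> c).
Proof. by split; exact: measurable_cst. Qed.

Lemma cmeasurableD f g : cmeasurable f -> cmeasurable g ->
  cmeasurable (fun t => f t + g t).
Proof.
move=> [f1 f2] [g1 g2]; split.
  by under eq_fun do rewrite ReD; exact: measurable_funD.
by under eq_fun do rewrite ImD; exact: measurable_funD.
Qed.

Lemma cmeasurableN f : cmeasurable f -> cmeasurable (fun t => - f t).
Proof.
move=> [f1 f2]; split.
  by under eq_fun do rewrite ReN; exact: measurable_funN.
by under eq_fun do rewrite ImN; exact: measurable_funN.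
Qed.

Lemma cmeasurableB f g : cmeasurable f -> cmeasurable g ->
  cmeasurable (fun t => f t - g t).
Proof. by move=> mf mg; apply: cmeasurableD => //; exact: cmeasurableN. Qed.

Lemma cmeasurableM f g : cmeasurable f -> cmeasurable g ->
  cmeasurable (fun t => f t * g t).
Proof.
move=> [f1 f2] [g1 g2]; split.
  under eq_fun do rewrite ReM.
  by apply: measurable_funB; exact: measurable_funM.
under eq_fun do rewrite ImM.
by apply: measurable_funD; exact: measurable_funM.
Qed.

Lemma measurable_sqr_normc f : cmeasurable f ->
  measurable_fun [set: R] (fun t => normc (f t) ^+ 2).
Proof.
move=> [f1 f2]; under eq_fun do rewrite sqr_normc.
by apply: measurable_funD; exact: measurable_funX.
Qed.

Lemma measurable_normc f : cmeasurable f ->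
  measurable_fun [set: R] (fun t => normc (f t)).
Proof.
move=> mf.
have -> : (fun t => normc (f t)) = (fun t => (normc (f t) ^+ 2) `^ (2^-1)).
  by apply/funext => t; rewrite powR12_sqrt ?sqr_ge0 // sqrtr_sqr ger0_norm // normc_ge0.
apply: (measurableT_comp (measurable_powR _)); exact: measurable_sqr_normc.
Qed.

Lemma cmeasurableV f : cmeasurable f -> cmeasurable (fun t => (f t)^-1).
Proof.
move=> mf; have [f1 f2] := mf.
have mi : measurable_fun [set: R] (fun t => (normc (f t) ^+ 2)^-1).
  have -> : (fun t => (normc (f t) ^+ 2)^-1) =
      (fun t => (normc (f t) ^+ 2) `^ (-1)).
    by apply/funext => t; rewrite powR_inv1 // sqr_ge0.
  apply: (measurableT_comp (measurable_powR _)); exact: measurable_sqr_normc.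
split.
  by under eq_fun do rewrite ReV; exact: measurable_funM.
under eq_fun do rewrite ImV; apply: measurable_funM => //.
exact: measurable_funN.
Qed.

Lemma cmeasurable_base y : cmeasurable (fun t => base t y).
Proof. by split; [exact: measurable_id|exact: measurable_cst]. Qed.

Lemma cmeasurable_hmean z f g : cmeasurable z -> cmeasurable f ->
  cmeasurable g -> cmeasurable (fun t => hmean (z t) (f t) (g t)).
Proof.
move=> mz mf mg.
have ma : cmeasurable (fun t => amean (f t) (g t)).
  by apply: cmeasurableM; [exact: cmeasurableD|exact: cmeasurable_cst].
apply: cmeasurableM.
  by apply: cmeasurableB; exact: cmeasurableM.
by apply: cmeasurableV; exact: cmeasurableB.
Qed.

Definition ccvg (u : nat -> C) (l : C) : Prop :=
  (Re (u n) @[n --> \oo] --> Re l) /\ (Im (u n) @[n --> \oo] --> Im l).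

Lemma ccvg_cst c : ccvg (fun=> c) c.
Proof. by split; exact: cvg_cst. Qed.

Lemma ccvgD u v l k : ccvg u l -> ccvg v k -> ccvg (fun n => u n + v n) (l + k).
Proof.
move=> [u1 u2] [v1 v2]; split.
  by rewrite ReD; under eq_fun do rewrite ReD; exact: cvgD.
by rewrite ImD; under eq_fun do rewrite ImD; exact: cvgD.
Qed.

Lemma ccvgM u v l k : ccvg u l -> ccvg v k -> ccvg (fun n => u n * v n) (l * k).
Proof.
move=> [u1 u2] [v1 v2]; split.
  by rewrite ReM; under eq_fun do rewrite ReM; apply: cvgB; exact: cvgM.
by rewrite ImM; under eq_fun do rewrite ImM; apply: cvgD; exact: cvgM.
Qed.

Lemma ccvgN u l : ccvg u l -> ccvg (fun n => - u n) (- l).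
Proof.
move=> [u1 u2]; split.
  by rewrite ReN; under eq_fun do rewrite ReN; exact: cvgN.
by rewrite ImN; under eq_fun do rewrite ImN; exact: cvgN.
Qed.

Lemma cvg_sqr_normc u l : ccvg u l ->
  normc (u n) ^+ 2 @[n --> \oo] --> normc l ^+ 2.
Proof.
move=> [u1 u2]; rewrite sqr_normc; under eq_fun do rewrite sqr_normc.
by apply: cvgD; rewrite !expr2; under eq_fun do rewrite expr2; exact: cvgM.
Qed.

Lemma ccvgV u l : l != 0 -> ccvg u l -> ccvg (fun n => (u n)^-1) l^-1.
Proof.
move=> l0 hu; have [u1 u2] := hu.
have hn := cvg_sqr_normc hu.
have hi : (normc (u n) ^+ 2)^-1 @[n --> \oo] --> (normc l ^+ 2)^-1.
  by apply: cvgV => //; rewrite expf_neq0 // normc_eq0.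
split.
  by rewrite ReV; under eq_fun do rewrite ReV; exact: cvgM.
rewrite ImV; under eq_fun do rewrite ImV; apply: cvgM => //; exact: cvgN.
Qed.

Lemma ccvg_hmean z f g lz lf lg : lz - amean lf lg != 0 ->
    ccvg z lz -> ccvg f lf -> ccvg g lg ->
  ccvg (fun n => hmean (z n) (f n) (g n)) (hmean lz lf lg).
Proof.
move=> h hz hf hg.
have ha : ccvg (fun n => amean (f n) (g n)) (amean lf lg).
  by apply: ccvgM; [exact: ccvgD|exact: ccvg_cst].
apply: ccvgM.
  by apply: ccvgD; [exact: ccvgM|apply: ccvgN; exact: ccvgM].
by apply: ccvgV => //; apply: ccvgD => //; exact: ccvgN.
Qed.

Variables (kappa : nat -> R) (kappa_gt0 : forall n, 0 < kappa n).

Lemma cmeasurable_resp y n :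
  cmeasurable (fun t => respS kappa (base t y) n) /\
  cmeasurable (fun t => respA kappa (base t y) n).
Proof.
elim: n => [|n [hS hA]].
  split; first exact: cmeasurable_cst.
  apply: cmeasurableM; first exact: cmeasurable_cst.
  by apply: cmeasurableV; exact: cmeasurable_base.
split.
  under eq_fun do rewrite respSS.
  by apply: cmeasurableM; [exact: cmeasurableD|exact: cmeasurable_cst].
under eq_fun do rewrite respAS.
by apply: cmeasurable_hmean => //; exact: cmeasurable_cst.
Qed.

Lemma cmeasurable_tail y n j :
  cmeasurable (fun t => tail_resp kappa (base t y) n j).
Proof.
elim: j n => [|j IH] n; first exact: cmeasurable_cst.
have [hS hA] := cmeasurable_resp y n.
apply: cmeasurable_hmean => //; apply: cmeasurableN.
by apply: cmeasurableB => //; exact: cmeasurable_cst.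
Qed.

Lemma cmeasurable_chain y n j :
  cmeasurable (fun t => chain_resp kappa (base t y) n j).
Proof.
have [hS hA] := cmeasurable_resp y n.
apply: cmeasurable_hmean => //; apply: cmeasurableN.
by apply: cmeasurableB; [exact: cmeasurable_tail|exact: cmeasurable_cst].
Qed.

Lemma Im_resp_real (t : R) n :
  Im (respS kappa t%:C%C n) = 0 /\ Im (respA kappa t%:C%C n) = 0.
Proof.
have hr (z : C) : Im z = 0 -> z = (Re z)%:C%C by case: z => a b /= ->.
elim: n => [|n [/hr hS /hr hA]].
  have e : respA kappa t%:C%C 0 = (- 2 / t)%:C%C.
    by rewrite fmorph_div rmorphN rmorph_nat.
  by rewrite e.
rewrite respSS respAS hS hA; move: (Re (respS _ _ _)) (Re (respA _ _ _)) => s a {hS hA}.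
have e1 : amean s%:C%C a%:C%C = ((s + a) / 2)%:C%C.
  by rewrite /amean fmorph_div rmorphD rmorph_nat.
have e2 : hmean (kappa n)%:C%C s%:C%C a%:C%C =
    ((kappa n * ((s + a) / 2) - s * a) / (kappa n - (s + a) / 2))%:C%C.
  by rewrite /hmean e1 [RHS]fmorph_div !rmorphB !rmorphM.
by rewrite e1 e2.
Qed.

Notation evalC P E := (map_poly (real_complex R) P).[E].

(** The responses are rational with a common real denominator that has no zero in the upper
    half-plane. The irregular real energies are therefore among the zeros of countably many nonzero
    polynomials. *)
Lemma resp_rational n : exists D P Q : {poly R},
  (forall E : C, 0 < Im E -> evalC D E != 0) /\
  forall E : C, evalC D E != 0 -> [/\ E != 0,
    respS kappa E n = evalC P E / evalC D E,
    respA kappa E n = evalC Q E / evalC D E &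
    forall i, (i < n)%N -> (kappa i)%:C%C - respS kappa E i.+1 != 0].
Proof.
elim: n => [|n [D [P [Q [hD h]]]]].
  exists 'X, 0, (- 2)%:P; split=> [E|E]; rewrite map_polyX hornerX.
    exact: Im_gt0_neq0.
  move=> E0; split=> //; first by rewrite rmorph0 horner0 mul0r.
  by rewrite map_polyC hornerC /= rmorphN rmorph_nat.
(* Up to the factor [2 D] this is [kappa n - S n.+1], the denominator introduced by [hmean]. *)
pose W := (2 * kappa n) *: D - P - Q.
exists (D * W), (2^-1 *: ((P + Q) * W)), (kappa n *: ((P + Q) * D) - 2 *: (P * Q)).
have WE (E : C) : evalC W E =
    2 * (kappa n)%:C%C * evalC D E - evalC P E - evalC Q E.
  by rewrite /W !rmorphB /= !hornerE map_polyZ hornerZ rmorphM rmorph_nat.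
have key (E : C) : evalC D E != 0 ->
    evalC W E = 2 * evalC D E * ((kappa n)%:C%C - respS kappa E n.+1).
  move=> /[dup] d0 /h [_ hS hA _]; rewrite WE respSS /amean hS hA.
  by field.
split=> [E hE|E].
  rewrite rmorphM hornerM mulf_neq0 ?hD // key ?hD //.
  have Y0 : 0 < Im E / 2 by rewrite divr_gt0.
  have YE : 2 * (Im E / 2) <= Im E by rewrite mulrC divfK // pnatr_eq0.
  rewrite !mulf_neq0 ?pnatr_eq0 ?hD //.
  exact: (kappa_sub_respS_neq0 kappa_gt0 Y0 YE).
rewrite rmorphM hornerM mulf_eq0 negb_or => /andP[d0 w0].
have [E0 hS hA hk] := h _ d0; have kE := key _ d0.
have k0 : (kappa n)%:C%C - respS kappa E n.+1 != 0.
  by apply: contraNneq w0 => e; rewrite kE e mulr0.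
have SE : respS kappa E n.+1 = (evalC P E + evalC Q E) / 2 / evalC D E.
  by rewrite respSS /amean hS hA; field.
split=> //.
- rewrite map_polyZ hornerZ rmorphM hornerM rmorphD hornerD /= fmorphV rmorph_nat SE.
  by field; rewrite d0 w0.
- rewrite respAS /hmean -respSS.
  rewrite rmorphB /= !map_polyZ hornerD hornerN !hornerZ !rmorphM !hornerM.
  rewrite rmorphD hornerD /= rmorph_nat.
  have -> : (kappa n)%:C%C - respS kappa E n.+1 = evalC W E / (2 * evalC D E).
    by rewrite kE; field; rewrite d0.
  rewrite SE hS hA.
  by field; rewrite d0 w0.
move=> i; rewrite ltnS leq_eqVlt => /predU1P[-> //|]; exact: hk.
Qed.

Definition regular (t : R) : Prop :=
  t != 0 /\ forall n, (kappa n)%:C%C - respS kappa t%:C%C n.+1 != 0.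

Lemma finite_poly_roots (D : {poly R}) : D != 0 ->
  finite_set [set t : R | D.[t] = 0].
Proof.
move=> D0; pose DC := map_poly (real_complex R) D.
have [r hr] := closed_field_poly_normal DC.
have DC0 : lead_coef DC != 0 by rewrite lead_coef_eq0 map_poly_eq0.
apply: (@sub_finite_set _ _ [set` map (@complex.Re R) r]); last first.
  exact: finite_seq.
move=> t /= Dt; apply/mapP; exists (t%:C%C) => //.
have : DC.[t%:C%C] = 0 by rewrite /DC horner_map Dt.
rewrite hr hornerZ => /eqP; rewrite mulf_eq0 (negbTE DC0) /=.
by rewrite -[_ == 0]/(root _ _) root_prod_XsubC.
Qed.

Lemma countable_irregular : countable [set t | ~ regular t].
Proof.
have /choice [D hD] : forall n, exists D : {poly R}, D != 0 /\
    forall t : R, D.[t] != 0 -> t != 0 /\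
      forall i, (i < n)%N -> (kappa i)%:C%C - respS kappa t%:C%C i.+1 != 0.
  move=> n; have [D [P [Q [h1 h2]]]] := resp_rational n; exists D; split.
    apply: contraTneq (h1 (Complex 0 1) _) => [->|/=]; last exact: ltr01.
    by rewrite rmorph0 horner0 eqxx.
  move=> t Dt; have [] := h2 t%:C%C.
    by rewrite horner_map /= -[0]/(0%:C%C) (inj_eq (@complexI R)).
  move=> t0 _ _ hk; split => //; apply: contraNneq t0 => ->; by [].
apply: (@sub_countable _ _ _ (\bigcup_n [set t | (D n).[t] = 0])).
  apply: subset_card_le => t nr; apply: contrapT => h; apply: nr.
  have hn n : (D n).[t] != 0.
    by apply/eqP => e; apply: h; exists n.
  split; first by have [_ /(_ t (hn 0%N)) []] := hD 0%N.
  by move=> n; have [_ /(_ t (hn n.+1)) [_ ]] := hD n.+1; apply.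
apply: bigcup_countable => // n _; apply: finite_set_countable.
by apply: finite_poly_roots; case: (hD n).
Qed.

Lemma ccvg_resp (t : R) n : regular t ->
  ccvg (fun q => respS kappa (base t q.+1%:R^-1) n) (respS kappa t%:C%C n) /\
  ccvg (fun q => respA kappa (base t q.+1%:R^-1) n) (respA kappa t%:C%C n).
Proof.
move=> [t0 ht]; elim: n => [|n [hS hA]].
  split; first exact: ccvg_cst.
  apply: ccvgM; first exact: ccvg_cst.
  apply: ccvgV; first by rewrite -normc_eq0 normc_real normr_eq0.
  split => /=; first exact: cvg_cst.
  exact: (@cvg_harmonic R).
split.
  rewrite respSS; under eq_fun do rewrite respSS.
  by apply: ccvgM; [exact: ccvgD|exact: ccvg_cst].
rewrite respAS; under eq_fun do rewrite respAS.
by apply: ccvg_hmean => //; [rewrite -respSS|exact: ccvg_cst].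
Qed.

Lemma ccvg_dist u l : ccvg u l -> normc (u n - l) @[n --> \oo] --> (0 : R).
Proof.
move=> [u1 u2].
have d1 : `|Re (u n) - Re l| + `|Im (u n) - Im l| @[n --> \oo] --> (0 : R).
  rewrite -[X in _ --> X]addr0; apply: cvgD.
    rewrite -[X in _ --> X](normr0 R) -(subrr (Re l)); apply: cvg_norm.
    by apply: cvgB => //; exact: cvg_cst.
  rewrite -[X in _ --> X](normr0 R) -(subrr (Im l)); apply: cvg_norm.
  by apply: cvgB => //; exact: cvg_cst.
apply: (squeeze_cvgr _ (@cvg_cst _ _ _ _ _) d1).
by near=> n; rewrite normc_ge0 /= -ReB -ImB normc_le_ReIm.
Unshelve. all: by end_near.
Qed.

(* Egorov's theorem, along the heights [1 / (q + 1)]. *)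
Lemma resp_boundary (W eps beta : R) n : 0 < W -> 0 < eps -> 0 < beta ->
  exists (Bad : set R) (B : R) (q0 : nat), [/\ measurable Bad,
    (mu Bad <= beta%:E)%E, 0 < B &
    forall t, `|t| <= W -> ~ Bad t -> forall q, (q0 <= q)%N ->
      [/\ normc (respS kappa (base t q.+1%:R^-1) n - respS kappa t%:C%C n) <= eps,
          normc (respA kappa (base t q.+1%:R^-1) n - respA kappa t%:C%C n) <= eps,
          normc (respS kappa t%:C%C n) <= B & normc (respA kappa t%:C%C n) <= B]].
Proof.
move=> W0 eps0 beta0.
pose S q t := respS kappa (base t q) n; pose A q t := respA kappa (base t q) n.
(* The last summand also tends to 0 pointwise; once it is below [eps] at index [q0] off the bad set,
   the boundary values there are bounded by [eps * (q0 + 1)]. *)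
pose f (q : nat) (t : R) : R := normc (S q.+1%:R^-1 t - S 0 t) +
  normc (A q.+1%:R^-1 t - A 0 t) + (normc (S 0 t) + normc (A 0 t)) * q.+1%:R^-1.
pose irr : set R := [set t | ~ regular t].
have mirr : measurable irr by apply: countable_measurable countable_irregular => t; exact: measurable_set1.
pose X : set R := `[- W, W]%classic `\` irr.
have mX : measurable X by apply: measurableD => //; exact: measurable_itv.
have mS q : cmeasurable (S q) by case: (cmeasurable_resp q n).
have mA q : cmeasurable (A q) by case: (cmeasurable_resp q n).
have mf q : measurable_fun [set: R] (f q).
  apply: measurable_funD; first apply: measurable_funD.
  - by apply: measurable_normc; exact: cmeasurableB.
  - by apply: measurable_normc; exact: cmeasurableB.
  apply: measurable_funM; last exact: measurable_cst.
  by apply: measurable_funD; exact: measurable_normc.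
have f_cvg t : X t -> f ^~ t @ \oo --> (0 : R).
  move=> [_ /contrapT rt]; have [cS cA] := ccvg_resp n rt.
  rewrite -[X in _ --> X]addr0; apply: cvgD.
    rewrite -[X in _ --> X]addr0.
    by apply: cvgD; [exact: ccvg_dist cS|exact: ccvg_dist cA].
  rewrite -[X in _ --> X](mulr0 (normc (S 0 t) + normc (A 0 t))).
  by apply: cvgM; [exact: cvg_cst|exact: (@cvg_harmonic R)].
have muX : (mu X < +oo)%E.
  apply: (@le_lt_trans _ _ (mu `[- W, W]%classic)).
    by apply: le_measure; rewrite ?inE //; apply: subDsetl.
  by rewrite lebesgue_measure_itv /=; case: ifP => _; rewrite ltry.
have [Y [mY muY hu]] := @pointwise_almost_uniform _ R _ mu f (fun=> 0) X beta
  (fun q => measurable_funTS (mf q)) mX muX f_cvg beta0.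
have [q0 hq0] : exists q0, forall q, (q0 <= q)%N -> forall t, (X `\` Y) t ->
    f q t < eps.
  have nb : nbhs ((fun=> 0) : {uniform` X `\` Y -> R})
      [set h : {uniform` X `\` Y -> R} | forall t, (X `\` Y) t -> ball 0 eps (h t)].
    apply/uniform_nbhs; exists [set xy : R * R | ball xy.1 eps xy.2]; split.
      exact: (entourage_ball _ (PosNum eps0)).
    by move=> h hh t Xt; exact: hh.
  have [q0 _ hq] := hu _ nb; exists q0 => q q0q t Xt.
  have := hq q q0q t Xt; rewrite /ball /= sub0r normrN => /lt_le_trans h.
  by apply: le_lt_trans (ler_norm _) _; exact: h.
exists (Y `|` irr), (eps * q0.+1%:R), q0; split.
- exact: measurableU.
- apply: le_trans (measureU2 _ _ _) _ => //.
  rewrite [X in (_ + X)%E](countable_lebesgue_measure0 countable_irregular).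
  by rewrite adde0 ltW.
- by rewrite mulr_gt0.
move=> t tW nB q q0q.
have Xt : (X `\` Y) t.
  split; last by move=> Yt; apply: nB; left.
  by split; [rewrite /= in_itv /= -ler_norml|move=> it; apply: nB; right].
have h1 := hq0 q q0q t Xt; have h2 := hq0 q0 (leqnn _) t Xt.
have p (x : C) : 0 <= normc x := normc_ge0 x.
have i0 k : (0 : R) <= k.+1%:R^-1 by rewrite invr_ge0.
have m0 k := mulr_ge0 (addr_ge0 (p (S 0 t)) (p (A 0 t))) (i0 k).
have h3 : (normc (S 0 t) + normc (A 0 t)) * q0.+1%:R^-1 < eps.
  by apply: le_lt_trans h2; rewrite /f lerDr addr_ge0.
rewrite ltr_pdivrMr // in h3.
split.
- apply: ltW; apply: le_lt_trans h1; rewrite /f -addrA lerDl.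
  by rewrite addr_ge0.
- apply: ltW; apply: le_lt_trans h1; rewrite /f -addrA addrCA lerDl.
  by rewrite addr_ge0.
- by apply: ltW; apply: le_lt_trans h3; rewrite lerDl.
- by apply: ltW; apply: le_lt_trans h3; rewrite lerDr.
Qed.

End ComplexMeasurable.

(** * From frequencies at the nodes to Lebesgue measure *)

Section Sampling.
Variable R : realType.
Local Notation C := R[i].
Local Notation normc := ComplexField.Normc.normc.
Local Notation Re := complex.Re.
Local Notation Im := complex.Im.
Notation mu := (@lebesgue_measure R).

Lemma freq_indic m (A : set R) t s :
  freq m (fun u => A (t + s * u)) = rmean m (fun u => \1_A (t + s * u)).
Proof. by apply: eq_rmean => u; rewrite indicE. Qed.

Lemma bounded_mfun_freq m (A : set R) s : measurable A ->
  bounded_mfun 1 (fun t => freq m (fun u => A (t + s * u))).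
Proof.
move=> mA; under eq_fun do rewrite freq_indic.
apply: (@bounded_mfun_rmean _ 1 m (fun u t => \1_A (t + s * u))) => u.
exact: (bounded_mfun_shift (s * u) (bounded_mfun_indic mA)).
Qed.

Let itvI_freq L m (A : set R) s : 0 < L -> measurable A ->
  itvI L (fun t => freq m (fun u => A (t + s * u))) =
  rmean m (fun u => itvI L (fun t => \1_A (t + s * u))).
Proof.
move=> L0 mA; under eq_fun do rewrite freq_indic.
apply: (@itvI_rmean _ _ L0 1 m (fun u t => \1_A (t + s * u))) => u.
exact: (bounded_mfun_shift (s * u) (bounded_mfun_indic mA)).
Qed.

(** For a fixed node the integral over [t] is the measure of a translate of [A], so nothing is lost
    except for nodes that may push [A] out of the window. *)
Lemma sampling_lower L m (A : set R) s a b : 0 < L -> measurable A ->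
    (forall t, A t -> `|t| <= a) -> a + b <= L -> (mu A < +oo)%E ->
  fine (mu A) * (1 - freq m (fun u => b <= `|s * u|)) <=
    itvI L (fun t => freq m (fun u => A (t + s * u))).
Proof.
move=> L0 mA hA abL fA; rewrite itvI_freq //.
have fmu : (fine (mu A))%:E = mu A.
  by rewrite fineK // ge0_fin_numE.
have mu0 : 0 <= fine (mu A) by apply: fine_ge0.
rewrite /freq -{1}(rmean_cst m 1) mulrBr -!rmeanZ.
rewrite lerBlDr -rmeanD; apply: ler_rmean => u; rewrite mulr1.
have i0 : 0 <= itvI L (fun t => \1_A (t + s * u)).
  exact: (itvI_ge0 _ (bounded_mfun_shift (s * u) (bounded_mfun_indic mA))).
case: asboolP => [_|/negP]; first by rewrite mulr1 lerDr.
rewrite -ltNge mulr0 addr0 => h.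
rewrite -lee_fin fmu (itvI_indic_shift L0 mA hA) //.
by move: abL h; lra.
Qed.

Lemma sampling_upper L m (A : set R) s : 0 < L -> measurable A ->
    (mu A < +oo)%E ->
  itvI L (fun t => freq m (fun u => A (t + s * u))) <= fine (mu A).
Proof.
move=> L0 mA fA; rewrite itvI_freq //.
rewrite -(rmean_cst m (fine (mu A))); apply: ler_rmean => u.
have fmu : (fine (mu A))%:E = mu A by rewrite fineK // ge0_fin_numE.
rewrite -lee_fin fmu; exact: itvI_indic_shift_le.
Qed.

Lemma freq_tail_half : exists m0, forall m, (m0 <= m)%N ->
  freq m (fun u : R => 16 <= `|1 * u|) <= 2^-1.
Proof.
have e0 : (0 : R) < 4^-1 by rewrite invr_gt0.
have [m0 hm0] := freq_tail (ltr0n R 16) e0.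
exists m0 => m mm; apply: le_trans (_ : freq m (fun u : R => 16 <= `|u|) <= _).
  by apply: freq_le => u; rewrite mul1r.
apply: le_trans (hm0 m mm) _.
have : 2 / (1 + 16) <= (4^-1 : R) by rewrite ler_pdivrMr; lra.
lra.
Qed.

Definition cut8 (P : R -> Prop) : set R := [set t | `|t| <= 8 /\ P t].

(** The window is [24 = 8 + 16]: nodes beyond 16 have frequency at most 1/2, so half the measure of
    the set is at most [48 * r]. *)
Lemma sampling_bound (f : C -> C) (y : R) (P : C -> Prop) (r : R) :
    0 < y -> 0 < r ->
    measurable (cut8 (fun t => P (f (base t y)))) ->
    (exists m0, forall m, (m0 <= m)%N -> forall t, `|t| <= 24 ->
       freq m (fun u => P (f (sample (y + 1) y t u))) <= r) ->
  (mu (cut8 (fun t => P (f (base t y)))) <= (96 * r)%:E)%E.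
Proof.
set A := cut8 _; move=> y0 r0 mA [m0 hm0].
have [m1 hm1] := freq_tail_half.
pose m := maxn m0 m1.
have hA t : A t -> `|t| <= 8 by case.
have AI : A `<=` `[- 8, 8]%classic.
  by move=> t /hA; rewrite /= in_itv /= -ler_norml.
have fA : (mu A < +oo)%E.
  apply: (@le_lt_trans _ _ (mu `[- 8, 8]%classic)).
    by apply: le_measure; rewrite ?inE //; exact: measurable_itv.
  by rewrite lebesgue_measure_itv /=; case: ifP => _; rewrite ltry.
have mu0 : 0 <= fine (mu A) by apply: fine_ge0.
have L0 : (0 : R) < 24 by [].
have low := @sampling_lower 24 m A 1 8 16 L0 mA hA _ fA.
have up : itvI 24 (fun t => freq m (fun u => A (t + 1 * u))) <= r * (2 * 24).
  rewrite -(itvI_cst L0 (ltW r0)).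
  apply: (itvI_le L0 (bounded_mfun_freq m 1 mA) (bounded_mfun_cst (ltW r0))).
  move=> t ht; apply: le_trans (hm0 m (leq_maxl _ _) t _); last first.
    by rewrite ler_norml.
  apply: freq_le => u [_]; congr (P (f _)).
  by rewrite /sample; congr base; ring.
have h1 := hm1 m (leq_maxr _ _).
have h2 : 8 + 16 <= (24 : R) by lra.
have h3 := le_trans (low h2) up.
have h4 : fine (mu A) * 2^-1 <= fine (mu A) *
    (1 - freq m (fun u : R => 16 <= `|1 * u|)).
  by apply: ler_wpM2l => //; move: h1; lra.
rewrite -(@fineK _ (mu A)) ?ge0_fin_numE // lee_fin.
by move: h3 h4; lra.
Qed.

Section NearMeasure.
Variables (f : C -> C) (y : R).
Hypotheses (y0 : 0 < y).
Let D (t : R) : Prop := `|t| <= 24.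
Hypothesis tf : tame D id (y + 1) y (fun _ E => f E).
Hypothesis hf : horo_valued D y (fun (_ : R) E => f E).
Hypothesis hf1 : forall t, horodisc (2^-1) (f (base t (y + 1))).
Hypothesis mf : cmeasurable (fun t => f (base t y)).
Let yy : y < y + 1. Proof. by rewrite ltrDl. Qed.

Let measurable_ball8 : measurable [set t : R | `|t| <= 8].
Proof.
have -> : [set t : R | `|t| <= 8] = `[- 8, 8]%classic.
  by apply/seteqP; split => t /=; rewrite in_itv /= -ler_norml.
exact: measurable_itv.
Qed.

Lemma measurable_near8 (x eta : R) :
  measurable (cut8 (fun t => normc (f (base t y) - x%:C%C) <= eta)).
Proof.
apply: measurableI => //.
rewrite -[X in measurable X]setTI.
have mg : measurable_fun [set: R] (fun t => normc (f (base t y) - x%:C%C)).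
  by apply: measurable_normc; apply: cmeasurableB => //; exact: cmeasurable_cst.
have := mg measurableT `]-oo, eta]%classic (measurable_itv _).
by congr measurable; apply/seteqP; split => t /=; rewrite in_itv.
Qed.

Lemma measurable_far8 (T : R) :
  measurable (cut8 (fun t => T <= normc (f (base t y) - 0%:C%C))).
Proof.
apply: measurableI => //.
rewrite -[X in measurable X]setTI.
have mg : measurable_fun [set: R] (fun t => normc (f (base t y) - 0%:C%C)).
  by apply: measurable_normc; apply: cmeasurableB => //; exact: cmeasurable_cst.
have := mg measurableT `[T, +oo[%classic (measurable_itv _).
by congr measurable; apply/seteqP; split => t /=; rewrite in_itv /= ?andbT.
Qed.

(** Lower bound for the distance from [v] to the horodisc of parameter 1/2, which contains the chain
    responses at height [y + 1] whatever [y > 0] is. *)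
Definition gap (v : R) : R := Num.min (v / 2) (2^-1 * (v / 2) ^+ 2).

Lemma gap_gt0 v : 0 < v -> 0 < gap v.
Proof. by move=> v0; rewrite lt_min divr_gt0 //= mulr_gt0 // exprn_gt0 // divr_gt0. Qed.

Lemma gap_le v s : 0 < v -> horodisc (2^-1) s -> gap v <= normc (s - v%:C%C).
Proof.
move=> v0 hs; have h0 : (0 : R) < 2^-1 by rewrite invr_gt0.
have v20 : 0 < v / 2 by rewrite divr_gt0.
have := @dist_kappa_horodisc R (fun=> v / 2) (fun=> v20) _ h0 s 0 hs.
by rewrite [2 * (v / 2)]mulrC divfK ?pnatr_eq0.
Qed.

(** Harmonic measure seen from height [y + 1], where the response keeps distance [gap v] from [v].
    The constant is therefore independent of [y] and of the length of the chain; [288 = 96 * 3], two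
    parts from [freq_near] and one for its error. *)
Lemma near_measure (v eta : R) : 0 < v -> 0 < eta ->
  (mu (cut8 (fun t => (normc (f (base t y) - v%:C%C) <= eta)%R)) <=
    (288 / gap v * eta)%:E)%E.
Proof.
move=> v0 eta0; have g0 := gap_gt0 v0.
have e0 : 0 < eta / gap v by rewrite divr_gt0.
have fv t : D t -> f (base t (y + 1)) != v%:C%C.
  by move=> _; rewrite -subr_eq0 -normc_gt0; exact: lt_le_trans (gap_le v0 (hf1 t)).
have [m0 hm0] := freq_near y0 yy eta0 hf tf e0 fv.
have -> : 288 / gap v * eta = 96 * (3 * (eta / gap v)) by ring.
apply: (@sampling_bound f y (fun s => normc (s - v%:C%C) <= eta)) => //.
- by rewrite mulr_gt0.
- exact: measurable_near8.
exists m0 => m mm t ht; apply: le_trans (hm0 m mm t ht) _.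
have : eta / normc (f (base t (y + 1)) - v%:C%C) <= eta / gap v.
  rewrite ler_pM2l // lef_pV2 ?posrE ?gap_le //.
  exact: lt_le_trans (gap_le v0 (hf1 t)).
by move: (eta / gap v) => g; lra.
Qed.

Lemma far_measure (T : R) : 0 < T ->
  (mu (cut8 (fun t => (T <= normc (f (base t y) - 0%:C%C))%R)) <=
    (480 * T^-1)%:E)%E.
Proof.
move=> T0; have e0 : 0 < T^-1 by rewrite invr_gt0.
have x0 t : D t -> `|(fun=> 0) t : R| <= 1 by rewrite normr0.
have [m0 hm0] := freq_far y0 yy T0 x0 hf tf e0.
(* At height [y + 1] the response has norm at most 2, so [freq_far] contributes [4 / T], and its
   error is [1 / T]. *)
have -> : 480 * T^-1 = 96 * (5 * T^-1) by ring.
apply: (@sampling_bound f y (fun s => T <= normc (s - 0%:C%C))) => //.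
- by rewrite mulr_gt0.
- exact: measurable_far8.
exists m0 => m mm t ht; apply: le_trans (hm0 m mm t ht) _.
have h2 : (0 : R) < 2^-1 by rewrite invr_gt0.
have := horodisc_norm h2 (hf1 t); rewrite invrK => h.
rewrite subr0.
have : normc (f (base t (y + 1))) / T <= 2 / T by rewrite ler_pM2r.
by move: (T^-1) => g; lra.
Qed.

End NearMeasure.

(* Otherwise the limit of [q] in the first index would drop by [eps] along
   arbitrarily many heights. *)
Lemma select_height (q : nat -> R -> R) (B eps y0 : R) : 0 < eps -> 0 < y0 ->
    (forall N y, 0 < y -> 0 <= q N y <= B) ->
    (forall y e, 0 < y -> 0 < e -> exists N0, forall N M,
       (N0 <= N)%N -> (N0 <= M)%N -> q N y <= q M y + e) ->
  exists y, [/\ 0 < y, y < y0 & forall y', 0 < y' -> y' < y ->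
    exists N0, forall N, (N0 <= N)%N -> q N y' <= q N y + eps].
Proof.
move=> eps0 y00 hB hC; apply: contrapT => hno.
have step y : 0 < y -> y < y0 -> exists y', [/\ 0 < y', y' < y &
    exists N0, forall N, (N0 <= N)%N -> q N y + eps / 2 <= q N y'].
  move=> yp yy0; apply: contrapT => hs; apply: hno; exists y; split=> // y' y'p y'y.
  apply: contrapT => hN; apply: hs; exists y'; split=> //.
  have e8 : 0 < eps / 4 by rewrite divr_gt0.
  have [N1 h1] := hC y (eps / 4) yp e8; have [N2 h2] := hC y' (eps / 4) y'p e8.
  pose N0 := maxn N1 N2.
  have [M MN0 hM] : exists2 M, (N0 <= M)%N & q M y + eps < q M y'.
    apply: contrapT => h; apply: hN; exists N0 => N NN; rewrite leNgt.
    by apply/negP => hlt; apply: h; exists N.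
  move: MN0; rewrite geq_max => /andP[M1 M2].
  exists N0 => N; rewrite geq_max => /andP[n1 n2].
  have := h1 N M n1 M1; have := h2 M N M2 n2; lra.
have iter k : exists y, [/\ 0 < y, y < y0 &
    exists N0, forall N, (N0 <= N)%N -> k%:R * (eps / 2) <= q N y].
  elim: k => [|k [y [yp yy0 [N0 hN]]]].
    exists (y0 / 2); split; rewrite ?divr_gt0 //.
      by rewrite ltr_pdivrMr // ltr_pMr // ltr1n.
    by exists 0%N => N _; rewrite mul0r; case/andP: (hB N (y0 / 2) (divr_gt0 y00 (ltr0n R 2))).
  have [y' [y'p y'y [N1 hN1]]] := step y yp yy0.
  exists y'; split=> //; first exact: lt_trans yy0.
  exists (maxn N0 N1) => N; rewrite geq_max => /andP[n0 n1].
  by have := hN _ n0; have := hN1 _ n1; rewrite -natr1; lra.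
have [y [yp yy0 [N0 hN]]] := iter (Num.bound (B / (eps / 2))).
have e2 : 0 < eps / 2 by rewrite divr_gt0.
have B0 : 0 <= B / (eps / 2).
  by rewrite divr_ge0 // ?(ltW e2) //; case/andP: (hB 0%N y yp); exact: le_trans.
have := archi_boundP B0; rewrite ltr_pdivrMr // => hb.
have := hN N0 (leqnn _); case/andP: (hB N0 y yp) => _ qB.
by move=> /(lt_le_trans hb) /lt_le_trans /(_ qB); rewrite ltxx.
Qed.

End Sampling.

(** * Chains of blocks along horizontal lines *)

Section Variance.
Variable R : realType.
Local Notation C := R[i].
Local Notation normc := ComplexField.Normc.normc.
Local Notation Re := complex.Re.
Local Notation Im := complex.Im.
Notation mu := (@lebesgue_measure R).
Variables (kappa : nat -> R) (kappa_gt0 : forall n, 0 < kappa n).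

Lemma contracting_le k k' f : k <= k' ->
  @contracting R k f -> contracting k' f.
Proof.
move=> kk' hf r z w r0 hz hw zw; apply: le_trans (hf r z w r0 hz hw zw) _.
by rewrite ler_wpM2r ?normc_ge0 // ler_wpM2r.
Qed.

Lemma eventually_contracting (Y eps : R) : 0 < Y -> 0 < eps ->
  exists n0, forall n, (n0 <= n)%N -> forall E : C, 2 * Y <= Im E ->
    contracting eps (loaded kappa E n).
Proof.
move=> Y0 eps0; pose k := contraction_factor kappa Y.
have k0 : 0 <= k by exact: contraction_factor_ge0.
have beta0 : 0 < Num.min (kappa 0) (Y * kappa 0 ^+ 2).
  by rewrite lt_min kappa_gt0 mulr_gt0 // exprn_gt0.
have k1 : k < 1.
  have x1 : 1 < 1 + (Y * Num.min (kappa 0) (Y * kappa 0 ^+ 2)) ^+ 2.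
    by rewrite ltrDl exprn_gt0 // mulr_gt0.
  rewrite -(@ltr_pXn2r _ 2) ?nnegrE // /k /contraction_factor sqr_sqrtr.
    by rewrite expr1n invf_lt1 // (lt_trans ltr01).
  by rewrite invr_ge0 ltW // (lt_trans ltr01).
have [n0 hn0] := exprn_small k0 k1 eps0.
exists n0.+1 => -[//|n]; rewrite ltnS => nn E hE.
apply: (contracting_le _ (contracting_loaded kappa_gt0 Y0 hE n)).
by apply: hn0; apply: leq_trans nn _; apply: ltnW; exact: ltn_expl.
Qed.

Definition gtest (s : C) : C := (s - Complex 0 (- 1))^-1.

Lemma gtestE s : gtest s = (s + 'i%C)^-1.
Proof.
congr (_^-1); apply: complex_eqP;
  by rewrite ?(ReB, ImB, ReD, ImD) /= ?oppr0 ?opprK.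
Qed.

Lemma gtest_le1 s : 0 <= Im s -> normc (gtest s) <= 1.
Proof.
move=> hs; rewrite gtestE normcV.
have h : 1 <= normc (s + 'i%C).
  by apply: le_trans (ler_Im_normc _); rewrite ImD /= lerDr.
by rewrite invf_le1 // (lt_le_trans ltr01).
Qed.

Definition chain N (E : C) : C := chain_resp kappa E 0 N.

Lemma chain_split (E : C) Y n j : 0 < Y -> 2 * Y <= Im E ->
  chain (n + j) E = chain_resp kappa E n j.
Proof.
move=> Y0 YE; rewrite /chain (chain_resp_shift kappa_gt0 Y0 YE 0) add0n.
by rewrite (chain_resp_shift kappa_gt0 Y0 YE n).
Qed.

Lemma Im_chain_ge0 (t y : R) N : 0 < y -> 0 <= Im (chain N (base t y)).
Proof.
move=> y0; have y2 : 0 < y / 2 by rewrite divr_gt0.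
apply: (@horodisc_Im_ge0 _ (y / 2)); first exact: ltW.
by apply: horodisc_chain => //=; rewrite mulrC divfK // pnatr_eq0.
Qed.

(** Read from level n, the two chains are the same block with different loads. *)
Lemma chain_hclose (E : C) Y eps n N M : 0 < Y -> 2 * Y <= Im E ->
    contracting eps (loaded kappa E n) -> (n <= N)%N -> (n <= M)%N ->
  hclose eps (chain N E) (chain M E).
Proof.
move=> Y0 YE hc nN nM.
rewrite -(subnKC nN) -(subnKC nM) !(chain_split _ _ Y0 YE) -[eps]mulr1.
have hu j : upper (tail_resp kappa E n j - (2 * kappa n)%:C%C).
  apply: (upper_tail_shift kappa_gt0 Y0); exact: horodisc_tail.
by apply: hc => //; apply: hclose1; case: (hu (N - n)%N); case: (hu (M - n)%N).
Qed.

Definition gsq N (y t : R) : R := normc (gtest (chain N (base t y))) ^+ 2.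

Lemma cmeasurable_gtest N y : cmeasurable (fun t => gtest (chain N (base t y))).
Proof.
apply: cmeasurableV; apply: cmeasurableB; last exact: cmeasurable_cst.
exact: cmeasurable_chain.
Qed.

Lemma bounded_gsq N y : 0 < y -> bounded_mfun 1 (gsq N y).
Proof.
move=> y0; split; first exact: measurable_sqr_normc (cmeasurable_gtest N y).
move=> t; rewrite sqr_ge0 /= expr_le1 ?normc_ge0 //.
by apply: gtest_le1; exact: Im_chain_ge0.
Qed.

Definition qsq N (y : R) : R := itvI 8 (gsq N y).

Let L0 : (0 : R) < 8. Proof. by []. Qed.

Lemma qsq_bound N y : 0 < y -> 0 <= qsq N y <= 16.
Proof.
move=> y0; rewrite (itvI_ge0 _ (bounded_gsq N y0)) /=.
by apply: le_trans (itvI_bound L0 (bounded_gsq N y0)) _; lra.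
Qed.

Lemma qsq_cauchy (y e : R) : 0 < y -> 0 < e ->
  exists N0, forall N M, (N0 <= N)%N -> (N0 <= M)%N -> qsq N y <= qsq M y + e.
Proof.
move=> y0 e0; have y2 : 0 < y / 2 by rewrite divr_gt0.
have e64 : 0 < e / 64 by rewrite divr_gt0.
have [n0 hn0] := eventually_contracting y2 e64.
exists n0 => N M nN nM.
have e4 : 0 <= e / 16 by rewrite divr_ge0 // ltW.
have -> : e = itvI 8 (fun=> e / 16) by rewrite itvI_cst //; field.
rewrite /qsq -(itvID L0 (bounded_gsq M y0) (bounded_mfun_cst e4)).
apply: (itvI_le L0 (bounded_gsq N y0)
  (bounded_mfunD (bounded_gsq M y0) (bounded_mfun_cst e4))) => t _.
have YE : 2 * (y / 2) <= Im (base t y) by rewrite /= mulrC divfK // pnatr_eq0.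
have hc := chain_hclose y2 YE (hn0 n0 (leqnn _) _ YE) nN nM.
have i1 := Im_chain_ge0 t N y0; have i2 := Im_chain_ge0 t M y0.
have d : normc (gtest (chain N (base t y)) - gtest (chain M (base t y))) <=
    2 * (e / 64).
  have := @hclose_inv_dist R (e / 64) _ _ (Complex 0 (- 1)) (ltW e64) i1 i2.
  by rewrite /= ltrN10 opprK divr1 => /(_ isT hc).
have a1 := gtest_le1 i1; have a2 := gtest_le1 i2.
have h := le_trans (normc_geB _ _) d.
rewrite /gsq.
move: a1 a2 h (normc_ge0 (gtest (chain N (base t y))))
  (normc_ge0 (gtest (chain M (base t y)))).
move: (normc (gtest (chain N _))) (normc (gtest (chain M _))).
move=> a b a1 b1 h a0 b0.
have e64' := ltW e64.
suff : (a - b) * (a + b) <= 2 * (e / 64) * 2 by move: e0; nra.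
have [ab|ab] := lerP a b; last first.
  by apply: ler_pM; rewrite ?subr_ge0 ?(ltW ab) ?addr_ge0 //; move: a1 b1; lra.
apply: (@le_trans _ _ 0); last by move: e0; lra.
by rewrite mulr_le0_ge0 ?addr_ge0 // subr_le0.
Qed.

Definition variance N m (y y' t : R) : R :=
  rmean m (fun u => normc (gtest (chain N (sample y y' t u)) -
                           gtest (chain N (base t y))) ^+ 2).

Section Bound.
Variables (y y' : R) (N : nat).
Hypotheses (y'0 : 0 < y') (yy' : y' < y).
Let y0 : 0 < y. Proof. exact: lt_trans yy'. Qed.

Let bvar1 u : bounded_mfun 4 (fun t => normc (gtest (chain N (sample y y' t u)) -
                           gtest (chain N (base t y))) ^+ 2).
Proof.
split.
  apply: measurable_sqr_normc; apply: cmeasurableB; last exact: cmeasurable_gtest.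
  have [h1 h2] := cmeasurable_gtest N y'.
  have ms : measurable_fun [set: R] (fun t : R => t + (y - y') * u).
    by apply: measurable_funD; [exact: measurable_id|exact: measurable_cst].
  by split; [exact: (measurableT_comp h1 ms)|exact: (measurableT_comp h2 ms)].
move=> t; rewrite sqr_ge0 /=.
have -> : (4 : R) = 2 ^+ 2 by rewrite -natrX.
rewrite lerXn2r ?nnegrE ?normc_ge0 //.
apply: le_trans (normcB _ _) _.
have := gtest_le1 (Im_chain_ge0 (t + (y - y') * u) N y'0).
by have := gtest_le1 (Im_chain_ge0 t N y0); rewrite /sample; lra.
Qed.

Lemma bounded_variance m : bounded_mfun 4 (variance N m y y').
Proof.
exact: (@bounded_mfun_rmean _ 4 m (fun u t =>
   normc (gtest (chain N (sample y y' t u)) - gtest (chain N (base t y))) ^+ 2)).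
Qed.

(** Mean of the squares minus square of the mean: the mean of [gtest] over the nodes is almost its
    central value, so the integrated variance is at most the growth of [qsq] from height [y] to
    [y']. The other terms pay for shifting the window by at most [b], for the remaining nodes, and
    for the error of the mean value property. *)
Lemma variance_bound m (b e : R) : 0 <= b -> 0 <= e ->
    (forall t, `|t| <= 8 ->
      normc (node_mean m (fun u => gtest (chain N (sample y y' t u))) -
             gtest (chain N (base t y))) <= e) ->
  itvI 8 (variance N m y y') + qsq N y <=
    qsq N y' + 2 * b + 16 * freq m (fun u => b <= `|(y - y') * u|) + 32 * e.
Proof.
move=> b0 e0 he.
pose F u t := gsq N y' (t + (y - y') * u).
have bF u : bounded_mfun 1 (F u).
  exact: bounded_mfun_shift (bounded_gsq N y'0).
have bm : bounded_mfun 1 (fun t => rmean m (fun u => F u t)).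
  exact: bounded_mfun_rmean.
have e20 : 0 <= 2 * e by rewrite mulr_ge0.
rewrite -(itvID L0 (bounded_variance m) (bounded_gsq N y0)).
apply: le_trans (itvI_le L0 (bounded_mfunD (bounded_variance m) (bounded_gsq N y0))
  (bounded_mfunD bm (bounded_mfun_cst e20)) _) _.
  move=> t; rewrite -ler_norml => ht; have := he t ht.
  rewrite /variance /F /gsq.
  pose a u := gtest (chain N (sample y y' t u)).
  rewrite -/(a _) -[gtest (chain N (base _ _))]/(gtest (chain N (base t y))).
  set c := gtest (chain N (base t y)) => hm.
  have c1 : normc c <= 1 by apply: gtest_le1; exact: Im_chain_ge0.
  have ex u : normc (a u - c) ^+ 2 =
      normc (a u) ^+ 2 + ((- 2) * Re (a u * (c^*)%C) + normc c ^+ 2).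
    by rewrite !sqr_normc !(ReB, ImB, ReM, Re_conj, Im_conj); ring.
  rewrite (eq_rmean _ ex) rmeanD rmeanD rmeanZ rmean_cst.
  have -> : rmean m (fun u => Re (a u * (c^*)%C)) = Re (node_mean m a * (c^*)%C).
    rewrite -[RHS]/(Re (_ / _ * _)) mulrAC mulr_suml.
    by rewrite -Re_node_mean.
  have : Re (c * (c^*)%C) - e <= Re (node_mean m a * (c^*)%C).
    rewrite lerBlDr addrC -lerBlDr -ReB -mulrBl.
    apply: le_trans (ler_Re_normc _) _; rewrite normcM normc_conj normc_distC.
    by rewrite -[e]mulr1 ler_pM ?normc_ge0.
  have -> : Re (c * (c^*)%C) = normc c ^+ 2.
    by rewrite sqr_normc ReM Re_conj Im_conj; ring.
  by move: (normc c ^+ 2) (Re _) (rmean _ _) => p q s; lra.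
rewrite (itvID L0 bm (bounded_mfun_cst e20)) (itvI_cst L0 e20).
have -> : 2 * e * (2 * 8) = 32 * e by ring.
rewrite lerD2r (itvI_rmean L0 m bF).
have -> : qsq N y' + 2 * b + 16 * freq m (fun u => b <= `|(y - y') * u|) =
   rmean m (fun u => (qsq N y' + 2 * b) + 16 * (`[< b <= `|(y - y') * u| >])%:R).
  by rewrite rmeanD rmeanZ rmean_cst.
apply: ler_rmean => u.
have [q0 q1] := andP (qsq_bound N y'0).
case: asboolP => [_|/negP]; rewrite [nat_of_bool _]/=.
  apply: le_trans (itvI_bound L0 (bF u)) _.
  by move: q0 b0; lra.
rewrite -ltNge => h.
apply: le_trans (itvI_shift L0 ((y - y') * u) (bounded_gsq N y'0)) _.
by rewrite -/(qsq N y'); move: h; lra.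
Qed.

End Bound.
End Variance.

(** * The averaged reflectionless identity *)

Section Average.
Variable R : realType.
Local Notation C := R[i].
Local Notation normc := ComplexField.Normc.normc.
Local Notation Re := complex.Re.
Local Notation Im := complex.Im.
Notation mu := (@lebesgue_measure R).
Variables (kappa : nat -> R) (kappa_gt0 : forall n, 0 < kappa n).

Lemma gtest_dist (F f : C) (e M : R) : 0 <= Im F -> 0 <= Im f ->
    normc f <= M -> 0 <= M -> 0 <= e -> e * (M + 1) <= 2^-1 ->
    normc (gtest F - gtest f) <= e ->
  normc (F - f) <= 2 * e * (M + 1) ^+ 2.
Proof.
move=> iF jf fM M0 e0 eM; rewrite !gtestE => h.
have F1 : F + 'i%C != 0 by apply: Im_gt0_neq0; rewrite ImD /= ltr_wpDl.
have f1 : f + 'i%C != 0 by apply: Im_gt0_neq0; rewrite ImD /= ltr_wpDl.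
have nf : normc (f + 'i%C) <= M + 1.
  apply: le_trans (normcD _ _) _; rewrite lerD //.
  by rewrite -[leRHS]sqrtr1 /= expr0n expr1n add0r.
have E1 : normc (F - f) =
    normc ((F + 'i%C)^-1 - (f + 'i%C)^-1) * normc (F + 'i%C) * normc (f + 'i%C).
  rewrite normc_distC -!normcM; congr normc.
  move: F1 f1; have -> : F = (F + 'i%C) - 'i%C by rewrite addrK.
  have -> : f = (f + 'i%C) - 'i%C by rewrite addrK.
  by move: (F + 'i%C) (f + 'i%C) 'i%C => p q i; rewrite !subrK => p0 q0; field; rewrite p0 q0.
have := normc_geB ((f + 'i%C)^-1) ((F + 'i%C)^-1).
rewrite normc_distC !normcV => h2; have {h2} := le_trans h2 h.
rewrite E1; move: h; move: (normc (_ - _)) => D hD.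
have := normc_gt0 (F + 'i%C); have := normc_gt0 (f + 'i%C); rewrite F1 f1.
move: (normc (F + 'i%C)) (normc (f + 'i%C)) nf => p q qM q0 p0 hpq.
have pM : p <= 2 * (M + 1).
  rewrite leNgt; apply/negP => hp.
  have M1 : 0 < M + 1 by lra.
  have i1 : p^-1 < (2 * (M + 1))^-1 by rewrite ltf_pV2 // posrE; lra.
  have i2 : (M + 1)^-1 <= q^-1 by rewrite lef_pV2 // posrE.
  have i3 : e <= (M + 1)^-1 * 2^-1 by rewrite mulrC ler_pdivlMr.
  by rewrite invfM in i1; move: i1 i2 i3 hpq; lra.
have -> : 2 * e * (M + 1) ^+ 2 = e * (2 * (M + 1)) * (M + 1) by ring.
have [D0|D0] := lerP 0 D.
  by rewrite !ler_pM ?mulr_ge0 // ltW.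
apply: (@le_trans _ _ 0); last by rewrite !mulr_ge0 //; lra.
by rewrite mulr_le0_ge0 ?mulr_le0_ge0 // ltW.
Qed.

Section Fixed.
Variables (t y y' : R) (n i m : nat).
Hypotheses (y'0 : 0 < y') (yy' : y' < y).
Let E := base t y.
Let Eu u := sample y y' t u.
Let j := i.+1.
Let f := chain kappa (n + j) E.

(** The two sides of the pointwise relation are analytic and antianalytic in the energy, so both
    averages are evaluated at the centre. Each of the two kinds of exceptional nodes has frequency
    at most [theta] and costs 2, whence [4 * theta]. *)
Lemma reflection_average (h M e1 eps B theta e e3 : R) :
    0 < h -> h <= Im f -> normc f <= M ->
    0 <= e1 -> e1 * (M + 1) <= 2^-1 -> 2 * e1 * (M + 1) ^+ 2 <= h / 2 ->
    0 <= eps -> eps <= h / 4 -> 0 <= B -> 0 <= e3 ->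
    freq m (fun u => e1 <=
      normc (gtest (chain kappa (n + j) (Eu u)) - gtest f)) <= theta ->
    freq m (fun u => ~ (near_real eps B (respS kappa (Eu u) n) /\
                        near_real eps B (respA kappa (Eu u) n))) <= theta ->
    normc (node_mean m (fun u =>
        refl_test (kappa n) (loaded kappa (Eu u) n (- (f^*)%C))) -
      refl_test (kappa n) (loaded kappa E n (- (f^*)%C))) <= e ->
    normc (node_mean m (fun u => (tail_resp kappa (Eu u) n j + 'i%C)^-1) -
      (tail_resp kappa E n j + 'i%C)^-1) <= e ->
    contracting e3 (loaded kappa E n) ->
  `|2 * Re f - 2 * kappa n| <=
    (4 * e1 * (M + 1) ^+ 2 / h + 2 * eps * perturb_const h B M + 4 * theta +
     2 * e + 4 * e3) *
    ((2 * kappa n + 1 + M) * (M + 1)).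
Proof.
move=> h0 hf fM e10 e1M dh eps0 epsh B0 e30 H1 H2 H3 H4 H5.
have y0 : 0 < y := lt_trans y'0 yy'.
have M0 : 0 <= M := le_trans (normc_ge0 _) fM.
have Y'0 : 0 < y' / 2 by rewrite divr_gt0.
have Y0 : 0 < y / 2 by rewrite divr_gt0.
have YEu u : 2 * (y' / 2) <= Im (Eu u) by rewrite /= mulrC divfK // pnatr_eq0.
have YE : 2 * (y / 2) <= Im E by rewrite /= mulrC divfK // pnatr_eq0.
have fE : f = chain_resp kappa E n j by exact: (chain_split kappa_gt0 _ _ Y0 YE).
pose X u := refl_test (kappa n) (loaded kappa (Eu u) n (- (f^*)%C)).
pose Z u := (tail_resp kappa (Eu u) n j + 'i%C)^-1.
pose c0 := 4 * e1 * (M + 1) ^+ 2 / h + 2 * eps * perturb_const h B M.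
have c00 : 0 <= c0.
  rewrite addr_ge0 ?mulr_ge0 ?exprn_ge0 ?invr_ge0 ?addr_ge0 // ?(ltW h0) //.
    by rewrite divr_ge0 // ?addr_ge0 ?mulr_ge0 ?(ltW h0) //.
  by rewrite divr_ge0 // ?addr_ge0 ?mulr_ge0 ?addr_ge0 ?exprn_ge0 ?divr_ge0 ?(ltW h0) //.
have mean : normc (node_mean m X - ((node_mean m Z)^*)%C) <= c0 + 4 * theta.
  rewrite conj_node_mean -node_meanB.
  apply: le_trans (normc_node_mean _ _) _.
  pose P1 u := e1 <= normc (gtest (chain kappa (n + j) (Eu u)) - gtest f).
  pose P2 u := ~ (near_real eps B (respS kappa (Eu u) n) /\
                        near_real eps B (respA kappa (Eu u) n)).
  apply: (@le_trans _ _ (rmean m (fun u => c0 + (2 * (`[< P1 u >])%:R + 2 * (`[< P2 u >])%:R)))).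
    apply: ler_rmean => u.
    have Fu : chain kappa (n + j) (Eu u) = chain_resp kappa (Eu u) n j.
      exact: (chain_split kappa_gt0 _ _ Y'0 (YEu u)).
    have triv : normc (X u - (Z u)^*%C) <= 2.
      apply: (reflection_trivial kappa_gt0 n j Y'0 (YEu u)); split.
        by rewrite ImN Im_conj opprK (le_trans (ltW h0)).
      rewrite oppr_eq0; apply: Im_lt0_neq0.
      by rewrite Im_conj oppr_lt0 (lt_le_trans h0).
    case: asboolP => p1; rewrite [nat_of_bool _]/=.
      have : (0 : R) <= (`[< P2 u >])%:R by rewrite ler0n.
      by move: triv c00; lra.
    case: asboolP => p2; rewrite [nat_of_bool _]/=.
      by move: triv c00; lra.
    rewrite !mulr0 !addr0.
    have [hs ha] : near_real eps B (respS kappa (Eu u) n) /\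
                        near_real eps B (respA kappa (Eu u) n) by apply: contrapT.
    have dF : normc (chain_resp kappa (Eu u) n j - f) <= 2 * e1 * (M + 1) ^+ 2.
      rewrite -Fu; apply: gtest_dist => //.
      - exact: Im_chain_ge0.
      - by rewrite (le_trans (ltW h0)).
      - by rewrite ltW // ltNge; apply/negP.
    have := reflection_pointwise kappa_gt0 Y'0 (YEu u) h0 eps0 epsh B0 hf fM dF
      dh hs ha.
    rewrite -/(X u) -/(Z u) => h1; apply: le_trans h1 _.
    by rewrite /c0 lerD2r !mulrA -natrM.
  rewrite rmeanD rmean_cst rmeanD !rmeanZ.
  by move: H1 H2; rewrite -/(freq m P1) -/(freq m P2); lra.
rewrite -/X in H3; rewrite -/Z in H4.
apply: (reflection_solve (kappa_gt0 n)) => //.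
  by rewrite (le_trans (ltW h0)).
apply: le_trans (reflection_centre kappa_gt0 Y0 YE (erefl j) fE h0 e30 hf fM H5) _.
rewrite lerD2r.
set x := refl_test _ _ in H3 *; set z := (tail_resp _ _ _ _ + _)^-1 in H4 *.
apply: le_trans (normc_triangle _ _ (node_mean m X)) _.
rewrite normc_distC.
apply: le_trans (lerD H3 (normc_triangle _ _ (((node_mean m Z)^*)%C))) _.
have H4' : normc ((node_mean m Z)^*%C - (z^*)%C) <= e.
  by rewrite -conjcB normc_conj.
by move: mean H4'; rewrite /c0; lra.
Qed.

End Fixed.
End Average.

(** * Estimates uniform in the base point, for many nodes *)

Section Eventual.
Variable R : realType.
Local Notation C := R[i].
Local Notation normc := ComplexField.Normc.normc.
Local Notation Re := complex.Re.
Local Notation Im := complex.Im.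
Notation mu := (@lebesgue_measure R).
Variables (kappa : nat -> R) (kappa_gt0 : forall n, 0 < kappa n).

Section Heights.
Variables (y y' : R).
Hypotheses (y'0 : 0 < y') (yy' : y' < y).

Lemma gtest_mean N e : 0 < e -> exists m0, forall m, (m0 <= m)%N ->
  forall t, `|t| <= 8 ->
  normc (node_mean m (fun u => gtest (chain kappa N (sample y y' t u))) -
         gtest (chain kappa N (base t y))) <= e.
Proof.
move=> e0; pose D (t : R) := `|t| <= 8.
have ht : tame D id y y' (fun _ E => gtest (chain kappa N E)).
  apply: (@tame_resolvent R R D id y y' y'0 _
    (fun=> Complex 0 (- 1)) 1 1) => //.
  - by move=> tau _; rewrite /= expr0n /= sqrrN expr1n add0r sqrtr1.
  - exact: (horo_chain kappa_gt0 y'0).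
  - exact: (tame_chain kappa_gt0 y'0 yy' (fun t (h : D t) => h)).
exact: (node_mean_tame yy' ht e0).
Qed.

Lemma variance_eventually N e : 0 < e -> exists m0, forall m, (m0 <= m)%N ->
  forall b, 0 <= b ->
  itvI 8 (variance kappa N m y y') + qsq kappa N y <=
    qsq kappa N y' + 2 * b + 16 * freq m (fun u => b <= `|(y - y') * u|) + 32 * e.
Proof.
move=> e0; have [m0 hm0] := gtest_mean N e0; exists m0 => m mm b b0.
exact: (variance_bound kappa_gt0 y'0 yy' b0 (ltW e0) (hm0 m mm)).
Qed.

Lemma reflection_eventually n i h M e : 0 < h -> 0 < e ->
  exists m0, forall m, (m0 <= m)%N -> forall t, `|t| <= 8 ->
    let f := chain kappa (n + i.+1) (base t y) in
    h <= Im f -> normc f <= M ->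
  forall e1 eps B theta e3,
    0 <= e1 -> e1 * (M + 1) <= 2^-1 -> 2 * e1 * (M + 1) ^+ 2 <= h / 2 ->
    0 <= eps -> eps <= h / 4 -> 0 <= B -> 0 <= e3 ->
    freq m (fun u => e1 <=
      normc (gtest (chain kappa (n + i.+1) (sample y y' t u)) - gtest f))
      <= theta ->
    freq m (fun u => ~ (near_real eps B (respS kappa (sample y y' t u) n) /\
                        near_real eps B (respA kappa (sample y y' t u) n)))
      <= theta ->
    contracting e3 (loaded kappa (base t y) n) ->
  `|2 * Re f - 2 * kappa n| <=
    (4 * e1 * (M + 1) ^+ 2 / h + 2 * eps * perturb_const h B M + 4 * theta +
     2 * e + 4 * e3) *
    ((2 * kappa n + 1 + M) * (M + 1)).
Proof.
move=> h0 e0; pose f t := chain kappa (n + i.+1) (base t y).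
pose D t := [/\ `|t| <= 8, h <= Im (f t) & normc (f t) <= M].
have D8 : forall t, D t -> `|id t| <= 8 by move=> t [].
have hc t : D t -> h <= Im (- ((f t)^*)%C) by case=> _ + _; rewrite ImN Im_conj opprK.
have nc t : D t -> normc (- ((f t)^*)%C) <= M by case=> _ _; rewrite normcN normc_conj.
have t1 : tame D id y y' (fun t E => (loaded kappa E n (- ((f t)^*)%C) -
     Complex (2 * kappa n) (- 1))^-1).
  apply: (@tame_resolvent R R D id y y' y'0 _
    (fun=> Complex (2 * kappa n) (- 1)) 1 (normc (Complex (2 * kappa n) (- 1)))) => //.
    exact: (horo_loaded_cst kappa_gt0 y'0 n h0 hc).
  exact: (tame_loaded_cst kappa_gt0 y'0 yy' D8 n h0 hc nc).
have t2 : tame D id y y' (fun t E => (tail_resp kappa E n i.+1 -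
     Complex 0 (- 1))^-1).
  apply: (@tame_resolvent R R D id y y' y'0 _
    (fun=> Complex 0 (- 1)) 1 (normc (Complex 0 (- 1 : R)))) => //.
    exact: (horo_tail kappa_gt0 y'0).
  exact: (tame_tail kappa_gt0 y'0 yy' D8).
have [m1 hm1] := node_mean_tame yy' t1 e0.
have [m2 hm2] := node_mean_tame yy' t2 e0.
exists (maxn m1 m2) => m; rewrite geq_max => /andP[mm1 mm2] t t8 f0 hf fM.
move=> e1 eps B theta e3 e10 e1M dh eps0 epsh B0 e30 H1 H2 H5.
have Dt : D t by [].
apply: (reflection_average kappa_gt0 y'0 yy' h0 hf fM e10 e1M dh eps0 epsh B0
  e30 H1 H2 _ _ H5).
  have := hm1 m mm1 t Dt.
  rewrite -normcN opprB; congr (normc _ <= _).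
  rewrite refl_testE opprK addrC; congr (_ + _).
  rewrite -mulNr -sumrN; congr (_ / _); apply: eq_bigr => u _.
  by rewrite refl_testE.
have := hm2 m mm2 t Dt.
rewrite -gtestE.
suff -> : (fun u => (tail_resp kappa (sample y y' t u) n i.+1 + 'i%C)^-1) =
  (fun u => gtest (tail_resp kappa (sample y y' t u) n i.+1)) by [].
by apply/funext => u; rewrite gtestE.
Qed.

(** Here the target [Re f] moves with [t]; this is why [freq_far] admits a bounded function of [t]
    as target. *)
Lemma concentration_eventually n N M eta e : 0 < eta -> 0 < e ->
  exists m0, forall m, (m0 <= m)%N -> forall t, `|t| <= 8 ->
    let f := chain kappa N (base t y) in normc f <= M ->
  freq m (fun u =>
     eta <= normc (respS kappa (sample y y' t u) n - (Re f)%:C%C) \/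
     eta <= normc (respA kappa (sample y y' t u) n - (Re f)%:C%C)) <=
  2 * (normc (respS kappa (base t y) n - (Re f)%:C%C) / eta) +
  2 * (normc (respA kappa (base t y) n - (Re f)%:C%C) / eta) + 2 * e.
Proof.
move=> eta0 e0; pose f t := chain kappa N (base t y).
pose D t := `|t| <= 8 /\ normc (f t) <= M.
have D8 : forall t, D t -> `|id t| <= 8 by move=> t [].
have xM t : D t -> `|Re (f t)| <= M.
  by case=> _; apply: le_trans; exact: ler_normr_normc_Re.
have [tS tA] := tame_resp kappa_gt0 y'0 yy' D8 n.
have YE (E : C) : y' <= Im E -> 2 * (y' / 2) <= Im E.
  by rewrite mulrC divfK // pnatr_eq0.
have Y'0 : 0 < y' / 2 by rewrite divr_gt0.
have hS : horo_valued D y' (fun _ E => respS kappa E n).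
  by move=> t E _ hE; case: (horodisc_resp kappa_gt0 Y'0 (YE E hE) n).
have hA : horo_valued D y' (fun _ E => respA kappa E n).
  by move=> t E _ hE; case: (horodisc_resp kappa_gt0 Y'0 (YE E hE) n).
have [m1 hm1] := freq_far y'0 yy' eta0 xM hS tS e0.
have [m2 hm2] := freq_far y'0 yy' eta0 xM hA tA e0.
exists (maxn m1 m2) => m; rewrite geq_max => /andP[mm1 mm2] t t8 f0 fM.
apply: le_trans (freq_or _ _ _) _.
have Dt : D t by [].
have := hm1 m mm1 t Dt; have := hm2 m mm2 t Dt.
by move=> i1 i2; apply: le_trans (lerD i2 i1) _; rewrite -/f0 /f0 /f; lra.
Qed.

End Heights.

Lemma near_list (V : seq R) (y eta : R) N : (forall v, v \in V -> 0 < v) ->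
    0 < y -> 0 < eta ->
  exists G : set R, [/\ measurable G,
    (mu G <= ((480 + \sum_(v <- V) 288 / gap v) * eta)%:E)%E &
    forall t, `|t| <= 8 ->
      (exists2 v, v \in V & normc (chain kappa N (base t y) - v%:C%C) <= eta) \/
      eta^-1 <= normc (chain kappa N (base t y)) -> G t].
Proof.
move=> V0 y0 eta0; have yy1 : y < y + 1 by rewrite ltrDl.
pose D (t : R) := `|t| <= 24.
have D24 : forall t, D t -> `|id t| <= 24 by [].
have tf := tame_chain kappa_gt0 y0 yy1 D24 0 N.
have hf : horo_valued D y (fun (_ : R) E => chain_resp kappa E 0 N).
  exact: (horo_chain kappa_gt0 y0).
have hf1 t : horodisc (2^-1) (chain_resp kappa (base t (y + 1)) 0 N).
  by apply: horodisc_chain => //=; rewrite mulfV ?pnatr_eq0 // lerDr ltW.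
have mf := cmeasurable_chain kappa y 0 N.
elim: V V0 => [|v V IH] V0.
  exists (cut8 (fun t => eta^-1 <= normc (chain kappa N (base t y) - 0%:C%C))).
  split; first exact: (@measurable_far8 R (chain kappa N) y mf).
    rewrite big_nil addr0.
    have := @far_measure R (chain kappa N) y y0 tf hf hf1 mf _ (_ : 0 < eta^-1).
    by rewrite invr_gt0 invrK; apply.
  by move=> t t8 [[] //|h]; split; rewrite ?subr0.
have [v' hv'|G [mG muG hG]] := IH; first by apply: V0; rewrite inE hv' orbT.
exists (cut8 (fun t => normc (chain kappa N (base t y) - v%:C%C) <= eta) `|` G).
have mn := @measurable_near8 R (chain kappa N) y mf v eta.
split; first exact: measurableU.
  apply: le_trans (measureU2 _ _ _) _ => //.
  rewrite big_cons addrCA mulrDl EFinD leeD //.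
  by apply: (@near_measure R (chain kappa N) y y0 tf hf hf1 mf) => //; apply: V0; rewrite mem_head.
move=> t t8 [[w]|h]; last by right; apply: hG => //; right.
rewrite inE => /predU1P[-> h|wV h]; first by left.
by right; apply: hG => //; left; exists w.
Qed.

(** [eps] will be chosen small compared with [perturb_const], which involves [B]; so [B] has to be
    found before [eps]. *)
Lemma resp_boundary_unif (W beta : R) n : 0 < W -> 0 < beta ->
  exists2 B : R, 0 < B & forall eps : R, 0 < eps ->
  exists (Bad : set R) (q0 : nat), [/\ measurable Bad,
    (mu Bad <= beta%:E)%E &
    forall t, `|t| <= W -> ~ Bad t -> forall q, (q0 <= q)%N ->
      [/\ normc (respS kappa (base t q.+1%:R^-1) n - respS kappa t%:C%C n) <= eps,
          normc (respA kappa (base t q.+1%:R^-1) n - respA kappa t%:C%C n) <= eps,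
          normc (respS kappa t%:C%C n) <= B & normc (respA kappa t%:C%C n) <= B]].
Proof.
move=> W0 b0; have b2 : 0 < beta / 2 by rewrite divr_gt0.
have [Bad1 [B [q1 [m1 mu1 B0 h1]]]] := resp_boundary kappa_gt0 n W0 ltr01 b2.
exists B => // eps e0.
have [Bad2 [B' [q2 [m2 mu2 B'0 h2]]]] := resp_boundary kappa_gt0 n W0 e0 b2.
exists (Bad1 `|` Bad2), (maxn q1 q2); split; first exact: measurableU.
  apply: le_trans (measureU2 _ _ _) _ => //.
  by rewrite [beta]splitr EFinD leeD.
move=> t tW /not_orP[n1 n2] q; rewrite geq_max => /andP[qq1 qq2].
have [_ _ c1 c2] := h1 t tW n1 q qq1.
by have [d1 d2 _ _] := h2 t tW n2 q qq2.
Qed.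

End Eventual.

(** * The exceptional energies form a null set *)

Section Null.
Variable R : realType.
Local Notation C := R[i].
Local Notation normc := ComplexField.Normc.normc.
Local Notation Re := complex.Re.
Local Notation Im := complex.Im.
Notation mu := (@lebesgue_measure R).
Variables (kappa : nat -> R) (kappa_gt0 : forall n, 0 < kappa n).

Lemma freq_le1 m (P : R -> Prop) : freq m P <= 1.
Proof.
rewrite -(rmean_cst m (1 : R)); apply: ler_rmean => u.
by case: asboolP; rewrite [nat_of_bool _]/= ?ler01.
Qed.

Lemma near_real_boundary (eps B y' s : R) n : eps <= 1 ->
    normc (respS kappa (base s y') n - respS kappa s%:C%C n) <= eps ->
    normc (respA kappa (base s y') n - respA kappa s%:C%C n) <= eps ->
    normc (respS kappa s%:C%C n) <= B -> normc (respA kappa s%:C%C n) <= B ->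
  near_real eps (B + 1) (respS kappa (base s y') n) /\
  near_real eps (B + 1) (respA kappa (base s y') n).
Proof.
move=> e1 d1 d2 b1 b2; have [i1 i2] := Im_resp_real kappa s n.
have h (z w : C) : Im w = 0 -> normc (z - w) <= eps -> normc w <= B ->
    near_real eps (B + 1) z.
  move=> iw d b; split.
    by have := ler_normr_normc_Im (z - w); rewrite ImB iw subr0 => /le_trans; exact.
  have := normc_geB z w; move: (normc _) (normc w) d b => p q d b.
  by move: d b e1; lra.
by split; [exact: h d1 b1|exact: h d2 b2].
Qed.

(** If both responses are near [x], the resonance disc of centre [amean S A] and radius
    [|S - A| / 2] is close to [x] as a whole. *)
Lemma block_near_real (x eta : R) (S A v : C) :
  normc (S - x%:C%C) <= eta -> normc (A - x%:C%C) <= eta ->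
  normc (amean S A - v) <= normc ((S - A) / 2) ->
  normc (x%:C%C - v) <= 2 * eta.
Proof.
move=> hS hA hv.
have h1 : normc ((S - A) / 2) <= eta.
  rewrite normc_half ler_pdivrMr //.
  apply: le_trans (normc_triangle _ _ x%:C%C) _.
  by rewrite mulr_natr mulr2n lerD // normc_distC.
have h2 : normc (amean S A - x%:C%C) <= eta.
  have -> : amean S A - x%:C%C = ((S - x%:C%C) + (A - x%:C%C)) / 2.
    by rewrite /amean; field.
  rewrite normc_half ler_pdivrMr // mulr_natr mulr2n.
  by apply: le_trans (normcD _ _) _; rewrite lerD.
apply: le_trans (normc_triangle _ _ (amean S A)) _.
rewrite mulr_natl mulr2n lerD //; first by rewrite normc_distC.
exact: le_trans hv h1.
Qed.

(** Three errors of size [h]: from [S] or [A] to their mean, from the mean to [f], both small by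
    contraction, and from [f] to its real part. *)
Lemma respS_near_chain (t y h k : R) n i : 0 < y ->
    0 <= k -> k <= 2^-1 -> 0 <= h ->
    16 * k / (y / 2) ^+ 2 <= h ^+ 2 -> 16 * k / (y / 2) <= h ->
    contracting k (loaded kappa (base t y) n) ->
    let f := chain kappa (n + i) (base t y) in 0 <= Im f -> Im f <= h ->
  normc (respS kappa (base t y) n - (Re f)%:C%C) <= 3 * h /\
  normc (respA kappa (base t y) n - (Re f)%:C%C) <= 3 * h.
Proof.
move=> y0 k0 k2 h0 hk1 hk2 hc f f0 fh.
have Y0 : 0 < y / 2 by rewrite divr_gt0.
have YE : 2 * (y / 2) <= Im (base t y) by rewrite /= mulrC divfK // pnatr_eq0.
set E := base t y in YE hc f f0 fh *.
have fE : f = loaded kappa E n (tail_resp kappa E n i - (2 * kappa n)%:C%C).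
  exact: (chain_split kappa_gt0 _ _ Y0 YE).
have iz : 0 <= Im (tail_resp kappa E n i - (2 * kappa n)%:C%C).
  by case: (upper_tail_shift kappa_gt0 Y0 n (horodisc_tail kappa_gt0 Y0 YE n i)).
have [c1 c2] := contracting_resp_close kappa_gt0 Y0 YE k0 k2 hc iz.
rewrite -fE in c2.
have b1 : normc ((respS kappa E n - respA kappa E n) / 2) <= h.
  by rewrite -(@ler_pXn2r _ 2) ?nnegrE ?normc_ge0 // (le_trans c1).
have b2 := le_trans c2 hk2.
have b3 : normc (f - (Re f)%:C%C) <= h.
  have -> : f - (Re f)%:C%C = Complex 0 (Im f).
    by apply: complex_eqP; rewrite ?(ReB, ImB) /= ?subrr ?subr0.
  by rewrite /= expr0n add0r sqrtr_sqr ger0_norm.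
have b4 : normc (respS kappa E n.+1 - (Re f)%:C%C) <= 2 * h.
  apply: le_trans (normc_triangle _ _ f) _.
  by rewrite normc_distC mulr_natl mulr2n lerD.
have eS : respS kappa E n - respS kappa E n.+1 =
    (respS kappa E n - respA kappa E n) / 2 by rewrite respSS /amean; field.
have eA : respA kappa E n - respS kappa E n.+1 =
    - ((respS kappa E n - respA kappa E n) / 2) by rewrite respSS /amean; field.
have -> : 3 * h = h + 2 * h by ring.
by split; (apply: le_trans (normc_triangle _ _ (respS kappa E n.+1)) _);
  rewrite lerD // ?eS ?eA ?normcN.
Qed.

End Null.

(** * Measure of the set of resonant energies *)

Section NullMain.
Variable R : realType.
Local Notation C := R[i].
Local Notation normc := ComplexField.Normc.normc.
Local Notation Re := complex.Re.
Local Notation Im := complex.Im.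
Notation mu := (@lebesgue_measure R).
Variables (kappa : nat -> R) (kappa_gt0 : forall n, 0 < kappa n).
Variables (V : seq R) (v1 v2 : R) (K0 : set R).
Hypotheses (kappaV : forall n, kappa n \in V) (V_gt0 : forall v, v \in V -> 0 < v).
Hypotheses (v12 : v1 != v2)
  (inf1 : forall n0, exists2 n, (n0 <= n)%N & kappa n = v1)
  (inf2 : forall n0, exists2 n, (n0 <= n)%N & kappa n = v2).
Hypotheses (mK0 : measurable K0) (K04 : forall t, K0 t -> `|t| <= 4).
Hypothesis K0P : forall t, K0 t -> forall n, (0 < n)%N -> exists2 j, (n <= j)%N &
  normc (respS kappa t%:C%C n.+1 - (kappa j)%:C%C) <=
  normc ((respS kappa t%:C%C n - respA kappa t%:C%C n) / 2).

Let L0 : (0 : R) < 8. Proof. by []. Qed.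

(** If all three terms were below their thresholds, the reflectionless identity at the levels [n1]
    and [n2] would place [Re f] at distance less than [|v1 - v2| / 2] from both [v1] and [v2]. The
    alternative is stated as a sum that is at least 1 so that it can be integrated over [t]. *)
Lemma exceptional_point (t y y' e1 theta eps B b : R)
    (n1 i1 n2 i2 m : nat) (Bad1 Bad2 : set R) :
    let f := chain kappa (n1 + i1.+1) (base t y) in
    let var := variance kappa (n1 + i1.+1) m y y' t in
    (n1 + i1.+1 = n2 + i2.+1)%N -> kappa n1 = v1 -> kappa n2 = v2 ->
    0 < e1 -> 0 < theta ->
    (forall n i, (n = n1 /\ i = i1) \/ (n = n2 /\ i = i2) ->
      freq m (fun u => e1 <=
         normc (gtest (chain kappa (n + i.+1) (sample y y' t u)) - gtest f)) <= theta ->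
      freq m (fun u => ~ (near_real eps B (respS kappa (sample y y' t u) n) /\
                        near_real eps B (respA kappa (sample y y' t u) n)))
        <= theta ->
      `|2 * Re f - 2 * kappa n| < `|v1 - v2|) ->
    (forall u, `|(y - y') * u| < b -> ~ Bad1 (t + (y - y') * u) ->
        near_real eps B (respS kappa (sample y y' t u) n1) /\
        near_real eps B (respA kappa (sample y y' t u) n1)) ->
    (forall u, `|(y - y') * u| < b -> ~ Bad2 (t + (y - y') * u) ->
        near_real eps B (respS kappa (sample y y' t u) n2) /\
        near_real eps B (respA kappa (sample y y' t u) n2)) ->
    freq m (fun u => b <= `|(y - y') * u|) <= theta / 2 ->
  1 <= (e1 ^+ 2 * theta)^-1 * var +
     ((theta / 2)^-1 * freq m (fun u => Bad1 (t + (y - y') * u)) +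
      (theta / 2)^-1 * freq m (fun u => Bad2 (t + (y - y') * u))).
Proof.
move=> f var N12 k1 k2 e10 th0 hrefl near1 near2 tail.
have e1t : 0 < e1 ^+ 2 * theta by rewrite mulr_gt0 ?exprn_gt0.
have th2 : 0 < theta / 2 by rewrite divr_gt0.
have var0 : 0 <= var.
  rewrite -(rmean_cst m (0 : R)); apply: ler_rmean => u; exact: sqr_ge0.
have p1 : 0 <= (e1 ^+ 2 * theta)^-1 * var.
  by rewrite mulr_ge0 // invr_ge0 ltW.
have pB (A : set R) : 0 <= (theta / 2)^-1 * freq m (fun u => A (t + (y - y') * u)).
  by rewrite mulr_ge0 ?freq_ge0 // invr_ge0 ltW.
have nf n (A : set R) : (forall u, `|(y - y') * u| < b -> ~ A (t + (y - y') * u) ->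
        near_real eps B (respS kappa (sample y y' t u) n) /\
        near_real eps B (respA kappa (sample y y' t u) n)) ->
    freq m (fun u => A (t + (y - y') * u)) <= theta / 2 ->
    freq m (fun u => ~ (near_real eps B (respS kappa (sample y y' t u) n) /\
                        near_real eps B (respA kappa (sample y y' t u) n))) <= theta.
  move=> hn hA; rewrite [theta]splitr.
  apply: le_trans (lerD hA tail); apply: le_trans (freq_or _ _ _).
  apply: freq_le => u hu; have [|hb] := lerP b `|(y - y') * u|; first by right.
  by left; apply: contrapT => hA'; apply: hu; exact: hn.
have [v_small|v_large] := lerP var (e1 ^+ 2 * theta); last first.
  have : 1 <= (e1 ^+ 2 * theta)^-1 * var by rewrite ler_pdivlMl // mulr1 ltW.
  by have := pB Bad1; have := pB Bad2; lra.
have [s1|l1] := lerP (freq m (fun u => Bad1 (t + (y - y') * u))) (theta / 2);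
  last first.
  have : 1 <= (theta / 2)^-1 * freq m (fun u => Bad1 (t + (y - y') * u)).
    by rewrite ler_pdivlMl // mulr1 ltW.
  by have := pB Bad2; lra.
have [s2|l2] := lerP (freq m (fun u => Bad2 (t + (y - y') * u))) (theta / 2);
  last first.
  have : 1 <= (theta / 2)^-1 * freq m (fun u => Bad2 (t + (y - y') * u)).
    by rewrite ler_pdivlMl // mulr1 ltW.
  by have := pB Bad1; lra.
exfalso.
have fr : freq m (fun u => e1 <=
    normc (gtest (chain kappa (n1 + i1.+1) (sample y y' t u)) - gtest f)) <= theta.
  apply: (@le_trans _ _ (var / e1 ^+ 2)); last first.
    by rewrite ler_pdivrMr ?exprn_gt0 // mulrC.
  apply: freq_markov; first by rewrite exprn_gt0.
    by move=> u; exact: sqr_ge0.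
  by move=> u hu; rewrite lerXn2r ?nnegrE ?normc_ge0 // ltW.
have r1 := hrefl n1 i1 (or_introl (conj erefl erefl)) fr (nf n1 Bad1 near1 s1).
rewrite N12 in fr.
have r2 := hrefl n2 i2 (or_intror (conj erefl erefl)) fr (nf n2 Bad2 near2 s2).
rewrite k1 in r1; rewrite k2 in r2.
have : `|2 * (v1 - v2)| <= `|2 * Re f - 2 * v2| + `|2 * Re f - 2 * v1|.
  have -> : 2 * (v1 - v2) = (2 * Re f - 2 * v2) - (2 * Re f - 2 * v1) by ring.
  exact: ler_normB.
by rewrite normrM ger0_norm //; move: r1 r2; lra.
Qed.



Lemma small3 (a b c : R) : 0 < a -> 0 < b -> 0 < c ->
  exists x, [/\ 0 < x, x <= a, x <= b & x <= c].
Proof.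
move=> a0 b0 c0; exists (Num.min a (Num.min b c)).
by split; rewrite ?lt_min ?ge_min ?a0 ?b0 ?c0 ?lexx ?orbT.
Qed.

Lemma small4 (a b c d : R) : 0 < a -> 0 < b -> 0 < c -> 0 < d ->
  exists x, [/\ 0 < x, x <= a, x <= b, x <= c & x <= d].
Proof.
move=> a0 b0 c0 d0; have [x [x0 xa xb xc]] := small3 a0 b0 c0.
exists (Num.min x d).
by split; rewrite ?lt_min ?ge_min ?x0 ?d0 ?xa ?xb ?xc ?lexx ?orbT.
Qed.

(** [eta * CV = ep] gives the exceptional set of [near_list] measure at most [ep]. The divisor 256
    makes the concentration estimate add up to [3/4 ep] before its error, and [h] negligible against
    [eta]. *)
Lemma threshold_constants (ep CV : R) : 0 < ep -> ep <= 1 -> 480 <= CV ->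
  exists eta M h : R, [/\ 0 < eta, eta * CV = ep, M = eta^-1, 0 <= M &
    [/\ 0 < h, h <= eta / 256, h <= 1, h = eta * ep / 256 & h <= M]].
Proof.
move=> ep0 ep1 CV480; have CV0 : 0 < CV by move: CV480; lra.
have eta0 : 0 < ep / CV by rewrite divr_gt0.
have eta1 : ep / CV <= 1.
  by rewrite ler_pdivrMr // mul1r; move: ep1 CV480; lra.
exists (ep / CV), (ep / CV)^-1, (ep / CV * ep / 256).
have M1 : 1 <= (ep / CV)^-1 by rewrite -invr1 lef_pV2 // posrE.
have etaE : ep / CV * CV = ep by rewrite divfK // gt_eqF.
move: M1 eta0 eta1 etaE; move: (ep / CV) => eta M1 eta0 eta1 etaE.
have e2 : eta * ep <= eta by rewrite ler_piMr // ltW.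
have e3 : 0 < eta * ep by rewrite mulr_gt0.
split; [by []|exact: etaE|by []|lra|split; [lra|lra|lra|by []|lra]].
Qed.

Lemma reflection_constants (h M d D : R) : 0 < h -> h <= 1 -> 0 <= M -> 0 < d ->
    0 < D ->
  exists g theta e1 : R, [/\ 0 < g, 16 * g * D <= d, theta = g / 4,
    0 < theta & [/\ 0 < e1, 4 * e1 * (M + 1) ^+ 2 = h * g,
      e1 * (M + 1) <= 2^-1, 2 * e1 * (M + 1) ^+ 2 <= h / 2 & g <= 1]].
Proof.
move=> h0 h1 M0 d0 D0.
have dD : 0 < d / (16 * D) by rewrite divr_gt0 // mulr_gt0.
have [g [g0 g1 gD _]] := small3 ltr01 dD ltr01.
have MM : 0 < M + 1 by rewrite ltr_wpDl.
exists g, (g / 4), (h * g / (4 * (M + 1) ^+ 2)).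
have e10 : 0 < h * g / (4 * (M + 1) ^+ 2).
  by rewrite divr_gt0 ?mulr_gt0 ?exprn_gt0.
have eE : 4 * (h * g / (4 * (M + 1) ^+ 2)) * (M + 1) ^+ 2 = h * g.
  by field; rewrite gt_eqF.
have hg : h * g <= h by rewrite ler_piMr // ltW.
move: e10 eE; move: (h * g / _) => e1 e10 eE.
have gD' : 16 * g * D <= d.
  by move: gD; rewrite ler_pdivlMr ?mulr_gt0 //; lra.
split=> //; first by rewrite divr_gt0.
have k : e1 * (M + 1) * 1 <= e1 * (M + 1) * (M + 1).
  by rewrite ler_pM2l ?mulr_gt0 //; move: M0; lra.
have k2 : e1 * (M + 1) * (M + 1) = h * g / 4 by rewrite -eE expr2; field.
by split=> //; [move: k k2; lra|move: eE; lra].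
Qed.

(** Each of the five error terms is allotted [g], and [5 g] leaves a margin under [16 g]. *)
Lemma reflection_total (h g M x y theta e k D D0 d : R) : 0 < h -> 0 < g ->
    x = h * g -> y <= g -> theta = g / 4 -> e <= g / 2 -> k <= g / 4 ->
    0 < D -> D <= D0 -> 16 * g * D0 <= d ->
  (x / h + y + 4 * theta + 2 * e + 4 * k) * D < d.
Proof.
move=> h0 g0 -> yg -> eg kg D1 D2 gd.
rewrite [h * g]mulrC mulfK ?gt_eqF //.
have c5 : g + y + 4 * (g / 4) + 2 * e + 4 * k <= 5 * g by move: yg eg kg; lra.
apply: le_lt_trans (ler_wpM2r (ltW D1) c5) _.
apply: lt_le_trans gd.
have gD := mulr_gt0 g0 D1.
have gDD : g * D <= g * D0 by rewrite ler_pM2l.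
by rewrite -!mulrA; lra.
Qed.

Lemma concentration_total (eta ep h e a b : R) : 0 < eta -> h = eta * ep / 256 ->
    e <= ep / 8 -> a <= 3 * h -> b <= 3 * h ->
  2 * (a / (eta / 16)) + 2 * (b / (eta / 16)) + 2 * e <= ep.
Proof.
move=> eta0 hE ee ha hb; have eta16 : 0 < eta / 16 by rewrite divr_gt0.
have H c : c <= 3 * h -> c / (eta / 16) <= 3 / 16 * ep.
  by rewrite hE ler_pdivrMr // => hc; apply: le_trans hc _; lra.
by have := H a ha; have := H b hb; lra.
Qed.

Let eighth (x : R) : x / 16 + x / 16 = x / 8.
Proof. by field. Qed.

Let eighth_le (h x : R) : 0 < x -> h <= x / 256 -> h + 2 * (x / 8) <= x.
Proof. by move=> x0 hx; lra. Qed.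

Let double_le (x a : R) : x * 2^-1 <= 37 / 2 * a -> x <= 37 * a.
Proof. by move=> h; lra. Qed.

Let bad_le (a b : R) : 0 < a -> b <= 1 -> a * b / 8 <= 2 * a.
Proof.
move=> a0 b1; have : a * b <= a * 1 by rewrite ler_pM2l.
by move=> h; lra.
Qed.

(** Origin of 39: one [ep] for the set of [near_list], one for the variance, [1/2] for the two bad
    sets and 16 for the integral of the pointwise [ep] over the window give [37/2]. This is doubled
    because nodes of frequency up to 1/2 may leave the window, and 2 is added for the set [Bad1]
    removed from [K0]. *)
Lemma null_quantitative (ep : R) : 0 < ep -> ep <= 1 -> (mu K0 <= (39 * ep)%:E)%E.
Proof.
move=> ep0 ep1.
have [CV CVE] : exists CV, CV = 480 + \sum_(v <- V) 288 / gap v by eexists.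
have CV480 : 480 <= CV.
  rewrite CVE lerDl big_seq; apply: sumr_ge0 => v vV; apply: mulr_ge0.
    exact: ler0n.
  by rewrite invr_ge0 ltW // gap_gt0 // V_gt0.
have CV0 : 0 < CV by move: CV480; lra.
have [eta [M [h [eta0 etaE ME M0 [h0 heta h1 hE hM]]]]] := threshold_constants ep0 ep1 CV480.
have v1V : 0 < v1 by have [n _ <-] := inf1 0; exact: kappa_gt0.
have v2V : 0 < v2 by have [n _ <-] := inf2 0; exact: kappa_gt0.
have [D0 D0E] : exists D0, D0 = (2 * (v1 + v2) + 1 + M) * (M + 1) by eexists.
have D00 : 0 < D0 by rewrite D0E mulr_gt0 //; move: v1V v2V M0; lra.
have dv : 0 < `|v1 - v2| by rewrite normr_gt0 subr_eq0.
have [g [theta [e1 [g0 gD thE th0 [e10 e1M2 e1M dh g1]]]]] :=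
  reflection_constants h0 h1 M0 dv D00.
have [ev evE] : exists ev, ev = e1 ^+ 2 * theta by eexists.
have ev0 : 0 < ev by rewrite evE mulr_gt0 ?exprn_gt0.
(* A quarter each for the choice of the height, the shift [b], the far nodes and the error of the
   mean value property. *)
have [esel eselE] : exists esel, esel = ev * ep / 4 by eexists.
have es0 : 0 < esel by rewrite eselE divr_gt0 // mulr_gt0.
have pdiv (x : R) n : 0 < x -> 0 < x / n.+1%:R by move=> x0; rewrite divr_gt0.
have [e [e0 ee1 ee2 ee3]] := small3 (pdiv _ 7 ep0) (pdiv _ 1 g0) (pdiv _ 31 es0).
have [b [b0 bb1 bb2 _]] := small3 ltr01 (pdiv _ 1 es0) ltr01.
have [tau [ta0 ta1 ta2 ta3]] :=
  small3 (pdiv _ 1 ltr01) (pdiv _ 1 th0) (pdiv _ 15 es0).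
have [U UE] : exists U, U = 4 / tau by eexists.
have U0 : 0 < U by rewrite UE divr_gt0.
have [mt hmt] := freq_tail U0 (divr_gt0 ta0 (ltr0n _ 2)).
have tailU m : (mt <= m)%N -> freq m (fun u => U <= `|u|) <= tau.
  move=> mm; apply: le_trans (hmt m mm) _.
  have : 2 / (1 + U) <= 2 / U by rewrite ler_pM2l // lef_pV2 ?posrE ?addr_gt0 // lerDr.
  have -> : 2 / U = tau / 2 by rewrite UE; field; rewrite gt_eqF.
  by move=> c; apply: le_trans (lerD c (lexx _)) _; rewrite -splitr.
(* Heights below [y0] keep the displacement [(y - y') * u] below [b] unless [|u| >= U]. *)
have [y0 y0E] : exists y0, y0 = b / U by eexists.
have y00 : 0 < y0 by rewrite y0E divr_gt0.
(* The selection holds against every lower height, so [y'] can be taken later, as low as the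
   boundary values of the blocks demand. *)
have [y [yp yy0 hsel]] := @select_height R (qsq kappa) 16 esel y0 es0 y00
  (fun N z z0 => qsq_bound kappa_gt0 N z0)
  (fun z x z0 x0 => qsq_cauchy kappa_gt0 z0 x0).
have [Y YE] : exists Y, Y = y / 2 by eexists.
have Y0 : 0 < Y by rewrite YE divr_gt0.
have hY2 : 0 < h ^+ 2 * Y ^+ 2 by rewrite mulr_gt0 ?exprn_gt0.
have hY : 0 < h * Y by rewrite mulr_gt0.
have [k [k0 kk1 kk2 kk3 kk4]] :=
  small4 (pdiv _ 1 ltr01) (pdiv _ 3 g0) (pdiv _ 15 hY2) (pdiv _ 15 hY).
rewrite div1r in kk1.
have hk1 : 16 * k / Y ^+ 2 <= h ^+ 2.
  by rewrite ler_pdivrMr ?exprn_gt0 // mulrC -ler_pdivlMr.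
have hk2 : 16 * k / Y <= h by rewrite ler_pdivrMr // mulrC -ler_pdivlMr.
have [nc hnc] := eventually_contracting kappa_gt0 Y0 k0.
have contr n t : (nc <= n)%N -> contracting k (loaded kappa (base t y) n).
  move=> nn; apply: hnc => //.
  by rewrite YE /= mulrC divfK // pnatr_eq0.
(* Asking for a level above [nc] makes [n1] positive, as the resonance hypothesis requires. *)
have [n1 n1c kn1] := inf1 nc.+1; have [n2 n2c kn2] := inf2 nc.+1.
have nn1 := ltnW n1c; have nn2 := ltnW n2c.
have [beta beE] : exists beta, beta = ep * theta / 8 by eexists.
have be0 : 0 < beta by rewrite beE divr_gt0 // mulr_gt0.
have W0 : (0 : R) < 9 by [].
have [B1 B10 hB1] := resp_boundary_unif kappa_gt0 n1 W0 be0.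
have [B2 B20 hB2] := resp_boundary_unif kappa_gt0 n2 W0 be0.
have [B BE] : exists B, B = B1 + B2 + 1 by eexists.
have B0 : 0 < B by rewrite BE !addr_gt0.
have [pc pcE] : exists pc, pc = perturb_const h B M by eexists.
have pc0 : 0 < pc.
  have Mh : 0 < M + h by rewrite ltr_wpDl.
  have h4 : 0 < h / 4 by rewrite divr_gt0.
  have x1 : 0 < M + h + 2 * B by rewrite addr_gt0 // mulr_gt0.
  have x2 : 0 < B * (M + h) + B ^+ 2 by rewrite addr_gt0 ?mulr_gt0 ?exprn_gt0.
  by rewrite pcE /perturb_const addr_gt0 // divr_gt0 // exprn_gt0.
have gpc : 0 < g / (2 * pc) by rewrite divr_gt0 // mulr_gt0.
have [eps [eps0 ep_1 ep_h ep_g ep_eta]] :=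
  small4 ltr01 (pdiv _ 3 h0) gpc (pdiv _ 15 eta0).
have ep_pc : 2 * eps * pc <= g.
  by move: ep_g; rewrite ler_pdivlMr ?mulr_gt0 // mulrCA mulrA.
have [Bad1 [q1 [mB1 muB1 hq1]]] := hB1 eps eps0.
have [Bad2 [q2 [mB2 muB2 hq2]]] := hB2 eps eps0.
have [q3 _ hq3] := near_infty_natSinv_lt (PosNum yp).
pose q := maxn q3 (maxn q1 q2).
have [qq1 qq2] : (q1 <= q)%N /\ (q2 <= q)%N.
  by rewrite /q !leq_max !leqnn !orbT.
pose y' : R := q.+1%:R^-1.
have y'0 : 0 < y' by rewrite invr_gt0.
have yy' : y' < y by apply: hq3; rewrite /= /q leq_maxl.
have [N0 hN0] := hsel y' y'0 yy'.
pose N := (N0 + n1 + n2).+1.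
pose i1 := (N0 + n2)%N; pose i2 := (N0 + n1)%N.
have N1E : (n1 + i1.+1)%N = N by rewrite addnS /N /i1 addnCA addnA.
have N2E : (n2 + i2.+1)%N = N by rewrite addnS /N /i2 addnC.
have hNsel : qsq kappa N y' <= qsq kappa N y + esel by apply: hN0; rewrite /N -addnA -addnS leq_addr.
have [G [mG muG hG]] := near_list kappa_gt0 N V_gt0 yp eta0.
have {}muG : (mu G <= ep%:E)%E.
  by apply: le_trans muG _; rewrite lee_fin -CVE mulrC etaE.
have [m1 hm1] := reflection_eventually kappa_gt0 y'0 yy' n1 i1 M h0 e0.
have [m2 hm2] := reflection_eventually kappa_gt0 y'0 yy' n2 i2 M h0 e0.
have eta16 : 0 < eta / 16 by rewrite divr_gt0.
have [m3 hm3] := concentration_eventually kappa_gt0 y'0 yy' n1 N M eta16 e0.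
have [m4 hm4] := variance_eventually kappa_gt0 y'0 yy' N e0.
pose m := maxn mt (maxn (maxn m1 m2) (maxn m3 m4)).
have [mmt mm1 mm2 mm3 mm4] : [/\ (mt <= m)%N, (m1 <= m)%N, (m2 <= m)%N,
    (m3 <= m)%N & (m4 <= m)%N].
  by rewrite /m !leq_max !leqnn !orbT.
have tail : freq m (fun u => b <= `|(y - y') * u|) <= tau.
  apply: le_trans (tailU m mmt); apply: freq_le => u hu.
  have : b <= y0 * `|u|.
    apply: le_trans hu _; rewrite normrM ler_wpM2r //.
    by rewrite ger0_norm ?subr_ge0 ?(ltW yy') //; rewrite (le_trans _ (ltW yy0)) // gerBl ltW.
  by rewrite y0E mulrAC ler_pdivlMr // ler_pM2l.
pose Kp := K0 `\` Bad1.
have mKp : measurable Kp by exact: measurableD.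
have muKp : (mu Kp < +oo)%E.
  apply: (@le_lt_trans _ _ (mu `[- 8, 8]%classic)).
    apply: le_measure; rewrite ?inE //.
    move=> t [/K04 t4 _]; rewrite /= in_itv /= -ler_norml.
    by apply: le_trans t4 _; rewrite ler_nat.
  by rewrite lebesgue_measure_itv /= lte_fin gtrN // -EFinB ltry.
have bound9 t u : `|t| <= 8 -> `|(y - y') * u| < b -> `|t + (y - y') * u| <= 9.
  move=> t8 ub; apply: le_trans (ler_normD _ _) _.
  have -> : (9 : R) = 8 + 1 by rewrite natr1.
  exact: lerD t8 (le_trans (ltW ub) bb1).
pose var := variance kappa N m y y'.
pose fB (A : set R) t := freq m (fun u => A (t + (y - y') * u)).
(* Three cases. On [G] the indicator pays. If [Im f >= h], [exceptional_point] applies. If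
   [Im f < h], both block responses concentrate near [Re f], which is away from all [kappa j], so
   few samples can be resonant. *)
have pointwise t : - 8 <= t <= 8 ->
  fB Kp t <= \1_G t + (ev^-1 * var t + ((theta / 2)^-1 * fB Bad1 t +
     (theta / 2)^-1 * fB Bad2 t) + ep).
  rewrite -ler_norml => t8.
  have var0 : 0 <= var t.
    by rewrite -(rmean_cst m (0 : R)); apply: ler_rmean => u; exact: sqr_ge0.
  have pB (A : set R) : 0 <= (theta / 2)^-1 * fB A t.
    by rewrite mulr_ge0 ?freq_ge0 // invr_ge0 ltW // divr_gt0.
  have pv : 0 <= ev^-1 * var t by rewrite mulr_ge0 // invr_ge0 ltW.
  have f1 := freq_le1 m (fun u => Kp (t + (y - y') * u)).
  have [Gt|nG] := pselect (G t).
    rewrite indicE mem_set // [nat_of_bool _]/=.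
    by apply: le_trans f1 _; rewrite lerDl !addr_ge0 // ltW.
  rewrite indicE memNset // [nat_of_bool _]/= add0r.
  pose f := chain kappa N (base t y).
  have fV v : v \in V -> eta < normc (f - v%:C%C).
    by move=> vV; rewrite ltNge; apply/negP => c; apply: nG; apply: hG => //;
      left; exists v.
  have fM : normc f <= M.
    by rewrite ltW // ltNge; apply/negP => c; apply: nG; apply: hG => //;
      right; rewrite -ME.
  have [hf|hf] := lerP h (Im f).
    apply: le_trans f1 _.
    have refl n i : (n = n1 /\ i = i1) \/ (n = n2 /\ i = i2) ->
      freq m (fun u => e1 <=
         normc (gtest (chain kappa (n + i.+1) (sample y y' t u)) - gtest f)) <= theta ->
      freq m (fun u => ~ (near_real eps B (respS kappa (sample y y' t u) n) /\
                        near_real eps B (respA kappa (sample y y' t u) n)))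
        <= theta ->
      `|2 * Re f - 2 * kappa n| < `|v1 - v2|.
      have MM : 0 < M + 1 by rewrite ltr_wpDl.
      case=> -[-> ->] H1 H2.
        rewrite /f -N1E in hf fM H1 *.
        apply: le_lt_trans (hm1 m mm1 t t8 hf fM e1 eps B theta k (ltW e10) e1M
          dh (ltW eps0) ep_h (ltW B0) (ltW k0) H1 H2 (contr n1 t nn1)) _.
        apply: (@reflection_total h g M _ _ theta e k _ D0) => //.
          by rewrite -pcE.
          by rewrite mulr_gt0 // ltr_wpDr // addr_gt0 // kn1 mulr_gt0.
        by rewrite D0E kn1 ler_pM2r // !lerD2r ler_pM2l // lerDl ltW.
      rewrite /f -N2E in hf fM H1 *.
      apply: le_lt_trans (hm2 m mm2 t t8 hf fM e1 eps B theta k (ltW e10) e1M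
        dh (ltW eps0) ep_h (ltW B0) (ltW k0) H1 H2 (contr n2 t nn2)) _.
      apply: (@reflection_total h g M _ _ theta e k _ D0) => //.
        by rewrite -pcE.
        by rewrite mulr_gt0 // ltr_wpDr // addr_gt0 // kn2 mulr_gt0.
      by rewrite D0E kn2 ler_pM2r // !lerD2r ler_pM2l // lerDr ltW.
    have near1 u : `|(y - y') * u| < b -> ~ Bad1 (t + (y - y') * u) ->
        near_real eps B (respS kappa (sample y y' t u) n1) /\
        near_real eps B (respA kappa (sample y y' t u) n1).
      move=> ub hB; have [d1 d2 c1 c2] := hq1 _ (bound9 t u t8 ub) hB q qq1.
      rewrite BE; apply: near_real_boundary => //.
        by rewrite (le_trans c1) // lerDl ltW.
      by rewrite (le_trans c2) // lerDl ltW.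
    have near2 u : `|(y - y') * u| < b -> ~ Bad2 (t + (y - y') * u) ->
        near_real eps B (respS kappa (sample y y' t u) n2) /\
        near_real eps B (respA kappa (sample y y' t u) n2).
      move=> ub hB; have [d1 d2 c1 c2] := hq2 _ (bound9 t u t8 ub) hB q qq2.
      rewrite BE; apply: near_real_boundary => //.
        by rewrite (le_trans c1) // lerDr ltW.
      by rewrite (le_trans c2) // lerDr ltW.
    have := @exceptional_point t y y' e1 theta eps B b n1 i1 n2 i2 m Bad1 Bad2.
    rewrite N1E -evE -/f -/var => H.
    have {}H := H (esym N2E) kn1 kn2 e10 th0 refl near1 near2 (le_trans tail ta2).
    by apply: le_trans H _; rewrite lerDl ltW.
  have f0 : 0 <= Im f by exact: Im_chain_ge0.
  have conc : fB Kp t <= ep.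
    have := @respS_near_chain R kappa kappa_gt0 t y h k n1 i1.+1 yp (ltW k0).
    rewrite N1E -/f -YE => H.
    have [cS cA] := H kk1 (ltW h0) hk1 hk2 (contr n1 t nn1) f0 (ltW hf).
    apply: le_trans (concentration_total eta0 hE ee1 cS cA).
    apply: le_trans (hm3 m mm3 t t8 fM); apply: freq_le => u [Ku nB].
    have u9 : `|t + (y - y') * u| <= 9.
      by apply: le_trans (K04 Ku) _; rewrite ler_nat.
    have [d1 d2 _ _] := hq1 _ u9 nB q qq1.
    rewrite -/(sample y y' t u) in d1 d2.
    apply: contrapT => /not_orP[/negP]; rewrite -ltNge => l1 /negP.
    rewrite -ltNge => l2.
    have [j _ hj] := K0P Ku (leq_trans (ltn0Sn nc) n1c).
    have l3 : normc (respS kappa (t + (y - y') * u)%:C%C n1 - (Re f)%:C%C) <= eta / 8.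
      apply: le_trans (normc_triangle _ _ (respS kappa (sample y y' t u) n1)) _.
      rewrite normc_distC; apply: le_trans (lerD (le_trans d1 ep_eta) (ltW l1)) _.
      by rewrite eighth.
    have l4 : normc (respA kappa (t + (y - y') * u)%:C%C n1 - (Re f)%:C%C) <= eta / 8.
      apply: le_trans (normc_triangle _ _ (respA kappa (sample y y' t u) n1)) _.
      rewrite normc_distC; apply: le_trans (lerD (le_trans d2 ep_eta) (ltW l2)) _.
      by rewrite eighth.
    rewrite respSS in hj; have l5 := block_near_real l3 l4 hj.
    have := fV _ (kappaV j); apply/negP; rewrite -leNgt.
    apply: le_trans (normc_triangle _ _ (Re f)%:C%C) _.
    have l6 : normc (f - (Re f)%:C%C) <= h.
      have -> : f - (Re f)%:C%C = Complex 0 (Im f).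
        by apply: complex_eqP; rewrite ?(ReB, ImB) /= ?subrr ?subr0.
      by rewrite /= expr0n add0r sqrtr_sqr ger0_norm // ltW.
    apply: le_trans (lerD l6 l5) _.
    exact: eighth_le.
  apply: le_trans conc _; rewrite lerDr !addr_ge0 //.
have fin (A : set R) : (mu A <= beta%:E)%E -> (mu A < +oo)%E.
  by move=> mA; apply: le_lt_trans mA _; rewrite ltry.
have bBad (A : set R) : measurable A -> (mu A <= beta%:E)%E ->
    itvI 8 (fB A) <= ep * theta / 8.
  move=> mA muA; rewrite -beE; apply: le_trans (sampling_upper m _ L0 mA (fin A muA)) _.
  by rewrite -lee_fin fineK // ge0_fin_numE ?measure_ge0 // fin.
have b1 := bBad Bad1 mB1 muB1; have b2 := bBad Bad2 mB2 muB2.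
have iG : itvI 8 \1_G <= ep.
  rewrite -lee_fin itvI_indic //; apply: le_trans muG.
  by apply: le_measure; rewrite ?inE //; exact: measurableI.
have ivar : itvI 8 var <= ev * ep.
  have := hm4 m mm4 b (ltW b0); rewrite -/var => c.
  have c2 : 16 * freq m (fun u => b <= `|(y - y') * u|) <= esel.
    by rewrite mulrC -ler_pdivlMr // (le_trans tail).
  have c3 : 32 * e <= esel by rewrite mulrC -ler_pdivlMr.
  have c4 : 2 * b <= esel by rewrite mulrC -ler_pdivlMr.
  have -> : ev * ep = esel + esel + esel + esel by rewrite eselE; field.
  rewrite -(lerD2r (qsq kappa N y)); apply: le_trans c _.
  have -> : esel + esel + esel + esel + qsq kappa N y =
    qsq kappa N y + esel + esel + esel + esel by ring.
  by rewrite !lerD.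
have th2 : 0 <= (theta / 2)^-1 by rewrite invr_ge0 ltW // divr_gt0.
have evi : 0 <= ev^-1 by rewrite invr_ge0 ltW.
have bfV := bounded_mfunZ evi (bounded_variance kappa_gt0 N y'0 yy' m).
have bf1 := bounded_mfunZ th2 (bounded_mfun_freq m (y - y') mB1).
have bf2 := bounded_mfunZ th2 (bounded_mfun_freq m (y - y') mB2).
have bf12 := bounded_mfunD bf1 bf2.
have bfVB := bounded_mfunD bfV bf12.
have bfe := bounded_mfun_cst (ltW ep0).
have bfA := bounded_mfunD bfVB bfe.
have bfG := bounded_mfun_indic mG.
have up : itvI 8 (fB Kp) <= 37 / 2 * ep.
  apply: le_trans (itvI_le L0 (bounded_mfun_freq m (y - y') mKp)
    (bounded_mfunD bfG bfA) pointwise) _.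
  rewrite (itvID L0 bfG bfA) (itvID L0 bfVB bfe) (itvID L0 bfV bf12).
  rewrite (itvID L0 bf1 bf2).
  rewrite (itvIZ L0 evi (bounded_variance kappa_gt0 N y'0 yy' m)).
  rewrite (itvIZ L0 th2 (bounded_mfun_freq m (y - y') mB1)).
  rewrite (itvIZ L0 th2 (bounded_mfun_freq m (y - y') mB2)) (itvI_cst L0 (ltW ep0)).
  have e4 (x : R) : x <= ep * theta / 8 -> (theta / 2)^-1 * x <= ep / 4.
    move=> hx; rewrite ler_pdivrMl ?divr_gt0 //; apply: le_trans hx _.
    by rewrite le_eqVlt; apply/orP; left; apply/eqP; field.
  have ev4 : ev^-1 * itvI 8 var <= ep by rewrite ler_pdivrMl.
  have -> : 37 / 2 * ep = ep + (ep + (ep / 4 + ep / 4) + ep * (2 * 8)) by field.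
  by apply: lerD => //; apply: lerD => //; apply: lerD => //; apply: lerD; apply: e4.
have low : fine (mu Kp) * (1 - freq m (fun u => b <= `|(y - y') * u|)) <= itvI 8 (fB Kp).
  apply: (@sampling_lower _ 8 m Kp (y - y') 4 b L0 mKp) => //.
    by move=> t [/K04].
  by apply: le_trans (lerD (lexx 4) bb1) _; rewrite natr1 ler_nat.
have muKp0 : 0 <= fine (mu Kp) by rewrite fine_ge0.
have half : fine (mu Kp) * 2^-1 <= 37 / 2 * ep.
  apply: le_trans up; apply: le_trans low; rewrite ler_wpM2l //.
  have : tau <= 2^-1 by apply: le_trans ta1 _; rewrite div1r.
  move=> c; rewrite lerBrDr -lerBrDl; apply: le_trans (le_trans tail c) _.
  by rewrite {2}[1]splitr div1r addrK.
have mK : (mu K0 <= mu Kp + mu Bad1)%E.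
  have := @measureU2 _ _ _ mu Kp Bad1 mKp mB1; apply: le_trans; apply: le_measure; rewrite ?inE //.
    exact: measurableU.
  by move=> t Kt; have [|nb] := pselect (Bad1 t); [right|left].
apply: le_trans mK _.
have -> : (39 * ep)%:E = ((37 * ep)%:E + (2 * ep)%:E)%E.
  by rewrite -EFinD; congr EFin; ring.
apply: leeD.
  rewrite -(@fineK _ (mu Kp)) ?ge0_fin_numE ?measure_ge0 // lee_fin.
  exact: double_le.
apply: le_trans muB1 _; rewrite lee_fin beE.
apply: bad_le => //; rewrite thE ler_pdivrMr // mul1r (le_trans g1) //.
by rewrite ler1n.
Qed.

Theorem null_boundary : mu K0 = 0%E.
Proof.
apply/eqP; rewrite eq_le measure_ge0 andbT.
apply/lee_addgt0Pr => e e0; rewrite add0e.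
have [x [x0 x1 xe _]] := small3 ltr01 (divr_gt0 e0 (ltr0n R 39)) ltr01.
apply: le_trans (null_quantitative x0 x1) _; rewrite lee_fin.
by rewrite mulrC -ler_pdivlMr.
Qed.
End NullMain.

(** * Finite words *)

Section Words.

(* The action on words of an element [b] on which all the [xi k] are nonzero. *)
Fixpoint flip (w : word) : word :=
  match w with
  | [::] => [::]
  | true :: w' => true :: flip w'
  | false :: w' => false :: aut_a w'
  end.

Lemma aut_bE m (xi : nat -> 'rV['Z_2]_m -> 'Z_2) b w :
  aut_b xi b w = if xi (index false w) b == 0 then w else flip w.
Proof.
elim: w xi => [|[] w IH] xi /=; first by case: ifP.
  by rewrite IH; case: ifP.
by case: ifP.
Qed.

Lemma aut_aK : involutive aut_a.
Proof. by case=> //= c w; rewrite negbK. Qed.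

Lemma size_aut_a w : size (aut_a w) = size w.
Proof. by case: w. Qed.

Lemma size_flip w : size (flip w) = size w.
Proof. by elim: w => [|[] w IH] //=; rewrite ?IH ?size_aut_a. Qed.

Lemma flipK : involutive flip.
Proof. by elim=> [|[] w IH] //=; rewrite ?IH ?aut_aK. Qed.

Lemma index_flip w : index false (flip w) = index false w.
Proof. by elim: w => [|[] w IH] //=; rewrite IH. Qed.

Lemma aut_a_cat w v : w != [::] -> aut_a (w ++ v) = aut_a w ++ v.
Proof. by case: w. Qed.

(** The ends of the path on words of length n + 1. When words are prolonged by a tail [v], [endA] is
    joined to the copy with tail [aut_a v] and [endB] to the copy with tail [flip v]; every other
    word has its neighbours in its own copy. *)
Definition endA n : word := rcons (nseq n true) false.
Definition endB n : word := nseq n.+1 true.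

Lemma size_endA n : size (endA n) = n.+1.
Proof. by rewrite size_rcons size_nseq. Qed.

Lemma size_endB n : size (endB n) = n.+1.
Proof. exact: size_nseq. Qed.

Lemma endA_S n : endA n.+1 = rcons (endB n) false.
Proof. by []. Qed.

Lemma endB_S n : endB n.+1 = rcons (endB n) true.
Proof. by rewrite /endB; elim: n => //= n IH; congr cons. Qed.

Lemma endA_neq_endB n : endA n != endB n.
Proof. by elim: n. Qed.

Lemma flip_endA n v : flip (endA n ++ v) = endA n ++ aut_a v.
Proof. by elim: n => //= n ->. Qed.

Lemma flip_endB n v : flip (endB n ++ v) = endB n ++ flip v.
Proof. by elim: n => //= n ->. Qed.

Lemma index_endA n v : index false (endA n ++ v) = n.
Proof. by elim: n => //= n ->. Qed.

Lemma index_endB n v : index false (endB n ++ v) = (n.+1 + index false v)%N.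
Proof. by elim: n => //= n ->. Qed.

Definition inner n (w : word) := (w != endA n) && (w != endB n).

Lemma flip_inner n w v : size w = n.+1 -> inner n w ->
  flip (w ++ v) = flip w ++ v /\ index false (w ++ v) = index false w.
Proof.
rewrite /inner; elim: n w => [[|[] [|? ?]]//|n IH] [//|c w] /= [sw].
case: c => /=; last first.
  by move=> _; split=> //; rewrite aut_a_cat // -size_eq0 sw.
rewrite /endA /endB /= !eqseq_cons /= => hw.
by have [-> ->] := IH w sw hw.
Qed.

Fixpoint words N : seq word :=
  if N is N'.+1 then map (cons true) (words N') ++ map (cons false) (words N')
  else [:: [::]].

Lemma mem_words N w : (w \in words N) = (size w == N).
Proof.
elim: N w => [|N IH] [|c w] //=.
  by rewrite mem_cat; apply/negbTE; rewrite negb_or; apply/andP; split;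
    apply/mapP => -[].
rewrite mem_cat eqSS -IH.
case: c; rewrite ?mem_map; try by move=> x y [].
  by rewrite orbC; case: mapP => // -[? ? []].
by case: mapP => // -[? ? []].
Qed.

Lemma uniq_words N : uniq (words N).
Proof.
elim: N => //= N IH; rewrite cat_uniq !map_inj_uniq ?IH /= ?andbT; try by move=> x y [].
by apply/hasPn => _ /mapP[w _ ->]; apply/mapP => -[].
Qed.

Lemma size_words N : size (words N) = (2 ^ N)%N.
Proof. by elim: N => //= N IH; rewrite size_cat !size_map IH expnS mul2n addnn. Qed.

Lemma perm_words N (f : word -> word) : involutive f ->
  (forall w, size (f w) = size w) -> perm_eq (map f (words N)) (words N).
Proof.
move=> fK fs; apply: uniq_perm; rewrite ?uniq_words //.
  by rewrite map_inj_uniq ?uniq_words //; exact: inv_inj.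
move=> w; rewrite mem_words; apply/mapP/eqP => [[v + ->]|sw].
  by rewrite mem_words fs => /eqP.
by exists (f w); rewrite ?fK // mem_words fs sw.
Qed.

Variable R : realType.
Implicit Types (F phi : word -> R).

Definition wsum N F : R := \sum_(w <- words N) F w.

Lemma eq_wsum N F F' : (forall w, size w = N -> F w = F' w) ->
  wsum N F = wsum N F'.
Proof. by move=> h; apply: eq_big_seq => w; rewrite mem_words => /eqP /h. Qed.

Lemma ler_wsum N F F' : (forall w, size w = N -> F w <= F' w) ->
  wsum N F <= wsum N F'.
Proof.
move=> h; rewrite /wsum big_seq [leRHS]big_seq; apply: ler_sum => w.
by rewrite mem_words => /eqP /h.
Qed.

Lemma wsum_ge0 N F : (forall w, size w = N -> 0 <= F w) -> 0 <= wsum N F.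
Proof.
move=> h; rewrite /wsum big_seq sumr_ge0 // => w.
by rewrite mem_words => /eqP /h.
Qed.

Lemma wsumD N F F' : wsum N (fun w => F w + F' w) = wsum N F + wsum N F'.
Proof. exact: big_split. Qed.

Lemma wsumZ N a F : wsum N (fun w => a * F w) = a * wsum N F.
Proof. by rewrite /wsum mulr_sumr. Qed.

Lemma wsum_cst N (a : R) : wsum N (fun=> a) = a * (2 ^ N)%:R.
Proof. by rewrite /wsum big_const_seq count_predT size_words iter_addr_0 mulr_natr. Qed.

Lemma wsum_invol N (f : word -> word) F : involutive f ->
  (forall w, size (f w) = size w) -> wsum N (fun w => F (f w)) = wsum N F.
Proof.
by move=> fK fs; rewrite /wsum -(big_map f xpredT F) (perm_big _ (perm_words N fK fs)).
Qed.

Lemma wsum_cat n k F :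
  wsum (n + k) F = wsum n (fun w => wsum k (fun v => F (w ++ v))).
Proof.
elim: n F => [|n IH] F; first by rewrite /wsum big_seq1.
by rewrite /wsum /= !big_cat /= !big_map -!/(wsum _ _) !IH.
Qed.

Lemma exchange_wsum n k (F : word -> word -> R) :
  wsum n (fun w => wsum k (F w)) = wsum k (fun v => wsum n (fun w => F w v)).
Proof. exact: exchange_big. Qed.

Lemma wsum_rcons n F :
  wsum n.+1 F = wsum n (fun w => F (rcons w true) + F (rcons w false)).
Proof.
rewrite -addn1 wsum_cat; apply: eq_wsum => w _.
by rewrite /wsum /= !big_cons big_nil addr0 !cats1.
Qed.

Lemma wsum_ge_term N F w : (forall w, size w = N -> 0 <= F w) -> size w = N ->
  F w <= wsum N F.
Proof.
move=> F0 sw; rewrite /wsum (bigD1_seq w) ?uniq_words ?mem_words ?sw //=.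
rewrite lerDl big_seq_cond sumr_ge0 // => v /andP[].
by rewrite mem_words => /eqP /F0.
Qed.

Lemma wsum_eq0 N F : (forall w, size w = N -> 0 <= F w) -> wsum N F <= 0 ->
  forall w, size w = N -> F w = 0.
Proof.
move=> F0 s0 w sw; apply/eqP; rewrite eq_le F0 // andbT.
exact: le_trans (wsum_ge_term F0 sw) s0.
Qed.

Variables (pa : R) (q : nat -> R).

(* The residual [(M - lambda) phi] in the coordinate [E = lambda - sum_b p_b - p_a]. *)
Definition hres (E : R) phi (w : word) : R :=
  pa * (phi (aut_a w) - phi w) + q (index false w) * (phi (flip w) - phi w) -
  E * phi w.

Definition tailed (v : word) phi : word -> R := fun w => phi (w ++ v).

Lemma hres_inner E phi n w v : size w = n.+1 -> inner n w ->
  hres E phi (w ++ v) = hres E (tailed v phi) w.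
Proof.
move=> sw iw; have [e1 e2] := flip_inner v sw iw.
by rewrite /hres e1 e2 aut_a_cat // -size_eq0 sw.
Qed.

Lemma hres_endA E phi n v : hres E phi (endA n ++ v) =
  hres E (tailed v phi) (endA n) +
  q n * (phi (endA n ++ aut_a v) - phi (endA n ++ v)).
Proof.
have := flip_endA n [::]; rewrite !cats0 => e1.
have := index_endA n [::]; rewrite cats0 => e2.
rewrite /hres flip_endA index_endA aut_a_cat -?size_eq0 ?size_endA //.
by rewrite /tailed e1 e2; ring.
Qed.

Lemma hres_endB E phi n v : hres E phi (endB n ++ v) =
  hres E (tailed v phi) (endB n) +
  q (n.+1 + index false v)%N * (phi (endB n ++ flip v) - phi (endB n ++ v)).
Proof.
have := flip_endB n [::]; rewrite !cats0 => e1.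
rewrite /hres flip_endB index_endB aut_a_cat -?size_eq0 ?size_endB //.
by rewrite /tailed e1; ring.
Qed.

End Words.

(** * The Markov operator in the energy coordinate *)

Section Markov.
Variables (R : realType) (m : nat) (xi : nat -> 'rV['Z_2]_m -> 'Z_2).
Variable p : slabel m -> R.

Definition ptot : R := \sum_(b : {b : 'rV['Z_2]_m | b != 0}) p (Some b).

Lemma sum_slabel (V : nmodType) (F : slabel m -> V) :
  \sum_(s : slabel m) F s =
  F None + \sum_(b : {b : 'rV['Z_2]_m | b != 0}) F (Some b).
Proof.
rewrite (bigD1 None) //=; congr (_ + _).
rewrite (reindex_omap Some id) /=; last by case.
by apply: eq_bigl => b; rewrite eqxx.
Qed.

(** On a given word the elements of the kernel of the relevant [xi k] act trivially and contribute
    only to the diagonal; all the others act as [flip], with total weight [qsum]. *)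
Lemma mopE E phi w : E = ptot + p None ->
  \sum_(s : slabel m) p s * phi (sgen xi s w) - E * phi w =
  hres (p None) (fun n => qsum p (xi n)) 0 phi w.
Proof.
move=> ->; rewrite /hres mul0r subr0 sum_slabel /=.
rewrite (bigID (fun b : {b : 'rV['Z_2]_m | b != 0} =>
  xi (index false w) (val b) != 0)) /=.
rewrite [X in _ + (X + _)](eq_bigr (fun b => p (Some b) * phi (flip w))); last first.
  by move=> b /negbTE h; rewrite aut_bE h.
rewrite [X in _ + (_ + X)](eq_bigr (fun b => p (Some b) * phi w)); last first.
  by move=> b /negPn h; rewrite aut_bE h.
rewrite -!mulr_suml /qsum /ptot [X in (X + p None)](bigID (fun b =>
  xi (index false w) (val b) != 0)) /=.
by ring.
Qed.

End Markov.

(** * Block responses on words *)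

Section Dominated.
Variables (R : realType) (T : Type).
Implicit Types (F G f g : T -> R).

(** The relations between currents and potentials hold exactly only where the residual vanishes
    inside the block; [dom] records that an error is controlled by a quadratic quantity, in a form
    stable under linear combinations. *)
Definition dom G f : Prop := exists2 C : R, 0 <= C & forall t, f t ^+ 2 <= C * G t.

Lemma dom_ext G f g : (forall t, f t = g t) -> dom G f -> dom G g.
Proof. by move=> fg [C C0 h]; exists C => // t; rewrite -fg. Qed.

Lemma dom_le G F f c : 0 <= c -> (forall t, F t <= c * G t) -> dom F f -> dom G f.
Proof.
move=> c0 FG [C C0 h]; exists (C * c); first exact: mulr_ge0.
by move=> t; apply: le_trans (h t) _; rewrite -mulrA ler_wpM2l.
Qed.

Lemma domD G f g : dom G f -> dom G g -> dom G (fun t => f t + g t).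
Proof.
move=> [C C0 hf] [D D0 hg]; exists (2 * C + 2 * D).
  by rewrite addr_ge0 ?mulr_ge0.
move=> t; have := hf t; have := hg t; have := sqr_ge0 (f t - g t).
by rewrite sqrrB sqrrD mulrDl -!mulrA; lra.
Qed.

Lemma domZ G f a : dom G f -> dom G (fun t => a * f t).
Proof.
move=> [C C0 hf]; exists (a ^+ 2 * C); first by rewrite mulr_ge0 ?sqr_ge0.
by move=> t; rewrite exprMn -mulrA ler_wpM2l ?sqr_ge0.
Qed.

Lemma domB G f g : dom G f -> dom G g -> dom G (fun t => f t - g t).
Proof.
move=> hf hg; apply: dom_ext (domD hf (domZ (-1) hg)) => t.
by rewrite mulN1r.
Qed.

Lemma dom_sqr G f : (forall t, f t ^+ 2 <= G t) -> dom G f.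
Proof. by move=> h; exists 1 => // t; rewrite mul1r. Qed.

End Dominated.

(** * Responses at real energies *)

Section RealResponse.
Variables (R : realType) (kappa : nat -> R) (E : R).

Fixpoint rresp n : R * R :=
  if n is n'.+1 then
    let: (s, t) := rresp n' in
    ((s + t) / 2, (kappa n' * ((s + t) / 2) - s * t) / (kappa n' - (s + t) / 2))
  else (0, - 2 / E).
Definition rS n := (rresp n).1.
Definition rA n := (rresp n).2.

Lemma rSS n : rS n.+1 = (rS n + rA n) / 2.
Proof. by rewrite /rS /rA /=; case: (rresp n). Qed.

Lemma rAS n : rA n.+1 =
  (kappa n * rS n.+1 - rS n * rA n) / (kappa n - rS n.+1).
Proof. by rewrite /rS /rA /=; case: (rresp n). Qed.

Lemma resp_real n : respS kappa E%:C%C n = (rS n)%:C%C /\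
  respA kappa E%:C%C n = (rA n)%:C%C.
Proof.
have divC (x y : R) : (x / y)%:C%C = x%:C%C / y%:C%C by exact: (fmorph_div (real_complex R)).
have natC : 2 = (2 : R)%:C%C by rewrite rmorph_nat.
elim: n => [|n [IS IA]].
  by split=> //; rewrite /respA /rA /= natC -[- _]rmorphN -divC.
have hS : respS kappa E%:C%C n.+1 = (rS n.+1)%:C%C.
  by rewrite respSS /amean IS IA rSS divC -natC rmorphD.
split=> //; rewrite respAS /hmean -respSS hS IS IA rAS divC.
by rewrite !rmorphB !rmorphM.
Qed.

End RealResponse.

Section Block.
Variables (R : realType) (pa : R) (q : nat -> R) (E : R).
Hypotheses (pa0 : 0 < pa) (q0 : forall n, 0 < q n).

(** Index 0 belongs to the edge of [a] between the two words of length 1. The edge of conductance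
    [q n] joins blocks of words of length n + 1, whence the shift of index. *)
Definition kap n : R := if n is n'.+1 then (2 * q n')^-1 else (2 * pa)^-1.

Lemma kap_gt0 n : 0 < kap n.
Proof. by case: n => [|n]; rewrite /= invr_gt0 mulr_gt0. Qed.

Notation S n := (rS kap E n).
Notation A n := (rA kap E n).
Notation res := (hres pa q E).
Implicit Types (phi : word -> R).

Definition inner_energy n phi : R :=
  wsum n.+1 (fun w => if inner n w then res phi w ^+ 2 else 0).

Lemma inner_energy_ge0 n phi : 0 <= inner_energy n phi.
Proof. by apply: wsum_ge0 => w _; case: ifP; rewrite ?sqr_ge0. Qed.

Definition resA n phi := res phi (endA n).
Definition resB n phi := res phi (endB n).

Definition energy n phi : R := inner_energy n phi + resA n phi ^+ 2 + resB n phi ^+ 2.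

Definition coefa n : R := S n.+2.
Definition coefb n : R := (S n.+1 - A n.+1) / 2.

Definition block_response n : Prop := [/\
  dom (inner_energy n)
    (fun phi => phi (endA n) - coefa n * resA n phi - coefb n * resB n phi),
  dom (inner_energy n)
    (fun phi => phi (endB n) - coefb n * resA n phi - coefa n * resB n phi) &
  forall w, size w = n.+1 -> dom (energy n) (fun phi => phi w)].

Hypothesis E0 : E != 0.

(** The recursion starts one level below, at a single vertex whose two ends coincide: opposite
    currents cancel and equal ones add up, giving the pair 0 and [-2 / E]. The recursion is
    symmetric in the pair, so their order does not matter. *)
Lemma block_response0 : kap 0 - S 1%N != 0 -> block_response 0.
Proof.
move=> k0.
have S1 : S 1%N = - E^-1 by rewrite rSS /rS /rA /=; field.
have Epa : E + 2 * pa != 0.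
  apply: contraNneq k0 => h. rewrite S1 opprK /=.
  have -> : 2 * pa = - E by apply/eqP; rewrite -addr_eq0 addrC h.
  by rewrite invrN addNr.
have A1 : A 1%N = - (E + 2 * pa)^-1.
  rewrite rAS S1 /rS /= mul0r subr0.
  have : (2 * pa)^-1 - - E^-1 = (E + 2 * pa) / (2 * pa * E).
    by field; rewrite E0 gt_eqF.
  by move=> ->; field; rewrite E0 Epa gt_eqF.
have ea phi : phi (endA 0) = coefa 0 * resA 0 phi + coefb 0 * resB 0 phi.
  rewrite /coefa /coefb [S 2%N]rSS S1 A1 /resA /resB /hres /endA /endB /=.
  by move: (phi _) (phi _) => x y; field; rewrite E0 Epa.
have eb phi : phi (endB 0) = coefb 0 * resA 0 phi + coefa 0 * resB 0 phi.
  rewrite /coefa /coefb [S 2%N]rSS S1 A1 /resA /resB /hres /endA /endB /=.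
  by move: (phi _) (phi _) => x y; field; rewrite E0 Epa.
have z phi : 0 <= 0 * inner_energy 0 phi by rewrite mul0r.
have dA : dom (energy 0) (resA 0).
  apply: dom_sqr => phi; rewrite /energy addrAC lerDr addr_ge0 ?sqr_ge0 //.
  exact: inner_energy_ge0.
have dB : dom (energy 0) (resB 0).
  apply: dom_sqr => phi; rewrite /energy lerDr addr_ge0 ?sqr_ge0 //.
  exact: inner_energy_ge0.
split.
- exists 0 => // phi; apply: le_trans (z phi).
  by rewrite -addrA -opprD -ea subrr expr0n.
- exists 0 => // phi; apply: le_trans (z phi).
  by rewrite -addrA -opprD -eb subrr expr0n.
move=> [|[] [|? ?]] // _.
  by apply: dom_ext (domD (domZ (coefb 0) dA) (domZ (coefa 0) dB)) => phi; rewrite -eb.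
by apply: dom_ext (domD (domZ (coefa 0) dA) (domZ (coefb 0) dB)) => phi; rewrite -ea.
Qed.

Lemma inner_cat n w c : size w = n.+1 -> w != endB n -> inner n.+1 (w ++ [:: c]).
Proof.
move=> sw wB; rewrite /inner endA_S endB_S cats1.
by rewrite !eqseq_rcons (negbTE wB).
Qed.

Lemma inner_energy_tailed n c phi :
  inner_energy n (tailed [:: c] phi) <= inner_energy n.+1 phi.
Proof.
rewrite /inner_energy [leRHS]wsum_rcons; apply: ler_wsum => w sw.
case: ifP => iw; last by apply: addr_ge0; case: ifP; rewrite ?sqr_ge0.
rewrite -!cats1 !inner_cat //; try by case/andP: iw.
by case: c; rewrite -(hres_inner _ _ _ _ _ sw iw) ?lerDl ?lerDr sqr_ge0.
Qed.

Lemma dom_tailed n c f : dom (inner_energy n) f ->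
  dom (inner_energy n.+1) (fun phi => f (tailed [:: c] phi)).
Proof.
case=> C C0 hf; exists C => // phi; apply: le_trans (hf _) _.
by rewrite ler_wpM2l // inner_energy_tailed.
Qed.

Lemma dom_endA n c :
  dom (inner_energy n.+1) (fun phi => res phi (endA n ++ [:: c])).
Proof.
apply: dom_sqr => phi; rewrite /inner_energy.
have iw : inner n.+1 (endA n ++ [:: c]).
  by apply: inner_cat; rewrite ?size_endA ?endA_neq_endB.
have := @wsum_ge_term R n.+2 (fun w => if inner n.+1 w then res phi w ^+ 2 else 0)
  (endA n ++ [:: c]).
rewrite iw; apply; first by move=> w _; case: ifP; rewrite ?sqr_ge0.
by rewrite size_cat size_endA addn1.
Qed.

Lemma resA_S n phi : resA n.+1 phi = resB n (tailed [:: false] phi).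
Proof. by rewrite /resA endA_S -cats1 hres_endB subrr mulr0 addr0. Qed.

Lemma resB_S n phi : resB n.+1 phi = resB n (tailed [:: true] phi).
Proof. by rewrite /resB endB_S -cats1 hres_endB subrr mulr0 addr0. Qed.

Lemma block_responseS n : kap n.+1 - S n.+2 != 0 ->
  block_response n -> block_response n.+1.
Proof.
move=> k0 [hA hB hw].
pose x c phi := resA n (tailed [:: c] phi).
pose y c phi := resB n (tailed [:: c] phi).
pose u c phi := phi (endA n ++ [:: c]).
pose v c phi := phi (endB n ++ [:: c]).
pose g c phi := res phi (endA n ++ [:: c]).
pose a := coefa n; pose b := coefb n; pose k := kap n.+1.
have gE c phi : g c phi = x c phi + q n * (u (~~ c) phi - u c phi).
  by rewrite /g hres_endA.
pose eta c phi := u c phi - a * x c phi - b * y c phi.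
pose theta c phi := v c phi - b * x c phi - a * y c phi.
have d1 c : dom (inner_energy n.+1) (eta c) := dom_tailed c hA.
have d2 c : dom (inner_energy n.+1) (theta c) := dom_tailed c hB.
have d3 c : dom (inner_energy n.+1) (g c) := dom_endA n c.
have ka : k - a != 0 by [].
have kq : k = (2 * q n)^-1 by [].
have q00 : q n != 0 by rewrite gt_eqF.
have k2a : k * 2 - (S n.+1 + A n.+1) != 0.
  apply: contraNneq ka => h; rewrite /a /coefa rSS.
  have -> : k - (S n.+1 + A n.+1) / 2 = (k * 2 - (S n.+1 + A n.+1)) / 2 by field.
  by rewrite h mul0r.
have aE : coefa n.+1 = a + b ^+ 2 / (2 * (k - a)).
  rewrite /coefa rSS rAS -/k /a /coefa /b /coefb rSS.
  by move: (S n.+1) (A n.+1) k2a => s t h; field.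
have bE : coefb n.+1 = - (b ^+ 2 / (2 * (k - a))).
  rewrite /coefb rAS -/k /a /coefa /b /coefb rSS.
  by move: (S n.+1) (A n.+1) k2a => s t h; field.
(* The two matching equations at the joining edge give the sum of the inner currents at once and
   their difference after division by [k - a]. *)
have xE c phi : x c phi = (g c phi + g (~~ c) phi) / 2 +
    (k * (g c phi - g (~~ c) phi) + (eta c phi - eta (~~ c) phi) +
     b * (y c phi - y (~~ c) phi)) / (2 * (k - a)).
  have := gE c phi; have := gE (~~ c) phi; rewrite negbK.
  rewrite /eta; move: (u c phi) (u (~~ c) phi) (x c phi) (x (~~ c) phi)
    (y c phi) (y (~~ c) phi) (g c phi) (g (~~ c) phi) => u1 u2 x1 x2 y1 y2 g1 g2 -> ->.
  move: ka; rewrite kq => ka; field; rewrite q00 /=.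
  apply: contraNneq ka => h; apply/eqP.
  have -> : (2 * q n)^-1 - a = (1 - 2 * a * q n) / (2 * q n) by field.
  by rewrite (_ : 1 - 2 * a * q n = 0) ?mul0r // -h; ring.
have yA phi : resA n.+1 phi = y false phi by exact: resA_S.
have yB phi : resB n.+1 phi = y true phi by exact: resB_S.
have kd c : dom (inner_energy n.+1) (fun phi =>
    theta c phi + (b / 2 * (g c phi + g (~~ c) phi) +
      b / (2 * (k - a)) * (k * (g c phi - g (~~ c) phi) +
                           (eta c phi - eta (~~ c) phi)))).
  apply: domD => //; apply: domD; apply: domZ; first exact: domD.
  by apply: domD; [apply: domZ|]; exact: domB.
split.
- apply: dom_ext (kd false) => phi; rewrite yA yB aE bE endA_S -cats1.
  rewrite -[phi _]/(v false phi) /theta (xE false) /=.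
  by field.
- apply: dom_ext (kd true) => phi; rewrite yA yB aE bE endB_S -cats1.
  rewrite -[phi _]/(v true phi) /theta (xE true) /=.
  by field.
have eG f : dom (inner_energy n.+1) f -> dom (energy n.+1) f.
  apply: (@dom_le _ _ _ _ _ 1) => // phi.
  by rewrite mul1r /energy -addrA lerDl addr_ge0 ?sqr_ge0.
have ey c : dom (energy n.+1) (y c).
  apply: dom_sqr => phi; rewrite /energy yA yB.
  have := inner_energy_ge0 n.+1 phi; have := sqr_ge0 (y false phi).
  have := sqr_ge0 (y true phi); case: c; lra.
have ex c : dom (energy n.+1) (x c).
  apply: (@dom_ext _ _ _ (fun phi => 2^-1 * (g c phi + g (~~ c) phi) +
    (2 * (k - a))^-1 * (k * (g c phi - g (~~ c) phi) + (eta c phi - eta (~~ c) phi) +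
     b * (y c phi - y (~~ c) phi)))).
    by move=> phi; rewrite xE; congr (_ + _); rewrite mulrC.
  apply: domD; apply: domZ; first by apply: domD; apply: eG.
  apply: domD; last by apply: domZ; exact: domB.
  by apply: domD; [apply: domZ|]; apply: domB; exact: eG.
move=> w; case/lastP: w => [//|w c]; rewrite size_rcons => -[sw].
have [C C0 hC] := hw w sw; have [D D0 hD] := ex c; have [D' D'0 hD'] := ey c.
exists (C * (1 + D + D')); first by rewrite mulr_ge0 // !addr_ge0.
move=> phi; rewrite -cats1; apply: le_trans (hC (tailed [:: c] phi)) _.
rewrite -mulrA ler_wpM2l // {1}/energy !mulrDl mul1r.
apply: lerD; last exact: hD'; apply: lerD; last exact: hD.
apply: le_trans (inner_energy_tailed n c phi) _.
by rewrite /energy -addrA lerDl addr_ge0 ?sqr_ge0.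
Qed.

Lemma block_responseP n : (forall i, (i <= n)%N -> kap i - S i.+1 != 0) ->
  block_response n.
Proof.
elim: n => [|n IH] h; first exact: block_response0 (h 0%N _).
by apply: block_responseS; [exact: h|apply: IH => i ni; apply: h; exact: leqW].
Qed.

End Block.

(** * A lower bound for residuals, uniform in the level, away from resonance *)

Section LowerBound.
Variables (R : realType) (pa : R) (q : nat -> R) (E : R).
Hypotheses (q0 : forall n, 0 < q n).
Notation kap := (kap pa q).
Notation res := (hres pa q E).
Implicit Types (phi : word -> R).

Lemma sqr4 (x y z w : R) :
  (x + y + z + w) ^+ 2 <= 4 * (x ^+ 2 + y ^+ 2 + z ^+ 2 + w ^+ 2).
Proof.
rewrite -subr_ge0.
have -> : 4 * (x ^+ 2 + y ^+ 2 + z ^+ 2 + w ^+ 2) - (x + y + z + w) ^+ 2 =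
  (x - y) ^+ 2 + (x - z) ^+ 2 + (x - w) ^+ 2 + (y - z) ^+ 2 + (y - w) ^+ 2 +
  (z - w) ^+ 2 by ring.
by rewrite !addr_ge0 ?sqr_ge0.
Qed.

(** Quantified diagonal dominance: multiplying by [2 d x] and completing squares leaves a total
    weight [4 d |b|] on the neighbouring currents against [4 d (|b| + d)] on [x]. *)
Lemma coercive_joint (k a b d x y y' z : R) : 0 < d -> `|b| + d <= `|k - a| ->
    2 * (k - a) * x = b * (y - y') + z ->
  4 * d * (`|b| + d) * x ^+ 2 <=
    2 * d * `|b| * (y ^+ 2 + y' ^+ 2) + z ^+ 2.
Proof.
move=> d0 hk e.
have h : 2 * (`|b| + d) * `|x| <= `|b| * (`|y| + `|y'|) + `|z|.
  apply: (@le_trans _ _ (`|2 * (k - a) * x|)).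
    by rewrite !normrM ger0_norm // ler_wpM2r // ler_pM2l.
  rewrite e; apply: le_trans (ler_normD _ _) _; rewrite lerD2r normrM.
  by rewrite ler_wpM2l // ler_normB.
rewrite -(real_normK (num_real x)) -(real_normK (num_real y)).
rewrite -(real_normK (num_real y')) -(real_normK (num_real z)).
move: h (normr_ge0 b) (normr_ge0 x); clear hk e.
move: `|b| `|x| `|y| `|y'| `|z| => {}b {}x {}y {}y' {}z h b0 x0.
have h2 : 2 * d * x * (2 * (b + d) * x) <= 2 * d * x * (b * (y + y') + z).
  by rewrite ler_wpM2l // !mulr_ge0 // ltW.
have h3 : d * b * (2 * x * (y + y')) <= d * b * (2 * x ^+ 2 + y ^+ 2 + y' ^+ 2).
  rewrite ler_wpM2l ?mulr_ge0 // ?(ltW d0) // -subr_ge0.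
  have -> : 2 * x ^+ 2 + y ^+ 2 + y' ^+ 2 - 2 * x * (y + y') =
    (x - y) ^+ 2 + (x - y') ^+ 2 by ring.
  by rewrite addr_ge0 ?sqr_ge0.
have h4 : 0 <= (2 * d * x - z) ^+ 2 by exact: sqr_ge0.
have h5 : 4 * (2 * d * x * z) <= 8 * d ^+ 2 * x ^+ 2 + 2 * z ^+ 2.
  rewrite -subr_ge0.
  have -> : 8 * d ^+ 2 * x ^+ 2 + 2 * z ^+ 2 - 4 * (2 * d * x * z) =
    2 * (2 * d * x - z) ^+ 2 by ring.
  by rewrite mulr_ge0.
have h6 : 2 * d * x * (2 * (b + d) * x) = 4 * d * (b + d) * x ^+ 2 by ring.
have h7 : 2 * d * x * (b * (y + y') + z) = d * b * (2 * x * (y + y')) + 2 * d * x * z by ring.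
have h8 : d * b * (2 * x ^+ 2 + y ^+ 2 + y' ^+ 2) =
  2 * (d * b) * x ^+ 2 + d * b * (y ^+ 2 + y' ^+ 2) by ring.
have h9 : 4 * d * (b + d) * x ^+ 2 = 4 * (d * b) * x ^+ 2 + 4 * d ^+ 2 * x ^+ 2 by ring.
have h10 : 2 * d * b * (y ^+ 2 + y' ^+ 2) = 2 * (d * b * (y ^+ 2 + y' ^+ 2)) by ring.
by lra.
Qed.

Variables (n : nat) (delta L : R).
Let a := coefa pa q E n.
Let b := coefb pa q E n.
Hypotheses (block : block_response pa q E n) (d0 : 0 < delta).
Hypothesis sep : forall j, (n < j)%N -> `|b| + delta <= `|kap j - a|.
Hypothesis kapL : forall j, `|kap j| <= L.

(* Matching condition at an edge of conductance [1 / (2 k)] joining two ends. *)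
Let joint (k a' b' g g' x x' y y' u u' e e' qq : R) : k = (2 * qq)^-1 -> 0 < qq ->
    x = g - qq * (u' - u) -> x' = g' - qq * (u - u') ->
    u = a' * x + b' * y + e -> u' = a' * x' + b' * y' + e' ->
  2 * (k - a') * x = b' * (y - y') +
    ((2 * k - a') * g + - a' * g' + e + - e').
Proof.
move=> kE qq0 hx hx' hu hu'.
have s : x + x' = g + g' by rewrite hx hx'; ring.
have d : 2 * k * (x - g) = u - u'.
  by rewrite hx kE; field; rewrite gt_eqF.
have e1 : 2 * k * x = 2 * k * g + (u - u') by rewrite -d; ring.
have e2 : u - u' = a' * (2 * x - g - g') + b' * (y - y') + e - e'.
  rewrite hu hu'.
  have -> : x' = g + g' - x by rewrite -s; ring.
  by ring.
have -> : 2 * (k - a') * x = 2 * k * x - 2 * a' * x by ring.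
by rewrite e1 e2; ring.
Qed.

Lemma wsum_pred1 N (F : word -> R) w0 : size w0 = N ->
  wsum N (fun w => if w == w0 then F w else 0) = F w0.
Proof.
move=> sw; rewrite /wsum (bigD1_seq w0) ?uniq_words ?mem_words ?sw //= eqxx.
by rewrite big1 ?addr0 // => w /negbTE ->.
Qed.

Lemma wsum_split i (F : word -> R) : wsum i.+1 F =
  F (endA i) + F (endB i) + wsum i.+1 (fun w => if inner i w then F w else 0).
Proof.
rewrite -{1}(wsum_pred1 F (size_endA i)) -(wsum_pred1 F (size_endB i)) -!wsumD.
apply: eq_wsum => w _; rewrite /inner.
case: eqP => [->|_]; first by rewrite (negbTE (endA_neq_endB i)) /= !addr0.
by case: eqP => [->|_] /=; rewrite ?addr0 ?add0r.
Qed.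

Section Sums.
Variables (k : nat) (phi : word -> R).
Let x v := resA pa q E n (tailed v phi).
Let y v := resB pa q E n (tailed v phi).
Let gA v := res phi (endA n ++ v).
Let gB v := res phi (endB n ++ v).
Let uA v := phi (endA n ++ v).
Let uB v := phi (endB n ++ v).
Let G v := inner_energy pa q E n (tailed v phi).
Let eA v := uA v - a * x v - b * y v.
Let eB v := uB v - b * x v - a * y v.
Variables (C : R).
Hypotheses (C0 : 0 <= C) (hA : forall v, eA v ^+ 2 <= C * G v)
  (hB : forall v, eB v ^+ 2 <= C * G v).

Let D := (2 * L + `|a|) ^+ 2 + C.
Let total v := gA v ^+ 2 + gB v ^+ 2 + G v.

Let G0 v : 0 <= G v. Proof. exact: inner_energy_ge0. Qed.

Let err_bound j (g g' e e' H H' : R) : e ^+ 2 <= C * H -> e' ^+ 2 <= C * H' ->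
    0 <= H -> 0 <= H' ->
  ((2 * kap j - a) * g + - a * g' + e + - e') ^+ 2 <=
    4 * D * ((g ^+ 2 + H) + (g' ^+ 2 + H')).
Proof.
move=> he he' H0 H'0; apply: le_trans (sqr4 _ _ _ _) _.
rewrite -mulrA ler_pM2l // !exprMn !sqrrN.
have L0 : 0 <= L by apply: le_trans (kapL 0); exact: normr_ge0.
have c1 : (2 * kap j - a) ^+ 2 <= (2 * L + `|a|) ^+ 2.
  rewrite -[leLHS]real_normK ?num_real // lerXn2r ?nnegrE ?addr_ge0 ?mulr_ge0 //.
  apply: le_trans (ler_normB _ _) _; rewrite lerD2r normrM ger0_norm //.
  by rewrite ler_pM2l.
have c2 : a ^+ 2 <= (2 * L + `|a|) ^+ 2.
  by rewrite -[leLHS]real_normK ?num_real // lerXn2r ?nnegrE ?addr_ge0 ?mulr_ge0 // lerDr mulr_ge0.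
rewrite /D; move: c1 c2 (sqr_ge0 (2 * L + `|a|)).
move: (_ ^+ 2) ((2 * L + `|a|) ^+ 2) => X Y c1 c2 Y0.
have g1 : X * g ^+ 2 <= Y * g ^+ 2 by rewrite ler_wpM2r ?sqr_ge0.
have g2 : a ^+ 2 * g' ^+ 2 <= Y * g' ^+ 2 by rewrite ler_wpM2r ?sqr_ge0.
have g3 : 0 <= C * g ^+ 2 by rewrite mulr_ge0 ?sqr_ge0.
have g4 : 0 <= C * g' ^+ 2 by rewrite mulr_ge0 ?sqr_ge0.
have g5 : 0 <= Y * H by rewrite mulr_ge0.
have g6 : 0 <= Y * H' by rewrite mulr_ge0.
have -> : (Y + C) * (g ^+ 2 + H + (g' ^+ 2 + H')) =
  Y * g ^+ 2 + Y * H + Y * g' ^+ 2 + Y * H' + C * g ^+ 2 + C * H + C * g' ^+ 2 + C * H'.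
  by ring.
by move: he he'; lra.
Qed.

(** Summed over all tails, the joints at the A ends bound the currents [x] by the currents [y], and
    those at the B ends do the converse. As [aut_a] and [flip] permute the tails, the terms with
    [4 delta |b|] cancel and [4 delta^2] survives, whatever [k] is. *)
Lemma ends_bound : 4 * delta ^+ 2 * (wsum k (fun v => x v ^+ 2) + wsum k (fun v => y v ^+ 2))
  <= 16 * D * wsum k total.
Proof.
have jA v : 4 * delta * (`|b| + delta) * x v ^+ 2 <=
    2 * delta * `|b| * (y v ^+ 2 + y (aut_a v) ^+ 2) +
    4 * D * ((gA v ^+ 2 + G v) + (gA (aut_a v) ^+ 2 + G (aut_a v))).
  have e : 2 * (kap n.+1 - a) * x v = b * (y v - y (aut_a v)) +
    ((2 * kap n.+1 - a) * gA v + - a * gA (aut_a v) + eA v + - eA (aut_a v)).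
    apply: (@joint _ _ _ _ _ _ (x (aut_a v)) _ _ (uA v) (uA (aut_a v)) _ _ (q n)) => //.
    - by rewrite /gA hres_endA /x /resA /uA; ring.
    - by rewrite /gA hres_endA aut_aK /x /resA /uA; ring.
    - by rewrite /eA; ring.
    - by rewrite /eA; ring.
  apply: le_trans (coercive_joint d0 (sep (leqnn _)) e) _.
  by rewrite lerD2l; exact: err_bound.
have jB v : 4 * delta * (`|b| + delta) * y v ^+ 2 <=
    2 * delta * `|b| * (x v ^+ 2 + x (flip v) ^+ 2) +
    4 * D * ((gB v ^+ 2 + G v) + (gB (flip v) ^+ 2 + G (flip v))).
  pose j := (n.+1 + index false v)%N.
  have e : 2 * (kap j.+1 - a) * y v = b * (x v - x (flip v)) +
    ((2 * kap j.+1 - a) * gB v + - a * gB (flip v) + eB v + - eB (flip v)).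
    apply: (@joint _ _ _ _ _ _ (y (flip v)) _ _ (uB v) (uB (flip v)) _ _ (q j)) => //.
    - by rewrite /gB hres_endB /y /resB /uB /j; ring.
    - by rewrite /gB hres_endB flipK index_flip /y /resB /uB /j; ring.
    - by rewrite /eB; ring.
    - by rewrite /eB; ring.
  have nj : (n < j.+1)%N by rewrite ltnS /j ltnW // ltnS leq_addr.
  apply: le_trans (coercive_joint d0 (sep nj) e) _.
  by rewrite lerD2l; exact: err_bound.
pose sX := wsum k (fun v => x v ^+ 2); pose sY := wsum k (fun v => y v ^+ 2).
pose sA := wsum k (fun v => gA v ^+ 2); pose sB := wsum k (fun v => gB v ^+ 2).
pose sG := wsum k G.
have ia F : wsum k (fun v => F (aut_a v)) = wsum k F :> R.
  by apply: wsum_invol; [exact: aut_aK|exact: size_aut_a].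
have ib F : wsum k (fun v => F (flip v)) = wsum k F :> R.
  by apply: wsum_invol; [exact: flipK|exact: size_flip].
have sumA : 4 * delta * (`|b| + delta) * sX <=
    2 * delta * `|b| * (sY + sY) + 4 * D * ((sA + sG) + (sA + sG)).
  rewrite -[X in X <= _]wsumZ; apply: le_trans (ler_wsum (fun v _ => jA v)) _.
  rewrite wsumD !wsumZ !wsumD (ia (fun v => y v ^+ 2)) (ia (fun v => gA v ^+ 2)).
  by rewrite (ia G).
have sumB : 4 * delta * (`|b| + delta) * sY <=
    2 * delta * `|b| * (sX + sX) + 4 * D * ((sB + sG) + (sB + sG)).
  rewrite -[X in X <= _]wsumZ; apply: le_trans (ler_wsum (fun v _ => jB v)) _.
  rewrite wsumD !wsumZ !wsumD (ib (fun v => x v ^+ 2)) (ib (fun v => gB v ^+ 2)).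
  by rewrite (ib G).
have -> : wsum k total = sA + sB + sG by rewrite /total !wsumD.
have D0 : 0 <= D by rewrite /D addr_ge0 ?sqr_ge0.
have sA0 : 0 <= D * sA by rewrite mulr_ge0 // wsum_ge0 // => v _; exact: sqr_ge0.
have sB0 : 0 <= D * sB by rewrite mulr_ge0 // wsum_ge0 // => v _; exact: sqr_ge0.
move: sumA sumB; rewrite -/sX -/sY.
have -> : 4 * delta * (`|b| + delta) * sX =
  4 * (delta * `|b| * sX) + 4 * delta ^+ 2 * sX by ring.
have -> : 4 * delta * (`|b| + delta) * sY =
  4 * (delta * `|b| * sY) + 4 * delta ^+ 2 * sY by ring.
have -> : 2 * delta * `|b| * (sY + sY) = 4 * (delta * `|b| * sY) by ring.
have -> : 2 * delta * `|b| * (sX + sX) = 4 * (delta * `|b| * sX) by ring.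
have -> : 4 * D * (sA + sG + (sA + sG)) = 8 * (D * sA) + 8 * (D * sG) by ring.
have -> : 4 * D * (sB + sG + (sB + sG)) = 8 * (D * sB) + 8 * (D * sG) by ring.
have -> : 4 * delta ^+ 2 * (sX + sY) = 4 * delta ^+ 2 * sX + 4 * delta ^+ 2 * sY by ring.
have -> : 16 * D * (sA + sB + sG) = 16 * (D * sA) + 16 * (D * sB) + 16 * (D * sG) by ring.
lra.
Qed.

Lemma total_le : wsum k total <= wsum (n.+1 + k) (fun w => res phi w ^+ 2).
Proof.
rewrite wsum_cat exchange_wsum; apply: ler_wsum => v _.
rewrite (wsum_split n (fun w => res phi (w ++ v) ^+ 2)) /total lerD2l.
rewrite /G /inner_energy; apply: ler_wsum => w sw.
by case: ifP => // iw; rewrite (hres_inner _ _ _ _ _ sw iw).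
Qed.

End Sums.

Lemma res_lower_bound : exists2 c : R, 0 <= c & forall k phi,
  wsum (n.+1 + k) (fun w => phi w ^+ 2) <=
    c * wsum (n.+1 + k) (fun w => res phi w ^+ 2).
Proof.
have [[CA CA0 hA] [CB CB0 hB] hw] := block.
have [Cw Cw0 hCw] : exists2 Cw : R, 0 <= Cw & forall phi,
    wsum n.+1 (fun w => phi w ^+ 2) <= Cw * energy pa q E n phi.
  have : forall s : seq word, {subset s <= words n.+1} ->
      exists2 Cw : R, 0 <= Cw & forall phi,
      \sum_(w <- s) phi w ^+ 2 <= Cw * energy pa q E n phi.
    elim=> [_|w s IH hs]; first by exists 0 => // phi; rewrite big_nil mul0r.
    have [|C C0 hC] := IH; first by move=> v vs; apply: hs; rewrite inE vs orbT.
    have [|C' C'0 hC'] := hw w.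
      by apply/eqP; rewrite -mem_words; apply: hs; rewrite mem_head.
    exists (C' + C) => [|phi]; first exact: addr_ge0.
    by rewrite big_cons mulrDl lerD.
  by move/(_ (words n.+1)) => [//|C C0 hC]; exists C.
pose C := CA + CB.
have C0 : 0 <= C by exact: addr_ge0.
have G0 phi : 0 <= inner_energy pa q E n phi by exact: inner_energy_ge0.
pose D := (2 * L + `|a|) ^+ 2 + C.
have D0 : 0 <= D by rewrite addr_ge0 ?sqr_ge0.
pose c1 := 1 + 16 * D / (4 * delta ^+ 2).
have dd : 0 < 4 * delta ^+ 2 by rewrite mulr_gt0 ?exprn_gt0.
have c10 : 0 <= 16 * D / (4 * delta ^+ 2) by rewrite divr_ge0 ?mulr_ge0 // ltW.
exists (Cw * c1); first by rewrite mulr_ge0 // addr_ge0.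
move=> k phi.
have hA' v : (phi (endA n ++ v) - a * resA pa q E n (tailed v phi) -
    b * resB pa q E n (tailed v phi)) ^+ 2 <= C * inner_energy pa q E n (tailed v phi).
  by apply: le_trans (hA (tailed v phi)) _; rewrite ler_wpM2r // lerDl.
have hB' v : (phi (endB n ++ v) - b * resA pa q E n (tailed v phi) -
    a * resB pa q E n (tailed v phi)) ^+ 2 <= C * inner_energy pa q E n (tailed v phi).
  by apply: le_trans (hB (tailed v phi)) _; rewrite ler_wpM2r // lerDr.
have ends := ends_bound k C0 hA' hB'.
have tot := total_le k phi.
set T := (X in X <= _) in tot; rewrite -/T in ends.
rewrite {1}wsum_cat exchange_wsum.
apply: le_trans (ler_wsum (fun v _ => hCw (tailed v phi))) _.
rewrite wsumZ -mulrA ler_wpM2l //.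
apply: (@le_trans _ _ (c1 * T)); last by rewrite ler_wpM2l // addr_ge0.
rewrite /c1 mulrDl mul1r /energy.
under eq_wsum do rewrite -addrA.
rewrite wsumD wsumD; apply: lerD.
  by apply: ler_wsum => v _; rewrite lerDr addr_ge0 ?sqr_ge0.
by rewrite mulrAC ler_pdivlMr // mulrC.
Qed.

End LowerBound.

(** * Two eigenvalues of a symmetric matrix *)

Section TwoEigenvalues.
Variable R : realType.
Local Notation C := R[i].
Local Notation Re := (@complex.Re R).
Local Notation Im := (@complex.Im R).
Local Notation cmx := (map_mx (real_complex R)).
Local Notation "M ^h" := (map_mx Num.conj (M^T)) (at level 30).

Lemma conj_real (x : R) : Num.conj (x%:C%C : C) = x%:C%C.
Proof. by apply/eqP; rewrite eq_complex /= oppr0 !eqxx. Qed.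

Lemma cmx_adj p n (X : 'M[R]_(p, n)) : (cmx X)^h = cmx X^T.
Proof. by apply/matrixP => i j; rewrite !mxE conj_real. Qed.

Lemma adjM p n k (X : 'M[C]_(p, n)) (Y : 'M[C]_(n, k)) : (X *m Y)^h = Y^h *m X^h.
Proof. by rewrite trmx_mul map_mxM. Qed.

Lemma Re_mulmx_real n (u : 'rV[C]_n) (A : 'M[R]_n) :
  map_mx Re (u *m cmx A) = map_mx Re u *m A.
Proof.
apply/matrixP => i j; rewrite !mxE.
rewrite (big_morph Re (@ReD R) (erefl : Re 0 = 0)); apply: eq_bigr => k _.
by rewrite !mxE ReMr.
Qed.

Lemma Im_mulmx_real n (u : 'rV[C]_n) (A : 'M[R]_n) :
  map_mx Im (u *m cmx A) = map_mx Im u *m A.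
Proof.
apply/matrixP => i j; rewrite !mxE.
rewrite (big_morph Im (@ImD R) (erefl : Im 0 = 0)); apply: eq_bigr => k _.
by rewrite !mxE ImMr.
Qed.

Lemma complex_mx_eq0 n (u : 'rV[C]_n) :
  map_mx Re u = 0 -> map_mx Im u = 0 -> u = 0.
Proof.
move=> /matrixP h1 /matrixP h2; apply/matrixP => i j.
have := h1 i j; have := h2 i j; rewrite !mxE => e2 e1.
by apply: complex_eqP.
Qed.

Lemma sqr_rownorm n (z : 'rV[C]_n) : (z *m z^h) 0 0 = \sum_i `|z 0 i| ^+ 2.
Proof. by rewrite mxE; apply: eq_bigr => i _; rewrite !mxE normCK. Qed.

Variables (n : nat) (A : 'M[R]_n) (k : 'I_n).
Hypothesis symA : A^T = A.
Hypothesis simple : forall u : 'rV[R]_n, u *m A = 0 -> u 0 k = 0 -> u = 0.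

Lemma csimple (u : 'rV[C]_n) : u *m cmx A = 0 -> u 0 k = 0 -> u = 0.
Proof.
move=> uA uk; apply: complex_mx_eq0; apply: simple.
- by rewrite -Re_mulmx_real uA; apply/matrixP => i j; rewrite !mxE.
- by rewrite mxE uk.
- by rewrite -Im_mulmx_real uA; apply/matrixP => i j; rewrite !mxE.
- by rewrite mxE uk.
Qed.

(** By [simple] at most one eigenvalue is 0. Some nonzero combination of the two rows of [X] has no
    component along its eigenvector, and because both Gram matrices are scalar its Rayleigh quotient
    for the square of [A] is still [tau / sig]; hence a nonzero eigenvalue has square at most
    [eps]. *)
Lemma two_eigenvalues (X : 'M[R]_(2, n)) (sig tau eps : R) :
    X *m X^T = sig%:M -> (X *m A) *m (X *m A)^T = tau%:M -> 0 < sig ->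
    tau <= eps * sig ->
  exists d (u : 'rV[R]_n), [/\ d != 0, d ^+ 2 <= eps, u != 0 & u *m A = d *: u].
Proof.
move=> XX XA sig0 te.
have hA : cmx A \is hermsymmx.
  apply/is_hermitianmxP; rewrite expr0 scale1r.
  by rewrite -[RHS]/((cmx A)^h) cmx_adj symA.
pose P := spectralmx (cmx A); pose sp := spectral_diag (cmx A).
have PU : P \is unitarymx := spectral_unitarymx _.
have AE : cmx A = P^h *m diag_mx sp *m P.
  by have /orthomx_spectralP := hermitian_normalmx hA; rewrite invmx_unitary.
have PPh : P *m P^h = 1%:M by apply/unitarymxP.
have PhP : P^h *m P = 1%:M by apply: mulmx1C.
have evE i : row i P *m cmx A = sp 0 i *: row i P.
  by rewrite -row_mul AE !mulmxA PPh mul1mx row_mul row_diag_mx -scalemxAl -rowE.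
have Punit : P \in unitmx by exact: unitarymx_unit.
have row0 i : row i P != 0.
  apply/eqP => h; have := congr1 (fun Q : 'M[C]_n => Q i i) PPh.
  rewrite mxE big1 ?mxE ?eqxx => [/eqP|j _]; first by rewrite eq_sym oner_eq0.
  by have /matrixP/(_ 0 j) := h; rewrite !mxE => ->; rewrite mul0r.
have zero_uniq i j : sp 0 i = 0 -> sp 0 j = 0 -> i = j.
  move=> i0 j0; apply/eqP; apply: contraT => ij.
  have h : P j k *: row i P - P i k *: row j P = 0.
    apply: csimple; last by rewrite !mxE mulrC subrr.
    by rewrite mulmxBl -!scalemxAl !evE i0 j0 !scale0r !scaler0 subrr.
  have Pk l : sp 0 l = 0 -> P l k != 0.
    move=> l0; apply: contraNneq (row0 l) => Pl.
    by apply/eqP; apply: csimple; rewrite ?evE ?l0 ?scale0r // mxE.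
  have : (P j k *: row i P - P i k *: row j P) *m P^h = 0 by rewrite h mul0mx.
  rewrite mulmxBl -!scalemxAl -!row_mul PPh => /matrixP /(_ 0 i).
  rewrite !mxE eqxx (eq_sym j) (negbTE ij) mulr1 mulr0 subr0 => /eqP.
  by rewrite (negbTE (Pk j j0)).
pose Z : 'M[C]_(2, n) := cmx X *m P^h.
have ZZ : Z *m Z^h = (sig%:C%C)%:M.
  rewrite /Z adjM mulmxA -(mulmxA (cmx X)).
  have -> : (P^h)^h = P by apply/matrixP => i j; rewrite !mxE conjCK.
  by rewrite PhP mulmx1 cmx_adj -map_mxM XX map_scalar_mx.
have ZD : (Z *m diag_mx sp) *m (Z *m diag_mx sp)^h = (tau%:C%C)%:M.
  have e : cmx (X *m A) = Z *m diag_mx sp *m P by rewrite map_mxM AE !mulmxA.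
  have -> : Z *m diag_mx sp = cmx (X *m A) *m P^h.
    by rewrite e -mulmxA PPh mulmx1.
  rewrite adjM mulmxA -(mulmxA (cmx _)).
  have -> : (P^h)^h = P by apply/matrixP => i j; rewrite !mxE conjCK.
  by rewrite PhP mulmx1 cmx_adj -map_mxM XA map_scalar_mx.
have [c c0 hc] : exists2 c : 'rV[C]_2, c != 0 &
    forall i, sp 0 i = 0 -> (c *m Z) 0 i = 0.
  have [[i0 i00]|none] := pselect (exists i, sp 0 i = 0); last first.
    exists (const_mx 1); last by move=> i hi; case: none; exists i.
    by apply/eqP => /matrixP/(_ 0 0); rewrite !mxE => /eqP; rewrite oner_eq0.
  have [z0|z0] := eqVneq (Z 0 i0) 0.
    exists (delta_mx 0 0).
      apply/eqP => /matrixP/(_ 0 0); rewrite !mxE !eqxx => /eqP.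
      by rewrite oner_eq0.
    by move=> i /zero_uniq/(_ i00) ->; rewrite -rowE mxE.
  exists (\row_j (if j == 0 then Z 1 i0 else - Z 0 i0)).
    by apply/eqP => /matrixP/(_ 0 1); rewrite mxE [RHS]mxE /= => /eqP; rewrite oppr_eq0 (negbTE z0).
  move=> i /zero_uniq/(_ i00) ->.
  rewrite mxE !big_ord_recl big_ord0 ![(\row_j _) _ _]mxE /= addr0.
  rewrite (_ : lift 0 0 = 1); last exact: val_inj.
  by rewrite mulNr mulrC subrr.
pose z := c *m Z.
pose s := \sum_i `|c 0 i| ^+ 2.
have s0 : 0 < s.
  rewrite lt_def sumr_ge0 ?andbT => [|i _]; last exact: exprn_ge0.
  rewrite /s psumr_eq0 => [|i _]; last exact: exprn_ge0.
  apply: contra c0 => /allP h; apply/eqP/matrixP => i j; rewrite ord1 mxE.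
  by have := h j (mem_index_enum j); rewrite sqrf_eq0 normr_eq0 => /eqP.
have zs : \sum_i `|z 0 i| ^+ 2 = sig%:C%C * s.
  rewrite -sqr_rownorm /z adjM mulmxA -(mulmxA c) ZZ mul_mx_scalar.
  by rewrite -scalemxAl mxE sqr_rownorm.
have zd : \sum_i `|z 0 i| ^+ 2 * `|sp 0 i| ^+ 2 = tau%:C%C * s.
  transitivity (((z *m diag_mx sp) *m (z *m diag_mx sp)^h) 0 0).
    rewrite sqr_rownorm; apply: eq_bigr => i _.
    by rewrite mul_mx_diag [(\matrix_(_, _) _) _ _]mxE normrM exprMn.
  rewrite /z -(mulmxA c); move: (Z *m diag_mx sp) ZD => W ZD.
  rewrite adjM mulmxA -(mulmxA c) ZD mul_mx_scalar.
  by rewrite -scalemxAl mxE sqr_rownorm.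
have [i [di dle]] : exists i, sp 0 i != 0 /\ `|sp 0 i| ^+ 2 <= eps%:C%C.
  apply: contrapT => none.
  have big i : sp 0 i != 0 -> eps%:C%C < `|sp 0 i| ^+ 2.
    move=> d0; rewrite real_ltNge ?realX ?normr_real ?complex_real //.
      by apply/negP => h; apply: none; exists i.
  have t0 i : 0 <= `|z 0 i| ^+ 2 * (`|sp 0 i| ^+ 2 - eps%:C%C).
    have [d0|d0] := eqVneq (sp 0 i) 0; first by rewrite /z hc // normr0 expr0n mul0r.
    by rewrite mulr_ge0 ?exprn_ge0 // subr_ge0 ltW // big.
  have st : \sum_i `|z 0 i| ^+ 2 * (`|sp 0 i| ^+ 2 - eps%:C%C) <= 0.
    under eq_bigr do rewrite mulrBr.
    rewrite sumrB zd -mulr_suml zs mulrAC -mulrBl pmulr_lle0 //.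
    by rewrite -rmorphM -rmorphB lecR subr_le0 mulrC.
  have z00 i : `|z 0 i| ^+ 2 = 0.
    have : `|z 0 i| ^+ 2 * (`|sp 0 i| ^+ 2 - eps%:C%C) == 0.
      rewrite eq_le t0 andbT; apply: le_trans st.
      by rewrite (bigD1 i) //= lerDl sumr_ge0.
    rewrite mulf_eq0 => /orP[/eqP //|h].
    have [d0|d0] := eqVneq (sp 0 i) 0; first by rewrite /z hc // normr0 expr0n.
    by have := big i d0; rewrite -subr_gt0 (eqP h) ltxx.
  have : sig%:C%C * s = 0 by rewrite -zs big1.
  by move/eqP; rewrite mulf_eq0 (gt_eqF s0) orbF => /eqP[] /eqP; rewrite gt_eqF.
have dreal : sp 0 i = (Re (sp 0 i))%:C%C.
  have /mxOverP/(_ 0 i) := hermitian_spectral_diag_real hA.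
  by move=> /complex_realP[x hx]; rewrite -/sp in hx; rewrite hx.
set d := Re (sp 0 i) in dreal.
have rE := evE i; rewrite dreal in rE.
have reE : map_mx Re (row i P) *m A = d *: map_mx Re (row i P).
  by rewrite -Re_mulmx_real rE; apply/matrixP => a b; rewrite !mxE mulrC ReMr mulrC.
have imE : map_mx Im (row i P) *m A = d *: map_mx Im (row i P).
  by rewrite -Im_mulmx_real rE; apply/matrixP => a b; rewrite !mxE mulrC ImMr mulrC.
have d0 : d != 0 by apply: contraNneq di => h; rewrite dreal h.
have d2 : d ^+ 2 <= eps.
  by move: dle; rewrite dreal normcE normc_real -rmorphXn lecR real_normK ?num_real.
have [r0|r0] := eqVneq (map_mx Re (row i P)) 0; last by exists d, (map_mx Re (row i P)).
exists d, (map_mx Im (row i P)); split=> //.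
by apply: contraNneq (row0 i) => h; apply/eqP; exact: complex_mx_eq0.
Qed.

End TwoEigenvalues.

(** * The spectrum on finite words *)

Section WordSpectrum.
Variables (R : realType) (pa : R) (q : nat -> R).
Hypotheses (pa0 : 0 < pa) (q0 : forall n, 0 < q n).
Notation kap := (kap pa q).
Notation res := (hres pa q).
Implicit Types (phi psi : word -> R) (E : R).

Lemma hres_shift E E' phi w : res E phi w = res E' phi w + (E' - E) * phi w.
Proof. by rewrite /hres; ring. Qed.

Lemma hres_lin E a phi psi w :
  res E (fun v => a * phi v + psi v) w = a * res E phi w + res E psi w.
Proof. by rewrite /hres; ring. Qed.

Lemma hres_ext E phi psi w : (forall v, size v = size w -> phi v = psi v) ->
  res E phi w = res E psi w.
Proof. by move=> h; rewrite /hres !h ?size_aut_a ?size_flip. Qed.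

Definition approx_eigen E eps N phi : Prop :=
  0 < wsum N (fun w => phi w ^+ 2) /\
  wsum N (fun w => res E phi w ^+ 2) <= eps * wsum N (fun w => phi w ^+ 2).

(* The approximate point spectrum of all finite levels together, in the
   coordinate [E]. *)
Definition wspec : set R :=
  [set E | forall eps : R, 0 < eps -> exists N phi, approx_eigen E eps N phi].

Lemma sqrD_le (x y : R) : (x + y) ^+ 2 <= 2 * x ^+ 2 + 2 * y ^+ 2.
Proof. by have := sqr_ge0 (x - y); rewrite sqrrB sqrrD; lra. Qed.

Lemma wspec0 : wspec 0.
Proof.
move=> eps eps0; exists 0%N, (fun=> 1); split.
  by rewrite wsum_cst expr1n mul1r ltr0n.
rewrite [leLHS](_ : _ = 0).
  by rewrite mulr_ge0 ?(ltW eps0) // wsum_ge0 // => w _; exact: sqr_ge0.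
by rewrite /wsum big1 // => w _; rewrite /hres; ring.
Qed.

Lemma wspec_adherent E :
  (forall d, 0 < d -> exists2 E', wspec E' & `|E - E'| <= d) -> wspec E.
Proof.
move=> h eps eps0; have e4 : 0 < eps / 4 by rewrite divr_gt0.
pose d := Num.sqrt (eps / 4).
have d0 : 0 < d by rewrite sqrtr_gt0.
have d2 : d ^+ 2 = eps / 4 by rewrite sqr_sqrtr // ltW.
have [E' /(_ _ e4)[N [phi [p0 hp]]] hE] := h d d0.
exists N, phi; split=> //.
have c : (E' - E) ^+ 2 <= eps / 4.
  rewrite -d2 -(real_normK (num_real (E' - E))) lerXn2r ?nnegrE ?(ltW d0) //.
  by rewrite distrC.
apply: le_trans (ler_wsum (F' := fun w => 2 * res E' phi w ^+ 2 +
  2 * (E' - E) ^+ 2 * phi w ^+ 2) _) _.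
  move=> w _; rewrite (hres_shift E E'); apply: le_trans (sqrD_le _ _) _.
  by rewrite lerD2l exprMn -[leRHS]mulrA.
rewrite wsumD !wsumZ.
have : (E' - E) ^+ 2 * wsum N (fun w => phi w ^+ 2) <=
    eps / 4 * wsum N (fun w => phi w ^+ 2) by rewrite ler_pM2r.
by rewrite -mulrA; lra.
Qed.

Lemma closed_wspec : closed wspec.
Proof.
move=> E clE; apply: wspec_adherent => d d0.
have [E' [hE' bE']] := clE _ (nbhsx_ballx E d d0).
by exists E' => //; exact: ltW.
Qed.

Lemma dirichlet N (f : word -> word) (c phi : word -> R) : involutive f ->
    (forall w, size (f w) = size w) -> (forall w, c (f w) = c w) ->
  2 * wsum N (fun w => phi w * (c w * (phi (f w) - phi w))) =
  - wsum N (fun w => c w * (phi (f w) - phi w) ^+ 2).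
Proof.
move=> fK fs cf.
have e : wsum N (fun w => c w * phi (f w) ^+ 2) = wsum N (fun w => c w * phi w ^+ 2).
  rewrite -(wsum_invol N (fun w => c w * phi w ^+ 2) fK fs).
  by apply: eq_wsum => w _; rewrite cf.
suff : 2 * wsum N (fun w => phi w * (c w * (phi (f w) - phi w))) +
    wsum N (fun w => c w * (phi (f w) - phi w) ^+ 2) =
    wsum N (fun w => c w * phi (f w) ^+ 2) + - 1 * wsum N (fun w => c w * phi w ^+ 2).
  by rewrite e mulN1r subrr => /eqP; rewrite addr_eq0 => /eqP.
by rewrite -!wsumZ -!wsumD; apply: eq_wsum => w _; ring.
Qed.

Hypothesis pq1 : forall n, pa + q n <= 1.

(** [D] is the Dirichlet form. Each of the two involutions contributes at most twice its weight
    times the square norm, and the weights sum to at most 1. *)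
Lemma res_form E N phi : exists2 D,
  0 <= D <= 2 * wsum N (fun w => phi w ^+ 2) &
  wsum N (fun w => phi w * res E phi w) = - D - E * wsum N (fun w => phi w ^+ 2).
Proof.
pose a := wsum N (fun w => pa * (phi (aut_a w) - phi w) ^+ 2).
pose b := wsum N (fun w => q (index false w) * (phi (flip w) - phi w) ^+ 2).
exists (a / 2 + b / 2); last first.
  have ea := @dirichlet N aut_a (fun=> pa) phi aut_aK size_aut_a (fun=> erefl).
  have eb := @dirichlet N flip (fun w => q (index false w)) phi flipK size_flip
    (fun w => congr1 q (index_flip w)).
  rewrite -/a -/b in ea eb.
  transitivity (wsum N (fun w => phi w * (pa * (phi (aut_a w) - phi w))) +
    wsum N (fun w => phi w * (q (index false w) * (phi (flip w) - phi w))) +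
    - E * wsum N (fun w => phi w ^+ 2)).
    by rewrite -wsumZ -!wsumD; apply: eq_wsum => w _; rewrite /hres; ring.
  by move: ea eb; lra.
have a0 : 0 <= a by apply: wsum_ge0 => w _; rewrite mulr_ge0 ?sqr_ge0 // ltW.
have b0 : 0 <= b by apply: wsum_ge0 => w _; rewrite mulr_ge0 ?sqr_ge0 // ltW.
apply/andP; split; first by move: a0 b0; lra.
have sa : a <= pa * (4 * wsum N (fun w => phi w ^+ 2)).
  rewrite /a wsumZ ler_pM2l //.
  apply: le_trans (ler_wsum (F' := fun w => 2 * phi (aut_a w) ^+ 2 + 2 * phi w ^+ 2) _) _.
    move=> w _; have := sqrD_le (phi (aut_a w)) (- phi w); by rewrite sqrrN.
  rewrite wsumD !wsumZ (wsum_invol N (fun w => phi w ^+ 2) aut_aK size_aut_a).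
  by lra.
have sb : b <= (1 - pa) * (4 * wsum N (fun w => phi w ^+ 2)).
  have pa1 : 0 <= 1 - pa by have := pq1 0; have := q0 0; lra.
  apply: (@le_trans _ _ (wsum N (fun w => (1 - pa) * (phi (flip w) - phi w) ^+ 2))).
    apply: ler_wsum => w _; rewrite ler_wpM2r ?sqr_ge0 //.
    by have := pq1 (index false w); lra.
  rewrite wsumZ ler_wpM2l //.
  apply: le_trans (ler_wsum (F' := fun w => 2 * phi (flip w) ^+ 2 + 2 * phi w ^+ 2) _) _.
    move=> w _; have := sqrD_le (phi (flip w)) (- phi w); by rewrite sqrrN.
  rewrite wsumD !wsumZ (wsum_invol N (fun w => phi w ^+ 2) flipK size_flip).
  by lra.
by move: sa sb; rewrite mulrBl mul1r; lra.
Qed.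

Lemma wspec_bound E : wspec E -> -2 <= E <= 0.
Proof.
move=> hE.
have key (g : R) (sg : R) : 0 < g -> sg ^+ 2 = 1 ->
    (forall N phi, g * wsum N (fun w => phi w ^+ 2) <=
       sg * wsum N (fun w => phi w * res E phi w)) -> False.
  move=> g0 sg2 h; have g2 : 0 < g ^+ 2 / 2 by rewrite divr_gt0 ?exprn_gt0.
  have [N [phi [p0 hp]]] := hE _ g2.
  have : 2 * g * (sg * wsum N (fun w => phi w * res E phi w)) <=
    g ^+ 2 * wsum N (fun w => phi w ^+ 2) + wsum N (fun w => res E phi w ^+ 2).
    rewrite mulrA -!wsumZ -wsumD; apply: ler_wsum => w _.
    have := sqr_ge0 (g * phi w - sg * res E phi w).
    by rewrite sqrrB !exprMn sg2 mul1r; lra.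
  have := h N phi; rewrite -(ler_pM2l (_ : 0 < 2 * g)) ?mulr_gt0 // => h1 h2.
  have := le_trans h1 (le_trans h2 (lerD (lexx _) hp)).
  have : 0 < g ^+ 2 * wsum N (fun w => phi w ^+ 2) by rewrite mulr_gt0 ?exprn_gt0.
  by rewrite expr2; lra.
apply/andP; split; rewrite leNgt; apply/negP => hlt.
  apply: (key (- 2 - E) 1); rewrite ?expr1n ?subr_gt0 // => N phi.
  have [D /andP[D0 D2] ->] := res_form E N phi.
  by rewrite mul1r mulrBl; move: D2; lra.
apply: (key E (-1)); rewrite ?sqrrN ?expr1n // => N phi.
have [D /andP[D0 D2] ->] := res_form E N phi.
by rewrite mulN1r; move: D0; lra.
Qed.

Lemma aut_a_take k w : aut_a (take k w) = take k (aut_a w).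
Proof. by case: w k => [|c w] []. Qed.

Lemma flip_take k w : flip (take k w) = take k (flip w).
Proof. by elim: w k => [|[] w IH] [|k] //=; rewrite ?IH ?aut_a_take. Qed.

Lemma hres_lift E k phi w :
  res E (fun v => phi (take k v)) w = res E phi (take k w).
Proof.
rewrite /hres -aut_a_take -flip_take; congr (_ + _ - _).
(* A prefix without the letter 0 may see another weight than [w] itself, but then [flip] fixes the
   prefix and the weight multiplies 0. *)
have [ik|ki] := boolP (false \in take k w).
  congr (q _ * _); rewrite -{1}(cat_take_drop k w) index_cat ik //.
suff -> : flip (take k w) = take k w by rewrite subrr !mulr0.
by elim: (take k w) ki => [|[] v IH] //= /IH ->.
Qed.

Lemma wsum_lift N k (F : word -> R) :
  wsum (N + k) (fun w => F (take N w)) = (2 ^ k)%:R * wsum N F.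
Proof.
rewrite wsum_cat -wsumZ; apply: eq_wsum => w sw.
rewrite (eq_wsum (F' := fun=> F w)) ?wsum_cst 1?mulrC // => v _.
by rewrite take_size_cat.
Qed.

Lemma approx_eigen_lift E eps N k phi : approx_eigen E eps N phi ->
  approx_eigen E eps (N + k) (fun w => phi (take N w)).
Proof.
move=> [p0 hp]; have k0 : (0 : R) < (2 ^ k)%:R by rewrite ltr0n expn_gt0.
split; first by rewrite (wsum_lift N k (fun w => phi w ^+ 2)) mulr_gt0.
rewrite (eq_wsum (F' := fun w => res E phi (take N w) ^+ 2)); last first.
  by move=> w _; rewrite hres_lift.
rewrite (wsum_lift N k (fun w => res E phi w ^+ 2)).
rewrite (wsum_lift N k (fun w => phi w ^+ 2)) mulrCA.
by rewrite ler_pM2l.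
Qed.

Lemma uniform_gap (V : seq R) (a b : R) : exists2 d, 0 < d &
  forall v, v \in V -> `|b| < `|v - a| -> `|b| + d <= `|v - a|.
Proof.
elim: V => [|v V [d d0 IH]]; first by exists 1.
have [h|h] := ltP `|b| `|v - a|; last first.
  exists d => // w; rewrite inE => /predU1P[->|]; last exact: IH.
  by move=> h'; have := lt_le_trans h' h; rewrite ltxx.
exists (Num.min d (`|v - a| - `|b|)); first by rewrite lt_min d0 subr_gt0.
move=> w; rewrite inE => /predU1P[->|wV hw].
  by move=> _; rewrite -lerBrDl ge_min lexx orbT.
by apply: le_trans (IH w wV hw); rewrite lerD2l ge_min lexx.
Qed.

(** Contrapositive of [res_lower_bound]. The finiteness of [V] turns strict separation from every
    later [kap j] into a uniform gap, and approximate eigenfunctions of low level are lifted until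
    the bound applies. *)
Lemma wspec_resonance (V : seq R) E : (forall n, kap n \in V) -> wspec E ->
    E != 0 -> (forall i, kap i - rS kap E i.+1 != 0) ->
  forall n, (0 < n)%N -> exists2 j, (n <= j)%N &
    `|rS kap E n.+1 - kap j| <= `|(rS kap E n - rA kap E n) / 2|.
Proof.
move=> kV hE E0 reg [//|n] _; apply: contrapT => no.
have [d d0 gap] := uniform_gap V (coefa pa q E n) (coefb pa q E n).
have sep j : (n < j)%N -> `|coefb pa q E n| + d <= `|kap j - coefa pa q E n|.
  move=> nj; apply: gap => //; rewrite ltNge; apply/negP => h; apply: no.
  by exists j => //; rewrite distrC.
have [L hL] : exists L, forall j, `|kap j| <= L.
  exists (\sum_(v <- V) `|v|) => j; rewrite (big_rem (kap j)) //= lerDl.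
  exact: sumr_ge0.
have block : block_response pa q E n.
  by apply: block_responseP => // i _; exact: reg.
have [c c0 hc] := res_lower_bound q0 block d0 sep hL.
have eps0 : 0 < (2 * (c + 1))^-1 by rewrite invr_gt0 mulr_gt0 // ltr_wpDl.
have [N [phi /approx_eigen_lift h]] := hE _ eps0.
have [p0 hp] := h n.+1; rewrite addnC in p0 hp.
have := le_trans (hc _ _) (ler_wpM2l c0 hp); move: p0.
move: (wsum _ _) => s s0; rewrite leNgt => /negP; apply.
rewrite mulrA gtr_pMl // ltr_pdivrMr ?mulr_gt0 // ?ltr_wpDl //.
by move: c0; lra.
Qed.

End WordSpectrum.

(** * Approximate eigenfunctions that vanish at both ends *)

Section Cutoff.
Variable R : realType.
Implicit Types (phi chi : word -> R).

(* Distance to [1^n] along the level-n graph, which is a path. *)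
Definition tent (w : word) : R :=
  (foldl (fun (s : nat * R) c =>
     (s.1.+1, if c then s.2 else 2 ^+ s.1.+1 - 1 - s.2)) (0%N, 0) w).2.

(** Appending a letter glues two copies of the path at [endA]; the copy with last letter 0 is
    traversed backwards, and the new path has [2 ^ (size w + 1) - 1] edges. *)
Lemma tent_rcons w c : tent (rcons w c) =
  if c then tent w else 2 ^+ (size w).+1 - 1 - tent w.
Proof.
rewrite /tent foldl_rcons /=.
suff -> : (foldl (fun (s : nat * R) c0 =>
  (s.1.+1, if c0 then s.2 else 2 ^+ s.1.+1 - 1 - s.2)) (0%N, 0) w).1 = size w by [].
by elim/last_ind: w => [|w d IH] //; rewrite foldl_rcons /= IH size_rcons.
Qed.

Lemma tent_nil : tent [::] = 0. Proof. by []. Qed.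

Lemma tent_bound w : 0 <= tent w <= 2 ^+ size w - 1.
Proof.
elim/last_ind: w => [|w c /andP[h1 h2]]; first by rewrite tent_nil expr0 subrr lexx.
rewrite tent_rcons size_rcons; have p : (1 : R) <= 2 ^+ size w by rewrite exprn_ege1 // ler1n.
by case: c; apply/andP; split; move: h1 h2 p; rewrite ?exprS; lra.
Qed.

Lemma tent_ones k : tent (nseq k true) = 0.
Proof.
elim: k => // k IH; rewrite (_ : nseq k.+1 true = rcons (nseq k true) true) ?tent_rcons //.
by elim: k {IH} => //= k <-.
Qed.

Lemma tent_endA n : tent (endA n) = 2 ^+ n.+1 - 1.
Proof. by rewrite tent_rcons tent_ones size_nseq subr0. Qed.

Lemma endA_or_inner n w : [\/ w = endA n, w = endB n | inner n w].
Proof.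
rewrite /inner; have [->|a] := eqVneq w (endA n); first by constructor 1.
by have [->|b] := eqVneq w (endB n); [constructor 2|constructor 3].
Qed.

Lemma tent_aut_a w : `|tent (aut_a w) - tent w| <= 1.
Proof.
case: w => [|x w]; first by rewrite subrr normr0.
elim/last_ind: w => [|w c IH].
  rewrite /aut_a -(cats0 [:: ~~ x]) -(cats0 [:: x]) /=.
  rewrite -[[:: ~~ x]]/(rcons [::] (~~ x)) -[[:: x]]/(rcons [::] x) !tent_rcons tent_nil.
  case: x; rewrite /= expr1.
    by rewrite subr0 subr0 (_ : 2 - 1 = 1) ?normr1 //; lra.
  by rewrite subr0 sub0r normrN (_ : 2 - 1 = 1) ?normr1 //; lra.
rewrite -rcons_cons (_ : aut_a (rcons (x :: w) c) = rcons (aut_a (x :: w)) c) //.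
rewrite !tent_rcons size_aut_a; case: c => //.
by rewrite opprB addrC subrKA distrC.
Qed.

Lemma tent_flip w : `|tent (flip w) - tent w| <= 1.
Proof.
elim/last_ind: w => [|w c IH]; first by rewrite subrr normr0.
have same : flip (rcons w c) = rcons (flip w) c ->
    `|tent (flip (rcons w c)) - tent (rcons w c)| <= 1.
  move=> ->; rewrite !tent_rcons size_flip; case: c => //.
  by rewrite opprB addrC subrKA distrC.
case: w IH same => [|x w] IH same; first by case: c {same}; rewrite subrr normr0.
have [wE|wE|iw] := endA_or_inner (size w) (x :: w).
- rewrite wE -cats1 flip_endA -[aut_a _]/[:: ~~ c] !cats1 !(tent_rcons (endA _)) tent_endA size_endA.
  rewrite [2 ^+ (size w).+2]exprS; case: c {same}; rewrite /=.
    rewrite (_ : _ - _ = 1) ?normr1 //; ring.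
  rewrite (_ : _ - _ = -1) ?normrN1 //; ring.
- apply: same; have := flip_endB (size w) [::]; rewrite !cats0 wE => ->.
  by rewrite -cats1 flip_endB; case: (c).
- by apply: same; rewrite -!cats1 (@flip_inner (size w) (x :: w) [:: c] erefl iw).1.
Qed.

Lemma wsum_tent n : (8 ^ n)%:R <= wsum n.+1 (fun w => tent w ^+ 2).
Proof.
rewrite wsum_rcons; apply: (@le_trans _ _ (wsum n (fun=> (4 ^ n)%:R))).
  by rewrite wsum_cst -natrM -expnMn.
apply: ler_wsum => w sw; rewrite !tent_rcons.
apply: (@le_trans _ _ ((2 ^+ (size w).+1 - 1 - tent w) ^+ 2)); last first.
  by rewrite lerDr sqr_ge0.
have /andP[_ h] := tent_bound w; rewrite sw in h *.
have -> : (4 ^ n)%:R = (2 ^+ n) ^+ 2 :> R by rewrite natrX -exprM mulnC exprM -(natrX _ 2 2).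
have p : (0 : R) <= 2 ^+ n by exact: exprn_ge0.
by rewrite lerXn2r ?nnegrE //; move: h p; rewrite exprS; lra.
Qed.

(** The words [1^n 0] and [1^(n+1)] share the prefix [1^n], where [tent] is 0; so this function
    vanishes at both ends and peaks in the middle of the path. *)
Definition hat (v : word) : R := tent (take (size v).-1 v).

Lemma hat_rcons w c : hat (rcons w c) = tent w.
Proof. by rewrite /hat size_rcons -cats1 take_size_cat. Qed.

Lemma hat_endA n : hat (endA n) = 0.
Proof. by rewrite /endA hat_rcons tent_ones. Qed.

Lemma hat_endB n : hat (endB n) = 0.
Proof.
case: n => [|n]; first by rewrite /hat /= tent_nil.
by rewrite endB_S hat_rcons tent_ones.
Qed.

Lemma hat_aut_a v : (hat (aut_a v) - hat v) ^+ 2 <= 1.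
Proof.
case/lastP: v => [|w c]; first by rewrite subrr expr0n.
case: w => [|x w]; first by case: c; rewrite /hat /= tent_nil subrr expr0n.
rewrite (_ : aut_a _ = rcons (aut_a (x :: w)) c) // !hat_rcons.
rewrite -[leLHS]real_normK ?num_real // expr_le1 //; exact: tent_aut_a.
Qed.

Lemma hat_flip v : (hat (flip v) - hat v) ^+ 2 <= 1.
Proof.
case/lastP: v => [|w c]; first by rewrite subrr expr0n.
suff [w' -> hw] : exists2 w', flip (rcons w c) = rcons w' (last c (flip (rcons w c))) &
    `|tent w' - tent w| <= 1.
  by rewrite !hat_rcons -[leLHS]real_normK ?num_real // expr_le1.
case: w => [|x w]; first by exists [::]; rewrite ?subrr ?normr0 //; case: c.
have [wE|wE|iw] := endA_or_inner (size w) (x :: w).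
- exists (x :: w); last by rewrite subrr normr0.
  by rewrite wE -cats1 flip_endA -[aut_a _]/[:: ~~ c] !cats1 last_rcons.
- exists (x :: w); last by rewrite subrr normr0.
  by rewrite wE -(cats1 (endB _) c) flip_endB (_ : flip [:: c] = [:: c]) ?cats1 ?last_rcons //; case: (c).
- exists (flip (x :: w)); last exact: tent_flip.
  by rewrite -(cats1 (x :: w) c) (@flip_inner (size w) (x :: w) [:: c] erefl iw).1 cats1 last_rcons.
Qed.

(** [hat] has increments at most 1 on [2 ^ (n + 2)] words, while its square sum is at least
    [2 * 8 ^ n], so the ratio decays like [4 ^ - n]. *)
Lemma cutoff_exists (eps : R) : 0 < eps -> exists k chi,
  [/\ chi (endA k) = 0, chi (endB k) = 0, 0 < wsum k.+1 (fun v => chi v ^+ 2),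
      wsum k.+1 (fun v => (chi (aut_a v) - chi v) ^+ 2) <=
        eps * wsum k.+1 (fun v => chi v ^+ 2) &
      wsum k.+1 (fun v => (chi (flip v) - chi v) ^+ 2) <=
        eps * wsum k.+1 (fun v => chi v ^+ 2)].
Proof.
move=> eps0; have [n hn] : exists n, 2 / eps < n%:R.
  by exists (Num.bound (2 / eps)); apply: archi_boundP; rewrite divr_ge0 // ltW.
exists n.+1, hat.
have s1 : 2 * (8 ^ n)%:R <= wsum n.+2 (fun v => hat v ^+ 2).
  rewrite wsum_rcons; under eq_wsum do rewrite !hat_rcons -mulr2n -mulr_natl.
  by rewrite wsumZ ler_pM2l // wsum_tent.
have s0 : (0 : R) < (8 ^ n)%:R by rewrite ltr0n expn_gt0.
have small : (2 ^ n.+2)%:R <= eps * wsum n.+2 (fun v => hat v ^+ 2).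
  apply: (@le_trans _ _ (eps * (2 * (8 ^ n)%:R))); last by rewrite ler_pM2l.
  have -> : (8 ^ n = 2 ^ n * 4 ^ n)%N by rewrite -expnMn.
  rewrite !expnS !natrM.
  have n4 : (n%:R : R) <= (4 ^ n)%:R by rewrite ler_nat ltnW // ltn_expl.
  have p2 : (0 : R) < (2 ^ n)%:R by rewrite ltr0n expn_gt0.
  have : 2 <= eps * (4 ^ n)%:R.
    by rewrite mulrC -ler_pdivrMr // (le_trans (ltW hn)).
  rewrite -(ler_pM2l p2) => h.
  have -> : eps * (2 * ((2 ^ n)%:R * (4 ^ n)%:R)) = 2 * ((2 ^ n)%:R * (eps * (4 ^ n)%:R)) by ring.
  by move: h; lra.
split; first exact: hat_endA.
- exact: hat_endB.
- by apply: lt_le_trans s1; rewrite mulr_gt0.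
- apply: le_trans small; rewrite -[leRHS]mul1r -wsum_cst; apply: ler_wsum => v _.
  exact: hat_aut_a.
- apply: le_trans small; rewrite -[leRHS]mul1r -wsum_cst; apply: ler_wsum => v _.
  exact: hat_flip.
Qed.

Variables (pa : R) (q : nat -> R).
Hypotheses (q0 : forall n, 0 < q n) (q1 : forall n, q n <= 1).
Notation res := (hres pa q).

(** The blocks are themselves arranged along a path indexed by the tails, with [aut_a] acting at the
    A ends and [flip] at the B ends. An amplitude [chi] that is constant on each block thus causes
    errors only at block ends, proportional to its increments. *)
Lemma res_tensor (E : R) n phi chi v w : size w = n.+1 ->
  let psi u := phi (take n.+1 u) * chi (drop n.+1 u) in
  res E psi (w ++ v) = chi v * res E phi w +
    (if w == endA n then q n * phi w * (chi (aut_a v) - chi v) else 0) +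
    (if w == endB n then q (n.+1 + index false v)%N * phi w * (chi (flip v) - chi v)
     else 0).
Proof.
move=> sw psi.
have psiE u v' : size u = n.+1 -> psi (u ++ v') = phi u * chi v'.
  by move=> su; rewrite /psi take_size_cat // drop_size_cat.
have inE u : size u = n.+1 -> res E (tailed v psi) u = chi v * res E phi u.
  move=> su; rewrite (@hres_ext _ _ _ _ _ (fun u' => chi v * phi u' + 0)); last first.
    by move=> u' su'; rewrite /tailed psiE ?su' // addr0 mulrC.
  by rewrite (hres_lin _ _ _ _ _ (fun=> 0)) [X in _ + X](_ : _ = 0) ?addr0 // /hres; ring.
have [wE|wE|iw] := endA_or_inner n w.
- rewrite wE eqxx (negbTE (endA_neq_endB n)) addr0 hres_endA inE ?size_endA //.
  by rewrite !psiE ?size_endA //; congr (_ + _); ring.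
- rewrite wE eqxx eq_sym (negbTE (endA_neq_endB n)) addr0 hres_endB inE ?size_endB //.
  by rewrite !psiE ?size_endB //; congr (_ + _); ring.
- have /andP[/negbTE -> /negbTE ->] := iw; rewrite !addr0.
  by rewrite (hres_inner _ _ _ _ _ sw iw) inE.
Qed.

Lemma approx_eigen_cutoff (E eps : R) : wspec pa q E -> 0 < eps -> exists n phi,
  [/\ phi (endA n) = 0, phi (endB n) = 0 & approx_eigen pa q E eps n.+1 phi].
Proof.
(* Three contributions, the residual of [phi] and the two kinds of block ends, each doubled by the
   inequality for the square of a sum. *)
move=> hE eps0; have e6 : 0 < eps / 6 by rewrite divr_gt0.
have [N [phi0 /(approx_eigen_lift 1)]] := hE _ e6.
rewrite addn1; move: (fun w => _) => phi [p0 hp].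
have [k [chi [cA cB c0 ca cf]]] := cutoff_exists e6.
pose psi u := phi (take N.+1 u) * chi (drop N.+1 u).
pose sp := wsum N.+1 (fun w => phi w ^+ 2); pose sc := wsum k.+1 (fun v => chi v ^+ 2).
have sE : wsum (N.+1 + k.+1) (fun u => psi u ^+ 2) = sp * sc.
  rewrite wsum_cat mulrC -wsumZ; apply: eq_wsum => w sw.
  rewrite mulrC -wsumZ; apply: eq_wsum => v _.
  by rewrite /psi take_size_cat // drop_size_cat // exprMn.
exists (N.+1 + k)%N, psi; rewrite -addnS; split.
- have -> : endA (N.+1 + k) = endB N ++ endA k.
    by rewrite /endA /endB nseqD rcons_cat.
  by rewrite /psi drop_size_cat ?size_endB // cA mulr0.
- have -> : endB (N.+1 + k) = endB N ++ endB k by rewrite /endB -nseqD addnS.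
  by rewrite /psi drop_size_cat ?size_endB // cB mulr0.
split; first by rewrite sE mulr_gt0.
rewrite sE wsum_cat.
pose T1 w := wsum k.+1 (fun v => chi v ^+ 2 * res E phi w ^+ 2).
pose T2 w := if w == endA N then sp * (eps / 6 * sc) else 0.
pose T3 w := if w == endB N then sp * (eps / 6 * sc) else 0.
have phi_sp w : size w = N.+1 -> phi w ^+ 2 <= sp.
  by move=> sw; apply: (wsum_ge_term (F := fun w => phi w ^+ 2)) => // u _; exact: sqr_ge0.
apply: le_trans (ler_wsum (F' := fun w => 2 * T1 w + 2 * (T2 w + T3 w)) _) _.
  move=> w sw; rewrite /T1 /T2 /T3.
  apply: (@le_trans _ _ (wsum k.+1 (fun v => 2 * (chi v ^+ 2 * res E phi w ^+ 2) +
    2 * ((if w == endA N then sp * (chi (aut_a v) - chi v) ^+ 2 else 0) +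
     (if w == endB N then sp * (chi (flip v) - chi v) ^+ 2 else 0))))).
    apply: ler_wsum => v _; rewrite (res_tensor _ _ _ _ sw).
    have qq j u : q j ^+ 2 * phi u ^+ 2 <= phi u ^+ 2.
      by rewrite ler_piMl ?sqr_ge0 // expr_le1 // ltW.
    have [wE|wE|/andP[/negbTE -> /negbTE ->]] := endA_or_inner N w.
    - rewrite wE eqxx (negbTE (endA_neq_endB N)) !addr0.
      apply: le_trans (sqrD_le _ _) _; rewrite !exprMn lerD2l ler_pM2l //.
      rewrite ler_wpM2r ?sqr_ge0 // (le_trans (qq _ _)) // phi_sp ?size_endA //.
    - rewrite wE eqxx eq_sym (negbTE (endA_neq_endB N)) !addr0 add0r.
      apply: le_trans (sqrD_le _ _) _; rewrite !exprMn lerD2l ler_pM2l //.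
      rewrite ler_wpM2r ?sqr_ge0 // (le_trans (qq _ _)) // phi_sp ?size_endB //.
    - rewrite !addr0 mulr0 addr0 exprMn. apply: ler_peMl; [apply: mulr_ge0; exact: sqr_ge0|by rewrite ler1n].
  rewrite wsumD !wsumZ lerD2l ler_pM2l // wsumD; apply: lerD; case: ifP => _.
  - by rewrite wsumZ ler_pM2l.
  - by rewrite wsum_cst mul0r.
  - by rewrite wsumZ ler_pM2l.
  - by rewrite wsum_cst mul0r.
rewrite wsumD !wsumZ wsumD.
rewrite (wsum_pred1 (fun=> sp * (eps / 6 * sc)) (size_endA N)).
rewrite (wsum_pred1 (fun=> sp * (eps / 6 * sc)) (size_endB N)).
have -> : wsum N.+1 T1 = wsum N.+1 (fun w => res E phi w ^+ 2) * sc.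
  rewrite mulrC -wsumZ; apply: eq_wsum => w _; rewrite /T1 mulrC -wsumZ.
  by apply: eq_wsum => v _; rewrite mulrC.
have : wsum N.+1 (fun w => res E phi w ^+ 2) * sc <= eps / 6 * sp * sc.
  by rewrite ler_pM2r.
have -> : sp * (eps / 6 * sc) = eps / 6 * sp * sc by ring.
have -> : eps * (sp * sc) = 6 * (eps / 6 * sp * sc) by field.
by lra.
Qed.

End Cutoff.

(** * A second eigenvalue close to any point of the spectrum *)

Section Doubling.
Variables (R : realType) (pa : R) (q : nat -> R).
Hypotheses (pa0 : 0 < pa) (q0 : forall n, 0 < q n) (q1 : forall n, q n <= 1).
Notation res := (hres pa q).
Implicit Types (phi psi : word -> R) (E : R).

Lemma hres_eq0 E phi w : (forall v, size v = size w -> phi v = 0) -> res E phi w = 0.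
Proof. by move=> h; rewrite (@hres_ext _ _ _ _ _ (fun=> 0)) // /hres; ring. Qed.

Lemma rcons_ends n (w : word) : size w = n.+2 ->
  exists2 v : word, size v = n.+1 & exists c, w = v ++ [:: c].
Proof.
case/lastP: w => // v c; rewrite size_rcons => -[sv].
by exists v => //; exists c; rewrite cats1.
Qed.

(* The level graph is a path, so a solution is propagated from one end. *)
Lemma propagation E n phi :
  (phi (endB n) = 0 -> (forall w, size w = n.+1 -> w != endA n -> res E phi w = 0) ->
    forall w, size w = n.+1 -> phi w = 0) /\
  (phi (endA n) = 0 -> (forall w, size w = n.+1 -> w != endB n -> res E phi w = 0) ->
    forall w, size w = n.+1 -> phi w = 0).
Proof.
elim: n phi => [|n IH] phi.
  split=> h0 hr.
    have := hr [:: true] erefl isT; rewrite /hres /= -[[:: true]]/(endB 0) h0.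
    rewrite !subr0 !mulr0 addr0 subr0 => /eqP; rewrite mulf_eq0 gt_eqF //= => /eqP e.
    by move=> [|[] [|? ?]].
  have := hr [:: false] erefl isT; rewrite /hres /= -[[:: false]]/(endA 0) h0.
  rewrite !subr0 !mulr0 addr0 subr0 => /eqP; rewrite mulf_eq0 gt_eqF //= => /eqP e.
  by move=> [|[] [|? ?]].
have step c : phi (endB n ++ [:: c]) = 0 ->
    (forall w, size w = n.+2 -> w != endB n ++ [:: ~~ c] -> res E phi w = 0) ->
    forall w, size w = n.+2 -> phi w = 0.
  move=> h0 hr.
  have szc w d : size w = n.+1 -> size (w ++ [:: d]) = n.+2.
    by move=> sw; rewrite size_cat sw addn1.
  have neq w d : w != endB n -> w ++ [:: d] != endB n ++ [:: ~~ c].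
    by move=> h; rewrite !cats1 eqseq_rcons (negbTE h).
  have inn d w : size w = n.+1 -> inner n w -> res E (tailed [:: d] phi) w = 0.
    move=> sw iw; rewrite -(hres_inner _ _ _ _ _ sw iw) hr ?szc // neq //.
    by case/andP: iw.
  have z1 w : size w = n.+1 -> phi (w ++ [:: c]) = 0.
    apply: (IH (tailed [:: c] phi)).1 => // {}w sw wA.
    have [wE|wE|iw] := endA_or_inner n w; [by rewrite wE eqxx in wA| |exact: inn].
    have := hres_endB pa q E phi n [:: c].
    have -> : flip [:: c] = [:: c] by case: (c).
    rewrite subrr mulr0 addr0 wE => <-; apply: hr; first by rewrite szc ?size_endB.
    by rewrite !cats1 eqseq_rcons eqxx /=; case: (c).
  have hA d : res E phi (endA n ++ [:: d]) = 0.
    by apply: hr; rewrite ?szc ?size_endA // neq // endA_neq_endB.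
  have uA : phi (endA n ++ [:: ~~ c]) = 0.
    have := hA c; rewrite hres_endA hres_eq0; last first.
      by move=> v; rewrite size_endA => /z1.
    rewrite z1 ?size_endA // subr0 add0r => /eqP; rewrite mulf_eq0 gt_eqF //=.
    by move/eqP.
  have z2 w : size w = n.+1 -> phi (w ++ [:: ~~ c]) = 0.
    apply: (IH (tailed [:: ~~ c] phi)).2 => // {}w sw wB.
    have [wE|wE|iw] := endA_or_inner n w; [|by rewrite wE eqxx in wB|exact: inn].
    have := hA (~~ c); rewrite hres_endA uA /= negbK z1 ?size_endA // subrr mulr0 addr0.
    by rewrite wE.
  move=> w /rcons_ends[v sv [d ->]].
  have [->|dc] := eqVneq d c; first exact: z1.
  by have -> : d = ~~ c; [move: dc; case: (d); case: (c)|exact: z2].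
split.
  by rewrite endB_S -cats1 endA_S -cats1; exact: (step true).
by rewrite endA_S -cats1 endB_S -cats1; exact: (step false).
Qed.

Lemma simple_spectrum E N phi : phi (nseq N true) = 0 ->
  (forall w, size w = N -> res E phi w = 0) -> forall w, size w = N -> phi w = 0.
Proof.
case: N => [|n] h0 hr; first by move=> [].
by apply: (propagation E n phi).1 => // w sw _; exact: hr.
Qed.

Lemma wsum_delta N phi x : size x = N ->
  wsum N (fun u => phi u * (x == u)%:R) = phi x.
Proof.
move=> sx; rewrite -(wsum_pred1 phi sx); apply: eq_wsum => u _.
by rewrite eq_sym; case: eqP => _; rewrite ?mulr1 ?mulr0.
Qed.

Lemma res_delta E N phi w : size w = N ->
  wsum N (fun u => phi u * res E (fun v => (v == u)%:R) w) = res E phi w.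
Proof.
move=> sw; rewrite /hres -(wsum_delta phi sw).
rewrite -(@wsum_delta N phi (aut_a w)) ?size_aut_a // -(@wsum_delta N phi (flip w)) ?size_flip //.
set W1 := wsum N (fun u => _ * (aut_a w == u)%:R).
set W2 := wsum N (fun u => _ * (flip w == u)%:R).
set W3 := wsum N (fun u => _ * (w == u)%:R).
transitivity (pa * W1 + (q (index false w) * W2 + (- pa - q (index false w) - E) * W3)).
  by rewrite -!wsumZ -!wsumD; apply: eq_wsum => u _; ring.
by ring.
Qed.

Lemma res_delta_sym E u w :
  res E (fun v => (v == u)%:R) w = res E (fun v => (v == w)%:R) u.
Proof.
rewrite /hres (eq_sym u w).
have -> : (aut_a w == u) = (aut_a u == w).
  by apply/eqP/eqP => <-; rewrite aut_aK.
have e : (flip w == u) = (flip u == w) by apply/eqP/eqP => <-; rewrite flipK.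
congr (_ + _ - _); rewrite e.
have [h|_] := boolP (flip u == w); last first.
  have [->|_] := eqVneq w u => //.
  by rewrite subrr !mulr0.
by rewrite -(eqP h) index_flip.
Qed.

Section Doubled.
Variables (E : R) (n : nat) (phi : word -> R).
Hypothesis phiA : phi (endA n) = 0.

Definition copy (c : bool) (v : word) : R :=
  (last false v == c)%:R * phi (take n.+1 v).

Lemma copy_rcons c w d : size w = n.+1 ->
  copy c (rcons w d) = (d == c)%:R * phi w.
Proof. by move=> sw; rewrite /copy last_rcons -cats1 take_size_cat. Qed.

(** The two halves of the next level meet at [endA], where [phi] vanishes, so a copy of [phi] on one
    half leaves no residual on the other. *)
Lemma res_copy c w d : size w = n.+1 ->
  res E (copy c) (rcons w d) = (d == c)%:R * res E phi w.
Proof.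
move=> sw; rewrite -cats1.
have tE : res E (tailed [:: d] (copy c)) w = (d == c)%:R * res E phi w.
  rewrite (@hres_ext _ _ _ _ _ (fun v => (d == c)%:R * phi v + 0)); last first.
    by move=> v sv; rewrite /tailed cats1 copy_rcons ?addr0 // sv.
  by rewrite (hres_lin _ _ _ _ _ (fun=> 0)) (@hres_eq0 _ (fun=> 0)) // addr0.
have [wE|wE|iw] := endA_or_inner n w.
- rewrite {1}wE hres_endA -wE tE -[aut_a _]/[:: ~~ d] !cats1 !copy_rcons // wE phiA.
  by rewrite !mulr0 subrr mulr0 addr0.
- rewrite {1}wE hres_endB -wE tE (_ : flip [:: d] = [:: d]); last by case: (d).
  by rewrite subrr mulr0 addr0.
- by rewrite (hres_inner _ _ _ _ _ sw iw).
Qed.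

Lemma wsum_copy c d (F : word -> R) (G : bool -> word -> R) :
    (forall w c e, size w = n.+1 -> G c (rcons w e) = (e == c)%:R * F w) ->
  wsum n.+2 (fun v => G c v * G d v) = (c == d)%:R * wsum n.+1 (fun w => F w ^+ 2).
Proof.
move=> hG; rewrite wsum_rcons -wsumZ; apply: eq_wsum => w sw.
by rewrite !hG //; case: c; case: d; rewrite /=; ring.
Qed.

(** The two copies are orthogonal and so are their residuals, which are equally long. The eigenvalue
    obtained differs from [E] whether or not [E] is itself an eigenvalue of that level. *)
Lemma second_eigenvalue eps : approx_eigen pa q E eps n.+1 phi ->
  exists2 d, d != 0 & d ^+ 2 <= eps /\ wspec pa q (E + d).
Proof.
move=> [p0 hp]; pose ws := words n.+2; pose l := size ws.
have memB : endB n.+1 \in ws by rewrite mem_words size_endB.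
have kB : (index (endB n.+1) ws < l)%N by rewrite index_mem.
pose k := Ordinal kB.
pose el (j : 'I_l) : word := nth [::] ws j.
have sel j : size (el j) = n.+2.
  by apply/eqP; rewrite -mem_words mem_nth.
have elk : el k = endB n.+1 by rewrite /el /= nth_index.
pose fn (u : 'rV[R]_l) (w : word) : R := u 0 (insubd k (index w ws)).
have fnE u j : fn u (el j) = u 0 j.
  rewrite /fn; congr (u 0 _); apply: val_inj.
  by rewrite val_insubd index_uniq ?uniq_words // ltn_ord.
have wsE (F : word -> R) : wsum n.+2 F = \sum_(j < l) F (el j).
  by rewrite /wsum (big_nth [::]) big_mkord.
have elP w : size w = n.+2 -> exists j, w = el j.
  move=> sw; have wi : w \in ws by rewrite mem_words sw.
  have h : (index w ws < l)%N by rewrite index_mem.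
  by exists (Ordinal h); rewrite /el /= nth_index.
pose A : 'M[R]_l := \matrix_(i, j) res E (fun v => (v == el i)%:R) (el j).
have symA : A^T = A.
  by apply/matrixP => i j; rewrite !mxE res_delta_sym.
have rowA (p : nat) (X : 'M[R]_(p, l)) (f : 'I_p -> word -> R) :
    (forall i j, X i j = f i (el j)) -> forall i j, (X *m A) i j = res E (f i) (el j).
  move=> hX i j; rewrite mxE -(res_delta E (f i) (sel j)) wsE.
  by apply: eq_bigr => r _; rewrite hX mxE.
have fnA u j : (u *m A) 0 j = res E (fn u) (el j).
  by apply: (rowA 1%N u (fun=> fn u)) => i r; rewrite fnE ord1.
have simple (u : 'rV[R]_l) : u *m A = 0 -> u 0 k = 0 -> u = 0.
  move=> uA uk; apply/matrixP => i j; rewrite ord1 mxE -fnE.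
  apply: (@simple_spectrum E n.+2) => //.
    by rewrite -[nseq _ _]/(endB n.+1) -elk fnE.
  by move=> w /elP[r ->]; rewrite -fnA uA mxE.
pose X : 'M[R]_(2, l) := \matrix_(i, j) copy (i == 0) (el j).
have bij (i j : 'I_2) : ((i == 0) == (j == 0)) = (i == j).
  by case: i j => [[|[|?]] ?] [[|[|?]] ?].
have XX : X *m X^T = (wsum n.+1 (fun w => phi w ^+ 2))%:M.
  apply/matrixP => i j; rewrite !mxE.
  transitivity (wsum n.+2 (fun v => copy (i == 0) v * copy (j == 0) v)).
    by rewrite wsE; apply: eq_bigr => r _; rewrite !mxE.
  rewrite (@wsum_copy _ _ phi) => [|w c e sw]; last exact: copy_rcons.
  by rewrite bij mulr_natl.
have XA : (X *m A) *m (X *m A)^T = (wsum n.+1 (fun w => res E phi w ^+ 2))%:M.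
  apply/matrixP => i j; rewrite mxE [RHS]mxE.
  transitivity (wsum n.+2 (fun v => res E (copy (i == 0)) v * res E (copy (j == 0)) v)).
    rewrite wsE; apply: eq_bigr => r _; rewrite [in X in _ * X]mxE.
    by rewrite !(rowA _ X (fun i => copy (i == 0))) // => a b; rewrite mxE.
  rewrite (@wsum_copy _ _ (res E phi) (fun c => res E (copy c))) => [|w c e sw]; last exact: res_copy.
  by rewrite bij mulr_natl.
have [d [u [d0 de u0 uE]]] := two_eigenvalues symA simple XX XA p0 hp.
exists d => //; split=> // eps' eps'0; exists n.+2, (fn u); split.
  rewrite lt_def wsum_ge0 ?andbT => [|w _]; last exact: sqr_ge0.
  apply: contra u0 => /eqP s0; apply/eqP/matrixP => i j; rewrite ord1 mxE -fnE.
  apply/eqP; rewrite -sqrf_eq0; apply/eqP.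
  by apply: (@wsum_eq0 _ n.+2 (fun w => fn u w ^+ 2)); rewrite ?s0 ?sel // => w _; exact: sqr_ge0.
rewrite (eq_wsum (F' := fun=> 0)).
  by rewrite wsum_cst mul0r mulr_ge0 ?(ltW eps'0) // wsum_ge0 // => w _; exact: sqr_ge0.
move=> w /elP[j ->]; rewrite (hres_shift _ _ _ E) -fnA uE mxE fnE.
by rewrite (_ : _ + _ = 0) ?expr0n //; ring.
Qed.

End Doubled.

Lemma wspec_not_isolated E (delta : R) : wspec pa q E -> 0 < delta ->
  exists2 E', wspec pa q E' & E' != E /\ `|E' - E| <= delta.
Proof.
move=> hE d0; have d20 : 0 < delta ^+ 2 by rewrite exprn_gt0.
have [n [phi [phiA _ h]]] := approx_eigen_cutoff q0 q1 hE d20.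
have [d dn0 [dd hd]] := second_eigenvalue phiA h.
exists (E + d) => //; split.
  by rewrite -subr_eq0 addrC addKr.
rewrite addrC addKr -(@ler_pXn2r _ 2) ?nnegrE ?(ltW d0) //.
by rewrite real_normK ?num_real.
Qed.

End Doubling.

(** * The spectrum on words is a null set *)

Section WordSpectrumNull.
Variables (R : realType) (pa : R) (q : nat -> R).
Hypotheses (pa0 : 0 < pa) (q0 : forall n, 0 < q n) (pq1 : forall n, pa + q n <= 1).
Notation kap := (kap pa q).
Notation mu := (@lebesgue_measure R).
Local Notation normc := ComplexField.Normc.normc.

Lemma regularE t : regular kap t <->
  t != 0 /\ forall n, kap n - rS kap t n.+1 != 0.
Proof.
suff e n : (kap n)%:C%C - respS kap t%:C%C n.+1 = (kap n - rS kap t n.+1)%:C%C.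
  split=> -[t0 h]; split=> // n; have := h n; rewrite e; last by rewrite fmorph_eq0.
  by rewrite fmorph_eq0.
by rewrite (resp_real _ _ _).1 rmorphB.
Qed.

Lemma measurable_wspec : measurable (wspec pa q).
Proof. exact: closed_measurable (@closed_wspec _ pa q). Qed.

Lemma wspec_null (V : seq R) (v1 v2 : R) :
    (forall n, kap n \in V) -> (forall v, v \in V -> 0 < v) -> v1 != v2 ->
    (forall n0, exists2 n, (n0 <= n)%N & kap n = v1) ->
    (forall n0, exists2 n, (n0 <= n)%N & kap n = v2) ->
  mu (wspec pa q) = 0%E.
Proof.
move=> kV V0 v12 inf1 inf2.
have kap0 := kap_gt0 pa0 q0.
pose I := [set t | ~ regular kap t].
have cI : countable I := countable_irregular kap0.
have mI : measurable I by exact: countable_measurable.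
pose K0 := wspec pa q `\` I.
have mK0 : measurable K0 by exact: measurableD measurable_wspec mI.
have n0 : mu K0 = 0%E.
  apply: (null_boundary kap0 kV V0 v12 inf1 inf2 mK0).
    move=> t [/(wspec_bound pa0 q0 pq1)/andP[h1 h2] _].
    by rewrite ler_norml; move: h1 h2; lra.
  move=> t [ht /contrapT/regularE[t0 reg]] n npos.
  have [j nj hj] := wspec_resonance pa0 q0 kV ht t0 reg npos.
  exists j => //.
  rewrite (resp_real _ _ _).1 (resp_real _ _ n).1 (resp_real _ _ _).2.
  rewrite -!rmorphB normcf_div !normc_real normc_nat.
  by move: hj; rewrite normrM normfV normr_nat.
apply/eqP; rewrite eq_le measure_ge0 andbT.
apply: (@le_trans _ _ (mu K0 + mu I)%E); last first.
  by rewrite n0 (countable_lebesgue_measure0 cI) adde0.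
have := @measureU2 _ _ _ mu K0 I mK0 mI; apply: le_trans.
apply: le_measure; rewrite ?inE //; first exact: measurable_wspec.
  exact: measurableU.
by move=> t ht; have [|] := pselect (I t); [right|left].
Qed.

End WordSpectrumNull.

(** * Cantor sets on the line *)

Section Cantor.
Variable R : realType.
Notation mu := (@lebesgue_measure R).

Lemma null_perfect_cantor (K : set R) (L : R) : K !=set0 -> closed K ->
    (forall x, K x -> `|x| <= L) -> mu K = 0%E ->
    (forall x d, K x -> 0 < d -> exists2 y, K y & y != x /\ `|y - x| <= d) ->
  cantor_set K.
Proof.
move=> K0 cK bK nK perfect; split=> //.
- apply: (subclosed_compact cK (@segment_compact _ (- L) L)) => x /bK.
  by rewrite /= in_itv /= ler_norml.
- move=> x Kx; apply/seteqP; split; last by move=> _ ->; exact: connected_component_refl.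
  (* A connected set with two points contains the interval between them, which would have positive
     measure. *)
  have noint a b : a < b -> `[a, b]%classic `<=` K -> False.
    move=> ab sub.
    have : (mu `[a, b]%classic <= mu K)%E.
      by apply: le_measure; rewrite ?inE //; exact: closed_measurable.
    rewrite nK lebesgue_measure_itv /= lte_fin ab -EFinB lee_fin subr_le0.
    by rewrite leNgt ab.
  move=> y [C [Cx CK /connected_intervalP itv] Cy] /=.
  apply/eqP; apply: contraT => yx; exfalso.
  have [lt|gt|e] := ltgtP x y; last by rewrite e eqxx in yx.
  + apply: (noint x y lt) => z; rewrite /= in_itv /= => hz.
    exact: CK (itv x y Cx Cy z hz).
  + apply: (noint y x gt) => z; rewrite /= in_itv /= => hz.
    exact: CK (itv y x Cy Cx z hz).
- apply/seteqP; split=> // x [/set_mem Kx [V nV VK]].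
  move: nV => /nbhs_ballP[e /= e0 eV].
  have [y Ky [yx ye]] := perfect x (e / 2) Kx (divr_gt0 e0 (ltr0n _ 2)).
  have : (V `&` K) y.
    split=> //; apply: eV; rewrite /ball /= distrC (le_lt_trans ye) //.
    by rewrite ltr_pdivrMr // ltr_pMr // ltr1n.
  by rewrite VK /= => /eqP; rewrite (negbTE yx).
Qed.

End Cantor.

(** * Charts of limit graphs *)

Section TreeAction.
Variables (m : nat) (xi : nat -> 'rV['Z_2]_m -> 'Z_2).

Definition tree_auto (g : word -> word) : Prop :=
  (forall w, size (g w) = size w) /\ (forall k w, g (take k w) = take k (g w)).

Lemma aut_b_take (zeta : nat -> 'rV['Z_2]_m -> 'Z_2) b k w :
  aut_b zeta b (take k w) = take k (aut_b zeta b w).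
Proof.
elim: w zeta k => [|[] w IH] zeta [|k] //=; first by rewrite IH.
by case: ifP => _; rewrite ?aut_a_take.
Qed.

Lemma sgen_tree s : tree_auto (sgen xi s).
Proof.
case: s => [b|]; split=> /= [w|k w].
- by rewrite aut_bE; case: ifP => _; rewrite ?size_flip.
- exact: aut_b_take.
- exact: size_aut_a.
- exact: aut_a_take.
Qed.

Lemma size_sgen s w : size (sgen xi s w) = size w.
Proof. exact: (sgen_tree s).1. Qed.

Lemma sgenK s : involutive (sgen xi s).
Proof.
case: s => [b|] w /=; last exact: aut_aK.
rewrite [X in aut_b _ _ X]aut_bE; case: ifP => h; first by rewrite aut_bE h.
by rewrite aut_bE index_flip h flipK.
Qed.

Lemma spinal_tree g : spinal_group xi g -> tree_auto g.
Proof.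
elim=> [s||{}g h _ [sg tg] _ [sh th]|{}g h _ [sg tg] gK hK].
- exact: sgen_tree.
- by [].
- by split=> [w|k w] /=; rewrite ?sg ?sh // th tg.
- split=> [w|k w]; first by rewrite -[in RHS](hK w) sg.
  by apply: (can_inj gK); rewrite hK tg hK.
Qed.

Lemma mkseq_bact g (x : bdry) N : tree_auto g ->
  mkseq (bact g x) N = g (mkseq x N).
Proof.
move=> [sg tg]; apply: (@eq_from_nth _ false); first by rewrite sg !size_mkseq.
move=> i; rewrite size_mkseq => iN; rewrite nth_mkseq // /bact.
have -> : mkseq x i.+1 = take i.+1 (mkseq x N).
  by rewrite /mkseq -map_take take_iota; have /minn_idPl -> := iN.
by rewrite tg nth_take.
Qed.

Lemma bdry_eqP (x y : bdry) : (forall N, mkseq x N = mkseq y N) -> x = y.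
Proof.
move=> h; apply/funext => n; have := congr1 (fun s => nth false s n) (h n.+1).
by rewrite !nth_mkseq.
Qed.

Lemma bact_comp g h (x : bdry) : tree_auto g -> tree_auto h ->
  bact g (bact h x) = bact (g \o h) x.
Proof.
move=> tg th; have tgh : tree_auto (g \o h).
  by case: tg th => [sg tg] [sh th]; split=> [w|k w] /=; rewrite ?sg ?sh // th tg.
by apply: bdry_eqP => N; rewrite !mkseq_bact.
Qed.

Lemma bact_sgenK s (x : bdry) : bact (sgen xi s) (bact (sgen xi s) x) = x.
Proof.
by apply: bdry_eqP => N; rewrite !mkseq_bact ?sgenK //; exact: sgen_tree.
Qed.

Lemma torbit_sgen x y s : torbit xi x y -> torbit xi x (bact (sgen xi s) y).
Proof.
move=> [g hg ->]; exists (sgen xi s \o g).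
  by apply: spinal_mul => //; exact: spinal_gen.
by rewrite bact_comp //; [exact: sgen_tree|exact: spinal_tree].
Qed.

End TreeAction.

Section Charts.
Variables (m : nat) (xi : nat -> 'rV['Z_2]_m -> 'Z_2) (X : lgraph (slabel m)).
Hypothesis hX : schreier_closure xi X.
Notation V := (gvert X).
Notation bs s := (bact (sgen xi s)).

Lemma gballS n (Y : lgraph (slabel m)) (y : gvert Y) : gball n y -> gball n.+1 y.
Proof. by left. Qed.

Lemma gball_le n k (Y : lgraph (slabel m)) (y : gvert Y) :
  (n <= k)%N -> gball n y -> gball k y.
Proof.
by move=> /subnK <- h; elim: (k - n)%N => // i IH; exact: gballS.
Qed.

(** The last clause carries edges back: the endpoint of an edge of the Schreier graph lies in the
    next ball and has a preimage there. In this way the limit graph inherits that every generator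
    acts. *)
Lemma ball_chart n : exists F : V -> bdry, [/\
  forall y z, gball n y -> gball n z -> F y = F z -> y = z,
  forall s y z, gball n y -> gball n z -> (gedge s y z <-> bs s (F y) = F z) &
  forall k s y, (k < n)%N -> gball k y ->
    exists2 z, gball k.+1 z & bs s (F y) = F z].
Proof.
have [Y [[x0 ->] [f [[fun_f inj_f surj_f] f0 fe]]]] := hX.2 n.
have hom k y : (k <= n)%N -> gball k y -> gball k (f y).
  elim: k y => [|k IH] y kn; first by move=> ->.
  case=> [h|[z hz [s e]]]; first by left; apply: IH => //; exact: ltnW.
  right; exists (f z); first by apply: IH => //; exact: ltnW.
  exists s; have zn : gball n z by apply: gball_le hz; exact: ltnW.
  have yn : gball n y by apply: (gball_le kn); right; exists z => //; exists s.
  by case: e => e; [left|right]; apply/fe.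
exists (fun y => val (f y)); split.
- move=> y z hy hz e; apply: inj_f; rewrite ?inE //; exact: val_inj.
- by move=> s y z hy hz; rewrite fe.
move=> k s y kn hy.
have oy : torbit xi x0 (bs s (val (f y))).
  by apply: torbit_sgen; have := valP (f y); rewrite inE.
pose z' : gvert (schreier xi x0) := exist _ (bs s (val (f y))) (mem_set oy).
have hz' : gball k.+1 z'.
  by right; exists (f y); [apply: hom => //; exact: ltnW|exists s; left].
have [z hz fz] := surj_f z' (gball_le kn hz').
have e : bs s (val (f y)) = val (f z) by rewrite fz.
exists z => //; right; exists y => //; exists s; left.
by apply/fe => //; apply: gball_le hy; exact: ltnW.
Qed.

Lemma in_ball (y : V) : exists n, gball n y.
Proof. exact: hX.1. Qed.

Lemma gedge_ex s (y : V) : exists z, gedge s y z.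
Proof.
have [n hn] := in_ball y; have [F [_ fe fs]] := ball_chart n.+1.
have [z hz e] := fs n s y (ltnSn n) hn.
by exists z; apply/fe => //; exact: gballS.
Qed.

Lemma gedge_uniq s (y z z' : V) : gedge s y z -> gedge s y z' -> z = z'.
Proof.
move=> e e'; have [n hn] := in_ball y; have [F [inj fe _]] := ball_chart n.+1.
have hz : gball n.+1 z by right; exists y => //; exists s; left.
have hz' : gball n.+1 z' by right; exists y => //; exists s; left.
have hy : gball n.+1 y := gballS hn.
by apply: inj => //; move/fe: e => <- //; move/fe: e' => <-.
Qed.

Lemma gact_edge s (y : V) : gedge s y (gact s y).
Proof.
rewrite /gact; case: xgetP => // no; have [z hz] := gedge_ex s y.
by case: (no z).
Qed.

Lemma gactP s (y z : V) : gedge s y z -> gact s y = z.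
Proof. by move=> e; apply: (@gedge_uniq s y) => //; exact: gact_edge. Qed.

Lemma gact_ball s n (y : V) : gball n y -> gball n.+1 (gact s y).
Proof. by move=> hy; right; exists y => //; exists s; left; exact: gact_edge. Qed.

Lemma chart r : exists F : V -> bdry,
  (forall y z, gball r y -> gball r z -> F y = F z -> y = z) /\
  (forall s y, gball r y -> F (gact s y) = bs s (F y)).
Proof.
have [F [inj fe fs]] := ball_chart r.+1; exists F; split.
  by move=> y z hy hz; apply: inj; exact: gballS.
move=> s y hy; have := gact_edge s y; move/fe => -> //; first exact: gballS.
exact: gact_ball.
Qed.

Lemma gact_rev s (y z : V) : gedge s y z -> gedge s z y.
Proof.
move=> e; have [n hn] := in_ball y; have [F [inj fe _]] := ball_chart n.+1.
have hz : gball n.+1 z by right; exists y => //; exists s; left.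
have hy : gball n.+1 y := gballS hn.
by apply/fe => //; move/fe: e => <- //; rewrite bact_sgenK.
Qed.

Lemma gactK s : involutive (@gact _ X s).
Proof. by move=> y; apply: gactP; apply: gact_rev; exact: gact_edge. Qed.

Lemma finite_gball n : finite_set (gball n : set V).
Proof.
elim: n => [|n IH]; first exact: finite_set1.
apply: (@sub_finite_set _ _ (gball n `|`
    \bigcup_(s in [set: slabel m]) (gact s @` gball n))).
  move=> y [h|[z hz [s [e|e]]]]; first by left.
    by right; exists s => //; exists z => //; exact: gactP.
  by right; exists s => //; exists z => //; exact: gactP (gact_rev e).
rewrite finite_setU; split=> //.
by apply: bigcup_finite => [|s _]; [exact: finite_finset|exact: finite_image].
Qed.

Lemma separate (A : set V) (F : V -> bdry) : finite_set A ->
    (forall y z, A y -> A z -> F y = F z -> y = z) ->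
  exists N0, forall N, (N0 <= N)%N ->
    forall y z, A y -> A z -> mkseq (F y) N = mkseq (F z) N -> y = z.
Proof.
move=> /finite_seqP[s ->] inj.
pose idx y z := xget 0%N [set i | F y i <> F z i].
exists (\max_(y <- s) \max_(z <- s) (idx y z).+1)%N => N hN y z ys zs e.
apply: inj => //; apply/funext => i; apply: contrapT => ni.
have hi : F y (idx y z) <> F z (idx y z).
  by rewrite /idx; case: xgetP => [j _ //|no]; case: (no i).
apply: hi.
have iN : (idx y z < N)%N.
  apply: leq_trans hN.
  have h1 := @leq_bigmax_seq V s xpredT (fun z => (idx y z).+1) z zs isT.
  have h2 := @leq_bigmax_seq V s xpredT (fun y => \max_(z <- s) (idx y z).+1)%N y ys isT.
  exact: leq_trans h1 h2.
have := congr1 (fun t => nth false t (idx y z)) e.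
by rewrite !nth_mkseq.
Qed.

(** Finitely many boundary points are told apart by their prefixes of one common length. *)
Lemma word_chart r : exists N0, forall N, (N0 <= N)%N -> exists e : V -> word,
  [/\ forall y, size (e y) = N,
      forall y z, gball r y -> gball r z -> e y = e z -> y = z &
      forall s y, gball r y -> e (gact s y) = sgen xi s (e y)].
Proof.
have [F [inj equi]] := chart r.
have [N0 sep] := separate (finite_gball r) inj.
exists N0 => N /sep {}sep; exists (fun y => mkseq (F y) N); split=> //.
  by move=> y; rewrite size_mkseq.
by move=> s y hy; rewrite equi // mkseq_bact //; exact: sgen_tree.
Qed.

End Charts.

(** * Resolvents *)

Definition sqn (R : realType) (c : R[i]) : R := complex.Re c ^+ 2 + complex.Im c ^+ 2.

Section Operators.
Variables (R : realType) (m : nat) (p : slabel m -> R).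
Variables (U : Type) (act : slabel m -> U -> U).
Local Notation C := R[i].
Implicit Types (h k : U -> C) (z : C) (t : R).

Definition gop h (u : U) : C := \sum_(s : slabel m) (p s)%:C%C * h (act s u).
Definition Lop z h (u : U) : C := gop h u - z * h u.
(* With [B = (T - z)^* (T - z)] bounded below and [t] small, [Rop = 1 - t B] is a
   contraction, and the Neumann sums [Qop] converge to the resolvent. *)
Definition Rop z t h (u : U) : C := h u - t%:C%C * Lop (z^*)%C (Lop z h) u.
Definition Qop z t n h (u : U) : C :=
  \sum_(k < n) t%:C%C * Lop (z^*)%C (iter k (Rop z t) h) u.

Lemma gop_lin a h k u : gop (fun v => a * h v + k v) u = a * gop h u + gop k u.
Proof.
rewrite /gop mulr_sumr -big_split; apply: eq_bigr => s _ /=.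
by rewrite mulrDr mulrCA.
Qed.

Lemma Lop_lin z a h k u : Lop z (fun v => a * h v + k v) u = a * Lop z h u + Lop z k u.
Proof. by rewrite /Lop gop_lin; ring. Qed.

Lemma LopC z z' h u : Lop z (Lop z' h) u = Lop z' (Lop z h) u.
Proof.
have e y y' : Lop y (Lop y' h) u = gop (gop h) u - (y + y') * gop h u + y * y' * h u.
  rewrite /Lop -/(Lop y' h).
  have -> : gop (Lop y' h) u = gop (fun v => - y' * h v + gop h v) u.
    by congr (gop _ u); apply/funext => v; rewrite /Lop; ring.
  by rewrite gop_lin; ring.
by rewrite !e; ring.
Qed.

Lemma Rop_lin z t a h k u :
  Rop z t (fun v => a * h v + k v) u = a * Rop z t h u + Rop z t k u.
Proof.
rewrite /Rop.
have -> : Lop z (fun v => a * h v + k v) = fun v => a * Lop z h v + Lop z k v.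
  by apply/funext => v; exact: Lop_lin.
by rewrite Lop_lin; ring.
Qed.

Lemma Lop_Rop z z' t h : Lop z' (Rop z t h) = Rop z t (Lop z' h).
Proof.
apply/funext => u; rewrite {2}/Rop.
have -> : Rop z t h = fun v => - t%:C%C * Lop (z^*)%C (Lop z h) v + h v.
  by apply/funext => v; rewrite /Rop; ring.
rewrite Lop_lin LopC.
have -> : Lop z' (Lop z h) = Lop z (Lop z' h) by apply/funext => v; exact: LopC.
by ring.
Qed.

Lemma Lop_iter z z' t n h : Lop z' (iter n (Rop z t) h) = iter n (Rop z t) (Lop z' h).
Proof. by elim: n => //= n <-; exact: Lop_Rop. Qed.

Lemma iter_Rop_lin z t n a h k u : iter n (Rop z t) (fun v => a * h v + k v) u =
  a * iter n (Rop z t) h u + iter n (Rop z t) k u.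
Proof.
elim: n u => //= n IH u; rewrite -Rop_lin; congr (Rop z t _ u).
by apply/funext => v; exact: IH.
Qed.

Lemma Qop_lin z t n a h k u :
  Qop z t n (fun v => a * h v + k v) u = a * Qop z t n h u + Qop z t n k u.
Proof.
rewrite /Qop mulr_sumr -big_split; apply: eq_bigr => i _ /=.
rewrite mulrCA -mulrDr -Lop_lin; congr (_ * Lop _ _ u).
by apply/funext => v; exact: iter_Rop_lin.
Qed.

Lemma Rop_step z t n h u : t%:C%C * Lop (z^*)%C (Lop z (iter n (Rop z t) h)) u =
  iter n (Rop z t) h u - iter n.+1 (Rop z t) h u.
Proof. by rewrite iterS {3}/Rop opprB addrC subrK. Qed.

Lemma Lop_Qop z t n h u : Lop z (Qop z t n h) u = h u - iter n (Rop z t) h u.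
Proof.
elim: n => [|n IH].
  rewrite (_ : Qop z t 0 h = fun=> 0); last by apply/funext => v; rewrite /Qop big_ord0.
  by rewrite /Lop /gop big1 => [|s _]; rewrite ?mulr0 ?subrr.
have -> : Qop z t n.+1 h = fun v => t%:C%C * Lop (z^*)%C (iter n (Rop z t) h) v + Qop z t n h v.
  by apply/funext => v; rewrite /Qop big_ord_recr addrC.
by rewrite Lop_lin IH LopC Rop_step addrC addrA subrK.
Qed.

Lemma Qop_Lop z t n h u : Qop z t n (Lop z h) u = h u - iter n (Rop z t) h u.
Proof.
elim: n => [|n IH]; first by rewrite /Qop big_ord0 subrr.
rewrite /Qop big_ord_recr /= -/(Qop z t n (Lop z h) u) IH -Lop_iter Rop_step.
by rewrite addrA subrK.
Qed.

End Operators.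

(** * Norm bounds on finite levels *)

Section WordBounds.
Variables (R : realType) (m : nat) (xi : nat -> 'rV['Z_2]_m -> 'Z_2).
Variables (p : slabel m -> R).
Hypothesis hp : markov_weights p.
Local Notation C := R[i].
Local Notation Re := (@complex.Re R).
Local Notation Im := (@complex.Im R).
Local Notation act := (sgen xi).
Implicit Types (phi psi : word -> C) (f g : word -> R) (z : C).

Definition mop f w : R := \sum_(s : slabel m) p s * f (act s w).

Let p0 s : 0 <= p s. Proof. by rewrite ltW // hp.1. Qed.

Lemma Re_sumC (I : finType) (F : I -> C) : Re (\sum_i F i) = \sum_i Re (F i).
Proof. exact: (big_morph Re (@ReD R) (erefl : Re 0 = 0)). Qed.

Lemma Im_sumC (I : finType) (F : I -> C) : Im (\sum_i F i) = \sum_i Im (F i).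
Proof. exact: (big_morph Im (@ImD R) (erefl : Im 0 = 0)). Qed.

Lemma Re_gop phi w : Re (gop p act phi w) = mop (fun v => Re (phi v)) w.
Proof. by rewrite Re_sumC; apply: eq_bigr => s _; rewrite mulrC ReMr mulrC. Qed.

Lemma Im_gop phi w : Im (gop p act phi w) = mop (fun v => Im (phi v)) w.
Proof. by rewrite Im_sumC; apply: eq_bigr => s _; rewrite mulrC ImMr mulrC. Qed.

Lemma wsum_sum N (F : slabel m -> word -> R) :
  wsum N (fun w => \sum_s F s w) = \sum_s wsum N (F s).
Proof. exact: exchange_big. Qed.

Lemma wsum_sgen N s (F : word -> R) : wsum N (fun w => F (act s w)) = wsum N F.
Proof. by apply: wsum_invol; [exact: sgenK|exact: size_sgen]. Qed.

Lemma mop_sym N f g : wsum N (fun w => mop f w * g w) = wsum N (fun w => f w * mop g w).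
Proof.
under eq_wsum do rewrite /mop mulr_suml.
under [RHS]eq_wsum do rewrite /mop mulr_sumr.
rewrite !wsum_sum; apply: eq_bigr => s _.
rewrite -(wsum_sgen N s); apply: eq_wsum => w _.
by rewrite sgenK mulrCA mulrA.
Qed.

(** Nonnegativity of the variance for weights of total mass at most 1. *)
Lemma sqr_mop f w : mop f w ^+ 2 <= mop (fun v => f v ^+ 2) w.
Proof.
have key : 0 <= \sum_s p s * (f (act s w) - mop f w) ^+ 2.
  by apply: sumr_ge0 => s _; rewrite mulr_ge0 ?sqr_ge0.
have e : \sum_s p s * (f (act s w) - mop f w) ^+ 2 =
    mop (fun v => f v ^+ 2) w - 2 * mop f w * mop f w + (\sum_s p s) * mop f w ^+ 2.
  transitivity (\sum_s (p s * f (act s w) ^+ 2 +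
      (- 2 * mop f w) * (p s * f (act s w)) + p s * mop f w ^+ 2)).
    by apply: eq_bigr => s _; ring.
  rewrite !big_split /= -mulr_sumr -mulr_suml.
  by rewrite -/(mop f w) -/(mop (fun v => f v ^+ 2) w); ring.
rewrite e in key.
have : (\sum_s p s) * mop f w ^+ 2 <= mop f w ^+ 2.
  by rewrite ler_piMl ?sqr_ge0 // hp.2.
by move: key; rewrite -mulrA -expr2; lra.
Qed.

Lemma mop_bound N f : wsum N (fun w => mop f w ^+ 2) <= wsum N (fun w => f w ^+ 2).
Proof.
apply: le_trans (ler_wsum (fun w _ => sqr_mop f w)) _.
rewrite /mop wsum_sum.
under eq_bigr do rewrite wsumZ (wsum_sgen _ _ (fun w => f w ^+ 2)).
rewrite -mulr_suml ler_piMl // ?hp.2 //.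
by apply: wsum_ge0 => w _; exact: sqr_ge0.
Qed.

Definition sqw N phi : R := wsum N (fun w => sqn (phi w)).

Lemma sqn_ge0 (c : C) : 0 <= sqn c.
Proof. by rewrite /sqn addr_ge0 ?sqr_ge0. Qed.

Lemma sqw_ge0 N phi : 0 <= sqw N phi.
Proof. by apply: wsum_ge0 => w _; exact: sqn_ge0. Qed.

Lemma sqwE N phi : sqw N phi = wsum N (fun w => Re (phi w) ^+ 2) +
  wsum N (fun w => Im (phi w) ^+ 2).
Proof. by rewrite /sqw -wsumD. Qed.

Lemma sqnM (a b : C) : sqn (a * b) = sqn a * sqn b.
Proof. by rewrite /sqn ReM ImM; ring. Qed.

Lemma sqnB_le (a b : C) : sqn (a - b) <= 2 * sqn a + 2 * sqn b.
Proof.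
rewrite /sqn ReB ImB.
have := sqrD_le (Re a) (- Re b); have := sqrD_le (Im a) (- Im b).
by rewrite !sqrrN; lra.
Qed.

Lemma sqn_conj (a : C) : sqn (a^*)%C = sqn a.
Proof. by rewrite /sqn Re_conj Im_conj sqrrN. Qed.

Lemma gop_bound N phi : sqw N (gop p act phi) <= sqw N phi.
Proof.
rewrite !sqwE.
under eq_wsum do rewrite Re_gop.
under [X in _ + X <= _]eq_wsum do rewrite Im_gop.
by apply: lerD; exact: mop_bound.
Qed.

(** Bound for the square norm of [T - z] and of its adjoint. Its inverse is the step [t] of the
    Neumann series. *)
Definition Lbound z : R := 2 + 2 * sqn z.

Lemma Lbound_gt0 z : 0 < Lbound z.
Proof. by rewrite /Lbound ltr_pwDl // mulr_ge0 // sqn_ge0. Qed.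

Lemma Lop_bound N z phi : sqw N (Lop p act z phi) <= Lbound z * sqw N phi.
Proof.
apply: (@le_trans _ _ (wsum N (fun w => 2 * sqn (gop p act phi w) + 2 * sqn z * sqn (phi w)))).
  apply: ler_wsum => w _; apply: le_trans (sqnB_le _ _) _.
  by rewrite sqnM mulrA.
rewrite wsumD !wsumZ -!/(sqw _ _) /Lbound [leRHS]mulrDl lerD2r ler_pM2l //.
exact: gop_bound.
Qed.

Definition dotw N phi psi : R :=
  wsum N (fun w => Re (phi w) * Re (psi w) + Im (phi w) * Im (psi w)).

Lemma dotw_Lop N z phi psi :
  dotw N (Lop p act (z^*)%C phi) psi = dotw N phi (Lop p act z psi).
Proof.
have e zz (a b : word -> C) : dotw N (Lop p act zz a) b =
    (wsum N (fun w => mop (fun v => Re (a v)) w * Re (b w)) +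
     wsum N (fun w => mop (fun v => Im (a v)) w * Im (b w))) +
    - 1 * wsum N (fun w => Re (zz * a w) * Re (b w) + Im (zz * a w) * Im (b w)).
  rewrite -wsumD -wsumZ -wsumD; apply: eq_wsum => w _.
  by rewrite /Lop ReB ImB Re_gop Im_gop; ring.
have -> : dotw N phi (Lop p act z psi) = dotw N (Lop p act z psi) phi.
  by apply: eq_wsum => w _; ring.
rewrite !e; congr (_ + _ + _ * _).
- by rewrite mop_sym; apply: eq_wsum => w _; exact: mulrC.
- by rewrite mop_sym; apply: eq_wsum => w _; exact: mulrC.
by apply: eq_wsum => w _; rewrite !ReM !ImM Re_conj Im_conj; ring.
Qed.

(** Expanding the square, the cross term is [- 2 t |(T - z) phi|^2], and the quadratic term is at
    most half as large in modulus because [t] is the inverse of [Lbound z]. *)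
Lemma Rop_contraction N z c phi : c * sqw N phi <= sqw N (Lop p act z phi) ->
  sqw N (Rop p act z (Lbound z)^-1 phi) <= (1 - c / Lbound z) * sqw N phi.
Proof.
move=> low; set b := Lbound z; set t := b^-1.
have b0 : 0 < b := Lbound_gt0 z.
have t0 : 0 < t by rewrite invr_gt0.
pose g := Lop p act z phi; pose k := Lop p act (z^*)%C g.
have kb : sqw N k <= b * sqw N g.
  by have := Lop_bound N (z^*)%C g; rewrite /Lbound sqn_conj.
have e : sqw N (Rop p act z t phi) =
    sqw N phi + (- (2 * t) * dotw N k phi + t ^+ 2 * sqw N k).
  rewrite /sqw /dotw -!wsumZ -!wsumD; apply: eq_wsum => w _.
  rewrite /Rop -/g -/k /sqn ReB ImB mulrC ReMr ImMr; ring.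
rewrite e /k dotw_Lop -/g.
have -> : dotw N g g = sqw N g by apply: eq_wsum => w _; rewrite /sqn; ring.
have h1 : t ^+ 2 * sqw N k <= t * sqw N g.
  rewrite expr2 -mulrA ler_pM2l // /t mulrC ler_pdivrMr // mulrC.
  exact: kb.
have h2 : t * (c * sqw N phi) <= t * sqw N g by rewrite ler_pM2l.
rewrite -/k mulrBl mul1r.
have -> : c / b * sqw N phi = t * (c * sqw N phi) by rewrite /t; ring.
have -> : - (2 * t) * sqw N g = - (2 * (t * sqw N g)) by ring.
by move: h1 h2; lra.
Qed.

Variables (z : C) (c : R).
Hypotheses (c0 : 0 < c)
  (low : forall N phi, c * sqw N phi <= sqw N (Lop p act z phi)).

(** The truncation at 0 spares a comparison of [c] with [Lbound z]. *)
Definition rho : R := Num.max 0 (1 - c / Lbound z).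
Notation t := (Lbound z)^-1.

Lemma rho_itv : 0 <= rho < 1.
Proof.
by rewrite /rho le_max lexx /= gt_max ltr01 /= ltrBlDr ltrDl divr_gt0 // Lbound_gt0.
Qed.

Lemma iter_Rop_bound n N phi :
  sqw N (iter n (Rop p act z t) phi) <= rho ^+ n * sqw N phi.
Proof.
have /andP[r0 r1] := rho_itv.
elim: n => [|n IH]; first by rewrite expr0 mul1r.
rewrite iterS; apply: le_trans (Rop_contraction (low N _)) _.
apply: (@le_trans _ _ (rho * sqw N (iter n (Rop p act z t) phi))).
  by rewrite ler_wpM2r ?sqw_ge0 // le_max lexx orbT.
by rewrite exprS -mulrA ler_wpM2l.
Qed.

(** The lower bound is applied to the Neumann sum itself, whose image under [T - z] telescopes to
    [phi] minus an iterate of norm at most that of [phi]; hence the uniform constant [4 / c]. *)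
Lemma Qop_bound n N phi : sqw N (Qop p act z t n phi) <= 4 / c * sqw N phi.
Proof.
rewrite mulrAC ler_pdivlMr // mulrC; apply: le_trans (low N _) _.
apply: (@le_trans _ _ (wsum N (fun w => 2 * sqn (phi w) +
    2 * sqn (iter n (Rop p act z t) phi w)))).
  by apply: ler_wsum => w _; rewrite Lop_Qop; exact: sqnB_le.
rewrite wsumD !wsumZ -!/(sqw _ _).
have /andP[r0 r1] := rho_itv.
have : sqw N (iter n (Rop p act z t) phi) <= sqw N phi.
  apply: le_trans (iter_Rop_bound n N phi) _.
  by rewrite ler_piMl ?sqw_ge0 // exprn_ile1 // ltW.
by lra.
Qed.

End WordBounds.

(** * Square-summable functions on a vertex set *)

Section L2Basics.
Variables (R : realType) (V : choiceType).
Implicit Types h : V -> R[i].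

Lemma l2norm2_ge_sum h (s : seq V) : uniq s ->
  ((\sum_(v <- s) sqn (h v))%:E <= l2norm2 h)%E.
Proof.
move=> us; apply: esum_ge; exists [set` s]; first by split=> //; exact: finite_seq.
by rewrite -fsbig_seq // sumEFin.
Qed.

Lemma l2norm2_le h (c : R) :
  (forall s : seq V, uniq s -> \sum_(v <- s) sqn (h v) <= c) ->
  (l2norm2 h <= c%:E)%E.
Proof.
move=> hc; apply: ub_ereal_sup => _ [A [fA _] <-].
by rewrite fsbig_finite // sumEFin lee_fin hc.
Qed.

Lemma l2norm2_ge0 h : (0 <= l2norm2 h)%E.
Proof. by apply: esum_ge0 => v _; rewrite lee_fin sqn_ge0. Qed.

Lemma l2_fin h : l2 h -> exists2 c : R, 0 <= c & l2norm2 h = c%:E.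
Proof.
move=> hh; exists (fine (l2norm2 h)); first by rewrite fine_ge0 // l2norm2_ge0.
by rewrite fineK // ge0_fin_numE // l2norm2_ge0.
Qed.

Lemma sqn_le_l2 h (c : R) v : (l2norm2 h <= c%:E)%E -> sqn (h v) <= c.
Proof.
move=> hc; rewrite -lee_fin; apply: le_trans hc.
by have := @l2norm2_ge_sum h [:: v] isT; rewrite big_seq1.
Qed.

End L2Basics.

(** * Transfer of norm bounds from words to the graph *)

Section Transfer.
Variables (R : realType) (m : nat) (xi : nat -> 'rV['Z_2]_m -> 'Z_2).
Variables (X : lgraph (slabel m)) (hX : schreier_closure xi X).
Variables (p : slabel m -> R) (hp : markov_weights p).
Local Notation C := R[i].
Notation V := (gvert X).
Notation wact := (sgen xi).
Notation xact := (@gact _ X).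
Implicit Types (h : V -> C) (phi : word -> C).

Definition equivariant (e : V -> word) r : Prop :=
  forall s y, gball r y -> e (xact s y) = wact s (e y).

Definition agree (e : V -> word) k phi h : Prop :=
  forall v, gball k v -> phi (e v) = h v.

(* [Pw phi] and [Px h] are given by the same formula in the generators and read
   only the ball of radius [d], so norm bounds on finite words pass to the graph
   without any inner product or limit on [l2]. *)
Definition local_op d (Pw : (word -> C) -> word -> C) (Px : (V -> C) -> V -> C) :=
  forall e r k phi h, equivariant e r -> (k + d <= r)%N ->
    agree e (k + d) phi h -> agree e k (Pw phi) (Px h).

Lemma local_op_le d d' Pw Px : (d <= d')%N -> local_op d Pw Px -> local_op d' Pw Px.
Proof.
move=> dd hl e r k phi h he kr ha; apply: hl he _ _.
  by apply: leq_trans kr; rewrite leq_add2l.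
by move=> v hv; apply: ha; apply: gball_le hv; rewrite leq_add2l.
Qed.

Lemma local_gop : local_op 1 (gop p wact) (gop p xact).
Proof.
move=> e r k phi h he; rewrite addn1 => kr ha v hv; apply: eq_bigr => s _.
rewrite -he; last by apply: gball_le hv; exact: ltnW.
by rewrite ha //; exact: (gact_ball hX).
Qed.

Lemma local_Lop z : local_op 1 (Lop p wact z) (Lop p xact z).
Proof.
move=> e r k phi h he kr ha v hv; rewrite /Lop (local_gop he kr ha) //.
by rewrite ha //; apply: gball_le hv; exact: leq_addr.
Qed.

Lemma local_comp d1 d2 Pw Px Qw Qx : local_op d1 Pw Px -> local_op d2 Qw Qx ->
  local_op (d1 + d2) (fun phi => Pw (Qw phi)) (fun h => Px (Qx h)).
Proof.
move=> hP hQ e r k phi h he kr ha; apply: (hP e r) => //.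
  by apply: leq_trans kr; rewrite addnA leq_addr.
by apply: (hQ e r) => //; rewrite -addnA.
Qed.

Lemma local_Rop z t : local_op 2 (Rop p wact z t) (Rop p xact z t).
Proof.
move=> e r k phi h he kr ha v hv; rewrite /Rop.
rewrite (local_comp (local_Lop (z^*)%C) (local_Lop z) he kr ha hv) ha //.
by apply: gball_le hv; exact: leq_addr.
Qed.

Lemma local_iter z t n :
  local_op (2 * n) (iter n (Rop p wact z t)) (iter n (Rop p xact z t)).
Proof.
elim: n => [|n IH]; first by move=> e r k phi h he; rewrite muln0 addn0.
by rewrite mulnS; exact: local_comp (local_Rop z t) IH.
Qed.

Lemma local_Qop z t n :
  local_op (2 * n) (Qop p wact z t n) (Qop p xact z t n).
Proof.
move=> e r k phi h he kr ha v hv; apply: eq_bigr => i _; congr (_ * _).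
have hl : local_op (2 * n) (fun phi => Lop p wact (z^*)%C (iter i (Rop p wact z t) phi))
    (fun h => Lop p xact (z^*)%C (iter i (Rop p xact z t) h)).
  apply: (local_op_le _ (local_comp (local_Lop (z^*)%C) (@local_iter z t i))).
  apply: (@leq_trans (2 + 2 * i)); first by rewrite leq_add2r.
  by rewrite -mulnS leq_mul2l ltn_ord orbT.
exact: hl he kr ha v hv.
Qed.

Lemma sum_words_sub N (t : seq word) (F : word -> R) : uniq t ->
    (forall w, w \in t -> size w = N) ->
  \sum_(w <- t) F w = \sum_(w <- words N | w \in t) F w.
Proof.
move=> ut st; rewrite -[RHS]big_filter; apply: perm_big.
apply: uniq_perm; rewrite ?filter_uniq ?uniq_words // => w.
by rewrite mem_filter mem_words; apply/idP/andP => [wt|[]//]; rewrite wt (st w wt).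
Qed.

Lemma seq_in_ball (s : seq V) : exists k, forall v, v \in s -> gball k v.
Proof.
elim: s => [|v s [k hk]]; first by exists 0%N.
have [n hn] := in_ball hX v; exists (maxn n k) => w.
rewrite inE => /predU1P[->|/hk hw]; first exact: gball_le (leq_maxl _ _) hn.
exact: gball_le (leq_maxr _ _) hw.
Qed.

Lemma transfer d Pw Px (r : R) : local_op d Pw Px -> 0 <= r ->
    (forall N phi, sqw N (Pw phi) <= r * sqw N phi) ->
  forall h (c : R), (l2norm2 h <= c%:E)%E -> (l2norm2 (Px h) <= (r * c)%:E)%E.
Proof.
move=> hl r0 hb h c hc; apply: l2norm2_le => s us.
have [k sk] := seq_in_ball s.
have [N /(_ N (leqnn _))[e [se ie he]]] := word_chart hX (k + d).
have /finite_seqP[b' bE] := finite_gball hX (k + d).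
pose b := undup b'.
have bP v : gball (k + d) v <-> v \in b.
  by rewrite mem_undup -[gball _ _]/((gball (k + d) : set V) v) bE.
(* A copy of [h] on the image of the larger ball and 0 elsewhere: the norm does not grow, and by
   locality the truncation is not felt on the ball of radius [k]. *)
pose phi w : C := if w \in map e b then
  h (xget (groot X) [set v | gball (k + d) v /\ e v = w]) else 0.
have ha : agree e (k + d) phi h.
  move=> v hv; rewrite /phi map_f; last exact/bP.
  case: xgetP => [u _ [hu eu]|no]; first by congr h; exact: ie.
  by case: (no v).
have nphi : sqw N phi <= c.
  rewrite /sqw /wsum (bigID (fun w => w \in map e b)) /=.
  rewrite [X in _ + X]big1 ?addr0 => [|w /negbTE hw]; last first.
    by rewrite /phi hw /sqn /= expr0n addr0.
  have um : uniq (map e b).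
    rewrite map_inj_in_uniq ?undup_uniq // => v w /bP hv /bP hw; exact: ie.
  rewrite -(sum_words_sub _ um) => [|w /mapP[v _ ->]]; last exact: se.
  rewrite big_map big_seq.
  under eq_bigr => v /bP hv do rewrite ha //.
  rewrite -big_seq -lee_fin; apply: le_trans hc.
  by apply: l2norm2_ge_sum; exact: undup_uniq.
have hP := hl e _ k phi h he (leqnn _) ha.
apply: (@le_trans _ _ (sqw N (Pw phi))); last first.
  by apply: le_trans (hb N phi) _; rewrite ler_wpM2l.
rewrite (eq_big_seq (fun v => sqn (Pw phi (e v)))) => [|v vs]; last first.
  by rewrite hP //; exact: sk.
rewrite -(big_map e xpredT (fun w => sqn (Pw phi w))).
rewrite (@sum_words_sub N) => [||w /mapP[v _ ->]]; last exact: se.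
  rewrite /sqw /wsum big_mkcond; apply: ler_sum => w _.
  by case: ifP => // _; exact: sqn_ge0.
rewrite map_inj_in_uniq // => v w vs ws.
exact: (ie _ _ (gball_le (leq_addr _ _) (sk v vs)) (gball_le (leq_addr _ _) (sk w ws))).
Qed.

End Transfer.

(** * The resolvent as a pointwise limit of Neumann sums *)

Section Resolvent.
Variables (R : realType) (m : nat) (xi : nat -> 'rV['Z_2]_m -> 'Z_2).
Variables (X : lgraph (slabel m)) (hX : schreier_closure xi X).
Variables (p : slabel m -> R) (hp : markov_weights p).
Local Notation C := R[i].
Local Notation Re := (@complex.Re R).
Local Notation Im := (@complex.Im R).
Notation V := (gvert X).
Notation wact := (sgen xi).
Notation xact := (@gact _ X).
Implicit Types (h : V -> C).
Variables (z : C) (c : R).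
Hypotheses (c0 : 0 < c)
  (low : forall N phi, c * sqw N phi <= sqw N (Lop p wact z phi)).
Notation t := (Lbound z)^-1.
Notation rho := (rho z c).

Lemma geometric_series_cvg (u : nat -> R) (K r : R) : 0 <= r -> r < 1 ->
  (forall n, u n ^+ 2 <= K * r ^+ n) -> cvgn (series u).
Proof.
move=> r0 r1 hu.
have sr1 : `|Num.sqrt r| < 1.
  by rewrite ger0_norm ?sqrtr_ge0 // -sqrtr1 ltr_sqrt.
apply: normed_cvg; apply: (@series_le_cvg _ _ (geometric (Num.sqrt K) (Num.sqrt r))).
- by move=> n; exact: normr_ge0.
- by move=> n; rewrite /geometric /= mulr_ge0 ?exprn_ge0 ?sqrtr_ge0.
- move=> n; rewrite /geometric /= -sqrtr_sqr.
  have K0 : 0 <= K.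
    by have := le_trans (sqr_ge0 _) (hu 0%N); rewrite expr0 mulr1.
  have -> : Num.sqrt r ^+ n = Num.sqrt (r ^+ n).
    elim: n => [|n IH]; first by rewrite !expr0 sqrtr1.
    by rewrite !exprS IH sqrtrM.
  by rewrite -sqrtrM // ler_wsqrtr.
exact: is_cvg_geometric_series.
Qed.

Lemma ccvg_unique (u : nat -> C) a b : ccvg u a -> ccvg u b -> a = b.
Proof.
move=> [a1 a2] [b1 b2]; apply: complex_eqP.
  by rewrite -(cvg_lim (@Rhausdorff R) a1) -(cvg_lim (@Rhausdorff R) b1).
by rewrite -(cvg_lim (@Rhausdorff R) a2) -(cvg_lim (@Rhausdorff R) b2).
Qed.

Lemma iter_pointwise h c1 v n : (l2norm2 h <= c1%:E)%E ->
  sqn (iter n (Rop p xact z t) h v) <= c1 * rho ^+ n.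
Proof.
move=> hh; apply: sqn_le_l2; rewrite mulrC.
have /andP[r0 _] := rho_itv z c0.
apply: (transfer hX (@local_iter _ _ _ _ hX p z t n)) => //; first exact: exprn_ge0.
by move=> N phi; exact: iter_Rop_bound.
Qed.

Lemma ccvg_iter h v : l2 h -> ccvg (fun n => iter n (Rop p xact z t) h v) 0.
Proof.
move=> /l2_fin[c1 _ hE]; have hh : (l2norm2 h <= c1%:E)%E by rewrite hE.
have /andP[r0 r1] := rho_itv z c0.
by split; apply: cvg_series_cvg_0; apply: (@geometric_series_cvg _ c1 rho) => // n;
  (apply: le_trans (iter_pointwise v n hh); rewrite /sqn ?lerDl ?lerDr sqr_ge0).
Qed.

Lemma Qop_cvg h v : l2 h -> exists l, ccvg (fun n => Qop p xact z t n h v) l.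
Proof.
move=> /l2_fin[c1 _ hE]; have hh : (l2norm2 h <= c1%:E)%E by rewrite hE.
have /andP[r0 r1] := rho_itv z c0.
pose b k := t%:C%C * Lop p xact (z^*)%C (iter k (Rop p xact z t) h) v.
pose K := sqn (t%:C%C) * (Lbound (z^*)%C * c1).
have bK k : sqn (b k) <= K * rho ^+ k.
  rewrite /b sqnM /K -!mulrA; apply: ler_wpM2l; first exact: sqn_ge0.
  apply: sqn_le_l2.
  have L0 := Lbound_gt0 (z^*)%C.
  apply: (transfer hX (@local_Lop _ _ _ _ hX p (z^*)%C)) => //; first exact: ltW.
    by move=> N phi; exact: Lop_bound.
  rewrite mulrC; apply: (transfer hX (@local_iter _ _ _ _ hX p z t k)) => //; first exact: exprn_ge0.
  by move=> N phi; exact: iter_Rop_bound.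
have sE (f : C -> R) : (forall a d, f (a + d) = f a + f d) -> f 0 = 0 ->
    (fun n => f (Qop p xact z t n h v)) = series (fun k => f (b k)).
  move=> fD f0; apply/funext => n; rewrite /series /= big_mkord.
  exact: (big_morph f fD f0).
have cf (f : C -> R) : (forall a d, f (a + d) = f a + f d) -> f 0 = 0 ->
    (forall a, f a ^+ 2 <= sqn a) -> cvgn (fun n => f (Qop p xact z t n h v)).
  move=> fD f0 fs; rewrite sE //; apply: (@geometric_series_cvg _ K rho) => // n.
  exact: le_trans (fs _) (bK n).
exists (Complex (limn (fun n => Re (Qop p xact z t n h v)))
  (limn (fun n => Im (Qop p xact z t n h v)))); split.
  by apply: (cf Re (@ReD R)) => // a; rewrite /sqn lerDl sqr_ge0.
by apply: (cf Im (@ImD R)) => // a; rewrite /sqn lerDr sqr_ge0.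
Qed.

Definition Qlim h v : C := xget 0 [set l | ccvg (fun n => Qop p xact z t n h v) l].

Lemma Qlim_eq h v l : ccvg (fun n => Qop p xact z t n h v) l -> Qlim h v = l.
Proof.
by move=> hl; rewrite /Qlim; case: xgetP => [x _ hx|/(_ l)//]; exact: ccvg_unique hx hl.
Qed.

Lemma Qlim_cvg h v : l2 h -> ccvg (fun n => Qop p xact z t n h v) (Qlim h v).
Proof. by move=> /Qop_cvg-/(_ v)[l hl]; rewrite (Qlim_eq hl). Qed.

Lemma ccvg_sum (I : finType) (u : I -> nat -> C) (l : I -> C) :
  (forall i, ccvg (u i) (l i)) -> ccvg (fun n => \sum_i u i n) (\sum_i l i).
Proof.
move=> hu; elim: (index_enum I) => [|i s IH].
  by rewrite big_nil; under eq_fun do rewrite big_nil; exact: ccvg_cst.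
by rewrite big_cons; under eq_fun do rewrite big_cons; exact: ccvgD.
Qed.

Lemma ccvg_Lop h v : l2 h ->
  ccvg (fun n => Lop p xact z (Qop p xact z t n h) v) (Lop p xact z (Qlim h) v).
Proof.
move=> hh; rewrite /Lop; apply: ccvgD.
  apply: ccvg_sum => s; apply: ccvgM; first exact: ccvg_cst.
  exact: Qlim_cvg.
by apply: ccvgN; apply: ccvgM; [exact: ccvg_cst|exact: Qlim_cvg].
Qed.

Lemma ccvg_sub_iter h v : l2 h -> ccvg (fun n => h v - iter n (Rop p xact z t) h v) (h v).
Proof.
move=> hh; rewrite -[X in ccvg _ X]subr0; apply: ccvgD; first exact: ccvg_cst.
by apply: ccvgN; exact: ccvg_iter.
Qed.

Lemma Lop_Qlim h v : l2 h -> Lop p xact z (Qlim h) v = h v.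
Proof.
move=> hh; apply: (ccvg_unique (ccvg_Lop v hh)).
by under eq_fun do rewrite Lop_Qop; exact: ccvg_sub_iter.
Qed.

Lemma Qlim_Lop h v : l2 h -> Qlim (Lop p xact z h) v = h v.
Proof.
move=> hh; apply: Qlim_eq.
by under eq_fun do rewrite Qop_Lop; exact: ccvg_sub_iter.
Qed.

Lemma Qlim_bound h c1 : l2 h -> (l2norm2 h <= c1%:E)%E ->
  (l2norm2 (Qlim h) <= (4 / c * c1)%:E)%E.
Proof.
move=> hh hc; apply: l2norm2_le => s us.
(* Pointwise convergence suffices: the uniform bound passes to the limit on every finite set of
   vertices. *)
have cs : (\sum_(v <- s) sqn (Qop p xact z t n h v)) @[n --> \oo] -->
    \sum_(v <- s) sqn (Qlim h v).
  elim: s {us} => [|v s IH].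
    by rewrite big_nil; under eq_fun do rewrite big_nil; exact: cvg_cst.
  rewrite big_cons; under eq_fun do rewrite big_cons.
  apply: cvgD => //; rewrite /sqn -sqr_normc; under eq_fun do rewrite -sqr_normc.
  by apply: cvg_sqr_normc; exact: Qlim_cvg.
rewrite -(cvg_lim (@Rhausdorff R) cs); apply: limr_le; first by apply/cvg_ex; eexists; exact: cs.
apply: nearW => n; rewrite -lee_fin.
apply: (@le_trans _ _ (l2norm2 (Qop p xact z t n h))).
  exact: l2norm2_ge_sum.
apply: (transfer hX (@local_Qop _ _ _ _ hX p z t n)) => //.
  by rewrite divr_ge0 // ltW.
by move=> N phi; exact: Qop_bound.
Qed.

Theorem not_in_spectrum : ~ spectrum (markov_op p X) z.
Proof.
move=> hz; apply: hz; exists Qlim; last first.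
  move=> h hh; split; apply/funext => v.
    exact: Qlim_Lop v hh.
  exact: Lop_Qlim v hh.
split.
- move=> h hh; have [c1 _ hE] := l2_fin hh.
  apply: le_lt_trans (Qlim_bound (c1 := c1) hh _) _; first by rewrite hE.
  by rewrite ltry.
- move=> a h k hh hk; apply/funext => v; apply: Qlim_eq.
  under eq_fun do rewrite (Qop_lin p xact z t _ a h k).
  apply: ccvgD; last exact: Qlim_cvg.
  by apply: ccvgM; [exact: ccvg_cst|exact: Qlim_cvg].
- exists (4 / c) => h hh; have [c1 _ hE] := l2_fin hh.
  by rewrite hE; apply: Qlim_bound => //; rewrite hE.
Qed.

End Resolvent.

(** * The spectrum of the Markov operator *)

Section SpectrumComplement.
Variables (R : realType) (m : nat) (xi : nat -> 'rV['Z_2]_m -> 'Z_2).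
Variables (p : slabel m -> R).
Local Notation C := R[i].
Local Notation Re := (@complex.Re R).
Local Notation Im := (@complex.Im R).
Notation wact := (sgen xi).
Notation wres := (hres (p None) (fun n => qsum p (xi n))).
Notation wsp := (wspec (p None) (fun n => qsum p (xi n))).
Implicit Types (phi : word -> C) (z : C).

Definition center : R := ptot p + p None.

Lemma mop_hres l (f : word -> R) w : mop xi p f w - l * f w = wres (l - center) f w.
Proof.
rewrite (hres_shift _ _ (l - center) 0) sub0r opprB -(@mopE R m xi p center f w (erefl _)).
by rewrite /mop; ring.
Qed.

(** By symmetry of the operator the cross terms cancel, so the square norm of [(T - z) phi] is that
    of [(T - Re z) phi] plus [(Im z)^2] times that of [phi]. *)
Lemma low_nonreal z N phi : Im z ^+ 2 * sqw N phi <= sqw N (Lop p wact z phi).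
Proof.
pose f v := Re (phi v); pose g v := Im (phi v).
pose T w := (mop xi p f w - Re z * f w) ^+ 2 + (mop xi p g w - Re z * g w) ^+ 2 +
  Im z ^+ 2 * sqn (phi w).
have -> : sqw N (Lop p wact z phi) = wsum N T + (2 * Im z * wsum N (fun w => mop xi p f w * g w) +
    - (2 * Im z) * wsum N (fun w => mop xi p g w * f w)).
  rewrite -!wsumZ -!wsumD; apply: eq_wsum => w _.
  rewrite /T /Lop /sqn ReB ImB ReM ImM Re_gop Im_gop -/f -/g; ring.
rewrite (mop_sym xi p N f g).
have -> : wsum N (fun w => f w * mop xi p g w) = wsum N (fun w => mop xi p g w * f w).
  by apply: eq_wsum => w _; rewrite mulrC.
rewrite mulNr subrr addr0 -wsumZ; apply: ler_wsum => w _.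
by rewrite /T lerDr addr_ge0 ?sqr_ge0.
Qed.

Lemma low_real (l : R) : ~ wsp (l - center) ->
  exists2 c : R, 0 < c &
    forall N phi, c * sqw N phi <= sqw N (Lop p wact l%:C%C phi).
Proof.
move=> no; have [eps [eps0 h]] : exists eps : R, 0 < eps /\
    forall N f, ~ approx_eigen (p None) (fun n => qsum p (xi n)) (l - center) eps N f.
  apply: contrapT => h; apply: no => eps eps0.
  by apply: contrapT => h'; apply: h; exists eps; split=> // N f hf; apply: h'; exists N, f.
have low N f : eps * wsum N (fun w => f w ^+ 2) <=
    wsum N (fun w => wres (l - center) f w ^+ 2).
  have f0 : 0 <= wsum N (fun w => f w ^+ 2) by apply: wsum_ge0 => w _; exact: sqr_ge0.
  have [->|fn0] := eqVneq (wsum N (fun w => f w ^+ 2)) 0.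
    by rewrite mulr0; apply: wsum_ge0 => w _; exact: sqr_ge0.
  rewrite leNgt; apply/negP => lt; apply: (h N f); split; last exact: ltW.
  by rewrite lt_def fn0.
exists eps => // N phi.
have -> : sqw N (Lop p wact l%:C%C phi) =
    wsum N (fun w => wres (l - center) (fun v => Re (phi v)) w ^+ 2) +
    wsum N (fun w => wres (l - center) (fun v => Im (phi v)) w ^+ 2).
  rewrite -wsumD; apply: eq_wsum => w _.
  rewrite /Lop /sqn ReB ImB Re_gop Im_gop mulrC ReMr ImMr -!mop_hres.
  by rewrite ![l * _]mulrC.
by rewrite sqwE mulrDr lerD.
Qed.

End SpectrumComplement.

(** * Connectedness of a block by moves that stay inside it *)

Section Reach.
Variable n : nat.

Fixpoint reach (w0 : word) k (w : word) : Prop :=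
  if k is k'.+1 then
    exists2 v, reach w0 k' v & w = aut_a v \/ (inner n v /\ w = flip v)
  else w = w0.

Lemma flip_ends w : ~~ inner n w -> flip w = w.
Proof.
rewrite /inner negb_and !negbK => /orP[] /eqP ->.
  by have := flip_endA n [::]; rewrite !cats0.
by have := flip_endB n [::]; rewrite !cats0.
Qed.

Lemma inner_flip w : inner n (flip w) = inner n w.
Proof.
have h v : ~~ inner n v -> ~~ inner n (flip v) by move=> hv; rewrite flip_ends.
by apply/idP/idP; apply: contraTT => /h; rewrite ?flipK.
Qed.

(* The indicator of the reachable words is harmonic, hence constant. *)
Lemma reach_all (R : realType) w0 w : size w0 = n.+1 -> size w = n.+1 ->
  exists k, reach w0 k w.
Proof.
move=> s0 sw; pose P v := exists k, reach w0 k v.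
pose phi v : R := (`[< P v >])%:R.
have Pa v : P v -> P (aut_a v) by case=> k hk; exists k.+1; exists v => //; left.
have Pf v : inner n v -> P v -> P (flip v).
  by move=> iv [k hk]; exists k.+1; exists v => //; right.
have ea v : phi (aut_a v) = phi v.
  rewrite /phi; congr (_%:R); congr (nat_of_bool _).
  by apply/asboolP/asboolP; [move/Pa; rewrite aut_aK|exact: Pa].
have ef v : phi (flip v) = phi v.
  have [iv|iv] := boolP (inner n v); last by rewrite flip_ends.
  rewrite /phi; congr (_%:R); congr (nat_of_bool _).
  by apply/asboolP/asboolP; [move/Pf; rewrite flipK inner_flip; exact|exact: Pf].
pose psi v := phi v - phi (endB n).
have psi0 : forall v, size v = n.+1 -> psi v = 0.
  apply: (@simple_spectrum R 1 (fun=> 1) ltr01 (fun=> ltr01) 0).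
    by rewrite /psi -[nseq _ _]/(endB n) subrr.
  by move=> v _; rewrite /hres /psi ea ef !subrr; ring.
have e1 := psi0 w0 s0; have e2 := psi0 w sw.
have : phi w = phi w0 by move: e1 e2; rewrite /psi => /subr0_eq -> /subr0_eq ->.
have P0 : P w0 by exists 0%N.
rewrite /phi (asboolT P0) [nat_of_bool true]/=.
by case: asboolP => // _ /eqP; rewrite eq_sym oner_eq0.
Qed.

Lemma reach_bound (R : realType) : exists K, forall w0 w, size w0 = n.+1 ->
  size w = n.+1 -> exists2 k, (k <= K)%N & reach w0 k w.
Proof.
pose f (w0 w : word) := xget 0%N [set k | reach w0 k w].
exists (\max_(w0 <- words n.+1) \max_(w <- words n.+1) f w0 w)%N => w0 w s0 sw.
exists (f w0 w).
  have m0 : w0 \in words n.+1 by rewrite mem_words s0.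
  have mw : w \in words n.+1 by rewrite mem_words sw.
  have h1 := @leq_bigmax_seq _ (words n.+1) xpredT (f w0) w mw isT.
  have h2 := @leq_bigmax_seq _ (words n.+1) xpredT
    (fun v => \max_(w <- words n.+1) f v w)%N w0 m0 isT.
  exact: leq_trans h1 h2.
rewrite /f; case: xgetP => [k _ //|no].
by have [k hk] := reach_all R s0 sw; case: (no k).
Qed.

End Reach.

(** * Copies of blocks in the limit graph *)

Section BlockCopy.
Variables (R : realType) (m : nat) (xi : nat -> 'rV['Z_2]_m -> 'Z_2).
Hypothesis xi_epi : forall k, Epi (xi k).
Variables (X : lgraph (slabel m)) (hX : schreier_closure xi X).
Variables (p : slabel m -> R).
Local Notation C := R[i].
Notation V := (gvert X).
Notation wact := (sgen xi).
Notation xact := (@gact _ X).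
Notation wres := (hres (p None) (fun n => qsum p (xi n))).
Notation wsp := (wspec (p None) (fun n => qsum p (xi n))).

Lemma flip_sgen w : exists s, forall v, index false (w ++ v) = index false w ->
  wact s (w ++ v) = flip (w ++ v).
Proof.
have [morph surj] := xi_epi (index false w).
have [b hb] := surj 1.
have b0 : b != 0.
  apply/eqP => e; have := morph 0 0; rewrite addr0 -e hb => /eqP.
  by rewrite -subr_eq0 opprD addrA subrr sub0r oppr_eq0.
exists (Some (exist _ b b0)) => v e.
by rewrite /= aut_bE e hb.
Qed.

Lemma sum_supp_le (s t : seq V) (F : V -> R) : uniq s -> uniq t ->
    (forall v, 0 <= F v) -> (forall v, v \notin t -> F v = 0) ->
  \sum_(v <- s) F v <= \sum_(v <- t) F v.
Proof.
move=> us ut F0 Ft; rewrite (bigID (mem t)) /=.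
rewrite [X in _ + X]big1 ?addr0; last by move=> v /Ft.
rewrite -big_filter (perm_big (seq.filter (mem s) t)).
  by rewrite big_filter big_mkcond; apply: ler_sum => v _; case: ifP.
apply: uniq_perm; rewrite ?filter_uniq // => v.
by rewrite !mem_filter andbC.
Qed.

(** The root itself lies in some block [w ++ zt]. Moves inside the block reach all of it in at most
    [K] steps, so the whole block is seen by one chart; since [phi] vanishes at the ends, what lies
    beyond does not matter. *)
Lemma block_copy n (phi : word -> R) (l : R) :
    phi (endA n) = 0 -> phi (endB n) = 0 ->
  exists h : V -> C,
    l2norm2 h = (wsum n.+1 (fun w => phi w ^+ 2))%:E /\
    (l2norm2 (Lop p xact l%:C%C h) <=
       (wsum n.+1 (fun w => wres (l - center p) phi w ^+ 2))%:E)%E.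
Proof.
move=> phiA phiB; have [K hK] := reach_bound n R.
(* Radius [K.+1] also covers the neighbours of the block; the maximum makes the words long enough to
   contain a prefix of length n + 1. *)
have [N0 /(_ (maxn N0 n.+1) (leq_maxl _ _))[e [se inj equi]]] := word_chart hX K.+1.
have nN v : (n.+1 <= size (e v))%N by rewrite se leq_maxr.
pose w0 := take n.+1 (e (groot X)); pose zt := drop n.+1 (e (groot X)).
have sw0 : size w0 = n.+1 by rewrite size_takel.
have reachV k w : (k <= K)%N -> reach n w0 k w -> size w = n.+1 /\
    exists2 v, gball k v & e v = w ++ zt.
  elim: k w => [|k IH] w kK /=.
    by move=> ->; split=> //; exists (groot X) => //; rewrite cat_take_drop.
  case=> u /(IH _ (ltnW kK))[su [v hv ev]] hw.
  have vK : gball K.+1 v by apply: gball_le hv; exact: leqW (ltnW kK).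
  case: hw => [->|[iu ->]].
    split; first by rewrite size_aut_a.
    exists (xact None v); first exact: (gact_ball hX).
    by rewrite equi // ev /= aut_a_cat // -size_eq0 su.
  split; first by rewrite size_flip.
  have [s hs] := flip_sgen u; exists (xact s v); first exact: (gact_ball hX).
  have [f1 f2] := flip_inner zt su iu.
  by rewrite equi // ev hs.
have blockV w : size w = n.+1 -> exists v, gball K v /\ e v = w ++ zt.
  move=> sw; have [k kK hk] := hK w0 w sw0 sw.
  have [_ [v hv ev]] := reachV k w kK hk.
  by exists v; split=> //; exact: gball_le kK hv.
pose vw w := xget (groot X) [set v | gball K v /\ e v = w ++ zt].
have vwP w : size w = n.+1 -> gball K (vw w) /\ e (vw w) = w ++ zt.
  move=> sw; rewrite /vw; case: xgetP => // no.
  by have [v hv] := blockV w sw; case: (no v).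
pose h v : C := if `[< gball K.+1 v >] && (drop n.+1 (e v) == zt)
  then (phi (take n.+1 (e v)))%:C%C else 0.
have blockE v : gball K.+1 v -> drop n.+1 (e v) = zt ->
    exists2 w, size w = n.+1 & v = vw w.
  move=> hv ev; have sw : size (take n.+1 (e v)) = n.+1 by rewrite size_takel.
  exists (take n.+1 (e v)) => //; have [h1 h2] := vwP _ sw.
  by apply: inj => //; [exact: gballS|rewrite h2 -ev cat_take_drop].
have hvw w : size w = n.+1 -> h (vw w) = (phi w)%:C%C.
  move=> sw; have [h1 h2] := vwP w sw.
  rewrite /h asboolT; last exact: gballS.
  by rewrite h2 -sw drop_size_cat // eqxx take_size_cat.
have hact w s : size w = n.+1 -> h (xact s (vw w)) = (phi (wact s w))%:C%C.
  move=> sw; have [h1 h2] := vwP w sw.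
  have hb : gball K.+1 (xact s (vw w)) by exact: (gact_ball hX).
  rewrite /h asboolT // equi; last exact: gballS.
  have tE : take n.+1 (wact s (w ++ zt)) = wact s w.
    by rewrite -(sgen_tree xi s).2 take_size_cat.
  rewrite h2 tE andTb; case: eqP => // hne.
  suff -> : phi (wact s w) = 0 by [].
  case: s hne {hb tE} => [b|] /=; last first.
    case; rewrite aut_a_cat ?drop_size_cat ?size_aut_a // -size_eq0 sw //.
  rewrite !aut_bE; case: ifP => h3.
    by case; rewrite drop_size_cat.
  have [wE|wE|iw] := endA_or_inner n w.
  - by have := flip_endA n [::]; rewrite !cats0 wE => -> _; case: ifP.
  - by have := flip_endB n [::]; rewrite !cats0 wE => -> _; case: ifP.
  - by have [f1 _] := flip_inner zt sw iw; rewrite f1 drop_size_cat ?size_flip // => -[].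
pose t := map vw (words n.+1).
have tP v : v \in t -> exists2 w, size w = n.+1 & v = vw w.
  by case/mapP => w; rewrite mem_words => /eqP sw ->; exists w.
have tw w : size w = n.+1 -> vw w \in t.
  by move=> sw; apply: map_f; rewrite mem_words sw.
have ut : uniq t.
  rewrite map_inj_in_uniq ?uniq_words // => w w'; rewrite !mem_words => /eqP s1 /eqP s2 ee.
  have [_ e1] := vwP w s1; have [_ e2] := vwP w' s2.
  have := congr1 (take n.+1) (etrans (etrans (esym e1) (congr1 e ee)) e2).
  by rewrite !take_size_cat.
have h0 v : v \notin t -> h v = 0.
  move=> vt; rewrite /h; case: asboolP => //= hv; case: eqP => // ev.
  by have [w sw vE] := blockE v hv ev; rewrite vE tw in vt.
(* A vertex outside the block has neighbours in it only at the ends, where [h] vanishes. *)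
have g0 v : v \notin t -> Lop p xact l%:C%C h v = 0.
  move=> vt; rewrite /Lop h0 // mulr0 subr0 /gop big1 // => s _.
  have [-> |hn] := eqVneq (h (xact s v)) 0; first by rewrite mulr0.
  exfalso; move/negP: vt; apply.
  have ut' : xact s v \in t by apply: contraNT hn => /h0 ->.
  have [w sw vE] := tP _ ut'.
  have iw : inner n w.
    apply/andP; split; apply: contraNneq hn => wE; rewrite vE hvw ?wE ?phiA ?phiB //;
      by rewrite ?size_endA ?size_endB.
  have [h1 h2] := vwP w sw.
  have ev : e v = wact s w ++ zt.
    rewrite -(gactK hX s v) vE equi; last exact: gballS.
    rewrite h2; case: s {hn vE ut'} => [b|] /=; last by rewrite aut_a_cat // -size_eq0 sw.
    have [f1 f2] := flip_inner zt sw iw.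
    by rewrite !aut_bE f2 f1; case: ifP.
  have ss : size (wact s w) = n.+1 by rewrite size_sgen.
  have [h3 h4] := vwP _ ss.
  have hv : gball K.+1 v by rewrite -(gactK hX s v) vE; exact: (gact_ball hX).
  have -> : v = vw (wact s w) by apply: inj => //; [exact: gballS|rewrite ev h4].
  exact: tw.
have gvw w : size w = n.+1 ->
    Lop p xact l%:C%C h (vw w) = (wres (l - center p) phi w)%:C%C.
  move=> sw; rewrite -mop_hres rmorphB rmorphM /Lop hvw // /mop rmorph_sum.
  congr (_ - _); apply: eq_bigr => s _.
  by rewrite rmorphM hact.
have sqr_real (x : R) : sqn (x%:C%C) = x ^+ 2 by rewrite /sqn /= expr0n addr0.
have tsum (g : V -> C) (G : word -> R) : (forall w, size w = n.+1 -> g (vw w) = (G w)%:C%C) ->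
    \sum_(v <- t) sqn (g v) = wsum n.+1 (fun w => G w ^+ 2).
  by move=> gG; rewrite big_map; apply: eq_wsum => w sw; rewrite gG.
have up (g : V -> C) (G : word -> R) : (forall w, size w = n.+1 -> g (vw w) = (G w)%:C%C) ->
    (forall v, v \notin t -> g v = 0) -> (l2norm2 g <= (wsum n.+1 (fun w => G w ^+ 2))%:E)%E.
  move=> gG gt; apply: l2norm2_le => s us; rewrite -(tsum g G gG).
  apply: sum_supp_le => // v; first exact: sqn_ge0.
  by move/gt => ->; rewrite /sqn /= expr0n addr0.
exists h; split; last exact: up.
apply/eqP; rewrite eq_le up //= -(tsum h phi hvw).
exact: l2norm2_ge_sum.
Qed.

Lemma wspec_in_spectrum (l : R) : (forall n, 0 < qsum p (xi n)) ->
    (forall n, qsum p (xi n) <= 1) -> wsp (l - center p) ->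
  spectrum (markov_op p X) l%:C%C.
Proof.
move=> q0 q1 hl [Q [_ _ [c hc]] QP].
(* A residual below [1 / (2 d)] would give [|h|^2 <= |h|^2 / 2] through the bounded inverse. Passing
   from [c] to [|c| + 1] provides a positive constant. *)
pose d := `|c| + 1.
have d0 : 0 < d by rewrite ltr_wpDl.
have e0 : 0 < (2 * d)^-1 by rewrite invr_gt0 mulr_gt0.
have [n [phi [phiA phiB [p0 hp]]]] := approx_eigen_cutoff q0 q1 hl e0.
have [h [hn gn]] := block_copy l phiA phiB.
have hh : l2 h by rewrite /l2 /= hn ltry.
set g := Lop p xact l%:C%C h in gn.
have gE : markov_op p X h - l%:C%C *: h = g by apply/funext.
have gl2 : l2 g by apply: le_lt_trans gn _; rewrite ltry.
have [e _] := QP h hh; rewrite gE in e.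
have := hc g gl2; rewrite e hn.
have [c1 c10 gc] := l2_fin gl2; rewrite gc -EFinM lee_fin.
rewrite gc lee_fin in gn; have gs := le_trans gn hp.
move=> h1; have h2 : c * c1 <= d * c1.
  by rewrite ler_wpM2r // (le_trans (ler_norm c)) // lerDl.
have h3 := le_trans h1 (le_trans h2 (ler_wpM2l (ltW d0) gs)).
move: h3 p0; move: (wsum _ _) => s.
by rewrite mulrA invfM mulrCA mulfV ?gt_eqF // mulr1; lra.
Qed.

End BlockCopy.

(** * Conclusion *)

Section Final.
Variables (R : realType) (m : nat) (xi : nat -> 'rV['Z_2]_m -> 'Z_2).
Hypothesis xi_epi : forall k, Epi (xi k).
Variables (p : slabel m -> R) (hp : markov_weights p).
Notation q := (fun n => qsum p (xi n)).
Notation pa := (p None).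

Lemma qsum_gt0 n : 0 < qsum p (xi n).
Proof.
have [morph surj] := xi_epi n; have [b hb] := surj 1.
have b0 : b != 0.
  apply/eqP => e; have := morph 0 0; rewrite addr0 -e hb => /eqP.
  by rewrite -subr_eq0 opprD addrA subrr sub0r oppr_eq0.
rewrite /qsum (bigD1 (exist _ b b0)) /=; last by rewrite hb.
by rewrite ltr_pwDl ?hp.1 // sumr_ge0 // => c _; rewrite ltW // hp.1.
Qed.

Lemma weight_qsum_le1 n : pa + qsum p (xi n) <= 1.
Proof.
apply: le_trans hp.2; rewrite sum_slabel lerD2l.
rewrite [leRHS](bigID (fun b : {b : 'rV['Z_2]_m | b != 0} => xi n (val b) != 0)) /=.
by rewrite lerDl sumr_ge0 // => b _; rewrite ltW // hp.1.
Qed.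

(** [qsum] depends on [xi n] only through the set of elements where it does not vanish, so listing
    all subsets exhausts the values; the filter discards the empty sum. *)
Lemma kap_finite : exists V : seq R,
  (forall n, kap pa q n \in V) /\ (forall v, v \in V -> 0 < v).
Proof.
pose B := {b : 'rV['Z_2]_m | b != 0}.
exists [seq v <- (2 * pa)^-1 :: [seq (2 * \sum_(b in A) p (Some b))^-1 | A : {set B}] | 0 < v].
split=> [n|v]; last by rewrite mem_filter => /andP[].
rewrite mem_filter (kap_gt0 (hp.1 None) qsum_gt0) /= inE.
case: n => [|n] /=; first by rewrite eqxx.
apply/orP; right; apply/mapP; exists [set b : B | xi n (val b) != 0]%SET.
  by rewrite mem_enum.
by congr (_ * _)^-1; apply: eq_bigl => b; rewrite inE.
Qed.

Lemma essential_recurs (phi : 'rV['Z_2]_m -> 'Z_2) : essential xi phi ->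
  forall n0, exists2 n, (n0 <= n)%N & kap pa q n = (2 * qsum p phi)^-1.
Proof.
move=> [_ inf] n0; apply: contrapT => no; apply: inf.
apply: (@sub_finite_set _ _ `I_n0); last exact: finite_II.
move=> j /= xj; rewrite ltnNge; apply/negP => nj; apply: no.
by exists j.+1; [exact: leqW|rewrite /= xj].
Qed.

End Final.

Theorem corollary7p2 (R : realType) (m : nat) (hm : (2 <= m)%N)
    (xi : nat -> 'rV['Z_2]_m -> 'Z_2) (hxi : Xi xi)
    (X : lgraph (slabel m)) (hX : Sch xi X)
    (p : slabel m -> R) (hp : markov_weights p)
    (hq : exists phi psi : 'rV['Z_2]_m -> 'Z_2,
        [/\ essential xi phi, essential xi psi & qsum p phi <> qsum p psi]) :
  exists K : set R,
    [/\ spectrum (markov_op p X) = [set x%:C%C | x in K],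
        cantor_set K
      & lebesgue_measure K = 0%E].
Proof.
have xi_epi := hxi.1; have hX' := hX.1.
have pa0 : 0 < p None := hp.1 None.
have q0 := qsum_gt0 xi_epi hp.
have pq1 := @weight_qsum_le1 R m xi p hp.
have q1 n : qsum p (xi n) <= 1.
  by apply: le_trans (pq1 n); rewrite lerDr ltW.
pose q n := qsum p (xi n).
pose W := wspec (p None) q; pose c := center p.
(* Undoes the shift of the spectral parameter by [center]; translations preserve null sets and the
   topology. *)
pose K := [set x | W (x - c)].
have KE x : K x = W (x - c) by [].
have nW : lebesgue_measure W = 0%E.
  have [V [kV V0]] := kap_finite xi_epi hp.
  have [phi [psi [ephi epsi ne]]] := hq.
  have ne' : (2 * qsum p phi)^-1 != (2 * qsum p psi)^-1.
    apply/eqP => /invr_inj e; apply: ne; apply: (mulfI _ e).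
    by rewrite pnatr_eq0.
  exact: (wspec_null pa0 q0 pq1 kV V0 ne' (essential_recurs p ephi)
    (essential_recurs p epsi)).
have nK : lebesgue_measure K = 0%E.
  exact: etrans (lebesgue_measure_shift (- c) (@measurable_wspec R (p None) q)) nW.
exists K; split=> //.
  apply/seteqP; split=> [z hz|_ [l hl <-]]; last exact: wspec_in_spectrum.
  have iz : complex.Im z = 0.
    apply: contrapT => /eqP iz; have c0 : 0 < complex.Im z ^+ 2 by rewrite exprn_even_gt0.
    exact: (not_in_spectrum hX' hp c0 (fun N phi => low_nonreal xi p z N phi) hz).
  have zE : z = (complex.Re z)%:C%C by apply: complex_eqP.
  exists (complex.Re z) => //; apply: contrapT => /low_real[d d0 low].
  by rewrite zE in hz; apply: (not_in_spectrum hX' hp d0 low hz).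
apply: (@null_perfect_cantor R K (2 + `|c|)) => //.
- by exists c; rewrite KE subrr; exact: wspec0.
- move=> x clx; apply: wspec_adherent => d d0.
  have [y [Ky xy]] := clx _ (nbhsx_ballx x d d0).
  exists (y - c) => //; rewrite opprB addrA subrK ltW //.
- move=> x /(wspec_bound pa0 q0 pq1)/andP[h1 h2].
  have -> : x = (x - c) + c by rewrite subrK.
  by apply: le_trans (ler_normD _ _) _; rewrite lerD2r ler_norml; move: h1 h2; lra.
- move=> x d Kx d0; have [y hy [yx yd]] := wspec_not_isolated pa0 q0 q1 Kx d0.
  exists (y + c); first by rewrite KE addrK.
  split; first by apply: contraNneq yx => <-; rewrite addrK.
  by move: yd; rewrite opprB addrA.
Qed.
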